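(* Fix $\theta,\rho\in[0,1]$ and $\varepsilon>0$. Let $\eta_0$ be sampled from $\Upsilon^{(\theta;\rho)}$, let $(\eta_t)$ be the stochastic six-vertex model on $\mathbb Z$ with initial data $\eta_0$, and let $G_y(x)=G(x,y)$ be the entropy solution of $\partial_yG+\partial_x\varphi(G)=0$ on $\mathbb R\times[0,1]$ with $G(x,0)=\theta\mathbf 1_{x\le0}+\rho\mathbf 1_{x>0}$. Then $$\lim_{N\to\infty}\mathbb P\Big[\max_{-N/\varepsilon<X_1<X_2<N/\varepsilon}\Big|\frac1N\sum_{x=X_1}^{X_2}\eta_N(x)-\int_{X_1/N}^{X_2/N}G_1(x)\,dx\Big|>\varepsilon\Big]=0.$$
   Context: Fix $0<b_1<b_2<1$, $\kappa=\frac{1-b_1}{1-b_2}$, $\varphi(z)=\frac{\kappa z}{(\kappa-1)z+1}$. Entropy solution: the unique bounded weak solution satisfying the Kružkov entropy inequalities. $\Upsilon^{(\theta;\rho)}$ is the product measure on $\{0,1\}^{\mathbb Z}$ with $P[\eta(x)=1]=\theta$ for $x\le0$ and $=\rho$ for $x>0$. The stochastic six-vertex model is the discrete-time Markov process on $\{0,1\}^{\mathbb Z}$ defined (for finitely many particles) as follows: at step $t$ take independent $\chi_t(x)\sim$ Bernoulli$(b_1)$ and $j_t(x)$ with $P[j_t(x)=r]=(1-b_2)b_2^{r-1}$, $r\ge1$; label particles at time $t-1$ as $p_{t-1}(-M)<\dots<p_{t-1}(N)$ ($p(i)=-\infty$ below, $+\infty$ above the range) and for $k=-M,\dots,N$ in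 order, with $x=p_{t-1}(k)$: if $p_t(k-1)<x$, set $p_t(k)=x$ if $\chi_t(x)=1$ and $p_t(k)=\min\{x+j_t(x),p_{t-1}(k+1)\}$ if $\chi_t(x)=0$; if $p_t(k-1)=x$, set $p_t(k)=\min\{x+j_t(x),p_{t-1}(k+1)\}$. With infinitely many particles the same rules are applied through a Harris-type construction (on finite time horizons space-time almost surely splits into finite non-interacting blocks). *)

(* Defs.v *)
From HB Require Import structures.
From mathcomp Require Import all_boot all_order all_algebra.
From mathcomp Require Import all_classical all_reals all_analysis.

Set Implicit Arguments.
Unset Strict Implicit.
Unset Printing Implicit Defensive.

Import Order.TTheory GRing.Theory Num.Theory.
Import numFieldNormedType.Exports.
Local Open Scope classical_set_scope.
Local Open Scope ring_scope.

Definition kappa {R : realType} (b1 b2 : R) : R := (1 - b1) / (1 - b2).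

Definition phi {R : realType} (b1 b2 : R) (z : R) : R :=
  kappa b1 b2 * z / ((kappa b1 b2 - 1) * z + 1).

Definition dX {R : realType} (psi : R -> R -> R) (x y : R) : R :=
  derive1 (fun x' => psi x' y) x.
Definition dY {R : realType} (psi : R -> R -> R) (x y : R) : R :=
  derive1 (fun y' => psi x y') y.

Definition test_fun {R : realType} (psi : R -> R -> R) : Prop :=
  [/\ (forall x y, 0 <= psi x y),
      (exists A c e : R, 0 < c /\ e < 1 /\
          (forall x y, A < `|x| \/ y < c \/ e < y -> psi x y = 0)),
      (forall x y, derivable (fun x' => psi x' y) x 1 /\
                   derivable (fun y' => psi x y') y 1),
      continuous (fun p : R * R => psi p.1 p.2) &
      continuous (fun p : R * R => dX psi p.1 p.2) /\
      continuous (fun p : R * R => dY psi p.1 p.2)].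

(* G is the (Kruzkov) entropy solution with flux f and initial datum G0,
   taken in its version continuous in time with values in L^1_loc. *)
Definition entropy_solution {R : realType} (f : R -> R) (G0 : R -> R)
    (G : R -> R -> R) : Prop :=
  [/\ measurable_fun setT (fun p : R * R => G p.1 p.2),
      (forall x y, 0 <= y <= 1 -> 0 <= G x y <= 1),
      (forall x, G x 0 = G0 x),
      (forall (a b y0 : R), 0 <= y0 <= 1 ->
        (fun y => (\int[@lebesgue_measure R]_(x in `[a, b]) (`|G x y - G x y0|)%:E)%E)
          @ (within `[0%R, 1%R] (nbhs y0)) --> 0%E) &
      (forall (k : R) (psi : R -> R -> R), 0 <= k <= 1 -> test_fun psi ->
        (0 <= \int[@lebesgue_measure R]_(y in `]0%R, 1%R[)
               \int[@lebesgue_measure R]_(x in setT)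
                 (`|G x y - k| * dY psi x y
                  + Num.sg (G x y - k) * (f (G x y) - f k) * dX psi x y)%:E)%E)].

Definition conf := int -> bool.

(* Local update at site x. [h] is the state of the "horizontal line" entering
   site x from the left: None = no moving particle, Some d = a moving particle
   whose (unblocked) target is d >= x.  e = eta_{t-1}(x), c = chi_t(x),
   jx = j_t(x).  Returns (eta_t(x), state entering site x+1).
   This encodes the sequential rule: a particle that stays (chi=1, not
   reached) stays; a moving particle goes to min{x + j_t(x), next particle};
   a particle reached (blocked at) by the previous one is pushed and moves to
   min{x + j_t(x), next particle}. *)
Definition local_rule (e c : bool) (jx : nat) (x : int) (h : option int)
    : bool * option int :=
  match e, h with
  | false, None => (false, None)
  | false, Some d => if d == x then (true, None) else (false, Some d)
  | true, None => if c then (true, None) else (false, Some (x + jx%:Z))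
  | true, Some _ => (true, Some (x + jx%:Z))
  end.

(* Dynamics restricted to the particles at sites >= a (all particles left of
   a removed): state entering site a + n. *)
Fixpoint trunc_state (eta : conf) (c : int -> bool) (jj : int -> nat)
    (a : int) (n : nat) : option int :=
  match n with
  | 0 => None
  | n'.+1 => (local_rule (eta (a + n'%:Z)) (c (a + n'%:Z)) (jj (a + n'%:Z))
                (a + n'%:Z) (trunc_state eta c jj a n')).2
  end.

(* value at site x (x >= a) after one step of the truncated dynamics *)
Definition trunc_val (eta : conf) (c : int -> bool) (jj : int -> nat)
    (a x : int) : bool :=
  let n := `|x - a|%N in
  (local_rule (eta x) (c x) (jj x) x (trunc_state eta c jj a n)).1.

(* One step on Z (Harris-type construction): the value at x is the value
   obtained from the truncated dynamics once it stabilises as the truncation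
   point a goes to -infinity (it a.s. stabilises, since space-time a.s. splits
   into finite non-interacting blocks). *)
Definition s6v_step (eta : conf) (c : int -> bool) (jj : int -> nat) : conf :=
  fun x => `[< exists a0 : int, forall a : int, a <= a0 -> trunc_val eta c jj a x >].

(* eta_t; step t+1 uses the randomness chi t, j t (i.e. chi_{t+1}, j_{t+1}). *)
Fixpoint s6v {T : Type} (eta0 : int -> T -> bool) (chi : nat -> int -> T -> bool)
    (jmp : nat -> int -> T -> nat) (t : nat) (w : T) : conf :=
  match t with
  | 0 => fun x => eta0 x w
  | t'.+1 => s6v_step (s6v eta0 chi jmp t' w) (fun x => chi t' x w)
                                               (fun x => jmp t' x w)
  end.

Definition idx := (int + (nat * int) + (nat * int))%type.

Definition drive_rv {T : Type} (eta0 : int -> T -> bool)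
    (chi : nat -> int -> T -> bool) (jmp : nat -> int -> T -> nat)
    (i : idx) (w : T) : nat :=
  match i with
  | inl (inl x) => nat_of_bool (eta0 x w)
  | inl (inr (t, x)) => nat_of_bool (chi t x w)
  | inr (t, x) => jmp t x w
  end.

Definition mutually_independent {d} {T : measurableType d} {R : realType}
    (P : probability T R) {I : eqType} (X : I -> T -> nat) : Prop :=
  forall (s : seq I) (v : I -> nat), uniq s ->
    P (\bigcap_(i in [set i | i \in s]) [set w | X i w = v i]) =
    (\prod_(i <- s) P [set w | X i w = v i])%E.

(* Main.v *)
(** The height function (particles counted relative to a ray) determines the
density, so it suffices to find its limit at time one.

On a finite interval with horizontal inputs of density [phi theta], Bernoulli
product measures are stationary (Burke property).  Two copies driven by the same
coins never create discrepancies, and in any block of [k] sites where they are not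
ordered, some pattern of coins annihilates a pair of them; hence unordered blocks
are rare, and comparing with all stationary densities forces flux = [phi] (density)
in most blocks.  As [phi] is concave, summing the flux relation over a window moving
at speed [v] bounds the height on one side by its initial value at the foot of the
ray; the other side follows from attractivity and a comparison with stationary
systems.  Rays are characteristics in a rarefaction fan, and have the chord speed
in a shock.

For the entropy solution, Kruzkov's inequalities tested on slabs bounded by two moving
lines, with constants [0], [1] and a third one, give the same height differences for
the integral of [G] at time one.

The process on the line restricted to sites on the right of a far away point has the
law of the finite model with no input: a geometric jump is a sequence of coins.  A
particle that rests until time [t] and is then not held back emits a moving particle
whatever comes from its left, so that such resting sites, one for each time step, erase
the effect of the truncation; and the effect of the missing input decays exponentially
with the distance. *)
Require Import Defs.
From HB Require Import structures.
From mathcomp Require Import all_boot all_order all_algebra.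
From mathcomp Require Import all_classical all_reals all_analysis.
From mathcomp Require Import measurable_realfun ring lra zify.
Set Implicit Arguments.
Unset Strict Implicit.
Unset Printing Implicit Defensive.
Import Order.TTheory GRing.Theory Num.Theory.
Import numFieldNormedType.Exports.
Local Open Scope classical_set_scope.
Local Open Scope ring_scope.

(** * Flux function *)

(** Laws of finite systems are weighted lists, so every estimate before the transfer to [P] is a
    finite sum and couplings are explicit. The obstacle is to replace the flux through a block by
    [phi] of its density without classifying stationary measures. A count does it: discrepancies
    between coupled copies are never created inside the system and at most one enters per step, so
    only O(N) of them can be annihilated, against a number of space-time blocks of order N^2. An
    unordered block of [k] sites annihilates a pair with probability at least [cmin ^+ k]; hence [k]
    and the mesh of reference densities are fixed before [N] grows. An input of density [phi theta]
    makes the left boundary invisible: by the Burke property a box may be lengthened to the left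
    without changing the law on the rest. Heights are controlled in mean absolute value by two
    one-sided bounds. The flux inequality along a ray gives one; the other compares with a single
    stationary system, whose mean height at the end of that ray is the same to leading order. *)

Section Flux.
Variables (R : realType) (b1 b2 : R).
Hypotheses (b12 : b1 < b2) (b2_lt1 : b2 < 1).
Local Notation ka := (kappa b1 b2).
Local Notation ph := (phi b1 b2).

Lemma kappa_gt1 : 1 < ka.
Proof. by rewrite /kappa ltr_pdivlMr ?subr_gt0 // mul1r ltrD2l ltrN2. Qed.

Lemma kappa_gt0 : 0 < ka.
Proof. exact: lt_trans ltr01 kappa_gt1. Qed.

Lemma kappa_ge0 : 0 <= ka.
Proof. exact: ltW kappa_gt0. Qed.

Definition phi_den (z : R) : R := (ka - 1) * z + 1.

Lemma phi_den_ge1 z : 0 <= z -> 1 <= phi_den z.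
Proof.
by move=> z0; rewrite /phi_den lerDr mulr_ge0 // subr_ge0 ltW // kappa_gt1.
Qed.

Lemma phi_den_gt0 z : 0 <= z -> 0 < phi_den z.
Proof. by move=> z0; rewrite (lt_le_trans ltr01) // phi_den_ge1. Qed.

Lemma phi_den_ge0 z : 0 <= z -> 0 <= phi_den z.
Proof. by move=> z0; rewrite ltW // phi_den_gt0. Qed.

Lemma phi0 : ph 0 = 0.
Proof. by rewrite /phi mulr0 mul0r. Qed.

Lemma phi1 : ph 1 = 1.
Proof.
by rewrite /phi !mulr1 subrK divff // gt_eqF // kappa_gt0.
Qed.

Lemma phiB u v : 0 <= u -> 0 <= v ->
  ph u - ph v = ka * (u - v) / (phi_den u * phi_den v).
Proof.
move=> u0 v0; have := phi_den_gt0 u0; have := phi_den_gt0 v0.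
rewrite /phi /phi_den => dv du; field.
by apply/andP; split; rewrite gt_eqF.
Qed.

Lemma le_phi u v : 0 <= u -> u <= v -> ph u <= ph v.
Proof.
move=> u0 uv; have v0 := le_trans u0 uv.
rewrite -subr_ge0 phiB //.
by apply: divr_ge0; apply: mulr_ge0; rewrite ?subr_ge0 ?kappa_ge0 ?phi_den_ge0.
Qed.

Lemma phi_ge0 u : 0 <= u -> 0 <= ph u.
Proof. by move=> u0; rewrite -phi0 le_phi. Qed.

Lemma phi_itv u : 0 <= u <= 1 -> 0 <= ph u <= 1.
Proof. by case/andP=> u0 u1; rewrite phi_ge0 //= -phi1 le_phi. Qed.

Lemma phi_lip u v : 0 <= u -> u <= v -> ph v - ph u <= ka * (v - u).
Proof.
move=> u0 uv; have v0 := le_trans u0 uv.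
rewrite phiB // ler_pdivrMr ?mulr_gt0 ?phi_den_gt0 // ler_peMr //.
  by rewrite mulr_ge0 ?subr_ge0 // kappa_ge0.
by rewrite -[1]mulr1 ler_pM ?phi_den_ge1.
Qed.

(** Balance of the two turning vertices: with vertical density [z] and horizontal density [phi z], a
    lone vertical path turns as often as a lone horizontal one. This relation singles out [phi] as
    the stationary flux. *)
Lemma phi_balance z : 0 <= z ->
  (1 - b1) * z * (1 - ph z) = (1 - b2) * (1 - z) * ph z.
Proof.
move=> z0; have := phi_den_gt0 z0; rewrite /phi_den /phi /kappa => dz.
field; apply/andP; split; first by rewrite subr_eq0 gt_eqF.
rewrite (_ : _ + _ = (1 - b2) * (((1 - b1) / (1 - b2) - 1) * z + 1)).
  by rewrite mulf_neq0 ?gt_eqF // subr_gt0.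
by field; rewrite subr_eq0 gt_eqF.
Qed.

Definition dphi (z : R) : R := ka / phi_den z ^+ 2.

Lemma dphi_ge0 z : 0 <= z -> 0 <= dphi z.
Proof.
by move=> z0; rewrite divr_ge0 // ?sqr_ge0 // kappa_ge0.
Qed.

Lemma dphi_le z : 0 <= z -> dphi z <= ka.
Proof.
move=> z0; rewrite ler_pdivrMr ?exprn_gt0 ?phi_den_gt0 // ler_peMr //.
  exact: kappa_ge0.
by rewrite expr_ge1 ?phi_den_ge1 // ltW // phi_den_gt0.
Qed.

(* The three-point identity behind the concavity of phi. *)
Lemma phi_secant u v w : 0 <= u -> 0 <= v -> 0 <= w ->
  ph u - ph v - ka / (phi_den v * phi_den w) * (u - v) =
  - (ka * (ka - 1)) / (phi_den u * phi_den v * phi_den w) * ((u - v) * (u - w)).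
Proof.
move=> u0 v0 w0; rewrite phiB //.
have := phi_den_gt0 u0; have := phi_den_gt0 v0; have := phi_den_gt0 w0.
rewrite /phi_den => dw dv du; field.
by do !(apply/andP; split); rewrite gt_eqF.
Qed.

Lemma secant_coef_ge0 u v w : 0 <= u -> 0 <= v -> 0 <= w ->
  0 <= ka * (ka - 1) / (phi_den u * phi_den v * phi_den w).
Proof.
move=> u0 v0 w0; have := kappa_gt1 => k1.
apply: divr_ge0; first by apply: mulr_ge0; rewrite ?kappa_ge0 // subr_ge0 ltW.
by apply: mulr_ge0; [apply: mulr_ge0|]; rewrite ?phi_den_ge0.
Qed.

Lemma phi_tangent u v : 0 <= u -> 0 <= v -> ph u <= ph v + dphi v * (u - v).
Proof.
move=> u0 v0; have := phi_secant u0 v0 v0; rewrite -expr2 -/(dphi v) => E.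
have : 0 <= ka * (ka - 1) / (phi_den u * phi_den v * phi_den v) * ((u - v) * (u - v)).
  by rewrite mulr_ge0 ?secant_coef_ge0 // -expr2 sqr_ge0.
by move: E; rewrite !mulNr => E h; lra.
Qed.

(** The Rankine-Hugoniot speed of a shock between the densities [v] and [w], written without a
    quotient by [w - v], so that it equals [dphi v] when [w = v]. *)
Definition slope (v w : R) : R := ka / (phi_den v * phi_den w).

Lemma slope_ge0 v w : 0 <= v -> 0 <= w -> 0 <= slope v w.
Proof.
move=> v0 w0; apply: divr_ge0; rewrite ?kappa_ge0 //.
by apply: mulr_ge0; rewrite ?phi_den_ge0.
Qed.

Lemma slope_le v w : 0 <= v -> 0 <= w -> slope v w <= ka.
Proof.
move=> v0 w0; rewrite ler_pdivrMr ?mulr_gt0 ?phi_den_gt0 // ler_peMr //.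
  exact: kappa_ge0.
by rewrite -[1]mulr1 ler_pM ?phi_den_ge1.
Qed.

Lemma slopeE v w : 0 <= v -> 0 <= w -> ph w - ph v = slope v w * (w - v).
Proof. by move=> v0 w0; rewrite phiB // /slope [phi_den w * _]mulrC mulrAC. Qed.

Lemma phi_chord_in v w u : 0 <= v -> v <= u -> u <= w ->
  ph v + slope v w * (u - v) <= ph u.
Proof.
move=> v0 vu uw; have u0 := le_trans v0 vu; have w0 := le_trans u0 uw.
have := phi_secant u0 v0 w0; rewrite -/(slope v w) => E.
have : 0 <= ka * (ka - 1) / (phi_den u * phi_den v * phi_den w) * ((u - v) * (w - u)).
  by rewrite mulr_ge0 ?secant_coef_ge0 // mulr_ge0 // subr_ge0.
by move: E; rewrite !mulNr => E h; lra.
Qed.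

End Flux.

(** * Finite distributions *)

Section FiniteDistributions.
Variable R : realType.
Implicit Types A B : Type.

(** Weights of any sign and repeated values are allowed; [is_dist] is assumed only where
    monotonicity or the total mass matters. *)
Definition dist A := seq (R * A).

Definition Ex A (d : dist A) (f : A -> R) : R := \sum_(x <- d) x.1 * f x.2.

Definition is_dist A (d : dist A) : Prop :=
  all (fun x => 0 <= x.1) d /\ Ex d (fun=> 1) = 1.

Definition dbind A B (d : dist A) (k : A -> dist B) : dist B :=
  flatten [seq [seq (x.1 * y.1, y.2) | y <- k x.2] | x <- d].

Definition dret A (a : A) : dist A := [:: (1, a)].

Definition dprod A B (d1 : dist A) (d2 : dist B) : dist (A * B) :=
  dbind d1 (fun a => dbind d2 (fun b => dret (a, b))).

Fixpoint dseq A (ds : seq (dist A)) : dist (seq A) :=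
  if ds is d :: ds' then dbind d (fun a => dbind (dseq ds') (fun s => dret (a :: s)))
  else dret [::].

Definition bern (p : R) : dist bool := [:: (p, true); (1 - p, false)].

Lemma Ex_bind A B (d : dist A) (k : A -> dist B) f :
  Ex (dbind d k) f = Ex d (fun a => Ex (k a) f).
Proof.
rewrite /Ex /dbind big_flatten big_map; apply: eq_bigr => x _.
by rewrite big_map mulr_sumr; apply: eq_bigr => y _; rewrite mulrA.
Qed.

Lemma Ex_ret A (a : A) f : Ex (dret a) f = f a.
Proof. by rewrite /Ex big_seq1 mul1r. Qed.

Lemma eq_Ex A (d : dist A) f g : f =1 g -> Ex d f = Ex d g.
Proof. by move=> fg; apply: eq_bigr => x _; rewrite fg. Qed.

Lemma Ex_prod A B (d1 : dist A) (d2 : dist B) f :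
  Ex (dprod d1 d2) f = Ex d1 (fun a => Ex d2 (fun b => f (a, b))).
Proof.
rewrite Ex_bind; apply: eq_Ex => a; rewrite Ex_bind; apply: eq_Ex => b.
by rewrite Ex_ret.
Qed.

Lemma Ex_nil A f : Ex (dseq (Nil (dist A))) f = f [::].
Proof. exact: Ex_ret. Qed.

Lemma Ex_cons A (d : dist A) ds f :
  Ex (dseq (d :: ds)) f = Ex d (fun a => Ex (dseq ds) (fun s => f (a :: s))).
Proof.
rewrite /= Ex_bind; apply: eq_Ex => a; rewrite Ex_bind; apply: eq_Ex => s.
by rewrite Ex_ret.
Qed.

Arguments dseq : simpl never.

Lemma ExD A (d : dist A) f g : Ex d (fun x => f x + g x) = Ex d f + Ex d g.
Proof. by rewrite /Ex -big_split; apply: eq_bigr => x _; rewrite mulrDr. Qed.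

Lemma ExZ A (d : dist A) c f : Ex d (fun x => c * f x) = c * Ex d f.
Proof. by rewrite /Ex mulr_sumr; apply: eq_bigr => x _; rewrite mulrCA. Qed.

Lemma ExZr A (d : dist A) c f : Ex d (fun x => f x * c) = Ex d f * c.
Proof. by rewrite mulrC -ExZ; apply: eq_Ex => x; rewrite mulrC. Qed.

Lemma ExB A (d : dist A) f g : Ex d (fun x => f x - g x) = Ex d f - Ex d g.
Proof.
rewrite ExD; congr (_ + _); rewrite -[RHS]mulN1r -ExZ.
by apply: eq_Ex => x; rewrite mulN1r.
Qed.

Lemma Ex0 A (d : dist A) : Ex d (fun=> 0) = 0.
Proof. by rewrite /Ex big1 // => x _; rewrite mulr0. Qed.

Lemma Ex_sum A (d : dist A) (I : Type) (r : seq I) (P : pred I) (f : I -> A -> R) :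
  Ex d (fun x => \sum_(i <- r | P i) f i x) = \sum_(i <- r | P i) Ex d (f i).
Proof.
rewrite /Ex exchange_big; apply: eq_bigr => x _.
by rewrite mulr_sumr.
Qed.

Lemma Ex_exchange A B (d1 : dist A) (d2 : dist B) f :
  Ex d1 (fun a => Ex d2 (f a)) = Ex d2 (fun b => Ex d1 (f^~ b)).
Proof.
rewrite /Ex; under eq_bigr do rewrite mulr_sumr.
rewrite exchange_big; apply: eq_bigr => y _; rewrite mulr_sumr.
by apply: eq_bigr => x _; rewrite mulrCA.
Qed.

Lemma Ex_cst A (d : dist A) c : is_dist d -> Ex d (fun=> c) = c.
Proof. by case=> _ d1; rewrite -[LHS]/(Ex d (fun=> c)) -[c]mulr1 ExZ d1. Qed.

Lemma le_Ex A (d : dist A) f g :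
  is_dist d -> (forall x, f x <= g x) -> Ex d f <= Ex d g.
Proof.
case=> d0 _ fg; rewrite /Ex; elim: d d0 => [|x d IH] /=; first by rewrite !big_nil.
by case/andP=> x0 d0; rewrite !big_cons lerD ?IH // ler_wpM2l.
Qed.

Lemma is_dist_ret A (a : A) : is_dist (dret a).
Proof. by split; rewrite ?Ex_ret //= ler01. Qed.

Lemma is_dist_bind A B (d : dist A) (k : A -> dist B) :
  is_dist d -> (forall a, is_dist (k a)) -> is_dist (dbind d k).
Proof.
move=> [d0 d1] hk; split; last first.
  by rewrite Ex_bind -[RHS]d1; apply: eq_Ex => a; rewrite (hk a).2.
elim: d d0 {d1} => //= x d IH /andP[x0 d0].
rewrite /dbind /= all_cat; apply/andP; split; last exact: IH.
rewrite all_map; have [h _] := hk x.2.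
by apply: sub_all h => y y0 /=; rewrite mulr_ge0.
Qed.

Lemma is_dist_prod A B (d1 : dist A) (d2 : dist B) :
  is_dist d1 -> is_dist d2 -> is_dist (dprod d1 d2).
Proof.
move=> h1 h2; apply: is_dist_bind => // a.
by apply: is_dist_bind => // b; apply: is_dist_ret.
Qed.

Lemma is_dist_nil A : is_dist (dseq (Nil (dist A))).
Proof. exact: is_dist_ret. Qed.

Lemma is_dist_cons A (d : dist A) ds :
  is_dist d -> is_dist (dseq ds) -> is_dist (dseq (d :: ds)).
Proof.
move=> h1 h2; apply: is_dist_bind => // a.
by apply: is_dist_bind => // b; apply: is_dist_ret.
Qed.

Lemma is_dist_nseq A n (d : dist A) : is_dist d -> is_dist (dseq (nseq n d)).
Proof.
move=> hd; elim: n => [|n IH]; first exact: is_dist_nil.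
exact: (@is_dist_cons _ d (nseq n d)).
Qed.

Lemma is_dist_bern p : 0 <= p <= 1 -> is_dist (bern p).
Proof.
case/andP=> p0 p1; split; first by rewrite /= p0 subr_ge0 p1.
by rewrite /Ex !big_cons big_nil /=; ring.
Qed.

Lemma Ex_bern p f : Ex (bern p) f = p * f true + (1 - p) * f false.
Proof. by rewrite /Ex !big_cons big_nil /= addr0. Qed.

Lemma is_dist_bern_map (ps : seq R) : all (fun p => 0 <= p <= 1) ps ->
  is_dist (dseq (map bern ps)).
Proof.
elim: ps => [|p ps IH] /=; first by move=> _; apply: is_dist_nil.
by case/andP=> hp hps; apply: is_dist_cons; [apply: is_dist_bern|apply: IH].
Qed.

(** Lists drawn from [dseq ds] have as many entries as [ds]; this is how size conditions become
    available under an expectation. *)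
Lemma eq_Ex_dseq A (ds : seq (dist A)) f g :
  (forall s, size s = size ds -> f s = g s) -> Ex (dseq ds) f = Ex (dseq ds) g.
Proof.
elim: ds f g => [|d ds IH] f g fg; first by rewrite !Ex_nil fg.
rewrite !Ex_cons; apply: eq_Ex => a; apply: IH => s ss; apply: fg.
by rewrite /= ss.
Qed.

Lemma le_Ex_dseq A (ds : seq (dist A)) f g : is_dist (dseq ds) ->
  (forall s, size s = size ds -> f s <= g s) -> Ex (dseq ds) f <= Ex (dseq ds) g.
Proof.
move=> hd fg.
rewrite (@eq_Ex_dseq _ _ f (fun s => if size s == size ds then f s else 0)).
  rewrite (@eq_Ex_dseq _ _ g (fun s => if size s == size ds then g s else 0)).
    by apply: le_Ex => // s; case: eqP => // /fg.
  by move=> s ->; rewrite eqxx.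
by move=> s ->; rewrite eqxx.
Qed.

Lemma Ex_cat A (ds1 ds2 : seq (dist A)) f :
  Ex (dseq (ds1 ++ ds2)) f =
  Ex (dseq ds1) (fun s1 => Ex (dseq ds2) (fun s2 => f (s1 ++ s2))).
Proof.
elim: ds1 f => [|d ds1 IH] f; first by rewrite Ex_nil.
by rewrite cat_cons !Ex_cons; apply: eq_Ex => a; rewrite IH.
Qed.

Lemma Ex_map_seq A B (ds : seq (dist A)) (ds' : seq (dist B)) (h : A -> B) f :
  size ds = size ds' ->
  (forall i d0 d0', (i < size ds)%N ->
     forall g, Ex (nth d0 ds i) (fun a => g (h a)) = Ex (nth d0' ds' i) g) ->
  Ex (dseq ds) (fun s => f (map h s)) = Ex (dseq ds') f.
Proof.
elim: ds ds' f => [|d ds IH] [|d' ds'] f //=; first by rewrite !Ex_nil.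
move=> [ss] H; rewrite !Ex_cons -(H 0%N d d' (ltn0Sn _)); apply: eq_Ex => a.
rewrite -(IH ds') // => i d0 d0' lti g; exact: (H i.+1 d0 d0').
Qed.

Lemma Ex_map_nseq A B n (d : dist A) (d' : dist B) (h : A -> B) f :
  (forall g, Ex d (fun a => g (h a)) = Ex d' g) ->
  Ex (dseq (nseq n d)) (fun s => f (map h s)) = Ex (dseq (nseq n d')) f.
Proof.
move=> H; apply: Ex_map_seq; first by rewrite !size_nseq.
by move=> i d0 d0'; rewrite size_nseq => lti g; rewrite !nth_nseq lti H.
Qed.

(** Turns a variance bound into a bound in mean absolute value without square roots; [c] will be a
    small fraction of the scale of the problem. *)
Lemma Ex_abs_le A (d : dist A) (f : A -> R) c : is_dist d -> 0 < c ->
  Ex d (fun x => `|f x|) <= c + Ex d (fun x => f x ^+ 2) / c.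
Proof.
move=> hd c0; rewrite -ExZr -[X in _ <= X + _](Ex_cst c hd) -ExD.
apply: le_Ex => // x; rewrite -[f x ^+ 2]real_normK ?num_real //.
set y := `|f x|; have y0 : 0 <= y by apply: normr_ge0.
rewrite -(ler_pM2r c0) mulrDl divfK ?gt_eqF //; nra.
Qed.

End FiniteDistributions.

Arguments dseq : simpl never.

(** * Rows of vertices *)

Definition coin := (bool * bool)%type.

(* The vertex with vertical input [e] and horizontal input [h]; the result is
   (vertical output, horizontal output).  The coin decides whether a lone
   vertical (resp. horizontal) path goes straight. *)
Definition vert (c : coin) (e h : bool) : bool * bool :=
  if e then (if h then (true, true) else (c.1, ~~ c.1))
  else (if h then (~~ c.2, c.2) else (false, false)).

(** Also the default read from an exhausted list of coins, which makes [outs], [hout] and [flux]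
    total; random rows carry one coin per site. *)
Definition straight : coin := (true, true).

Fixpoint outs (es : seq bool) (cs : seq coin) (h : bool) : seq bool :=
  if es is e :: es' then
    let v := vert (head straight cs) e h in v.1 :: outs es' (behead cs) v.2
  else [::].

Fixpoint hout (es : seq bool) (cs : seq coin) (h : bool) : bool :=
  if es is e :: es' then hout es' (behead cs) (vert (head straight cs) e h).2
  else h.

(** Counts the occupied edges entering the sites: the input [h] is counted, the edge [hout] that
    leaves the row is not. *)
Fixpoint flux (es : seq bool) (cs : seq coin) (h : bool) : nat :=
  if es is e :: es' then
    (h + flux es' (behead cs) (vert (head straight cs) e h).2)%N
  else 0%N.

Notation mass := (count id).

Lemma size_outs es cs h : size (outs es cs h) = size es.
Proof. by elim: es cs h => //= e es IH cs h; rewrite IH. Qed.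

Lemma vert_conserve c (e h : bool) : (e + h = (vert c e h).1 + (vert c e h).2)%N.
Proof. by case: c => [[] []]; case: e; case: h. Qed.

Lemma row_conserve es cs (h : bool) :
  (mass es + h = mass (outs es cs h) + hout es cs h)%N.
Proof.
elim: es cs h => [|e es IH] cs h //=.
have := vert_conserve (head straight cs) e h.
have := IH (behead cs) (vert (head straight cs) e h).2; lia.
Qed.

Lemma take_outs i es cs h : take i (outs es cs h) = outs (take i es) cs h.
Proof. by elim: es i cs h => [|e es IH] [|i] cs h //=; rewrite IH. Qed.

Lemma outs_cat es1 es2 cs1 cs2 h : size cs1 = size es1 ->
  outs (es1 ++ es2) (cs1 ++ cs2) h =
  outs es1 cs1 h ++ outs es2 cs2 (hout es1 cs1 h).
Proof.
elim: es1 cs1 h => [|e es1 IH] [|c cs1] h //= [sz].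
by rewrite IH.
Qed.

Lemma hout_cat es1 es2 cs1 cs2 h : size cs1 = size es1 ->
  hout (es1 ++ es2) (cs1 ++ cs2) h = hout es2 cs2 (hout es1 cs1 h).
Proof.
elim: es1 cs1 h => [|e es1 IH] [|c cs1] h //= [sz].
by rewrite IH.
Qed.

Lemma hout_take k es cs h : (size es <= k)%N ->
  hout es (take k cs) h = hout es cs h.
Proof.
elim: es k cs h => [|e es IH] [|k] [|c cs] h //= sz; first by rewrite IH.
Qed.

Lemma flux_take k es cs h : (size es <= k)%N ->
  flux es (take k cs) h = flux es cs h.
Proof.
elim: es k cs h => [|e es IH] [|k] [|c cs] h //= sz; first by rewrite IH.
Qed.

Lemma hout_take_drop a b es cs h :
  hout (take (a + b) es) cs h =
  hout (take b (drop a es)) (drop a cs) (hout (take a es) cs h).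
Proof.
elim: a es cs h => [|a IH] [|e es] [|c cs] h //=; rewrite ?IH ?take0 //=.
Qed.

Lemma fluxE es cs h :
  flux es cs h = (\sum_(r < size es) hout (take r es) cs h)%N.
Proof.
elim: es cs h => [|e es IH] cs h /=; first by rewrite big_ord0.
by rewrite big_ord_recl /= IH.
Qed.

Lemma flux_size es cs h : (flux es cs h <= size es)%N.
Proof.
elim: es cs h => [|e es IH] cs h //=.
by have := IH (behead cs) (vert (head straight cs) e h).2; case: h => /=; lia.
Qed.

(** [all2] fails on lists of different lengths, so the order includes equality of lengths. *)
Definition leb_seq := all2 implb.

Lemma leb_seq_refl s : leb_seq s s.
Proof. by elim: s => //= x s ->; case: x. Qed.

Lemma leb_seq_mass s1 s2 : leb_seq s1 s2 -> (mass s1 <= mass s2)%N.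
Proof.
elim: s1 s2 => [|x s1 IH] [|y s2] //= /andP[xy /IH]; case: x xy => /=; case: y; lia.
Qed.

Lemma leb_seq_take n s1 s2 : leb_seq s1 s2 -> leb_seq (take n s1) (take n s2).
Proof.
by elim: s1 s2 n => [|x s1 IH] [|y s2] [|n] //= /andP[-> /IH ->].
Qed.

Lemma leb_seq_drop n s1 s2 : leb_seq s1 s2 -> leb_seq (drop n s1) (drop n s2).
Proof.
elim: s1 s2 n => [|x s1 IH] [|y s2] [|n] //=.
by move=> /andP[_ /IH]; apply.
Qed.

(** Attractivity. Two comparable and distinct inputs include the empty or the full vertex, whose
    output is extreme whatever the coin. *)
Lemma vert_mono c e1 e2 h1 h2 : e1 ==> e2 -> h1 ==> h2 ->
  ((vert c e1 h1).1 ==> (vert c e2 h2).1) && ((vert c e1 h1).2 ==> (vert c e2 h2).2).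
Proof. by case: c => [[] []]; case: e1; case: e2; case: h1; case: h2. Qed.

Lemma row_mono e1 e2 cs h1 h2 : leb_seq e1 e2 -> h1 ==> h2 ->
  [/\ leb_seq (outs e1 cs h1) (outs e2 cs h2),
      hout e1 cs h1 ==> hout e2 cs h2 &
      (flux e1 cs h1 <= flux e2 cs h2)%N].
Proof.
elim: e1 e2 cs h1 h2 => [|x e1 IH] [|y e2] cs h1 h2 //= /andP[xy le12] h12.
have /andP[v1 v2] := vert_mono (head straight cs) xy h12.
have [-> -> fl] := IH _ (behead cs) _ _ le12 v2.
split=> //; first by rewrite v1.
by apply: leq_add => //; case: h1 h12 {v1 v2 fl}; case: h2.
Qed.

Fixpoint disc (s1 s2 : seq bool) : nat :=
  match s1, s2 with x :: s1', y :: s2' => (x (+) y) + disc s1' s2' | _, _ => 0%N end.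

(** The incoming edges take part in the order, since a horizontal discrepancy may meet a vertical
    one of the opposite sign. *)
Definition ordered (e1 e2 : seq bool) (h1 h2 : bool) : bool :=
  (leb_seq e1 e2 && (h1 ==> h2)) || (leb_seq e2 e1 && (h2 ==> h1)).

Lemma vert_disc c (e1 e2 h1 h2 : bool) :
  (((vert c e1 h1).1 (+) (vert c e2 h2).1) + ((vert c e1 h1).2 (+) (vert c e2 h2).2)
   <= (e1 (+) e2) + (h1 (+) h2))%N.
Proof. by case: c => [[] []]; case: e1; case: e2; case: h1; case: h2. Qed.

Lemma row_disc e1 e2 cs (h1 h2 : bool) : size e1 = size e2 ->
  (disc (outs e1 cs h1) (outs e2 cs h2) + (hout e1 cs h1 (+) hout e2 cs h2)
   <= disc e1 e2 + (h1 (+) h2))%N.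
Proof.
elim: e1 e2 cs h1 h2 => [|x e1 IH] [|y e2] cs h1 h2 //= [sz].
have := vert_disc (head straight cs) x y h1 h2.
have := IH e2 (behead cs) (vert (head straight cs) x h1).2
  (vert (head straight cs) y h2).2 sz; lia.
Qed.

(* Going straight carries the discrepancy of the horizontal line along the row,
   the coin (false, false) exchanges it with a vertical one, and (false, true)
   annihilates two opposite discrepancies meeting at a vertex. *)
Lemma forced_annihilation e1 e2 (h1 h2 : bool) : size e1 = size e2 ->
  ~~ ordered e1 e2 h1 h2 ->
  exists2 cs, size cs = size e1 &
  (disc (outs e1 cs h1) (outs e2 cs h2) + (hout e1 cs h1 (+) hout e2 cs h2) + 2
   <= disc e1 e2 + (h1 (+) h2))%N.
Proof.
elim: e1 e2 h1 h2 => [|x e1 IH] [|y e2] h1 h2 //=; first by case: h1; case: h2.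
move=> [sz] nord.
have [an|nan] := boolP [&& x (+) y, h1 (+) h2 & x (+) h1].
  exists ((false, true) :: nseq (size e1) straight); first by rewrite /= size_nseq.
  have := row_disc (nseq (size e1) straight) (vert (false,true) x h1).2
     (vert (false,true) y h2).2 sz.
  by rewrite /=; move: an; case: x nord; case: y; case: h1; case: h2 => //= _ _; lia.
have [ord|/(IH _ _ _ sz) [cs szc H]] := boolP (ordered e1 e2 h1 h2); last first.
  exists (straight :: cs); first by rewrite /= szc.
  by rewrite /=; move: H; case: (x); case: (y); case: (h1); case: (h2) => //=; lia.
have nord' : ~~ ordered e1 e2 x y.
  move: nord nan ord; rewrite /ordered /leb_seq /=.
  by case: (all2 _ _ _); case: (all2 _ _ _); case: (x); case: (y); case: (h1); case: (h2).
have h12 : h1 = h2.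
  move: nord nan ord; rewrite /ordered /leb_seq /=.
  by case: (all2 _ _ _); case: (all2 _ _ _); case: (x); case: (y); case: (h1); case: (h2).
have [cs szc H] := IH _ _ _ sz nord'.
exists ((false, false) :: cs); first by rewrite /= szc.
by subst h2; rewrite /=; move: H; case: (x); case: (y); case: (h1) => //=; lia.
Qed.

(** * One row: stationarity, blocks and second moments *)

Section RowExpectations.
Variables (R : realType) (b1 b2 : R).
Hypotheses (b1_gt0 : 0 < b1) (b12 : b1 < b2) (b2_lt1 : b2 < 1).
Local Notation ka := (kappa b1 b2).
Local Notation ph := (phi b1 b2).

Definition dcoin : dist R coin := dprod (bern b1) (bern b2).
Definition dcoins n : dist R (seq coin) := dseq (nseq n dcoin).
Definition dbern n (l : R) : dist R (seq bool) := dseq (nseq n (bern l)).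

Lemma is_dist_coin : is_dist dcoin.
Proof.
have [h1 h2 h3] := And3 b1_gt0 b12 b2_lt1.
by apply: is_dist_prod; apply: is_dist_bern; apply/andP; split; lra.
Qed.

Lemma is_dist_coins n : is_dist (dcoins n).
Proof. exact: is_dist_nseq is_dist_coin. Qed.

Lemma is_dist_dbern n l : 0 <= l <= 1 -> is_dist (dbern n l).
Proof. by move=> hl; apply/is_dist_nseq/is_dist_bern. Qed.

Lemma Ex_coin f : Ex dcoin f =
  b1 * b2 * f (true, true) + b1 * (1 - b2) * f (true, false) +
  (1 - b1) * b2 * f (false, true) + (1 - b1) * (1 - b2) * f (false, false).
Proof. by rewrite /dcoin Ex_prod !Ex_bern; ring. Qed.

Lemma Ex_coins0 f : Ex (dcoins 0) f = f [::].
Proof. exact: Ex_nil. Qed.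

Lemma Ex_coinsS n f : Ex (dcoins n.+1) f =
  Ex dcoin (fun c => Ex (dcoins n) (fun cs => f (c :: cs))).
Proof. exact: Ex_cons. Qed.

Lemma Ex_dbern0 l f : Ex (dbern 0 l) f = f [::].
Proof. exact: Ex_nil. Qed.

Lemma Ex_dbernS n l f : Ex (dbern n.+1 l) f =
  Ex (bern l) (fun e => Ex (dbern n l) (fun es => f (e :: es))).
Proof. exact: Ex_cons. Qed.

Lemma Ex_coinsD n1 n2 f : Ex (dcoins (n1 + n2)) f =
  Ex (dcoins n1) (fun c1 => Ex (dcoins n2) (fun c2 => f (c1 ++ c2))).
Proof. by rewrite /dcoins nseqD Ex_cat. Qed.

Lemma Ex_dbernD n1 n2 l f : Ex (dbern (n1 + n2) l) f =
  Ex (dbern n1 l) (fun c1 => Ex (dbern n2 l) (fun c2 => f (c1 ++ c2))).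
Proof. by rewrite /dbern nseqD Ex_cat. Qed.

Lemma eq_Ex_coins n f g : (forall s, size s = n -> f s = g s) ->
  Ex (dcoins n) f = Ex (dcoins n) g.
Proof. by move=> fg; apply: eq_Ex_dseq => s; rewrite size_nseq; apply: fg. Qed.

Lemma eq_Ex_dbern n l f g : (forall s, size s = n -> f s = g s) ->
  Ex (dbern n l) f = Ex (dbern n l) g.
Proof. by move=> fg; apply: eq_Ex_dseq => s; rewrite size_nseq; apply: fg. Qed.

(** Empty and full vertices are left unchanged; the two states with one path exchange mass, and
    [phi_balance] says that the two flows cancel. *)
Lemma vert_burke l (F : bool -> bool -> R) : 0 <= l ->
  Ex (bern l) (fun e => Ex (bern (ph l)) (fun h => Ex dcoin (fun c =>
    F (vert c e h).1 (vert c e h).2))) =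
  Ex (bern l) (fun e => Ex (bern (ph l)) (fun h => F e h)).
Proof.
move=> l0; have bal := phi_balance b12 b2_lt1 l0.
rewrite !Ex_bern !Ex_coin /= /vert /=.
set f := ph l in bal *; set F11 := F true true; set F10 := F true false.
set F01 := F false true; set F00 := F false false.
apply/eqP; rewrite -subr_eq0; apply/eqP.
transitivity (((1 - b2) * (1 - l) * f - (1 - b1) * l * (1 - f)) * (F10 - F01)).
  by ring.
by rewrite bal subrr mul0r.
Qed.

(** The edge leaving a vertex is independent of the site just updated, hence a fresh Bernoulli input
    for the rest of the row. *)
Lemma row_burke l n (F : seq bool -> bool -> R) : 0 <= l ->
  Ex (dbern n l) (fun es => Ex (bern (ph l)) (fun h => Ex (dcoins n) (fun cs =>
    F (outs es cs h) (hout es cs h)))) =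
  Ex (dbern n l) (fun es => Ex (bern (ph l)) (fun h => F es h)).
Proof.
move=> l0; elim: n F => [|n IH] F.
  by rewrite !Ex_dbern0; apply: eq_Ex => h; rewrite Ex_coins0.
rewrite !Ex_dbernS.
pose Phi e h := Ex (dbern n l) (fun es => Ex (dcoins n) (fun cs =>
  F (e :: outs es cs h) (hout es cs h))).
transitivity (Ex (bern l) (fun e => Ex (bern (ph l)) (fun h => Ex dcoin (fun c =>
    Phi (vert c e h).1 (vert c e h).2)))).
  apply: eq_Ex => e; rewrite Ex_exchange; apply: eq_Ex => h.
  under eq_Ex do rewrite Ex_coinsS.
  by rewrite Ex_exchange.
rewrite vert_burke //; apply: eq_Ex => e.
by rewrite -(IH (fun es h => F (e :: es) h)) [RHS]Ex_exchange.
Qed.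

Variable k : nat.

Fixpoint rstat (g : seq bool -> seq coin -> bool -> R) (m : nat)
    (es : seq bool) (cs : seq coin) (h : bool) : R :=
  if m is m'.+1 then
    g (take k es) (take k cs) h
    + rstat g m' (drop k es) (drop k cs) (hout (take k es) cs h)
  else 0.

Lemma rstatE g m es cs h : rstat g m es cs h =
  \sum_(j < m) g (take k (drop (j * k) es)) (take k (drop (j * k) cs))
                 (hout (take (j * k) es) cs h).
Proof.
elim: m es cs h => [|m IH] es cs h /=; first by rewrite big_ord0.
rewrite big_ord_recl /= mul0n !drop0 take0; congr (_ + _).
rewrite IH; apply: eq_bigr => j _.
by rewrite !drop_drop -mulSnr hout_take_drop.
Qed.

(** By [row_burke] the edge entering each block is again Bernoulli of density [phi l] and
    independent of the block, so every block contributes like the first. *)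
Lemma Ex_rstat_stationary g m l : 0 <= l <= 1 ->
  Ex (dbern (m * k) l) (fun es => Ex (bern (ph l)) (fun h =>
    Ex (dcoins (m * k)) (fun cs => rstat g m es cs h))) =
  m%:R * Ex (dbern k l) (fun es => Ex (bern (ph l)) (fun h =>
    Ex (dcoins k) (fun cs => g es cs h))).
Proof.
move=> hl; have /andP[l0 l1] := hl.
have hph : is_dist (bern (ph l)) by apply/is_dist_bern/phi_itv.
elim: m => [|m IH].
  rewrite mul0n mul0r -[RHS](Ex0 (dbern 0 l)); apply: eq_Ex => es.
  by rewrite -[RHS](Ex0 (bern (ph l))); apply: eq_Ex => h; rewrite Ex_coins0.
rewrite mulSn Ex_dbernD.
pose Psi h := Ex (dbern (m * k) l) (fun es => Ex (dcoins (m * k)) (fun cs =>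
  rstat g m es cs h)).
transitivity (Ex (dbern k l) (fun es => Ex (bern (ph l)) (fun h =>
  Ex (dcoins k) (fun cs => g es cs h + Psi (hout es cs h))))).
  apply: eq_Ex_dbern => e1 s1; rewrite Ex_exchange; apply: eq_Ex => h.
  under eq_Ex do rewrite Ex_coinsD.
  rewrite Ex_exchange; apply: eq_Ex_coins => c1 sc1.
  rewrite -(Ex_cst (g e1 c1 h) (is_dist_dbern (m * k) hl)) -ExD.
  apply: eq_Ex => e2.
  rewrite -[X in X + _](Ex_cst (g e1 c1 h) (is_dist_coins (m * k))) -ExD.
  apply: eq_Ex => c2 /=.
  rewrite !take_size_cat // !drop_size_cat //.
  by rewrite -(@hout_take k) ?s1 // take_size_cat.
transitivity (Ex (dbern k l) (fun es => Ex (bern (ph l)) (fun h =>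
  Ex (dcoins k) (fun cs => g es cs h))) + Ex (bern (ph l)) Psi).
  rewrite -[X in _ + X](Ex_cst _ (is_dist_dbern k hl)).
  rewrite -(row_burke k (fun=> Psi)) // -ExD; apply: eq_Ex => es.
  by rewrite -ExD; apply: eq_Ex => h; rewrite -ExD.
rewrite -natr1 mulrDl mul1r addrC -IH; congr (_ + _).
by rewrite Ex_exchange.
Qed.

(** The vanishing first moment is carried along with the variance because it cancels the cross term
    in the induction. *)
Lemma Ex_mass_sqr (ps : seq R) : all (fun p => 0 <= p <= 1) ps ->
  Ex (dseq (map (@bern R) ps)) (fun es => (mass es)%:R - \sum_(p <- ps) p) = 0 /\
  Ex (dseq (map (@bern R) ps)) (fun es => ((mass es)%:R - \sum_(p <- ps) p) ^+ 2)
    <= (size ps)%:R.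
Proof.
elim: ps => [|p ps IH] /=; first by rewrite !Ex_nil big_nil subrr expr0n.
case/andP=> hp hps; have [IH1 IH2] := IH hps; have hd := is_dist_bern_map hps.
have /andP[p0 p1] := hp.
set S := \sum_(q <- ps) q in IH1 IH2 *.
split.
  rewrite Ex_cons -[RHS](_ : p * (1 - p) + (1 - p) * (- p) = 0); last by ring.
  rewrite Ex_bern big_cons -/S; congr (_ * _ + _ * _).
    rewrite -[RHS]addr0 -IH1 -[in RHS](Ex_cst (1 - p) hd) -ExD.
    by apply: eq_Ex => es; rewrite /= natrD; ring.
  rewrite -[RHS]addr0 -IH1 -[in RHS](Ex_cst (- p) hd) -ExD.
  by apply: eq_Ex => es; rewrite /= add0n; ring.
have expand (x : R) : Ex (dseq (map (@bern R) ps))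
    (fun es => (x - p + ((mass es)%:R - S)) ^+ 2) =
    (x - p) ^+ 2 + Ex (dseq (map (@bern R) ps)) (fun es => ((mass es)%:R - S) ^+ 2).
  rewrite -[LHS]addr0 -(mulr0 (- 2 * (x - p))) -IH1 -ExZ -ExD.
  rewrite -[X in _ = X + _](Ex_cst ((x - p) ^+ 2) hd) -ExD.
  by apply: eq_Ex => es; ring.
rewrite Ex_cons big_cons Ex_bern.
rewrite (@eq_Ex _ _ _ _ (fun es => (1 - p + ((mass es)%:R - S)) ^+ 2)); last first.
  by move=> es; rewrite /= natrD; congr (_ ^+ 2); rewrite -/S; ring.
rewrite (@eq_Ex _ _ _ (fun s => ((mass (false :: s))%:R - (p + S)) ^+ 2)
  (fun es => (0 - p + ((mass es)%:R - S)) ^+ 2)); last first.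
  by move=> es; rewrite /= add0n; congr (_ ^+ 2); ring.
rewrite !expand -natr1.
set X := Ex _ _ in IH2 *.
have : p * (1 - p) ^+ 2 + (1 - p) * (0 - p) ^+ 2 <= 1 by nra.
lra.
Qed.

(* Telescoping sum of the martingale differences of the chain of horizontal edges. *)
Lemma Ex_flux_martingale l n h : 0 <= l <= 1 ->
  let ga := b2 - (b2 - b1) * l in
  let Z es cs h := (1 - ga) * ((flux es cs h)%:R - n%:R * ph l)
                   + (hout es cs h)%:R - h%:R : R in
  Ex (dbern n l) (fun es => Ex (dcoins n) (fun cs => Z es cs h)) = 0 /\
  Ex (dbern n l) (fun es => Ex (dcoins n) (fun cs => Z es cs h ^+ 2)) <= 4 * n%:R.
Proof.
(* In equilibrium the horizontal edges along a row form a two-state Markov chain, and [ga] is its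
   second eigenvalue: the probability of an occupied edge after an occupied one minus that after an
   empty one. *)
move=> hl ga; have /andP[l0 l1] := hl.
have [hb1 hb2 hb3] := And3 b1_gt0 b12 b2_lt1.
have bal := phi_balance b12 b2_lt1 l0.
have /andP[f0 f1] := phi_itv b12 b2_lt1 hl.
set f := ph l in bal f0 f1 *.
elim: n h => [|n IH] h Z.
  rewrite /Z !Ex_dbern0 !Ex_coins0 /= !mul0r subrr mulr0 add0r subrr expr0n mulr0.
  by [].
pose Z' es cs (h : bool) : R :=
  (1 - ga) * ((flux es cs h)%:R - n%:R * f) + (hout es cs h)%:R - h%:R.
pose dd h h' : R := (1 - ga) * ((h : bool)%:R - f) + ((h' : bool)%:R - h%:R).
have ZE e es c cs : Z (e :: es) (c :: cs) h =
    dd h (vert c e h).2 + Z' es cs (vert c e h).2.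
  by rewrite /Z /Z' /dd /= natrD -natr1; ring.
have hdE := is_dist_dbern n hl; have hdC := is_dist_coins n.
have hb := is_dist_bern hl; have hc := is_dist_coin.
have dd0 : Ex (bern l) (fun e => Ex dcoin (fun c => dd h (vert c e h).2)) = 0.
  rewrite Ex_bern !Ex_coin /dd /ga /vert; case: h {Z ZE} => /=.
    transitivity ((1 - b1) * l * (1 - f) - (1 - b2) * (1 - l) * f); first by ring.
    by rewrite bal subrr.
  transitivity ((1 - b1) * l * (1 - f) - (1 - b2) * (1 - l) * f); first by ring.
  by rewrite bal subrr.
have ga01 : 0 <= ga <= 1 by rewrite /ga; nra.
have dd4 h' : dd h h' ^+ 2 <= 4.
  have : -2 <= dd h h' <= 2.
    by move/andP: ga01 => [g0 g1]; rewrite /dd; case: (h); case: h' => /=; nra.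
  by move/andP => [? ?]; nra.
have step (Q : seq bool -> seq coin -> bool -> R) :
  Ex (dbern n.+1 l) (fun es => Ex (dcoins n.+1) (fun cs => Q es cs h)) =
  Ex (bern l) (fun e => Ex dcoin (fun c =>
    Ex (dbern n l) (fun es => Ex (dcoins n) (fun cs => Q (e :: es) (c :: cs) h)))).
  rewrite Ex_dbernS; apply: eq_Ex => e.
  by under eq_Ex do rewrite Ex_coinsS; rewrite Ex_exchange.
split.
  rewrite (step Z) -[RHS]dd0; apply: eq_Ex => e; apply: eq_Ex => c.
  rewrite -[RHS]addr0 -(IH (vert c e h).2).1 -[in RHS](Ex_cst (dd _ _) hdE) -ExD.
  apply: eq_Ex => es; rewrite -[in RHS](Ex_cst (dd _ _) hdC) -ExD.
  by apply: eq_Ex => cs; rewrite ZE.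
rewrite (step (fun es cs h => Z es cs h ^+ 2)).
have -> : 4 * n.+1%:R = 4 + 4 * n%:R :> R by rewrite -natr1; ring.
rewrite -(Ex_cst (4 + 4 * n%:R) hb); apply: le_Ex => // e.
rewrite -(Ex_cst (4 + 4 * n%:R) hc); apply: le_Ex => // c.
set h' := (vert c e h).2.
have [IH1 IH2] := IH h'.
rewrite (_ : Ex _ _ = dd h h' ^+ 2 + 
  Ex (dbern n l) (fun es => Ex (dcoins n) (fun cs => Z' es cs h' ^+ 2))).
  by rewrite lerD.
rewrite -[LHS]addr0 -(mulr0 (- 2 * dd h h')) -IH1 -ExZ -ExD.
rewrite -[X in _ = X + _](Ex_cst (dd h h' ^+ 2) hdE) -ExD.
apply: eq_Ex => es; rewrite -ExZ -ExD.
rewrite -[X in _ = X + _](Ex_cst (dd h h' ^+ 2) hdC) -ExD.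
apply: eq_Ex => cs; rewrite ZE -/h' /Z'; ring.
Qed.

End RowExpectations.

(** * Local equilibrium *)

Section LocalEquilibrium.
Variables (R : realType) (b1 b2 : R).
Hypotheses (b1_gt0 : 0 < b1) (b12 : b1 < b2) (b2_lt1 : b2 < 1).
Local Notation ka := (kappa b1 b2).
Local Notation ph := (phi b1 b2).
Local Notation dcoin := (dcoin b1 b2).
Local Notation dcoins := (dcoins b1 b2).

Definition pos (x : R) : R := Num.max x 0.

Lemma pos_ge0 x : 0 <= pos x.
Proof. by rewrite /pos le_max lexx orbT. Qed.

Lemma le_pos x : x <= pos x.
Proof. by rewrite /pos le_max lexx. Qed.

Lemma pos_le x y : x <= y -> 0 <= y -> pos x <= y.
Proof. by move=> xy y0; rewrite /pos ge_max xy. Qed.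

(* Distance of a pair (density [U], flux [F]) to the union of the two quadrants
   above and below the point (l, phi l). *)
Definition quad_dist (l U F : R) : R :=
  Num.min (pos (l - U) + pos (ph l - F)) (pos (U - l) + pos (F - ph l)).

Lemma quad_dist_ge0 l U F : 0 <= quad_dist l U F.
Proof. by rewrite /quad_dist le_min !addr_ge0 ?pos_ge0. Qed.

Lemma le_quad_dist l U F x :
  x <= pos (l - U) + pos (ph l - F) -> x <= pos (U - l) + pos (F - ph l) ->
  x <= quad_dist l U F.
Proof. by rewrite /quad_dist le_min => -> ->. Qed.

(** The double quadrants at the points of the increasing graph of [phi] intersect in that graph: if
    [F < phi U], some [l < U] has [phi l > F], and (U, F) lies in neither quadrant at [l]; likewise
    above the graph. Testing only multiples of 1 / K costs [K%:R^-1]. *)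
Lemma flux_of_quad_dist (K : nat) U F : (0 < K)%N -> 0 <= U <= 1 -> 0 <= F <= 1 ->
  `|F - ph U| <= 2 * ka *
    (K%:R^-1 + \sum_(i < K.+1) quad_dist (i%:R / K%:R) U F).
Proof.
move=> K0 /andP[U0 U1] /andP[F0 F1].
have KR : 0 < K%:R :> R by rewrite ltr0n.
have k1 := kappa_gt1 b12 b2_lt1.
suff [i [iK H]] : exists i : nat, (i <= K)%N /\
    `|F - ph U| / (2 * ka) - K%:R^-1 <= quad_dist (i%:R / K%:R) U F.
  have {}H : `|F - ph U| / (2 * ka) <=
    K%:R^-1 + \sum_(i < K.+1) quad_dist (i%:R / K%:R) U F.
    rewrite (bigD1 (Ordinal (iK : (i < K.+1)%N))) //=.
    have : 0 <= \sum_(j < K.+1 | j != Ordinal (iK : (i < K.+1)%N))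
        quad_dist (j%:R / K%:R) U F.
      by apply: sumr_ge0 => j _; apply: quad_dist_ge0.
    by move: H; lra.
  have k2 : 0 < 2 * ka by rewrite mulr_gt0 // (lt_trans ltr01).
  by move: H; rewrite ler_pdivrMr // mulrC.
set x := `|F - ph U|; have x0 : 0 <= x by apply: normr_ge0.
have xE : x / (2 * ka) * (2 * ka) = x.
  by rewrite divfK // gt_eqF // mulr_gt0 // (lt_trans ltr01).
have y0 : 0 <= x / (2 * ka) by rewrite divr_ge0 // mulr_ge0 // ltW // (lt_trans ltr01).
set y := x / (2 * ka) in xE y0 *.
have [x00|xn0] := eqVneq x 0.
  exists 0%N; split=> //; apply: le_trans (quad_dist_ge0 _ _ _).
  by rewrite /y x00 mul0r sub0r oppr_le0 invr_ge0 ltW.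
have xgt0 : 0 < x by rewrite lt_neqAle eq_sym xn0.
have yx2 : y <= x / 2 by rewrite -xE; nra.
pose mid := Num.min F (ph U) + x / 2.
have phU1 : ph U <= 1 by rewrite -(phi1 b12 b2_lt1) le_phi.
have phU0 : 0 <= ph U by rewrite phi_ge0.
have mid1 : mid < 1.
  rewrite /mid /x; case: (leP F (ph U)) => FU.
    rewrite ler0_norm; last by lra.
    move: xgt0; rewrite /x ler0_norm; lra.
  by rewrite gtr0_norm; lra.
have mid0 : 0 <= mid by rewrite /mid addr_ge0 ?divr_ge0 // le_min F0.
have exP : exists n, (n <= K)%N && (ph (n%:R / K%:R) <= mid).
  by exists 0%N; rewrite /= mul0r phi0.
have bdP n : (n <= K)%N && (ph (n%:R / K%:R) <= mid) -> (n <= K)%N by case/andP.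
case: (ex_maxnP exP bdP) => i /andP[iK phi_i] imax.
have lti : (i < K)%N.
  rewrite ltn_neqAle iK andbT; apply/eqP => iE; move: phi_i.
  by rewrite iE divff ?gt_eqF // phi1 // leNgt mid1.
have phiS : mid < ph (i.+1%:R / K%:R).
  rewrite ltNge; apply/negP => le; have := imax i.+1; rewrite lti le.
  by move=> /(_ isT); rewrite ltnn.
set l := i%:R / K%:R in phi_i *; set l' := i.+1%:R / K%:R in phiS *.
have ll' : l' = l + K%:R^-1 by rewrite /l' /l -natr1 mulrDl mul1r.
have l0 : 0 <= l by rewrite divr_ge0 // ltW.
have l'0 : 0 <= l' by rewrite divr_ge0 // ltW.
have [FU|UF] := leP F (ph U).
- have xV : x = ph U - F by rewrite /x ler0_norm; lra.
  have midE : mid = F + x / 2 by rewrite /mid min_l.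
  have lU : l < U.
    rewrite ltNge; apply/negP => Ul; have := le_phi b12 b2_lt1 U0 Ul; lra.
  have := phi_lip b12 b2_lt1 l0 (ltW lU) => lip.
  have yl : y <= U - l by nra.
  exists i.+1; split=> //; apply: le_quad_dist.
    have := le_pos (ph l' - F); have := pos_ge0 (l' - U).
    have : 0 < K%:R^-1 :> R by rewrite invr_gt0.
    by rewrite -/l'; lra.
  have := le_pos (U - l'); have := pos_ge0 (F - ph l'); rewrite -/l'; lra.
- have xV : x = F - ph U by rewrite /x gtr0_norm; lra.
  have midE : mid = ph U + x / 2 by rewrite /mid min_r // ltW.
  have lU : U < l'.
    rewrite ltNge; apply/negP => Ul; have := le_phi b12 b2_lt1 l'0 Ul; lra.
  have := phi_lip b12 b2_lt1 U0 (ltW lU) => lip.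
  have yl : y <= l' - U by nra.
  exists i; split=> //; apply: le_quad_dist.
    have := le_pos (l - U); have := pos_ge0 (ph l - F); rewrite -/l; lra.
  have := le_pos (F - ph l); have := pos_ge0 (U - l).
  have : 0 < K%:R^-1 :> R by rewrite invr_gt0.
  by rewrite -/l; lra.
Qed.

Definition cmin : R := b1 * (1 - b1) * (b2 * (1 - b2)).

Lemma cmin_gt0 : 0 < cmin.
Proof.
have [h1 h2 h3] := And3 b1_gt0 b12 b2_lt1.
by rewrite /cmin !mulr_gt0 // ?subr_gt0 //; lra.
Qed.

Lemma coin_prob_ge c : cmin <= Ex dcoin (fun c' => (c' == c)%:R).
Proof.
have [h1 h2 h3] := And3 b1_gt0 b12 b2_lt1.
have hb2 : 0 < b2 by lra. have hb1 : b1 < 1 by lra.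
have p1 : 0 < b1 * (1 - b1) <= b1 by nra.
have p1' : b1 * (1 - b1) <= 1 - b1 by nra.
have p2 : 0 < b2 * (1 - b2) <= b2 by nra.
have p2' : b2 * (1 - b2) <= 1 - b2 by nra.
move: p1 p2 => /andP[p10 p1] /andP[p20 p2].
rewrite Ex_coin /cmin; case: c => -[] [] /=.
all: rewrite ?mulr1 ?mulr0 ?add0r ?addr0.
all: by rewrite ler_pM // ltW.
Qed.

Lemma Ex_coin_force (f : coin -> R) A D c : 0 <= D ->
  (forall c, f c <= A) -> f c <= A - D -> Ex dcoin f <= A - cmin * D.
Proof.
move=> D0 fA fD; have hd := is_dist_coin b1_gt0 b12 b2_lt1.
apply: (@le_trans _ _ (Ex dcoin (fun c' => A - (c' == c)%:R * D))).
  apply: le_Ex => // c'; case: eqP => [->|_]; first by rewrite mul1r.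
  by rewrite mul0r subr0.
by rewrite ExB Ex_cst // ExZr lerB // ler_wpM2r // coin_prob_ge.
Qed.

Lemma Ex_coins_force n (f : seq coin -> R) A D cs : 0 <= D -> size cs = n ->
  (forall c, f c <= A) -> f cs <= A - D -> Ex (dcoins n) f <= A - cmin ^+ n * D.
Proof.
elim: n f A D cs => [|n IH] f A D [|c cs] //= D0.
  by move=> _ _; rewrite Ex_coins0 expr0 mul1r.
move=> [sz] fA fD; rewrite Ex_coinsS exprS -mulrA.
apply: (@Ex_coin_force _ _ _ c).
- by rewrite mulr_ge0 // exprn_ge0 // ltW // cmin_gt0.
- move=> c'; rewrite -[A](Ex_cst _ (is_dist_coins b1_gt0 b12 b2_lt1 n)).
  by apply: le_Ex => //; apply: is_dist_coins.
- exact: (IH _ _ _ cs).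
Qed.

Variables (k : nat).
Hypothesis k_gt0 : (0 < k)%N.
Let kR : 0 < k%:R :> R. Proof. by rewrite ltr0n. Qed.

Definition density (es : seq bool) : R := (mass es)%:R / k%:R.
Definition bflux (es : seq bool) cs h : R := (flux es cs h)%:R / k%:R.

Lemma density_itv es : (size es <= k)%N -> 0 <= density es <= 1.
Proof.
move=> se; rewrite divr_ge0 //= ler_pdivrMr // mul1r ler_nat.
exact: leq_trans (count_size _ _) se.
Qed.

Lemma bflux_itv es cs h : (size es <= k)%N -> 0 <= bflux es cs h <= 1.
Proof.
move=> se; rewrite divr_ge0 //= ler_pdivrMr // mul1r ler_nat.
exact: leq_trans (flux_size _ _ _) se.
Qed.

Definition vstat l es cs h : R := quad_dist l (density es) (bflux es cs h).
Definition bdev l es cs h : R := `|density es - l| + `|bflux es cs h - ph l|.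

(** [row_mono] orders density and flux in the same direction, so the first block lies in a quadrant
    based at the density and flux of the second, which are within [bdev] of (l, phi l). *)
Lemma vstat_ordered l e1 e2 cs h1 h2 : ordered e1 e2 h1 h2 ->
  vstat l e1 cs h1 <= bdev l e2 cs h2.
Proof.
rewrite /vstat /bdev /quad_dist ge_min.
case/orP => /andP[le12 h12]; apply/orP; [right|left].
- have [_ _ fl] := row_mono cs le12 h12; have ma := leb_seq_mass le12.
  rewrite lerD // pos_le //.
  + apply: le_trans (ler_norm _); rewrite lerB // ler_pM2r ?invr_gt0 //.
    by rewrite ler_nat.
  + apply: le_trans (ler_norm _); rewrite lerB // ler_pM2r ?invr_gt0 //.
    by rewrite ler_nat.
- have [_ _ fl] := row_mono cs le12 h12; have ma := leb_seq_mass le12.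
  rewrite lerD // pos_le //.
  + rewrite distrC; apply: le_trans (ler_norm _); rewrite lerB //.
    by rewrite ler_pM2r ?invr_gt0 // ler_nat.
  + rewrite distrC; apply: le_trans (ler_norm _); rewrite lerB //.
    by rewrite ler_pM2r ?invr_gt0 // ler_nat.
Qed.

Lemma vstat_le2 l es cs h : 0 <= l <= 1 -> (size es <= k)%N -> vstat l es cs h <= 2.
Proof.
move=> hl se; have /andP[u0 u1] := density_itv se.
have /andP[f0 f1] := bflux_itv cs h se.
have /andP[p0 p1] := phi_itv b12 b2_lt1 hl; have /andP[l0 l1] := hl.
rewrite /vstat /quad_dist ge_min; apply/orP; left.
rewrite -[2]/(1 + 1) lerD // pos_le //; lra.
Qed.

Lemma vstat_bound l e1 e2 cs h1 h2 : 0 <= l <= 1 -> (size e1 <= k)%N ->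
  vstat l e1 cs h1 <= 2 * (~~ ordered e1 e2 h1 h2)%:R + bdev l e2 cs h2.
Proof.
move=> hl se; case: (boolP (ordered e1 e2 h1 h2)) => o /=.
  by rewrite mulr0 add0r vstat_ordered.
rewrite mulr1 -[X in X <= _]addr0 lerD ?vstat_le2 //.
by rewrite addr_ge0.
Qed.

(** The number of blocks of a row in which two copies driven by the same coins are unordered. *)
Fixpoint ustat (m : nat) (e1 e2 : seq bool) (cs : seq coin) (h1 h2 : bool) : R :=
  if m is m'.+1 then
    (~~ ordered (take k e1) (take k e2) h1 h2)%:R
    + ustat m' (drop k e1) (drop k e2) (drop k cs)
        (hout (take k e1) cs h1) (hout (take k e2) cs h2)
  else 0.

Lemma rstat_vstat l m e1 e2 cs h1 h2 : 0 <= l <= 1 ->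
  rstat k (vstat l) m e1 cs h1 <=
  2 * ustat m e1 e2 cs h1 h2 + rstat k (bdev l) m e2 cs h2.
Proof.
move=> hl; elim: m e1 e2 cs h1 h2 => [|m IH] e1 e2 cs h1 h2 /=.
  by rewrite mulr0 addr0.
have := IH (drop k e1) (drop k e2) (drop k cs) (hout (take k e1) cs h1)
  (hout (take k e2) cs h2).
have := @vstat_bound l (take k e1) (take k e2) (take k cs) h1 h2 hl.
rewrite size_take_min geq_minl => /(_ isT); rewrite mulrDr; lra.
Qed.

(** No block creates discrepancies ([row_disc]), and an unordered one loses a pair with probability
    at least [cmin ^+ k] ([forced_annihilation]). The discrepancy of the edge between two blocks is
    counted so that the estimates telescope along the row. *)
Lemma Ex_ustat m e1 e2 h1 h2 : size e1 = (m * k)%N -> size e2 = (m * k)%N ->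
  Ex (dcoins (m * k)) (fun cs => 2 * cmin ^+ k * ustat m e1 e2 cs h1 h2 +
     (disc (outs e1 cs h1) (outs e2 cs h2) + (hout e1 cs h1 (+) hout e2 cs h2))%:R)
  <= (disc e1 e2 + (h1 (+) h2))%:R.
Proof.
elim: m e1 e2 h1 h2 => [|m IH] e1 e2 h1 h2.
  by case: e1 => //; case: e2 => //= _ _; rewrite Ex_coins0 mulr0 add0r.
rewrite mulSn => s1 s2.
have hdk := is_dist_coins b1_gt0 b12 b2_lt1 k.
have hdm := is_dist_coins b1_gt0 b12 b2_lt1 (m * k).
rewrite Ex_coinsD -(cat_take_drop k e1) -(cat_take_drop k e2).
set x1 := take k e1; set x2 := take k e2; set y1 := drop k e1; set y2 := drop k e2.
have sx1 : size x1 = k by rewrite size_take_min s1; apply/minn_idPl; lia.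
have sx2 : size x2 = k by rewrite size_take_min s2; apply/minn_idPl; lia.
have sy1 : size y1 = (m * k)%N by rewrite size_drop s1; lia.
have sy2 : size y2 = (m * k)%N by rewrite size_drop s2; lia.
have disc_cat (a1 a2 c1 c2 : seq bool) : size a1 = size a2 ->
    disc (a1 ++ c1) (a2 ++ c2) = (disc a1 a2 + disc c1 c2)%N.
  by elim: a1 a2 => [|p a1 IHa] [|q a2] //= [/IHa ->]; rewrite addnA.
set U := (~~ ordered x1 x2 h1 h2)%:R : R.
pose B cs : R := (disc (outs x1 cs h1) (outs x2 cs h2) +
                 (hout x1 cs h1 (+) hout x2 cs h2))%:R.
apply: (@le_trans _ _ (Ex (dcoins k) (fun c1 =>
   2 * cmin ^+ k * U + B c1 + (disc y1 y2)%:R))).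
  apply: le_Ex_dseq => // c1; rewrite size_nseq => sc1.
  have := IH y1 y2 (hout x1 c1 h1) (hout x2 c1 h2) sy1 sy2.
  set T := (T in T <= _ -> _) => HT.
  rewrite (_ : Ex _ _ = 2 * cmin ^+ k * U + (disc (outs x1 c1 h1) (outs x2 c1 h2))%:R + T).
    by move: HT; rewrite /B natrD [in X in _ -> X]natrD; lra.
  rewrite /T -(Ex_cst (2 * _ * U + _) hdm) -ExD; apply: eq_Ex => c2.
  rewrite /= !take_size_cat // !drop_size_cat //.
  rewrite !outs_cat ?sx1 // ?sx2 // disc_cat ?size_outs ?sx1 //.
  rewrite !hout_cat ?sx1 ?sx2 //.
  rewrite -[hout x1 (c1 ++ c2) h1](@hout_take k) ?sx1 //.
  rewrite -[hout x2 (c1 ++ c2) h2](@hout_take k) ?sx2 //.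
  rewrite !take_size_cat // -/U !natrD; ring.
rewrite disc_cat ?sx1 ?sx2 // ExD Ex_cst // ExD Ex_cst //.
have Bmax cs : B cs <= (disc x1 x2 + (h1 (+) h2))%:R.
  by rewrite ler_nat row_disc // sx1 sx2.
suff : Ex (dcoins k) B <= (disc x1 x2 + (h1 (+) h2))%:R - cmin ^+ k * (2 * U).
  by rewrite !natrD; lra.
rewrite /U; case: (boolP (ordered x1 x2 h1 h2)) => o /=.
  rewrite !mulr0 subr0 -[X in _ <= X](Ex_cst _ hdk); exact: le_Ex.
have [cs szc Hcs] := @forced_annihilation x1 x2 h1 h2 (etrans sx1 (esym sx2)) o.
apply: (@Ex_coins_force _ _ _ _ cs) => //; rewrite ?szc //; try by rewrite mulr1.
by rewrite mulr1 lerBrDr /B -natrD ler_nat.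
Qed.

End LocalEquilibrium.

(* One time step: the horizontal edge entering from the left, and the coins. *)
Definition rowdata := (bool * seq coin)%type.
Definition step (es : seq bool) (r : rowdata) : seq bool := outs es r.2 r.1.
Definition run (rows : seq rowdata) (es : seq bool) : seq bool := foldl step es rows.

Lemma size_run rows es : size (run rows es) = size es.
Proof. by elim: rows es => //= r rows IH es; rewrite IH size_outs. Qed.

(** * Systems in time, their couplings, and the count of unordered blocks *)

Section Systems.
Variables (R : realType) (b1 b2 : R).
Hypotheses (b1_gt0 : 0 < b1) (b12 : b1 < b2) (b2_lt1 : b2 < 1).
Local Notation ka := (kappa b1 b2).
Local Notation ph := (phi b1 b2).
Local Notation dcoin := (dcoin b1 b2).
Local Notation dcoins := (dcoins b1 b2).
Local Notation cmin := (cmin b1 b2).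

Definition itv01 (p : R) : bool := 0 <= p <= 1.

Definition dinit (ps : seq R) : dist R (seq bool) := dseq (map (@bern R) ps).
Definition drow (f : R) (L : nat) : dist R rowdata := dprod (bern f) (dcoins L).
Definition drows (f : R) (L N : nat) : dist R (seq rowdata) := dseq (nseq N (drow f L)).

(* Expectation for [N] steps on [size ps] sites, with independent initial
   occupations of densities [ps] and incoming horizontal edges of density [f]. *)
Definition Esys (ps : seq R) (f : R) (N : nat) (F : seq bool -> seq rowdata -> R) : R :=
  Ex (dinit ps) (fun es => Ex (drows f (size ps) N) (F es)).

(** The monotone coupling: one of the two mixed outcomes has weight zero, so the bits are ordered
    like [p] and [q]. *)
Definition cpl (p q : R) : dist R (bool * bool) :=
  [:: (Num.min p q, (true, true)); (p - Num.min p q, (true, false));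
      (q - Num.min p q, (false, true)); (1 - Num.max p q, (false, false))].

Lemma is_dist_cpl p q : itv01 p -> itv01 q -> is_dist (cpl p q).
Proof.
move=> /andP[p0 p1] /andP[q0 q1]; split.
  by rewrite /= !subr_ge0 !ge_min le_min ge_max !lexx p0 q0 p1 q1 orbT.
rewrite /Ex !big_cons big_nil /= !mulr1.
by have := addr_max_min p q; lra.
Qed.

Lemma Ex_cpl1 p q g : Ex (cpl p q) (fun a => g a.1) = Ex (bern p) g.
Proof.
rewrite /Ex /bern !big_cons !big_nil /=.
have e : Num.max p q = p + q - Num.min p q by rewrite -(addr_max_min p q) addrK.
by rewrite e; ring.
Qed.

Lemma Ex_cpl2 p q g : Ex (cpl p q) (fun a => g a.2) = Ex (bern q) g.
Proof.
rewrite /Ex /bern !big_cons !big_nil /=.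
have e : Num.max p q = p + q - Num.min p q by rewrite -(addr_max_min p q) addrK.
by rewrite e; ring.
Qed.

Definition rowdata2 := ((bool * bool) * seq coin)%type.
Definition row1 (r : rowdata2) : rowdata := (r.1.1, r.2).
Definition row2 (r : rowdata2) : rowdata := (r.1.2, r.2).

Definition dinit2 (ps qs : seq R) : dist R (seq (bool * bool)) :=
  dseq [seq cpl x.1 x.2 | x <- zip ps qs].
Definition drow2 (f g : R) (L : nat) : dist R rowdata2 := dprod (cpl f g) (dcoins L).
Definition drows2 (f g : R) (L N : nat) : dist R (seq rowdata2) :=
  dseq (nseq N (drow2 f g L)).

Definition Esys2 (ps qs : seq R) (f g : R) (N : nat)
    (F : seq (bool * bool) -> seq rowdata2 -> R) : R :=
  Ex (dinit2 ps qs) (fun es => Ex (drows2 f g (size ps) N) (F es)).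

Lemma is_dist_drow f L : itv01 f -> is_dist (drow f L).
Proof. by move=> hf; apply: is_dist_prod; [apply: is_dist_bern|apply: is_dist_coins]. Qed.

Lemma is_dist_drows f L N : itv01 f -> is_dist (drows f L N).
Proof. by move=> hf; apply: is_dist_nseq; apply: is_dist_drow. Qed.

Lemma is_dist_dinit ps : all itv01 ps -> is_dist (dinit ps).
Proof. exact: is_dist_bern_map. Qed.

Lemma is_dist_drow2 f g L : itv01 f -> itv01 g -> is_dist (drow2 f g L).
Proof.
by move=> hf hg; apply: is_dist_prod; [apply: is_dist_cpl|apply: is_dist_coins].
Qed.

Lemma is_dist_drows2 f g L N : itv01 f -> itv01 g -> is_dist (drows2 f g L N).
Proof. by move=> hf hg; apply: is_dist_nseq; apply: is_dist_drow2. Qed.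

Lemma is_dist_dinit2 ps qs : all itv01 ps -> all itv01 qs -> is_dist (dinit2 ps qs).
Proof.
elim: ps qs => [|p ps IH] [|q qs] /=; try by move=> *; apply: is_dist_nil.
move=> /andP[hp hps] /andP[hq hqs]; apply: is_dist_cons; first exact: is_dist_cpl.
exact: IH.
Qed.

Lemma Esys_proj1 ps qs f g N F : size ps = size qs ->
  Esys2 ps qs f g N (fun es rows => F (unzip1 es) (map row1 rows)) = Esys ps f N F.
Proof.
move=> sz; rewrite /Esys /Esys2.
rewrite -[in RHS](@Ex_map_seq _ _ _ [seq cpl x.1 x.2 | x <- zip ps qs] _ fst).
- apply: eq_Ex => es; rewrite /drows -(Ex_map_nseq _ (d := drow2 f g (size ps)) (h := row1)) //.
  by move=> G; rewrite !Ex_prod -(Ex_cpl1 f g).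
- by rewrite !size_map size_zip sz minnn.
- move=> i d0 d0'; rewrite size_map size_zip sz minnn => lti G.
  rewrite (nth_map (0, 0)) ?size_zip ?sz ?minnn // nth_zip // (nth_map 0) ?sz //=.
  exact: Ex_cpl1.
Qed.

Lemma Esys_proj2 ps qs f g N F : size ps = size qs ->
  Esys2 ps qs f g N (fun es rows => F (unzip2 es) (map row2 rows)) = Esys qs g N F.
Proof.
move=> sz; rewrite /Esys /Esys2.
rewrite -[in RHS](@Ex_map_seq _ _ _ [seq cpl x.1 x.2 | x <- zip ps qs] _ snd).
- apply: eq_Ex => es; rewrite /drows -sz -(Ex_map_nseq _ (d := drow2 f g (size ps)) (h := row2)) //.
  by move=> G; rewrite !Ex_prod -(Ex_cpl2 f g).
- by rewrite !size_map size_zip sz minnn.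
- move=> i d0 d0'; rewrite size_map size_zip sz minnn => lti G.
  rewrite (nth_map (0, 0)) ?size_zip ?sz ?minnn // nth_zip // (nth_map 0) ?sz //=.
  exact: Ex_cpl2.
Qed.

Lemma le_Esys ps f N F G : all itv01 ps -> itv01 f ->
  (forall es rows, size es = size ps -> size rows = N -> F es rows <= G es rows) ->
  Esys ps f N F <= Esys ps f N G.
Proof.
move=> hp hf FG; apply: le_Ex_dseq; first exact: is_dist_dinit.
move=> es; rewrite size_map => se; apply: le_Ex_dseq; first exact: is_dist_drows.
by move=> rows; rewrite size_nseq; apply: FG.
Qed.

Lemma le_Esys2 ps qs f g N F G : all itv01 ps -> all itv01 qs -> itv01 f -> itv01 g ->
  size ps = size qs ->
  (forall es rows, size es = size ps -> size rows = N -> F es rows <= G es rows) ->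
  Esys2 ps qs f g N F <= Esys2 ps qs f g N G.
Proof.
move=> hp hq hf hg sz FG; apply: le_Ex_dseq; first exact: is_dist_dinit2.
move=> es; rewrite size_map size_zip -sz minnn => se.
apply: le_Ex_dseq; first exact: is_dist_drows2.
by move=> rows; rewrite size_nseq; apply: FG.
Qed.

Lemma EsysD ps f N F G :
  Esys ps f N (fun es rows => F es rows + G es rows) = Esys ps f N F + Esys ps f N G.
Proof. by rewrite /Esys -ExD; apply: eq_Ex => es; rewrite ExD. Qed.

Lemma EsysZ ps f N c F :
  Esys ps f N (fun es rows => c * F es rows) = c * Esys ps f N F.
Proof. by rewrite /Esys -ExZ; apply: eq_Ex => es; rewrite ExZ. Qed.

Lemma Esys2D ps qs f g N F G :
  Esys2 ps qs f g N (fun es rows => F es rows + G es rows) =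
  Esys2 ps qs f g N F + Esys2 ps qs f g N G.
Proof. by rewrite /Esys2 -ExD; apply: eq_Ex => es; rewrite ExD. Qed.

Lemma Esys2Z ps qs f g N c F :
  Esys2 ps qs f g N (fun es rows => c * F es rows) = c * Esys2 ps qs f g N F.
Proof. by rewrite /Esys2 -ExZ; apply: eq_Ex => es; rewrite ExZ. Qed.

Lemma Esys_sum ps f N (n : nat) (F : nat -> seq bool -> seq rowdata -> R) :
  Esys ps f N (fun es rows => \sum_(i < n) F i es rows) =
  \sum_(i < n) Esys ps f N (F i).
Proof. by rewrite /Esys -Ex_sum; apply: eq_Ex => es; rewrite Ex_sum. Qed.

Lemma Esys_cst ps f N c : all itv01 ps -> itv01 f -> Esys ps f N (fun _ _ => c) = c.
Proof.
move=> hp hf; rewrite -[RHS](Ex_cst c (is_dist_dinit hp)); apply: eq_Ex => es.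
by rewrite Ex_cst //; apply: is_dist_drows.
Qed.

Lemma Esys_markov ps f N (F : seq bool -> seq rowdata -> R) c :
  all itv01 ps -> itv01 f -> 0 < c -> (forall es rows, 0 <= F es rows) ->
  Esys ps f N (fun es rows => (c < F es rows)%R%:R) <= Esys ps f N F / c.
Proof.
move=> hp hf c0 F0; rewrite mulrC -EsysZ; apply: le_Esys => // es rows _ _.
rewrite mulrC ler_pdivlMr //; case: ltP => [/ltW|_]; first by rewrite mul1r.
by rewrite mul0r.
Qed.

Fixpoint addf (g : seq bool -> rowdata -> R) (rows : seq rowdata) (es : seq bool) : R :=
  if rows is r :: rs then g es r + addf g rs (step es r) else 0.

Lemma addfE g rows es r0 : addf g rows es =
  \sum_(t < size rows) g (run (take t rows) es) (nth r0 rows t).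
Proof.
elim: rows es => [|r rows IH] es /=; first by rewrite big_ord0.
by rewrite big_ord_recl /= IH.
Qed.

Lemma Esys_stationary l L N F : 0 <= l <= 1 ->
  Esys (nseq L l) (ph l) N (fun es rows => F (run rows es)) = Ex (dbern L l) F.
Proof.
move=> hl; have /andP[l0 l1] := hl.
rewrite /Esys /dinit map_nseq size_nseq -/(dbern L l).
elim: N => [|N IH].
  by apply: eq_Ex => es; rewrite /drows Ex_nil.
rewrite -[RHS]IH.
transitivity (Ex (dbern L l) (fun es => Ex (bern (ph l)) (fun h => Ex (dcoins L)
  (fun cs => Ex (drows (ph l) L N) (fun rows => F (run rows (outs es cs h))))))).
  by apply: eq_Ex => es; rewrite /drows Ex_cons Ex_prod.
rewrite (@row_burke _ b1 b2 b12 b2_lt1 l L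
  (fun es _ => Ex (drows (ph l) L N) (fun rows => F (run rows es)))) //.
apply: eq_Ex => es; rewrite Ex_cst //; apply: is_dist_bern.
exact: phi_itv.
Qed.

Lemma Esys_addf_stationary g l L N : 0 <= l <= 1 ->
  Esys (nseq L l) (ph l) N (fun es rows => addf g rows es) =
  N%:R * Ex (dbern L l) (fun es => Ex (drow (ph l) L) (g es)).
Proof.
move=> hl; have /andP[l0 l1] := hl.
rewrite /Esys /dinit map_nseq size_nseq -/(dbern L l).
have hph := phi_itv b12 b2_lt1 hl.
elim: N => [|N IH].
  rewrite mul0r -[RHS](Ex0 (dbern L l)); apply: eq_Ex => es.
  by rewrite /drows Ex_nil.
rewrite -natr1 mulrDl mul1r addrC -IH.
rewrite -[X in _ = _ + X](_ : Ex (dbern L l) (fun es => Ex (bern (ph l)) (fun h =>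
    Ex (dcoins L) (fun cs => Ex (drows (ph l) L N) (fun rows => addf g rows (outs es cs h))))) = _);
  last first.
  rewrite (@row_burke _ b1 b2 b12 b2_lt1 l L
    (fun es _ => Ex (drows (ph l) L N) (fun rows => addf g rows es))) //.
  by apply: eq_Ex => es; rewrite Ex_cst //; apply: is_dist_bern.
rewrite -ExD; apply: eq_Ex => es.
transitivity (Ex (drow (ph l) L) (fun r => g es r +
    Ex (drows (ph l) L N) (fun rows => addf g rows (step es r)))).
  rewrite /drows Ex_cons; apply: eq_Ex => r /=; rewrite ExD Ex_cst //.
  exact: is_dist_drows.
by rewrite ExD; congr (_ + _); rewrite Ex_prod.
Qed.

Section Blocks.
Variables (k : nat).
Hypothesis k_gt0 : (0 < k)%N.

Fixpoint addu (m : nat) (rows : seq rowdata2) (e1 e2 : seq bool) : R :=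
  if rows is r :: rs then
    ustat R k m e1 e2 r.2 r.1.1 r.1.2 + addu m rs (step e1 (row1 r)) (step e2 (row2 r))
  else 0.

Lemma addf_vstat l m rows e1 e2 : 0 <= l <= 1 ->
  addf (fun es r => rstat k (vstat b1 b2 k l) m es r.2 r.1) (map row1 rows) e1 <=
  2 * addu m rows e1 e2 +
  addf (fun es r => rstat k (bdev b1 b2 k l) m es r.2 r.1) (map row2 rows) e2.
Proof.
move=> hl; elim: rows e1 e2 => [|r rows IH] e1 e2 /=; first by rewrite mulr0 addr0.
have := IH (step e1 (row1 r)) (step e2 (row2 r)).
have := rstat_vstat b12 b2_lt1 k_gt0 m e1 e2 r.2 r.1.1 r.1.2 hl.
rewrite mulrDr /=; lra.
Qed.

Lemma disc_le (s1 s2 : seq bool) : (disc s1 s2 <= size s1)%N.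
Proof. by elim: s1 s2 => [|x s1 IH] [|y s2] //=; have := IH s2; case: (_ (+) _); lia. Qed.

(** [Ex_ustat] telescopes in time. Only the horizontal input brings in discrepancies, at most one
    per step, whence the term [N]. *)
Lemma Ex_addu m N f g e1 e2 : itv01 f -> itv01 g ->
  size e1 = (m * k)%N -> size e2 = (m * k)%N ->
  2 * cmin ^+ k * Ex (drows2 f g (m * k) N) (fun rows => addu m rows e1 e2)
  <= (disc e1 e2 + N)%:R.
Proof.
move=> hf hg; elim: N e1 e2 => [|N IH] e1 e2 s1 s2.
  by rewrite /drows2 Ex_nil /= mulr0.
have hd := is_dist_drows2 (m * k) N hf hg.
rewrite /drows2 Ex_cons -/(drows2 f g (m * k) N) Ex_prod -ExZ.
rewrite -(Ex_cst (disc e1 e2 + N.+1)%:R (is_dist_cpl hf hg)).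
apply: le_Ex; first exact: is_dist_cpl.
move=> [h1 h2]; rewrite -ExZ.
apply: le_trans (_ : (disc e1 e2 + (h1 (+) h2))%:R + N%:R <= _); last first.
  by rewrite -natrD ler_nat; case: (_ (+) _) => /=; lia.
apply: (@le_trans _ _ (Ex (dcoins (m * k)) (fun cs =>
   2 * cmin ^+ k * ustat R k m e1 e2 cs h1 h2 +
     (disc (outs e1 cs h1) (outs e2 cs h2) + (hout e1 cs h1 (+) hout e2 cs h2))%:R)
    + N%:R)); last first.
  by rewrite lerD2r; apply: Ex_ustat.
have hc := is_dist_coins b1_gt0 b12 b2_lt1 (m * k).
rewrite -[X in _ <= _ + X](Ex_cst _ hc) -ExD; apply: le_Ex => // cs /=.
rewrite ExD Ex_cst // mulrDr -addrA lerD2l.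
apply: le_trans (IH _ _ _ _) _; rewrite ?size_outs //.
by rewrite -natrD ler_nat /step /=; lia.
Qed.

(** The second copy is stationary of density [l]. Disagreement at time zero is at most [m * k], and
    it is paid only once; the remaining term is the equilibrium fluctuation of the second copy. *)
Lemma Esys_vstat l m N ps f : 0 <= l <= 1 -> all itv01 ps -> itv01 f ->
  size ps = (m * k)%N ->
  Esys ps f N (fun es rows =>
    addf (fun es r => rstat k (vstat b1 b2 k l) m es r.2 r.1) rows es) <=
  (m * k + N)%:R / cmin ^+ k + (N * m)%:R *
   Ex (dbern k l) (fun es => Ex (bern (ph l)) (fun h =>
    Ex (dcoins k) (fun cs => bdev b1 b2 k l es cs h))).
Proof.
move=> hl hp hf sz; have hph := phi_itv b12 b2_lt1 hl.
have hq : all itv01 (nseq (m * k) l) by rewrite all_nseq /itv01 hl orbT.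
have szq : size ps = size (nseq (m * k) l) by rewrite size_nseq.
have cg : 0 < cmin ^+ k by rewrite exprn_gt0 // cmin_gt0.
rewrite -(Esys_proj1 (qs := nseq (m * k) l) _ (ph l)) //.
apply: le_trans (le_Esys2 (G := fun es rows =>
  2 * addu m rows (unzip1 es) (unzip2 es) +
  addf (fun es r => rstat k (bdev b1 b2 k l) m es r.2 r.1) (map row2 rows) (unzip2 es))
  _ _ _ _ _ _) _ => //.
  by move=> es rows _ _; apply: addf_vstat.
rewrite Esys2D lerD //; last first.
  rewrite (Esys_proj2 f _ _ (fun es rows => addf (fun es r => rstat k (bdev b1 b2 k l) m es r.2 r.1) rows es)) //.
  rewrite Esys_addf_stationary // natrM -mulrA -Ex_rstat_stationary //.
  rewrite le_eqVlt; apply/orP; left; apply/eqP; congr (_ * _).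
  by apply: eq_Ex => es; rewrite Ex_prod.
rewrite Esys2Z ler_pdivlMr // mulrAC.
have hd2 := is_dist_dinit2 hp hq.
rewrite /Esys2 -ExZ -(Ex_cst (m * k + N)%:R hd2).
apply: le_Ex_dseq => // es; rewrite size_map size_zip -szq minnn sz => se.
apply: le_trans (Ex_addu _ _ _ _ _) _; rewrite ?size_map //.
rewrite ler_nat leq_add2r; apply: leq_trans (disc_le _ _) _.
by rewrite size_map se.
Qed.

Definition lerr (es : seq bool) cs h : R :=
  `|bflux R k es cs h - ph (density R k es)|.

(** Each reference density i / K is compared in a coupling of its own: only expectations are added,
    so the [K.+1] couplings need not live together. *)
Lemma Esys_lerr (K : nat) (dv : R) m N ps f : (0 < K)%N ->
  (forall l, 0 <= l <= 1 -> Ex (dbern k l) (fun es => Ex (bern (ph l)) (fun h =>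
    Ex (dcoins k) (fun cs => bdev b1 b2 k l es cs h))) <= dv) ->
  all itv01 ps -> itv01 f -> size ps = (m * k)%N ->
  Esys ps f N (fun es rows =>
    addf (fun es r => rstat k lerr m es r.2 r.1) rows es) <=
  2 * ka * ((N * m)%:R / K%:R
            + K.+1%:R * ((m * k + N)%:R / cmin ^+ k + (N * m)%:R * dv)).
Proof.
move=> K0 hdv hp hf sz.
have k0 := kappa_ge0 b12 b2_lt1.
have hrow e c h : lerr (take k e) c h <= 2 * ka * (K%:R^-1 + \sum_(i < K.+1)
    vstat b1 b2 k (i%:R / K%:R) (take k e) c h).
  have se : (size (take k e) <= k)%N by rewrite size_take_min geq_minl.
  apply: flux_of_quad_dist => //; first exact: density_itv.
  exact: bflux_itv.
have hr mm e c h : rstat k lerr mm e c h <= 2 * ka * (mm%:R / K%:R +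
    \sum_(i < K.+1) rstat k (vstat b1 b2 k (i%:R / K%:R)) mm e c h).
  elim: mm e c h => [|mm IH] e c h /=; first by rewrite big1 // mul0r add0r mulr0.
  have := IH (drop k e) (drop k c) (hout (take k e) c h).
  have -> : mm.+1%:R / K%:R = mm%:R / K%:R + K%:R^-1 :> R.
    by rewrite -(natr1 mm) mulrDl mul1r.
  by have := hrow e (take k c) h; rewrite big_split /= !mulrDr; lra.
have ha rows es : addf (fun es r => rstat k lerr m es r.2 r.1) rows es <=
   2 * ka * ((size rows * m)%:R / K%:R + \sum_(i < K.+1)
     addf (fun es r => rstat k (vstat b1 b2 k (i%:R / K%:R)) m es r.2 r.1) rows es).
  elim: rows es => [|r rows IH] es /=.
    by rewrite mul0n mul0r big1 // addr0 mulr0.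
  have := IH (step es r); have := hr m es r.2 r.1.
  by rewrite big_split /= mulSn natrD [(_ + (_ * m)%:R) / _]mulrDl !mulrDr; lra.
apply: le_trans (le_Esys (G := fun es rows => 2 * ka * ((N * m)%:R / K%:R + \sum_(i < K.+1)
     addf (fun es r => rstat k (vstat b1 b2 k (i%:R / K%:R)) m es r.2 r.1) rows es)) _ _ _) _ => //.
  by move=> es rows _ <-; apply: ha.
have ka2 : 0 <= 2 * ka by apply: mulr_ge0.
rewrite EsysZ ler_wpM2l //.
rewrite (EsysD _ _ _ (fun _ _ => (N * m)%:R / K%:R) (fun es rows => \sum_(i < K.+1)
  addf (fun es r => rstat k (vstat b1 b2 k (i%:R / K%:R)) m es r.2 r.1) rows es)).
rewrite lerD ?Esys_cst //.
rewrite (Esys_sum _ _ _ _ (fun i es rows => addf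
  (fun es r => rstat k (vstat b1 b2 k (i%:R / K%:R)) m es r.2 r.1) rows es)).
set Y := (X in K.+1%:R * X).
have -> : K.+1%:R * Y = \sum_(i < K.+1) Y by rewrite sumr_const card_ord mulr_natl.
apply: ler_sum => i _.
have hi : 0 <= (i%:R / K%:R : R) <= 1.
  rewrite divr_ge0 //= ler_pdivrMr ?ltr0n // mul1r ler_nat.
  by have := ltn_ord i; rewrite ltnS.
apply: le_trans (Esys_vstat _ hi hp hf sz) _.
by rewrite lerD2l ler_wpM2l // hdv.
Qed.

End Blocks.
End Systems.

(** * Heights along rays *)

Section MovingWindow.
Variable R : realType.

Lemma lip_iter (f : nat -> R) n d :
  (forall i, `|f i.+1 - f i| <= 1) -> `|f (n + d)%N - f n| <= d%:R.
Proof.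
move=> hf; elim: d => [|d IH]; first by rewrite addn0 subrr normr0.
rewrite addnS -natr1; apply: le_trans (_ : `|f (n + d).+1 - f (n + d)%N| + `|f (n + d)%N - f n| <= _).
  by rewrite -[X in `|X|](subrKA (f (n + d)%N)) ler_normD.
by rewrite addrC lerD.
Qed.

Lemma shift_sum (f : nat -> R) a l d :
  \sum_(i < l) f (a + d + i)%N - \sum_(i < l) f (a + i)%N =
  \sum_(r < d) (f (a + l + r)%N - f (a + r)%N).
Proof.
elim: d => [|d IH]; first by rewrite big_ord0 addn0 subrr.
rewrite big_ord_recr /= -IH.
have -> : \sum_(i < l) f (a + d.+1 + i)%N =
    \sum_(i < l) f (a + d + i)%N + f (a + l + d)%N - f (a + d)%N.
  rewrite -[RHS](_ : \sum_(i < l.+1) f (a + d + i)%N - f (a + d)%N = _); last first.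
    by rewrite big_ord_recr /= -addnA [(d + l)%N]addnC addnA.
  rewrite big_ord_recl /= addn0 addrC addrA addNr add0r.
  by apply: eq_bigr => i _; rewrite /bump /= add1n !addnS addSn.
by ring.
Qed.

(** The window need not start or stop at a block boundary; rounding either end to a multiple of [k]
    costs at most [k%:R * Y]. *)
Lemma window_blocks (y g : nat -> R) a l k m Y : (0 < k)%N -> (a + l <= m * k)%N ->
  (forall i, `|y i| <= Y) -> (forall j, 0 <= g j) ->
  (forall j, (j < m)%N -> \sum_(r < k) y (j * k + r)%N <= g j) ->
  \sum_(i < l) y (a + i)%N <= \sum_(j < m) g j + 2 * k%:R * Y.
Proof.
move=> k0 alm hy hg hb; have Y0 : 0 <= Y := le_trans (normr_ge0 _) (hy 0%N).
have psum (z : nat -> R) n d :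
    \sum_(i < n + d) z i - \sum_(i < n) z i = \sum_(i < d) z (n + i)%N.
  elim: d => [|d IH]; first by rewrite addn0 subrr big_ord0.
  by rewrite big_ord_recr /= -IH addnS big_ord_recr /=; ring.
pose S n := \sum_(i < n) y i; have Sdiff := psum y.
have Sround n : `|S n - S (n %/ k * k)%N| <= k%:R * Y.
  rewrite {1}(divn_eq n k) /S Sdiff; apply: le_trans (ler_norm_sum _ _ _) _.
  apply: le_trans (ler_sum _ (fun i _ => hy _)) _.
  rewrite sumr_const card_ord -[X in X <= _]mulr_natl ler_wpM2r // ler_nat.
  by rewrite ltnW // ltn_mod.
have Sblock j d : (j + d <= m)%N -> S ((j + d) * k)%N - S (j * k)%N <= \sum_(i < d) g (j + i)%N.
  elim: d => [|d IH] jd; first by rewrite addn0 subrr big_ord0.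
  rewrite big_ord_recr /= addnS mulSnr.
  have := IH (ltnW (leq_trans (_ : (j + d < j + d.+1)%N) jd)); rewrite addnS ltnS leqnn => /(_ isT).
  have := Sdiff ((j + d) * k)%N k; rewrite -/(S _) -/(S _); have := hb (j + d)%N; rewrite -addnS => /(_ jd); lra.
rewrite -Sdiff -/(S _) -/(S _).
have le1 : (a %/ k <= (a + l) %/ k)%N by rewrite leq_div2r // leq_addr.
have le2 : ((a + l) %/ k <= m)%N by rewrite -(mulnK m k0) leq_div2r.
have := Sblock (a %/ k)%N ((a + l) %/ k - a %/ k)%N; rewrite subnKC // => /(_ le2) B.
have : \sum_(i < (a + l) %/ k - a %/ k) g (a %/ k + i)%N <= \sum_(j < m) g j.
  rewrite -psum subnKC // -[X in _ <= X]subr0 lerB ?sumr_ge0 //.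
  by rewrite -subr_ge0 -[in \sum_(i < m) _](subnKC le2) psum sumr_ge0.
have := Sround a; have := Sround (a + l)%N; rewrite !ler_norml.
by move=> /andP[? ?] /andP[? ?]; lra.
Qed.

(** Follows the sum of [H] over a window of width [l] whose left end moves at speed [v]. In the
    moving frame the growth per site and step is at most [c0], up to the block errors [g]. Averaging
    over the window is what allows information on blocks to be used at a single site. *)
Lemma line_bound (H : nat -> nat -> R) (N k m l x0 : nat) (v c0 : R) (g : nat -> nat -> R) :
  (0 < k)%N -> (0 < l)%N -> 0 <= v ->
  (forall t i, `|H t i.+1 - H t i| <= 1) -> (forall t i, `|H t.+1 i - H t i| <= 1) ->
  (forall t j, 0 <= g t j) ->
  (forall t j, (t < N)%N -> (j < m)%N ->
     \sum_(r < k) (H t.+1 (j * k + r)%N - H t (j * k + r)%N - c0)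
      - v * (H t (j * k)%N - H t (j.+1 * k)%N) <= g t j) ->
  (x0 + Num.truncn (v * N%:R) + l <= m * k)%N ->
  H N (x0 + Num.truncn (v * N%:R))%N <= H 0%N x0 + N%:R * c0
    + (\sum_(t < N) \sum_(j < m) g t j) / l%:R
    + N%:R * (2 * k%:R * (1 + `|c0| + v) + 2 * (v + 2) ^+ 2) / l%:R + 2 * l%:R + 1.
Proof.
move=> k0 l0 v0 hx ht hg hb hm.
set Y := 1 + `|c0| + v; set C2 := 2 * (v + 2) ^+ 2.
pose q t := Num.truncn (v * t%:R); pose a t := (x0 + q t)%N.
pose fr t := v * t%:R - (q t)%:R.
have qP t : (q t)%:R <= v * t%:R < (q t)%:R + 1.
  by rewrite natr1 truncn_itv // mulr_ge0.
pose A t := \sum_(i < l) H t (a t + i)%N.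
pose U t := H t (a t) - H t (a t + l)%N.
(* Moving the window by an integer [d] changes its sum by about [- d * U], while the block
   inequality contributes [v * U]. Since [v = d + fr t.+1 - fr t], subtracting [fr * U] makes the
   two cancel at each step and not only on average. *)
pose Psi t := A t - fr t * U t.
have lipx t n d : `|H t (n + d)%N - H t n| <= d%:R by apply: lip_iter (hx t).
have qmono s t : (s <= t)%N -> (q s <= q t)%N.
  by move=> st; apply: le_truncn; rewrite ler_wpM2l // ler_nat.
have stepP t : (t < N)%N ->
    Psi t.+1 <= Psi t + (l%:R * c0 + \sum_(j < m) g t j + (2 * k%:R * Y + C2)).
  move=> tN.
  have [d ad] : exists d, a t.+1 = (a t + d)%N.
    exists (q t.+1 - q t)%N; rewrite /a -addnA subnKC //; exact: qmono.
  have qd : (q t.+1)%:R = (q t)%:R + d%:R :> R.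
    by rewrite -natrD; congr _%:R; move: ad; rewrite /a; lia.
  have /andP[q1 q2] := qP t; have /andP[q3 q4] := qP t.+1.
  have vt : v * t.+1%:R = v * t%:R + v by rewrite -natr1 mulrDr mulr1.
  have d0 : 0 <= d%:R :> R by [].
  have dv : d%:R <= v + 1 by lra.
  have vE : v = d%:R + fr t.+1 - fr t by rewrite /fr qd vt; ring.
  have fr01 : 0 <= fr t.+1 <= 1 by rewrite /fr; apply/andP; split; lra.
  have near n e : `|H t.+1 (n + e)%N - H t n| <= e%:R + 1.
    rewrite -[X in `|X|](subrKA (H t.+1 n)); apply: le_trans (ler_normD _ _) _.
    by rewrite lerD.
  have AE : A t.+1 = \sum_(i < l) H t.+1 (a t + i)%N +
      \sum_(r < d) (H t.+1 (a t + l + r)%N - H t.+1 (a t + r)%N).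
    by rewrite -shift_sum /A ad; ring.
  have Sh : \sum_(r < d) (H t.+1 (a t + l + r)%N - H t.+1 (a t + r)%N)
      <= d%:R * (- U t + 2 * (d%:R + 1)).
    rewrite mulr_natl -[X in _ *+ X]card_ord -sumr_const; apply: ler_sum => r _.
    have rd : r%:R <= d%:R :> R by rewrite ler_nat ltnW.
    have := near (a t + l)%N r; have := near (a t) r; rewrite !ler_norml /U.
    by move=> /andP[? ?] /andP[? ?]; lra.
  have UU : `|U t.+1 - U t| <= 2 * (d%:R + 1).
    have := near (a t + l)%N d; have := near (a t) d; rewrite /U ad.
    rewrite addnAC.
    rewrite !ler_norml => /andP[? ?] /andP[? ?]; apply/andP; split; lra.
  have FU : - fr t.+1 * U t.+1 <= - fr t.+1 * U t + 2 * (d%:R + 1).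
    move: UU fr01; rewrite ler_norml => /andP[? ?] /andP[? ?]; nra.
  have dC : 2 * (d%:R + 1) + d%:R * (2 * (d%:R + 1)) <= C2 by rewrite /C2; nra.
  pose y i := H t.+1 i - H t i - c0 - v * (H t i - H t i.+1).
  have hy i : `|y i| <= Y.
    rewrite /y /Y; apply: le_trans (ler_normB _ _) _; rewrite lerD //.
      by apply: le_trans (ler_normB _ _) _; rewrite lerD.
    by rewrite normrM ger0_norm // ler_piMr // distrC.
  have tele n e : \sum_(r < e) (H t (n + r)%N - H t (n + r).+1) = H t n - H t (n + e)%N.
    elim: e => [|e IH]; first by rewrite big_ord0 addn0 subrr.
    by rewrite big_ord_recr /= IH addnS; ring.
  have W : \sum_(i < l) y (a t + i)%N <= \sum_(j < m) g t j + 2 * k%:R * Y.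
    apply: window_blocks => //.
      have aN : (a t <= a N)%N by rewrite leq_add2l qmono // ltnW.
      by apply: leq_trans hm; rewrite leq_add2r.
    move=> j jm; apply: le_trans (hb t j tN jm).
    by rewrite /y sumrB -mulr_sumr tele mulSnr.
  have WE : \sum_(i < l) y (a t + i)%N = \sum_(i < l) H t.+1 (a t + i)%N - A t
      - l%:R * c0 - v * U t.
    rewrite /y sumrB -mulr_sumr tele -/(U t) !sumrB sumr_const card_ord mulr_natl.
    by [].
  rewrite /Psi AE; move: W; rewrite WE {1}vE; move: Sh FU dC.
  by rewrite mulrDr mulNr mulrN; nra.
have iter n : (n <= N)%N -> Psi n <= Psi 0%N + n%:R * (l%:R * c0 + (2 * k%:R * Y + C2))
    + \sum_(t < n) \sum_(j < m) g t j.
  elim: n => [|n IH] nN; first by rewrite big_ord0 mul0r !addr0.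
  rewrite big_ord_recr /= -[in n.+1%:R]natr1.
  have := stepP n nN; have := IH (ltnW nN); lra.
have fr0 : fr 0%N = 0 by rewrite /fr /q mulr0 truncn0 subrr.
(* At the initial and the final time the window average is replaced by the height at the left end,
   at a cost of order [l] by the Lipschitz bound. *)
have P0 : Psi 0%N <= l%:R * (H 0%N x0 + l%:R).
  rewrite /Psi fr0 mul0r subr0 /A mulr_natl -[X in _ *+ X]card_ord -sumr_const.
  apply: ler_sum => i _; rewrite /a /q mulr0 truncn0 addn0.
  have := lipx 0%N x0 i; rewrite ler_norml => /andP[_].
  have : i%:R <= l%:R :> R by rewrite ler_nat ltnW.
  lra.
have PN : l%:R * (H N (a N) - l%:R - 1) <= Psi N.
  have UN : fr N * U N <= l%:R.
    have /andP[q1 q2] := qP N; have := lipx N (a N) l; rewrite ler_norml => /andP[u1 u2].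
    have : 0 <= fr N <= 1 by rewrite /fr; apply/andP; split; lra.
    by rewrite /U => /andP[? ?]; have : 0 <= l%:R :> R by []; nra.
  have : l%:R * (H N (a N) - l%:R) <= A N.
    rewrite /A mulr_natl -[X in _ *+ X]card_ord -sumr_const.
    apply: ler_sum => i _; have := lipx N (a N) i; rewrite ler_norml => /andP[? _].
    have : i%:R <= l%:R :> R by rewrite ler_nat ltnW.
    lra.
  by rewrite /Psi; lra.
have lR : 0 < l%:R :> R by rewrite ltr0n.
have E := le_trans PN (le_trans (iter N (leqnn _)) (lerD (lerD P0 (lexx _)) (lexx _))).
rewrite -(ler_pM2l lR); apply: le_trans (_ : l%:R * (H N (a N) - l%:R - 1) + l%:R * (l%:R + 1) <= _).
  rewrite -mulrDr; have -> : H N (a N) - l%:R - 1 + (l%:R + 1) = H N (a N) by ring.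
  by [].
apply: le_trans (lerD E (lexx _)) _.
rewrite le_eqVlt; apply/orP; left; apply/eqP.
by field; rewrite gt_eqF.
Qed.

End MovingWindow.

(** * Almost sure order under the couplings *)

Section Support.
Variable R : realType.

(** Support expressed through expectations, as entries of weight zero may violate [P] and [A] has no
    decidable equality. *)
Definition supported A (d : dist R A) (P : pred A) :=
  forall f g, (forall a, P a -> f a = g a) -> Ex d f = Ex d g.

Lemma le_Ex_supported A (d : dist R A) P f g : is_dist d -> supported d P ->
  (forall a, P a -> f a <= g a) -> Ex d f <= Ex d g.
Proof.
move=> hd sP fg.
rewrite (sP f (fun a => if P a then f a else 0)); last by move=> a ->.
rewrite (sP g (fun a => if P a then g a else 0)); last by move=> a ->.
by apply: le_Ex => // a; case: ifP => // /fg.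
Qed.

Lemma supported_dseq A (a0 : A) (d0 : dist R A) ds (P : nat -> pred A) :
  (forall i, (i < size ds)%N -> supported (nth d0 ds i) (P i)) ->
  supported (dseq ds) (fun s => (size s == size ds) &&
     all (fun i => P i (nth a0 s i)) (iota 0 (size ds))).
Proof.
elim: ds P => [|d ds IH] P hP f g fg; first by rewrite !Ex_nil; apply: fg.
rewrite !Ex_cons; apply: (hP 0%N) => // a Pa.
apply: (IH (fun i => P i.+1)) => [i lti|s /andP[/eqP ss Ps]]; first exact: (hP i.+1).
apply: fg; rewrite /= ss eqxx Pa /=.
by rewrite -[1%N]/(1 + 0)%N iotaDl all_map.
Qed.

Lemma supported_prod A B (d1 : dist R A) (d2 : dist R B) P :
  supported d1 P -> supported (dprod d1 d2) (fun a => P a.1).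
Proof.
move=> h f g fg; rewrite !Ex_prod; apply: h => a Pa; apply: eq_Ex => b.
exact: fg.
Qed.

(** For [p = q] both implications apply and the two bits coincide; this is how parts of the data
    common to both copies stay equal. *)
Definition sup (p q : R) (a : bool * bool) : bool :=
  ((q <= p) ==> (a.2 ==> a.1)) && ((p <= q) ==> (a.1 ==> a.2)).

Lemma supported_cpl p q : supported (cpl p q) (sup p q).
Proof.
move=> f g fg; rewrite /Ex /cpl !big_cons !big_nil /=.
rewrite (fg (true, true)); last by rewrite /sup /= !implybT.
rewrite (fg (false, false)); last by rewrite /sup /= !implybT.
case: (ltgtP p q) => pq.
- rewrite subrr !mul0r (fg (false, true)) //.
  by rewrite /sup /= leNgt pq implybT.
- rewrite subrr !mul0r (fg (true, false)) //.
  by rewrite /sup /= [p <= q]leNgt pq /= implybT.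
- by rewrite pq subrr !mul0r.
Qed.

End Support.

Section CoupledSupport.
Variables (R : realType) (b1 b2 : R).
Hypotheses (b1_gt0 : 0 < b1) (b12 : b1 < b2) (b2_lt1 : b2 < 1).
Local Notation ka := (kappa b1 b2).
Local Notation ph := (phi b1 b2).

Lemma le_Esys2_supported (ps qs : seq R) f g N F G :
  all (@itv01 R) ps -> all (@itv01 R) qs -> itv01 f -> itv01 g ->
  size ps = size qs ->
  (forall es rows, size es = size ps -> size rows = N ->
     (forall i, (i < size ps)%N -> sup ps`_i qs`_i (nth (false, false) es i)) ->
     all (fun r : rowdata2 => sup f g r.1) rows ->
     F es rows <= G es rows) ->
  Esys2 b1 b2 ps qs f g N F <= Esys2 b1 b2 ps qs f g N G.
Proof.
move=> hp hq hf hg sz FG.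
have s1 := @supported_dseq R _ (false, false) [::] [seq cpl x.1 x.2 | x <- zip ps qs]
  (fun i => sup ps`_i qs`_i).
apply: (le_Ex_supported (is_dist_dinit2 hp hq) (s1 _)).
  move=> i; rewrite size_map size_zip -sz minnn => lti.
  rewrite (nth_map (0, 0)) ?size_zip -?sz ?minnn // nth_zip //.
  exact: supported_cpl.
move=> es; rewrite size_map size_zip -sz minnn => /andP[/eqP se Pes].
have s2 := @supported_dseq R _ ((false, false), [::]) [::]
  (nseq N (drow2 b1 b2 f g (size ps))) (fun=> fun r => sup f g r.1).
apply: (le_Ex_supported (is_dist_drows2 b1_gt0 b12 b2_lt1 (size ps) N hf hg) (s2 _)).
  move=> i; rewrite size_nseq => lti; rewrite nth_nseq lti.
  apply: supported_prod; exact: supported_cpl.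
move=> rows; rewrite size_nseq => /andP[/eqP sr Pr]; apply: FG => //.
  by move=> i lti; apply: (allP Pes); rewrite mem_iota.
apply/(all_nthP ((false, false), [::])) => i; rewrite sr => lti.
by apply: (allP Pr); rewrite mem_iota.
Qed.

End CoupledSupport.

(** * The height function: conservation, monotonicity, increments *)

Section HeightFunction.
Variable R : realType.

Definition Jin (rows : seq rowdata) : nat := count (fun r => r.1) rows.

Fixpoint Jout (rows : seq rowdata) (es : seq bool) : nat :=
  if rows is r :: rs then (hout es r.2 r.1 + Jout rs (step es r))%N else 0%N.

Lemma run_conserve rows es :
  (Jin rows + mass es = mass (run rows es) + Jout rows es)%N.
Proof.
elim: rows es => [|r rows IH] es /=; first by rewrite addn0.
have := IH (step es r); have := row_conserve es r.2 r.1.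
by rewrite /step /=; case: (r.1) => /=; lia.
Qed.

(* Height function: number of particles that have crossed the bond in front of
   site [i], counted from the bond in front of site [o] at time zero. *)
Definition hgt (o : nat) (es : seq bool) (rows : seq rowdata) (i : nat) : R :=
  (Jin rows)%:R + (mass (take o es))%:R - (mass (take i (run rows es)))%:R.

(** By conservation the same height can be read from the right end, the form to use when the inputs
    on the left differ. *)
Lemma hgt_outE o es rows i : hgt o es rows i =
  (Jout rows es)%:R - (mass (drop o es))%:R + (mass (drop i (run rows es)))%:R.
Proof.
have mE j s : mass s = (mass (take j s) + mass (drop j s))%N.
  by rewrite -count_cat cat_take_drop.
have := run_conserve rows es; rewrite (mE o es) (mE i (run rows es)) /hgt.
move=> /(congr1 (fun n => n%:R : R)); rewrite !natrD; lra.
Qed.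

Lemma run_mono rows e1 e2 : leb_seq e1 e2 ->
  all (fun r : rowdata2 => r.1.1 ==> r.1.2) rows ->
  leb_seq (run (map row1 rows) e1) (run (map row2 rows) e2) /\
  (Jout (map row1 rows) e1 <= Jout (map row2 rows) e2)%N.
Proof.
elim: rows e1 e2 => [|r rows IH] e1 e2 //= le12 /andP[hr hrows].
have [le' h' _] := row_mono r.2 le12 hr.
have [-> J] := IH _ _ le' hrows; split=> //.
by rewrite leq_add //; case: (hout e1 _ _) h' => /=; case: (hout e2 _ _).
Qed.

(** Inputs and initial sites before [o] agree, so only the final mass before [i] differs, and
    attractivity makes it larger for the larger configuration. *)
Lemma hgt_more_right o rows e1 e2 i : leb_seq e1 e2 ->
  all (fun r : rowdata2 => r.1.1 == r.1.2) rows -> take o e1 = take o e2 ->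
  hgt o e2 (map row2 rows) i <= hgt o e1 (map row1 rows) i.
Proof.
move=> le12 hr ho.
have hr' : all (fun r : rowdata2 => r.1.1 ==> r.1.2) rows.
  by apply: sub_all hr => r /eqP ->; apply: implybb.
have [le' _] := run_mono le12 hr'.
rewrite /hgt ho.
have -> : Jin (map row2 rows) = Jin (map row1 rows).
  rewrite /Jin !count_map; elim: rows hr {le' hr'} => //= r rows IH /andP[/eqP e /IH ->].
  by rewrite e.
by rewrite lerB // ler_nat leb_seq_mass // leb_seq_take.
Qed.

(** Read from the right end, the initial terms agree, while the outflow and the final mass beyond
    [i] are both monotone. *)
Lemma hgt_more_left o rows e1 e2 i : leb_seq e1 e2 ->
  all (fun r : rowdata2 => r.1.1 ==> r.1.2) rows -> drop o e1 = drop o e2 ->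
  hgt o e1 (map row1 rows) i <= hgt o e2 (map row2 rows) i.
Proof.
move=> le12 hr ho; have [le' J] := run_mono le12 hr.
rewrite !hgt_outE ho lerD ?lerB ?ler_nat //.
by rewrite leb_seq_mass // leb_seq_drop.
Qed.

Lemma run_rcons rows r es : run (rcons rows r) es = step (run rows es) r.
Proof. by rewrite /run foldl_rcons. Qed.

Lemma hgt_step o es rows t i r0 : (t < size rows)%N ->
  hgt o es (take t.+1 rows) i - hgt o es (take t rows) i =
  (hout (take i (run (take t rows) es)) (nth r0 rows t).2 (nth r0 rows t).1)%:R.
Proof.
move=> lt; rewrite (take_nth r0) // /hgt run_rcons /Jin -cats1 count_cat /= addn0.
set st := run _ _; set r := nth _ _ _.
rewrite /step take_outs.
have := row_conserve (take i st) r.2 r.1.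
by move=> /(congr1 (fun n => n%:R : R)); rewrite !natrD; lra.
Qed.

Lemma mass_take_S i s : mass (take i.+1 s) = (mass (take i s) + nth false s i)%N.
Proof.
have [lti|gei] := ltnP i (size s); last first.
  by rewrite !take_oversize ?nth_default // ?addn0 // leqW.
by rewrite (take_nth false) // -cats1 count_cat /= addn0.
Qed.

Lemma hgt_space o es rows i :
  hgt o es rows i - hgt o es rows i.+1 = (nth false (run rows es) i)%:R.
Proof. by rewrite /hgt mass_take_S natrD; ring. Qed.

Lemma normr_bool (b : bool) : `|b%:R : R| <= 1.
Proof. by case: b; rewrite ?normr1 ?normr0. Qed.

Lemma hgt_lipx o es rows i : `|hgt o es rows i.+1 - hgt o es rows i| <= 1.
Proof. by rewrite distrC hgt_space normr_bool. Qed.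

Lemma hgt_lipt o es rows t i :
  `|hgt o es (take t.+1 rows) i - hgt o es (take t rows) i| <= 1.
Proof.
have [lt|ge] := ltnP t (size rows).
  by rewrite (hgt_step _ _ _ (false, [::]) lt) normr_bool.
by rewrite !take_oversize ?subrr ?normr0 // leqW.
Qed.

Section BlockIncrements.
Variables (k : nat).
Hypothesis k_gt0 : (0 < k)%N.
Let kR : 0 < k%:R :> R. Proof. by rewrite ltr0n. Qed.

Lemma hgt_block_flux o es rows t j r0 : (t < size rows)%N -> (j.+1 * k <= size es)%N ->
  let st := run (take t rows) es in let r := nth r0 rows t in
  \sum_(s < k) (hgt o es (take t.+1 rows) (j * k + s)%N - hgt o es (take t rows) (j * k + s)%N)
  = k%:R * bflux R k (take k (drop (j * k) st)) (take k (drop (j * k) r.2))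
            (hout (take (j * k) st) r.2 r.1).
Proof.
move=> lt szj st r; rewrite /bflux mulrC divfK ?gt_eqF //.
have sz : size (take k (drop (j * k) st)) = k.
  by rewrite size_take_min size_drop size_run; apply/minn_idPl; lia.
rewrite flux_take ?sz // fluxE sz natr_sum; apply: eq_bigr => s _.
rewrite (hgt_step _ _ _ r0 lt) hout_take_drop take_takel //.
by rewrite ltnW.
Qed.

Lemma hgt_block_mass o es rows j : (j.+1 * k <= size es)%N ->
  hgt o es rows (j * k)%N - hgt o es rows (j.+1 * k)%N =
  k%:R * density R k (take k (drop (j * k) (run rows es))).
Proof.
move=> szj; rewrite /density mulrC divfK ?gt_eqF // /hgt mulSn addnC takeD count_cat.
by rewrite natrD; ring.
Qed.

End BlockIncrements.
End HeightFunction.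

Section LineBound.
Variables (R : realType) (b1 b2 : R).
Hypotheses (b1_gt0 : 0 < b1) (b12 : b1 < b2) (b2_lt1 : b2 < 1).
Local Notation ph := (phi b1 b2).
Local Notation hgt := (@hgt R).
Variables (k : nat).
Hypothesis k_gt0 : (0 < k)%N.

(* [sg = 1] is used for upper bounds, [sg = -1] for lower bounds. *)
Lemma hgt_line (sg : R) o es rows m l x0 v c0 pen : sg ^+ 2 = 1 ->
  (0 < l)%N -> 0 <= v -> size es = (m * k)%N ->
  (forall u, 0 <= pen u) ->
  (forall u, 0 <= u <= 1 -> sg * (ph u - c0 - v * u) <= pen u) ->
  (x0 + Num.truncn (v * (size rows)%:R) + l <= m * k)%N ->
  sg * (hgt o es rows (x0 + Num.truncn (v * (size rows)%:R)) - hgt o es [::] x0 - (size rows)%:R * c0) <=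
   k%:R * addf (fun es r => rstat k (fun es cs h => lerr b1 b2 k es cs h
      + pen (density R k es)) m es r.2 r.1) rows es / l%:R
    + (size rows)%:R * (2 * k%:R * (1 + `|c0| + v) + 2 * (v + 2) ^+ 2) / l%:R + 2 * l%:R + 1.
Proof.
move=> sg2 l0 v0 sz pen0 hpen hm; set N := size rows.
have sgN : `|sg| = 1.
  by apply/eqP; rewrite -(@eqrXn2 _ 2) // expr1n real_normK ?num_real // sg2.
pose r0 : rowdata := (false, [::]).
pose H t i := sg * hgt o es (take t rows) i.
pose blk t j (G : seq bool -> seq coin -> bool -> R) :=
  let st := run (take t rows) es in let r := nth r0 rows t in
  G (take k (drop (j * k) st)) (take k (drop (j * k) r.2)) (hout (take (j * k) st) r.2 r.1).
pose err es cs h : R := lerr b1 b2 k es cs h + pen (density R k es).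
pose g t j := k%:R * blk t j err.
have err0 e c h : 0 <= err e c h by rewrite /err addr_ge0 // /lerr normr_ge0.
have lb := @line_bound R H N k m l x0 v (sg * c0) g k_gt0 l0 v0.
have hadd : k%:R * addf (fun es r => rstat k err m es r.2 r.1) rows es =
    \sum_(t < N) \sum_(j < m) g t j.
  rewrite (addfE _ _ _ r0) mulr_sumr; apply: eq_bigr => t _.
  by rewrite rstatE mulr_sumr.
rewrite hadd.
have -> : `|c0| = `|sg * c0| by rewrite normrM sgN mul1r.
have h1 t i : `|H t i.+1 - H t i| <= 1 by rewrite -mulrBr normrM sgN mul1r hgt_lipx.
have h2 t i : `|H t.+1 i - H t i| <= 1 by rewrite -mulrBr normrM sgN mul1r hgt_lipt.
have h3 t j : 0 <= g t j by apply: mulr_ge0; [exact: ler0n|exact: err0].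
(* On one block the flux minus [c0 + v * density] splits into the local equilibrium error and the
   gap between [phi] and the line [c0 + v * u] at the block density, which [pen] bounds. *)
have h4 t j : (t < N)%N -> (j < m)%N ->
    \sum_(s < k) (H t.+1 (j * k + s)%N - H t (j * k + s)%N - sg * c0)
      - v * (H t (j * k)%N - H t (j.+1 * k)%N) <= g t j.
  move=> tN jm; have jk : (j.+1 * k <= size es)%N by rewrite sz leq_mul2r jm orbT.
  rewrite sumrB sumr_const card_ord /H.
  under eq_bigr do rewrite -mulrBr.
  rewrite -mulr_sumr (hgt_block_flux _ k_gt0 _ r0 tN jk) -mulrBr (hgt_block_mass _ k_gt0 _ _ jk).
  rewrite /g /blk; set e := take k _; set c := take k _; set h := hout _ _ _.
  have se : (size e <= k)%N by rewrite /e size_take_min geq_minl.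
  have hp := hpen _ (density_itv R k_gt0 se).
  have le : sg * (bflux R k e c h - ph (density R k e)) <= lerr b1 b2 k e c h.
    by rewrite /lerr -[X in _ <= X]mul1r -sgN -normrM ler_norm.
  have -> : sg * (k%:R * bflux R k e c h) - sg * c0 *+ k - v * (sg * (k%:R * density R k e))
     = k%:R * (sg * (bflux R k e c h - ph (density R k e)) +
               sg * (ph (density R k e) - c0 - v * density R k e)).
    by rewrite -mulr_natl; ring.
  by rewrite ler_wpM2l // /err lerD.
have := lb h1 h2 h3 h4 hm; rewrite {1 2}/H take_oversize // take0 !mulrBr; lra.
Qed.

End LineBound.

Section RiemannData.
Variable R : realType.

Definition riem (p q : R) (o L : nat) : seq R := nseq o p ++ nseq (L - o) q.

Lemma size_riem p q o L : (o <= L)%N -> size (riem p q o L) = L.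
Proof. by move=> oL; rewrite size_cat !size_nseq subnKC. Qed.

Lemma all_riem p q o L : itv01 p -> itv01 q -> all (@itv01 R) (riem p q o L).
Proof. by move=> hp hq; rewrite all_cat !all_nseq hp hq !orbT. Qed.

Lemma nth_riem p q o L i : (i < L)%N -> (riem p q o L)`_i = if (i < o)%N then p else q.
Proof.
move=> iL; rewrite nth_cat size_nseq !nth_nseq; case: ltnP => io //.
by rewrite ltn_sub2r //; lia.
Qed.

Lemma riem_diag p o L : (o <= L)%N -> riem p p o L = nseq L p.
Proof. by move=> oL; rewrite /riem -nseqD subnKC. Qed.

Lemma leb_seq_unzip (s : seq (bool * bool)) :
  (forall i, (i < size s)%N -> (nth (false, false) s i).1 ==> (nth (false, false) s i).2) ->
  leb_seq (unzip1 s) (unzip2 s).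
Proof.
elim: s => //= a s IH h; rewrite (h 0%N) //=; apply: IH => i; exact: (h i.+1).
Qed.

End RiemannData.

(** * Fluctuations in equilibrium and comparison of step data with equilibrium *)

Section LawOfLargeNumbers.
Variables (R : realType) (b1 b2 : R).
Hypotheses (b1_gt0 : 0 < b1) (b12 : b1 < b2) (b2_lt1 : b2 < 1).
Local Notation ka := (kappa b1 b2).
Local Notation ph := (phi b1 b2).
Local Notation dcoins := (dcoins b1 b2).
Local Notation Esys := (Esys b1 b2).
Local Notation hgt := (@hgt R).

Lemma sum_nseq n (p : R) : \sum_(q <- nseq n p) q = n%:R * p.
Proof.
elim: n => [|n IH]; first by rewrite big_nil mul0r.
by rewrite -[nseq n.+1 p]/(p :: nseq n p) big_cons IH -natr1; ring.
Qed.

Lemma Ex_mass_dev ps c : all (@itv01 R) ps -> 0 < c ->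
  Ex (dinit ps) (fun es => `|(mass es)%:R - \sum_(p <- ps) p|) <= c + (size ps)%:R / c.
Proof.
move=> hp c0; apply: le_trans (Ex_abs_le _ (is_dist_dinit hp) c0) _.
by rewrite lerD2l ler_pM2r ?invr_gt0 //; case: (Ex_mass_sqr hp).
Qed.

Lemma Ex_dinit_take (ps : seq R) i (F : seq bool -> R) : (i <= size ps)%N ->
  Ex (dinit ps) (fun es => F (take i es)) = Ex (dinit (take i ps)) F.
Proof.
move=> ip; have hs : size (map (@bern R) (take i ps)) = i.
  by rewrite size_map size_takel.
rewrite /dinit -{1}(cat_take_drop i ps) map_cat Ex_cat.
apply: eq_Ex_dseq => s1; rewrite hs => s1i.
under eq_Ex do rewrite take_size_cat //.
elim: (drop i ps) => [|p qs IH]; first by rewrite Ex_nil.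
by rewrite Ex_cons Ex_bern IH; ring.
Qed.

Lemma Ex_mass_take_dev ps i c : all (@itv01 R) ps -> 0 < c -> (i <= size ps)%N ->
  Ex (dinit ps) (fun es => `|(mass (take i es))%:R - \sum_(p <- take i ps) p|)
    <= c + i%:R / c.
Proof.
move=> hp c0 ip; rewrite (Ex_dinit_take (fun s => `|(mass s)%:R - _|)) //.
rewrite -[X in _ <= _ + X%:R / _](size_takel ip).
apply: Ex_mass_dev => //; apply/allP => x /mem_take; exact: (allP hp).
Qed.

Lemma Esys_init ps f N (F : seq bool -> R) : itv01 f ->
  Esys ps f N (fun es _ => F es) = Ex (dinit ps) F.
Proof. by move=> hf; apply: eq_Ex => es; rewrite Ex_cst //; apply: is_dist_drows. Qed.

Lemma Esys_Jin ps f N (F : nat -> R) : all (@itv01 R) ps ->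
  Esys ps f N (fun _ rows => F (Jin rows)) = Ex (dbern N f) (fun es => F (mass es)).
Proof.
move=> hp; rewrite -[RHS](Ex_cst _ (is_dist_dinit hp)); apply: eq_Ex => es.
rewrite -(@Ex_map_nseq R rowdata bool N (drow b1 b2 f (size ps)) (bern f) fst).
  by apply: eq_Ex => rows; rewrite /Jin count_map.
move=> g; rewrite Ex_prod; apply: eq_Ex => b.
by rewrite /= (Ex_cst (g b)) //; apply: is_dist_coins.
Qed.

(** The height combines three sums of independent bits: the inputs, the initial mass and, by
    stationarity, the final mass. They are dependent on each other, but mean absolute deviations
    simply add. *)
Lemma Esys_hgt_stationary l L N o i c : 0 <= l <= 1 -> 0 < c ->
  (o <= L)%N -> (i <= L)%N ->
  Esys (nseq L l) (ph l) N (fun es rows =>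
     `|hgt o es rows i - (N%:R * ph l + o%:R * l - i%:R * l)|) <=
  3 * c + (N + o + i)%:R / c.
Proof.
move=> hl c0 oL iL; have hph := phi_itv b12 b2_lt1 hl.
have hp : all (@itv01 R) (nseq L l) by rewrite all_nseq /itv01 hl orbT.
apply: le_trans (le_Esys b1_gt0 b12 b2_lt1 (G := fun es rows =>
   `|(Jin rows)%:R - N%:R * ph l| + (`|(mass (take o es))%:R - o%:R * l|
    + `|(mass (take i (run rows es)))%:R - i%:R * l|)) hp hph _) _.
  move=> es rows _ _; rewrite /hgt.
  set a := _%:R; set a' := (mass (take o es))%:R; set a'' := (mass _)%:R.
  rewrite -[X in `|X|](_ : (a - N%:R * ph l) + ((a' - o%:R * l) - (a'' - i%:R * l)) = _); last by ring.
  apply: le_trans (ler_normD _ _) _; rewrite lerD2l; exact: ler_normB.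
rewrite !EsysD (Esys_Jin _ _ (fun n => `|n%:R - _|)) // (Esys_init _ _ (fun es => `|_|)) //.
rewrite (Esys_stationary b12 b2_lt1 _ _ (fun es => `|(mass (take i es))%:R - _|)) //.
have dE n (q : R) : dbern n q = dinit (nseq n q) by rewrite /dinit map_nseq.
have h1 : Ex (dbern N (ph l)) (fun es => `|(mass es)%:R - N%:R * ph l|) <= c + N%:R / c.
  rewrite dE -sum_nseq -[X in _ <= _ + X%:R / _](size_nseq N (ph l)).
  by apply: Ex_mass_dev => //; rewrite all_nseq /itv01 hph orbT.
have h2 j : (j <= L)%N -> Ex (dinit (nseq L l)) (fun es => `|(mass (take j es))%:R - j%:R * l|)
    <= c + j%:R / c.
  move=> jL; have -> : j%:R * l = \sum_(p <- take j (nseq L l)) p.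
    by rewrite take_nseq // sum_nseq.
  by apply: Ex_mass_take_dev => //; rewrite size_nseq.
have := h2 o oL; have := h2 i iL; rewrite -(dE L l).
by move: h1; rewrite !natrD !mulrDl; lra.
Qed.

Lemma Esys_hgt_left p p' q o L N i (Phi : R -> R) :
  0 <= p -> p <= p' -> p' <= 1 -> itv01 q -> (o <= L)%N ->
  {homo Phi : x y / x <= y} ->
  Esys (riem p q o L) (ph p) N (fun es rows => Phi (hgt o es rows i)) <=
  Esys (riem p' q o L) (ph p') N (fun es rows => Phi (hgt o es rows i)).
Proof.
move=> p0 pp' p'1 hq oL hPhi.
have hp : itv01 p by apply/andP; split=> //; exact: le_trans pp' _.
have hp' : itv01 p' by apply/andP; split=> //; exact: le_trans _ pp'.
have hs : size (riem p q o L) = size (riem p' q o L) by rewrite !size_riem.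
rewrite -(Esys_proj1 b1 b2 (ph p) (ph p') N (fun es rows => Phi (hgt o es rows i)) hs).
rewrite -(Esys_proj2 b1 b2 (ph p) (ph p') N (fun es rows => Phi (hgt o es rows i)) hs).
apply: le_Esys2_supported; rewrite ?all_riem ?size_riem // ?[itv01 (ph _)]phi_itv //.
move=> es rows se sr hes hrows; apply: hPhi; apply: hgt_more_left.
- apply: leb_seq_unzip => j; rewrite se => jL; have := hes j jL.
  rewrite !nth_riem // /sup; case: ifP => _; first by rewrite pp' => /andP[_].
  by rewrite lexx => /andP[_].
- apply: sub_all hrows => r; rewrite /sup (le_phi b12 b2_lt1 p0 pp') => /andP[_].
  exact.
- rewrite -!map_drop.
  apply: (@eq_from_nth _ false); rewrite !size_map // => j; rewrite size_drop se => jL.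
  rewrite !(nth_map (false, false)) ?size_drop ?se // !nth_drop.
  have jL' : (o + j < L)%N by lia.
  have := hes _ jL'; rewrite !nth_riem // ltnNge leq_addr /= /sup lexx /=.
  by case: (nth _ _ _) => [[] []].
Qed.

Lemma Esys_hgt_right p q q' o L N i (Phi : R -> R) :
  itv01 p -> 0 <= q -> q <= q' -> q' <= 1 -> (o <= L)%N ->
  {homo Phi : x y / x <= y} ->
  Esys (riem p q' o L) (ph p) N (fun es rows => Phi (hgt o es rows i)) <=
  Esys (riem p q o L) (ph p) N (fun es rows => Phi (hgt o es rows i)).
Proof.
move=> hp q0 qq' q'1 oL hPhi.
have hq : itv01 q by apply/andP; split=> //; exact: le_trans qq' _.
have hq' : itv01 q' by apply/andP; split=> //; exact: le_trans _ qq'.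
have hs : size (riem p q o L) = size (riem p q' o L) by rewrite !size_riem.
rewrite -(Esys_proj1 b1 b2 (ph p) (ph p) N (fun es rows => Phi (hgt o es rows i)) hs).
rewrite -(Esys_proj2 b1 b2 (ph p) (ph p) N (fun es rows => Phi (hgt o es rows i)) hs).
apply: le_Esys2_supported; rewrite ?all_riem ?size_riem // ?[itv01 (ph _)]phi_itv //.
move=> es rows se sr hes hrows; apply: hPhi; apply: hgt_more_right.
- apply: leb_seq_unzip => j; rewrite se => jL; have := hes j jL.
  rewrite !nth_riem // /sup; case: ifP => _; last by rewrite qq' => /andP[_].
  by rewrite lexx => /andP[_].
- apply: sub_all hrows => r; rewrite /sup lexx /=.
  by case: (r.1) => [[] []].
- rewrite -!map_take.
  have so : size (take o es) = o by rewrite size_takel // se.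
  apply: (@eq_from_nth _ false); rewrite !size_map // => j; rewrite so => jo.
  rewrite !(nth_map (false, false)) ?so // !nth_take //.
  have jL : (j < L)%N by lia.
  have := hes _ jL; rewrite !nth_riem // jo /= /sup lexx /=.
  by case: (nth _ _ _) => [[] []].
Qed.

Lemma EsysN ps f N F : Esys ps f N (fun es rows => - F es rows) = - Esys ps f N F.
Proof.
rewrite -[RHS]mulN1r -EsysZ; apply: eq_Ex => es; apply: eq_Ex => rows.
by rewrite mulN1r.
Qed.

Lemma homo_pos (a : R) : {homo (fun x => pos (x - a)) : x y / x <= y}.
Proof. by move=> x y xy; apply: pos_le (pos_ge0 _); apply: le_trans (le_pos _); rewrite lerB. Qed.

Lemma homo_Npos (a : R) : {homo (fun x => - pos (a - x)) : x y / x <= y}.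
Proof.
move=> x y xy; rewrite lerN2; apply: pos_le (pos_ge0 _).
by apply: le_trans (le_pos _); rewrite lerB.
Qed.

(** Passing from the constant density [l] to the step adds particles on the left and removes some on
    the right; both raise the height. *)
Lemma rarefaction_compare th rh l o L N i a :
  0 <= rh -> rh <= l -> l <= th -> th <= 1 -> (o <= L)%N ->
  Esys (riem th rh o L) (ph th) N (fun es rows => pos (a - hgt o es rows i)) <=
  Esys (nseq L l) (ph l) N (fun es rows => pos (a - hgt o es rows i)).
Proof.
move=> r0 rl lt t1 oL; rewrite -(riem_diag l oL) -lerN2 -!EsysN.
have l0 := le_trans r0 rl; have l1 := le_trans lt t1.
have hl : itv01 l by rewrite /itv01 l0.
have hr : itv01 rh by rewrite /itv01 r0 (le_trans rl).
apply: le_trans (@Esys_hgt_right l rh l o L N i _ hl r0 rl l1 oL (@homo_Npos a)) _.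
exact: (@Esys_hgt_left l th rh o L N i _ l0 lt t1 hr oL (@homo_Npos a)).
Qed.

(** With [l] equal to one of the two states, only one side changes, and each of the two changes
    lowers the height. *)
Lemma shock_compare th rh l o L N i a :
  0 <= th -> th <= rh -> rh <= 1 -> l = th \/ l = rh -> (o <= L)%N ->
  Esys (riem th rh o L) (ph th) N (fun es rows => pos (hgt o es rows i - a)) <=
  Esys (nseq L l) (ph l) N (fun es rows => pos (hgt o es rows i - a)).
Proof.
move=> t0 tr r1 hl oL; rewrite -(riem_diag l oL).
have r0 := le_trans t0 tr; have t1 := le_trans tr r1.
case: hl => ->.
  have ht : itv01 th by rewrite /itv01 t0.
  exact: (@Esys_hgt_right th th rh o L N i _ ht t0 tr r1 oL (@homo_pos a)).
have hr : itv01 rh by rewrite /itv01 r0.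
exact: (@Esys_hgt_left th rh rh o L N i _ t0 tr r1 hr oL (@homo_pos a)).
Qed.

End LawOfLargeNumbers.

(** * Size of the local equilibrium error *)

Section FiniteHydrodynamics.
Variables (R : realType) (b1 b2 : R).
Hypotheses (b1_gt0 : 0 < b1) (b12 : b1 < b2) (b2_lt1 : b2 < 1).
Local Notation ka := (kappa b1 b2).
Local Notation ph := (phi b1 b2).
Local Notation dcoins := (dcoins b1 b2).
Local Notation Esys := (Esys b1 b2).
Local Notation hgt := (@hgt R).

Definition block_dev (k : nat) (l : R) : R :=
  Ex (dbern k l) (fun es => Ex (bern (ph l)) (fun h =>
    Ex (dcoins k) (fun cs => bdev b1 b2 k l es cs h))).

Lemma block_dev_le k l e : (0 < k)%N -> 0 <= l <= 1 -> 0 < e ->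
  block_dev k l <= (2 * e + 5 / (k%:R * e) + k%:R^-1) / (1 - b2).
Proof.
move=> k0 hl e0; have kR : 0 < k%:R :> R by rewrite ltr0n.
have hph := phi_itv b12 b2_lt1 hl; have /andP[l0 l1] := hl.
have [hb1 hb12 hb2] := And3 b1_gt0 b12 b2_lt1.
have hd := is_dist_dbern k hl; have hc := is_dist_coins b1_gt0 b12 b2_lt1 k.
have q0 : 0 < 1 - b2 by rewrite subr_gt0.
have ke : 0 < k%:R * e by rewrite mulr_gt0.
pose m1 := Ex (dbern k l) (fun es => `|(mass es)%:R - k%:R * l|).
have hm1 : m1 <= k%:R * e + k%:R / (k%:R * e).
  have := @Ex_mass_dev R (nseq k l) (k%:R * e) _ ke.
  rewrite /dinit map_nseq size_nseq sum_nseq; apply.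
  by rewrite all_nseq /itv01 hl orbT.
pose ga := b2 - (b2 - b1) * l.
(* A spectral gap uniform in [l]: dividing the martingale estimate by [1 - ga] recovers the flux
   with constants independent of the density. *)
have ga1 : 1 - b2 <= 1 - ga by rewrite /ga; nra.
pose Z (h : bool) es cs : R := (1 - ga) * ((flux es cs h)%:R - k%:R * ph l)
   + (hout es cs h)%:R - h%:R.
pose m2 h := Ex (dbern k l) (fun es => Ex (dcoins k) (fun cs => `|Z h es cs|)).
have hm2 h : m2 h <= k%:R * e + 4 * k%:R / (k%:R * e).
  rewrite /m2 -(Ex_prod _ _ (fun p => `|Z h p.1 p.2|)).
  apply: le_trans (Ex_abs_le _ (is_dist_prod hd hc) ke) _.
  rewrite lerD2l ler_pM2r ?invr_gt0 // Ex_prod.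
  by have [_] := Ex_flux_martingale b1_gt0 b12 b2_lt1 k h hl.
rewrite /block_dev Ex_exchange.
have hb := is_dist_bern hph.
rewrite -[X in _ <= X](Ex_cst _ hb); apply: le_Ex => // h.
apply: (@le_trans _ _ (m1 / k%:R + (m2 h + 1) / ((1 - b2) * k%:R))).
  rewrite /m1 /m2 -ExZr -[X in _ <= _ + (_ + X) / _](Ex_cst 1 hd) -ExD -ExZr -ExD.
  apply: le_Ex => // es.
  rewrite -[X in _ <= X + _](Ex_cst _ hc) -[X in _ <= _ + (_ + X) / _](Ex_cst 1 hc).
  rewrite -ExD -ExZr -ExD; apply: le_Ex => // cs; rewrite /bdev lerD //.
    rewrite /density -[X in X <= _](_ : `|((mass es)%:R - k%:R * l) / k%:R| = _).
      by rewrite normrM (@ger0_norm _ k%:R^-1) // invr_ge0 ltW.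
    by congr `|_|; field; rewrite gt_eqF.
  rewrite ler_pdivlMr ?mulr_gt0 //.
  have -> : `|bflux R k es cs h - ph l| * ((1 - b2) * k%:R) =
      (1 - b2) * `|(flux es cs h)%:R - k%:R * ph l|.
    rewrite -[X in _ = _ * `|X|](_ : (bflux R k es cs h - ph l) * k%:R = _).
      by rewrite normrM (@ger0_norm _ k%:R) // ?ltW //; ring.
    by rewrite /bflux; field; rewrite gt_eqF.
  apply: (@le_trans _ _ `|(1 - ga) * ((flux es cs h)%:R - k%:R * ph l)|).
    rewrite normrM ler_wpM2r // ger0_norm //; exact: le_trans (ltW q0) ga1.
  rewrite -[X in `|X|](_ : Z h es cs - ((hout es cs h)%:R - h%:R) = _); last by rewrite /Z; ring.
  apply: le_trans (ler_normB _ _) _; rewrite lerD2l.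
  by case: (hout es cs h); case: h; rewrite /= ?subrr ?subr0 ?sub0r ?normrN ?normr1 ?normr0.
have i1 : 1 <= (1 - b2)^-1.
  by rewrite -[1]invr1 lef_pV2 ?posrE ?ltr01 //; lra.
have A1 : m1 / k%:R <= (e + 1 / (k%:R * e)) / (1 - b2).
  apply: (@le_trans _ _ (e + 1 / (k%:R * e))).
    rewrite ler_pdivrMr //; apply: le_trans hm1 _.
    by rewrite le_eqVlt; apply/orP; left; apply/eqP; field; rewrite !gt_eqF.
  by rewrite ler_peMr // addr_ge0 ?divr_ge0 // ltW.
have A2 : (m2 h + 1) / ((1 - b2) * k%:R) <= (e + 4 / (k%:R * e) + k%:R^-1) / (1 - b2).
  rewrite ler_pdivrMr ?mulr_gt0 //; apply: le_trans (lerD (hm2 h) (lexx _)) _.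
  rewrite le_eqVlt; apply/orP; left; apply/eqP; field.
  by rewrite !gt_eqF.
apply: le_trans (lerD A1 A2) _; rewrite -mulrDl ler_pM2r ?invr_gt0 //.
rewrite le_eqVlt; apply/orP; left; apply/eqP; field.
by rewrite !gt_eqF.
Qed.

Lemma nat_above (x : R) : exists n : nat, x <= n%:R.
Proof. by exists (Num.truncn x).+1; rewrite ltW // truncnS_gt. Qed.

Lemma block_dev_small d : 0 < d -> exists2 k, (0 < k)%N &
  forall l, 0 <= l <= 1 -> block_dev k l <= d.
Proof.
move=> d0; have q0 : 0 < 1 - b2 by rewrite subr_gt0.
set q := 1 - b2 in q0; pose e := d * q / 4.
have e0 : 0 < e by rewrite divr_gt0 ?mulr_gt0.
have [n hn] := nat_above ((5 / e + 1) / (d * q / 2)).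
have dq : 0 < d * q / 2 by rewrite divr_gt0 ?mulr_gt0.
exists n.+1 => // l hl; apply: le_trans (block_dev_le _ hl e0) _ => //.
have nR : 0 < n.+1%:R :> R by rewrite ltr0n.
rewrite ler_pdivrMr // -/q.
have H : (5 / e + 1) / n.+1%:R <= d * q / 2.
  rewrite ler_pdivrMr // [X in _ <= X]mulrC -ler_pdivrMr //.
  by apply: le_trans hn _; rewrite ler_nat.
have E (x y : R) : 0 < x -> 0 < y -> 5 / (x * y) + x^-1 = (5 / y + 1) / x.
  by move=> x0 y0; field; rewrite !gt_eqF.
have eE : 2 * e = d * q / 2 by rewrite /e; lra.
by rewrite -addrA E // eE [X in _ <= X]splitr lerD2l.
Qed.

Section Rstat.
Variables (k : nat).
Hypothesis k_gt0 : (0 < k)%N.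
Let kR : 0 < k%:R :> R. Proof. by rewrite ltr0n. Qed.

Lemma rstatD g1 g2 m es cs h :
  rstat k (fun es cs h => g1 es cs h + g2 es cs h) m es cs h =
  rstat k g1 m es cs h + rstat k g2 m es cs h :> R.
Proof.
elim: m es cs h => [|m IH] es cs h /=; first by rewrite addr0.
by rewrite IH; ring.
Qed.

Lemma rstatZ c g m es cs h :
  rstat k (fun es cs h => c * g es cs h) m es cs h = c * rstat k g m es cs h :> R.
Proof.
elim: m es cs h => [|m IH] es cs h /=; first by rewrite mulr0.
by rewrite IH; ring.
Qed.

Lemma addfD (g1 g2 : seq bool -> rowdata -> R) rows es :
  addf (fun es r => g1 es r + g2 es r) rows es = addf g1 rows es + addf g2 rows es.
Proof.
elim: rows es => [|r rows IH] es /=; first by rewrite addr0.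
by rewrite IH; ring.
Qed.

Lemma addfZ c (g : seq bool -> rowdata -> R) rows es :
  addf (fun es r => c * g es r) rows es = c * addf g rows es.
Proof.
elim: rows es => [|r rows IH] es /=; first by rewrite mulr0.
by rewrite IH; ring.
Qed.

Lemma eq_addf (g1 g2 : seq bool -> rowdata -> R) rows es :
  (forall es r, g1 es r = g2 es r) -> addf g1 rows es = addf g2 rows es.
Proof. by move=> E; elim: rows es => [|r rows IH] es //=; rewrite E IH. Qed.

Lemma rstat_low l m e1 e2 cs (h1 h2 : bool) : leb_seq e2 e1 -> h2 ==> h1 ->
  rstat k (fun es _ _ => pos (l - density R k es)) m e1 cs h1 <=
  rstat k (bdev b1 b2 k l) m e2 cs h2.
Proof.
elim: m e1 e2 cs h1 h2 => [|m IH] e1 e2 cs h1 h2 //= le21 h21.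
have le' := leb_seq_take k le21.
rewrite lerD //; last first.
  by apply: IH; [exact: leb_seq_drop|case: (row_mono cs le' h21)].
apply: le_trans (_ : `|density R k (take k e2) - l| <= _); last by rewrite lerDl.
rewrite pos_le // distrC; apply: le_trans (ler_norm _); rewrite lerB //.
by rewrite ler_pM2r ?invr_gt0 // ler_nat leb_seq_mass.
Qed.

Lemma rstat_high l m e1 e2 cs (h1 h2 : bool) : leb_seq e1 e2 -> h1 ==> h2 ->
  rstat k (fun es _ _ => pos (density R k es - l)) m e1 cs h1 <=
  rstat k (bdev b1 b2 k l) m e2 cs h2.
Proof.
elim: m e1 e2 cs h1 h2 => [|m IH] e1 e2 cs h1 h2 //= le21 h21.
have le' := leb_seq_take k le21.
rewrite lerD //; last first.
  by apply: IH; [exact: leb_seq_drop|case: (row_mono cs le' h21)].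
apply: le_trans (_ : `|density R k (take k e2) - l| <= _); last by rewrite lerDl.
rewrite pos_le //; apply: le_trans (ler_norm _); rewrite lerB //.
by rewrite ler_pM2r ?invr_gt0 // ler_nat leb_seq_mass.
Qed.

Lemma Esys_bdev l m N : 0 <= l <= 1 ->
  Esys (nseq (m * k) l) (ph l) N (fun es rows =>
    addf (fun es r => rstat k (bdev b1 b2 k l) m es r.2 r.1) rows es) =
  (N * m)%:R * block_dev k l.
Proof.
move=> hl; rewrite Esys_addf_stationary // natrM -mulrA -Ex_rstat_stationary //.
by congr (_ * _); apply: eq_Ex => es; rewrite Ex_prod.
Qed.

(** The step system dominates the stationary one of density [th] under the coupling, so block
    densities below [th] are due to equilibrium fluctuations of the latter. *)
Lemma Esys_low th rh m N o : 0 <= th -> th <= rh -> rh <= 1 -> (o <= m * k)%N ->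
  Esys (riem th rh o (m * k)) (ph th) N (fun es rows =>
    addf (fun es r => rstat k (fun es _ _ => pos (th - density R k es)) m es r.2 r.1) rows es)
  <= (N * m)%:R * block_dev k th.
Proof.
move=> t0 tr r1 oL; have t1 := le_trans tr r1; have r0 := le_trans t0 tr.
have ht : itv01 th by rewrite /itv01 t0.
have hr : itv01 rh by rewrite /itv01 r0.
rewrite -Esys_bdev //.
have hs : size (riem th rh o (m * k)) = size (nseq (m * k) th).
  by rewrite size_riem // size_nseq.
rewrite -(Esys_proj1 b1 b2 (ph th) (ph th) N _ hs).
rewrite -(Esys_proj2 b1 b2 (ph th) (ph th) N (fun es rows =>
    addf (fun es r => rstat k (bdev b1 b2 k th) m es r.2 r.1) rows es) hs).
have hq : all (@itv01 R) (nseq (m * k) th) by rewrite all_nseq ht orbT.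
apply: le_Esys2_supported; rewrite ?all_riem // ?size_riem ?size_nseq // ?[itv01 (ph _)]phi_itv //.
move=> es rows se sr hes hrows.
have {hes} : leb_seq (unzip2 es) (unzip1 es).
  have : leb_seq (unzip1 [seq (a.2, a.1) | a <- es]) (unzip2 [seq (a.2, a.1) | a <- es]).
    apply: leb_seq_unzip => i; rewrite size_map se => iL.
    rewrite (nth_map (false, false)) ?se //=; have := hes i iL.
    rewrite nth_riem // nth_nseq iL /sup; case: ifP => _; last by rewrite tr => /andP[].
    by rewrite lexx => /andP[].
  by rewrite /unzip1 /unzip2 -!map_comp.
elim: rows (unzip1 es) (unzip2 es) {sr} hrows => [|r rows IH] e1 e2 //= /andP[hr' hrows] le21.
have h21 : r.1.2 ==> r.1.1 by move: hr'; rewrite /sup lexx => /andP[].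
by rewrite lerD ?rstat_low // IH //; case: (row_mono r.2 le21 h21).
Qed.

Lemma Esys_high th rh m N o : 0 <= th -> th <= rh -> rh <= 1 -> (o <= m * k)%N ->
  Esys (riem th rh o (m * k)) (ph th) N (fun es rows =>
    addf (fun es r => rstat k (fun es _ _ => pos (density R k es - rh)) m es r.2 r.1) rows es)
  <= (N * m)%:R * block_dev k rh.
Proof.
move=> t0 tr r1 oL; have t1 := le_trans tr r1; have r0 := le_trans t0 tr.
have ht : itv01 th by rewrite /itv01 t0.
have hr : itv01 rh by rewrite /itv01 r0.
rewrite -Esys_bdev //.
have hs : size (riem th rh o (m * k)) = size (nseq (m * k) rh).
  by rewrite size_riem // size_nseq.
rewrite -(Esys_proj1 b1 b2 (ph th) (ph rh) N _ hs).
rewrite -(Esys_proj2 b1 b2 (ph th) (ph rh) N (fun es rows =>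
    addf (fun es r => rstat k (bdev b1 b2 k rh) m es r.2 r.1) rows es) hs).
have hq : all (@itv01 R) (nseq (m * k) rh) by rewrite all_nseq hr orbT.
apply: le_Esys2_supported; rewrite ?all_riem // ?size_riem ?size_nseq // ?[itv01 (ph _)]phi_itv //.
move=> es rows se sr hes hrows.
have {hes} : leb_seq (unzip1 es) (unzip2 es).
  apply: leb_seq_unzip => i; rewrite se => iL; have := hes i iL.
  rewrite nth_riem // nth_nseq iL /sup; case: ifP => _; first by rewrite tr => /andP[].
  by rewrite lexx => /andP[].
elim: rows (unzip1 es) (unzip2 es) {sr} hrows => [|r rows IH] e1 e2 //= /andP[hr' hrows] le12.
have h12 : r.1.1 ==> r.1.2.
  by move: hr'; rewrite /sup (le_phi b12 b2_lt1 t0 tr) => /andP[].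
by rewrite lerD ?rstat_high // IH //; case: (row_mono r.2 le12 h12).
Qed.

End Rstat.

(** On [th, rh] concavity puts [phi] above its chord; outside, the chord exceeds [phi] by at most
    the Lipschitz constant times the distance to the interval. *)
Definition shock_pen (th rh u : R) : R := ka * (pos (th - u) + pos (u - rh)).

(** Three error terms receive d / 3 each: the grid size [K] handles the mesh, then [k] the
    equilibrium fluctuations, whose tolerance depends on [K], and finally [N0] the annihilation
    count with its factor 1 / [cmin ^+ k]. All choices are uniform in the densities. *)
Lemma block_error_small (C d : R) : 0 < C -> 0 < d ->
  exists2 k, (0 < k)%N & exists N0 : nat, forall N m o (th rh : R), (N0 <= N)%N ->
   itv01 th -> itv01 rh -> (o <= m * k)%N -> (m * k)%:R <= C * N%:R ->
   k%:R * Esys (riem th rh o (m * k)) (ph th) N (fun es rows =>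
     addf (fun es r => rstat k (lerr b1 b2 k) m es r.2 r.1) rows es) <= d * N%:R ^+ 2 /\
   (th <= rh -> k%:R * Esys (riem th rh o (m * k)) (ph th) N (fun es rows =>
     addf (fun es r => rstat k (fun es cs h => lerr b1 b2 k es cs h
       + shock_pen th rh (density R k es)) m es r.2 r.1) rows es) <= 2 * d * N%:R ^+ 2).
Proof.
move=> C0 d0; have ka0 := kappa_gt0 b12 b2_lt1.
have [c cE c0] : exists2 c : R, c = 2 * ka & 0 < c.
  by exists (2 * ka) => //; apply: mulr_gt0.
have [K0 hK0] := nat_above (3 * c * C / d).
pose K := K0.+1; have KR : 0 < K%:R :> R by rewrite ltr0n.
have hK : c * C / K%:R <= d / 3.
  have h : 3 * c * C / d <= K%:R by apply: le_trans hK0 _; rewrite ler_nat.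
  move: h; rewrite ler_pdivrMr // ler_pdivrMr //; lra.
pose dv := d / (3 * c * K.+1%:R * C).
have K1 : 0 < K.+1%:R :> R by rewrite ltr0n.
have dv0 : 0 < dv by rewrite divr_gt0 // !mulr_gt0.
have hdvE : c * K.+1%:R * C * dv = d / 3.
  by rewrite /dv; field; rewrite !gt_eqF // mulr_gt0.
clearbody dv; have [k k0 hk] := block_dev_small dv0.
have kR : 0 < k%:R :> R by rewrite ltr0n.
have cm : 0 < cmin b1 b2 ^+ k by rewrite exprn_gt0 // cmin_gt0.
exists k => //.
pose D := c * K.+1%:R * k%:R * (C + 1) / cmin b1 b2 ^+ k.
have [N0 hN0] := nat_above (3 * D / d); exists N0 => N m o th rh NN ht hr oL hL.
have hN : D <= d / 3 * N%:R.
  have h : 3 * D / d <= N%:R by apply: le_trans hN0 _; rewrite ler_nat.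
  by move: h; rewrite ler_pdivrMr //; lra.
have NR : 0 <= N%:R :> R by [].
have mk : (m * k)%:R = m%:R * k%:R :> R by rewrite natrM.
have main : k%:R * Esys (riem th rh o (m * k)) (ph th) N (fun es rows =>
     addf (fun es r => rstat k (lerr b1 b2 k) m es r.2 r.1) rows es) <= d * N%:R ^+ 2.
  apply: le_trans (ler_wpM2l (ltW kR) (@Esys_lerr _ _ _ b1_gt0 b12 b2_lt1 k k0 K dv m N
    (riem th rh o (m * k)) (ph th) _ hk _ _ _)) _ => //.
  - exact: all_riem.
  - exact: phi_itv.
  - exact: size_riem.
  rewrite -cE.
  have -> : k%:R * (c * ((N * m)%:R / K%:R + K.+1%:R *
      ((m * k + N)%:R / cmin b1 b2 ^+ k + (N * m)%:R * dv))) =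
      c / K%:R * N%:R * (m * k)%:R
      + c * K.+1%:R * k%:R / cmin b1 b2 ^+ k * ((m * k)%:R + N%:R)
      + c * K.+1%:R * dv * N%:R * (m * k)%:R.
    by rewrite !natrD !natrM; ring.
  have t1 : c / K%:R * N%:R * (m * k)%:R <= d / 3 * N%:R ^+ 2.
    apply: le_trans (ler_wpM2l _ hL) _; first by rewrite !mulr_ge0 ?invr_ge0 //; apply: ltW.
    apply: le_trans (_ : c * C / K%:R * N%:R ^+ 2 <= _); last by rewrite ler_wpM2r ?sqr_ge0.
    by rewrite le_eqVlt; apply/orP; left; apply/eqP; ring.
  have t2 : c * K.+1%:R * k%:R / cmin b1 b2 ^+ k * ((m * k)%:R + N%:R) <= d / 3 * N%:R ^+ 2.
    apply: (@le_trans _ _ (D * N%:R)); last first.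
      by rewrite expr2 mulrA ler_wpM2r.
    rewrite /D (_ : _ * (C + 1) / _ * N%:R =
      c * K.+1%:R * k%:R / cmin b1 b2 ^+ k * (C * N%:R + N%:R)); last by ring.
    by rewrite ler_wpM2l ?lerD2r // divr_ge0 ?mulr_ge0 //; apply: ltW.
  have t3 : c * K.+1%:R * dv * N%:R * (m * k)%:R <= d / 3 * N%:R ^+ 2.
    apply: le_trans (ler_wpM2l _ hL) _; first by rewrite !mulr_ge0 //; apply: ltW.
    by rewrite -hdvE le_eqVlt; apply/orP; left; apply/eqP; ring.
  lra.
split=> // tr; have /andP[t0 t1] := ht; have /andP[r0 r1] := hr.
have := @Esys_low k k0 th rh m N o t0 tr r1 oL.
have := @Esys_high k k0 th rh m N o t0 tr r1 oL.
set Eh := Esys _ _ _ _ => hEh; set El := Esys _ _ _ _ => hEl.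
have -> : Esys (riem th rh o (m * k)) (ph th) N (fun es rows =>
     addf (fun es r => rstat k (fun es cs h => lerr b1 b2 k es cs h
       + shock_pen th rh (density R k es)) m es r.2 r.1) rows es) =
   Esys (riem th rh o (m * k)) (ph th) N (fun es rows =>
     addf (fun es r => rstat k (lerr b1 b2 k) m es r.2 r.1) rows es) + ka * (El + Eh).
  rewrite /El /Eh -!EsysD -EsysZ -EsysD; apply: eq_Ex => es; apply: eq_Ex => rows.
  rewrite -addfD -addfZ -addfD; apply: eq_addf => {}es r.
  rewrite -rstatD -rstatZ -rstatD //.
rewrite mulrDr (_ : 2 * d * _ = d * N%:R ^+ 2 + d * N%:R ^+ 2); last by ring.
rewrite lerD //.
have hr1 := hk _ hr; have ht1 := hk _ ht.
have : k%:R * (ka * (El + Eh)) <= c * dv * N%:R * (m * k)%:R.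
  rewrite cE; apply: (@le_trans _ _ (k%:R * (ka * ((N * m)%:R * dv + (N * m)%:R * dv)))).
    apply: ler_wpM2l; first exact: ltW.
    rewrite ler_pM2l // lerD //.
      by apply: le_trans hEl _; rewrite ler_wpM2l.
    by apply: le_trans hEh _; rewrite ler_wpM2l.
  by rewrite !natrM le_eqVlt; apply/orP; left; apply/eqP; ring.
move=> /le_trans; apply.
apply: le_trans (ler_wpM2l _ hL) _; first by rewrite !mulr_ge0 //; apply: ltW.
have : c * dv * N%:R * (C * N%:R) <= c * K.+1%:R * C * dv * N%:R ^+ 2.
  rewrite (_ : c * K.+1%:R * C * dv * N%:R ^+ 2 = K.+1%:R * (c * dv * N%:R * (C * N%:R))); last by ring.
  by rewrite ler_peMl // ?ler1n // !mulr_ge0 //; apply: ltW.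
rewrite hdvE; have : 0 <= d * N%:R ^+ 2 by rewrite mulr_ge0 ?sqr_ge0 ?ltW.
lra.
Qed.

End FiniteHydrodynamics.

(** * Limit heights of the finite model *)

Section HeightLimit.
Variables (R : realType) (b1 b2 : R).
Hypotheses (b1_gt0 : 0 < b1) (b12 : b1 < b2) (b2_lt1 : b2 < 1).
Local Notation ka := (kappa b1 b2).
Local Notation ph := (phi b1 b2).
Local Notation Esys := (Esys b1 b2).
Local Notation hgt := (@hgt R).

(** The rescaled initial height: minus the integral of the initial density from 0 to [z]. *)
Definition h_init (th rh z : R) : R := if z <= 0 then - th * z else - rh * z.

Lemma truncn_close (x : R) : 0 <= x -> `|(Num.truncn x)%:R - x| <= 1.
Proof.
move=> x0; have /andP[] := truncn_itv x0; rewrite -natr1 => h1 h2.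
by rewrite ler_norml; apply/andP; split; lra.
Qed.

Lemma hgt_lip o es rows i j : `|hgt o es rows i - hgt o es rows j| <= `|i%:R - j%:R|.
Proof.
wlog ij : i j / (j <= i)%N => [H|].
  by case: (leqP j i) => [/H //|/ltnW /H]; rewrite distrC [X in _ <= X -> _]distrC.
rewrite -natrB // normr_nat -{1}(subnKC ij).
by apply: lip_iter => n; apply: hgt_lipx.
Qed.

Lemma norm_pos_sg (sg y : R) : sg ^+ 2 = 1 -> `|y| <= pos (sg * y) + pos (- sg * y).
Proof.
move=> sg2; have -> : `|y| = `|sg * y|.
  rewrite normrM; have -> : `|sg| = 1; last by rewrite mul1r.
  by apply/eqP; rewrite -(@eqrXn2 _ 2) // expr1n real_normK ?num_real // sg2.
rewrite mulNr ler_norml; have := le_pos (sg * y); have := le_pos (- (sg * y)).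
by have := pos_ge0 (sg * y); have := pos_ge0 (- (sg * y)); move=> *; apply/andP; split; lra.
Qed.

Lemma sum_take_riem (p q : R) o L i : (o <= L)%N -> (i <= L)%N ->
  \sum_(r <- take i (riem p q o L)) r =
  if (i <= o)%N then i%:R * p else o%:R * p + (i%:R - o%:R) * q.
Proof.
move=> oL iL; rewrite /riem take_cat size_nseq; case: ltnP => io.
  by rewrite (ltnW io) take_nseq 1?ltnW // sum_nseq.
rewrite big_cat /= take_nseq; last by lia.
rewrite !sum_nseq natrB //; case: leqP => // oi.
by have -> : i = o by [apply/eqP; rewrite eqn_leq oi]; rewrite subrr mul0r addr0.
Qed.

Lemma riem_profile (th rh C x v : R) (N L : nat) : itv01 th -> itv01 rh -> 0 < N%:R :> R ->
  0 <= C -> 0 <= C + x - v -> (Num.truncn (C * N%:R) <= L)%N ->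
  (Num.truncn ((C + x - v) * N%:R) <= L)%N ->
  let S j := \sum_(r <- take j (riem th rh (Num.truncn (C * N%:R)) L)) r in
  `|S (Num.truncn (C * N%:R)) - S (Num.truncn ((C + x - v) * N%:R))
    - N%:R * h_init th rh (x - v)| <= 2.
Proof.
move=> /andP[th0 th1] /andP[rh0 rh1] NR0 C0 Cxv0; set o := Num.truncn (C * N%:R).
set x0 := Num.truncn ((C + x - v) * N%:R) => oL x0L; cbv zeta.
have oE : `|o%:R - C * N%:R| <= 1 by apply: truncn_close; rewrite mulr_ge0 // ltW.
have x0E : `|x0%:R - (C + x - v) * N%:R| <= 1.
  by apply: truncn_close; rewrite mulr_ge0 // ltW.
rewrite !sum_take_riem // leqnn /h_init.
move: oE x0E; rewrite !ler_norml => /andP[oa ob] /andP[x1 x2].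
have xvE : (C + x - v) * N%:R = C * N%:R + (x - v) * N%:R by ring.
case: (lerP (x - v) 0) => xv.
  have xo : (x0 <= o)%N.
    apply: le_truncn; rewrite ler_pM2r //; lra.
  rewrite xo (_ : _ - _ - _ = th * (o%:R - x0%:R + (x - v) * N%:R)); last by ring.
  by apply/andP; split; nra.
have xo : (o <= x0)%N by apply: le_truncn; rewrite ler_pM2r //; lra.
case: leqP => xo'.
  have xe : x0 = o by apply/eqP; rewrite eqn_leq xo xo'.
  move: xvE; rewrite xe subrr sub0r => xvE.
  rewrite xe in x1 x2.
  by apply/andP; split; nra.
rewrite (_ : _ - _ - _ = rh * ((x - v) * N%:R - (x0%:R - o%:R))); last by ring.
by apply/andP; split; nra.
Qed.

(** Common to both regimes. The deviation of sign [sg] is bounded by [hgt_line] on the ray of speed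
    [v] that ends at [x]; the opposite one by a stationary system of density [l]. The equation on
    [h_init] says that both bounds aim at the same value [phi l - l x]. *)
Lemma hgt_lln_bound (sg th rh l v c0 x C e : R) (pen : R -> R) (k : nat) :
  sg ^+ 2 = 1 -> itv01 th -> itv01 rh -> itv01 l -> 0 <= v ->
  0 < e -> e <= 1 / 4 -> (0 < k)%N -> 0 <= C -> v <= C + x -> x <= C - 1 ->
  (forall u, 0 <= pen u) ->
  (forall u, 0 <= u <= 1 -> sg * (ph u - c0 - v * u) <= pen u) ->
  h_init th rh (x - v) + c0 = ph l - l * x ->
  (forall o L N i a, (o <= L)%N ->
    Esys (riem th rh o L) (ph th) N (fun es rows => pos (- sg * (hgt o es rows i - a))) <=
    Esys (nseq L l) (ph l) N (fun es rows => pos (- sg * (hgt o es rows i - a)))) ->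
  exists N0 : nat, forall N m, (N0 <= N)%N -> 2 * C * N%:R <= (m * k)%:R ->
   let o := Num.truncn (C * N%:R) in
   k%:R * Esys (riem th rh o (m * k)) (ph th) N (fun es rows =>
     addf (fun es r => rstat k (fun es cs h => lerr b1 b2 k es cs h
       + pen (density R k es)) m es r.2 r.1) rows es) <= e ^+ 2 * N%:R ^+ 2 ->
   Esys (riem th rh o (m * k)) (ph th) N (fun es rows =>
     `|hgt o es rows (Num.truncn ((C + x) * N%:R)) - N%:R * (ph l - l * x)|)
   <= 20 * e * N%:R.
Proof.
move=> sg2 ht hr hl v0 e0 e4 k0 C0 vCx xC pen0 hpen hE cmp.
set h := ph l - l * x in hE *.
pose C2 := 2 * k%:R * (1 + `|c0| + v) + 2 * (v + 2) ^+ 2.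
(* The contributions bounded independently of [N] sum to [C2 / e + (6 * C + 1) / e + 12] and are
   absorbed into [10 * e * N]; those proportional to [e * N] sum to 8 of them, so 20 leaves room. *)
have [N1 hN1] := nat_above ((C2 / e + (6 * C + 1) / e + 12) / (10 * e)).
have [N2 hN2] := nat_above (4 / e).
exists (N1 + N2 + 2)%N => N m NN hL o hErr.
have [NN1 NN2 NN3] : [/\ (N1 <= N)%N, (N2 <= N)%N & (2 <= N)%N].
  split; apply: leq_trans NN; first by rewrite -addnA leq_addr.
    by rewrite addnAC leq_addl.
  by rewrite leq_addl.
have sgN : `|sg| = 1.
  by apply/eqP; rewrite -(@eqrXn2 _ 2) // expr1n real_normK ?num_real // sg2.
have NR : 2 <= N%:R :> R by rewrite (ler_nat R 2).
have NR0 : 0 < N%:R :> R by lra.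
have eN : 4 <= e * N%:R.
  have : 4 / e <= N%:R by apply: le_trans hN2 _; rewrite ler_nat.
  by rewrite ler_pdivrMr // mulrC.
have KN : C2 / e + (6 * C + 1) / e + 12 <= 10 * e * N%:R.
  have : (C2 / e + (6 * C + 1) / e + 12) / (10 * e) <= N%:R.
    by apply: le_trans hN1 _; rewrite ler_nat.
  by rewrite ler_pdivrMr ?mulr_gt0 // [X in _ <= X -> _]mulrC.
set L := (m * k)%N in hL hErr *.
have Cx0 : 0 <= C + x by lra.
have Cxv0 : 0 <= C + x - v by rewrite subr_ge0.
set i := Num.truncn ((C + x) * N%:R).
pose x0 := Num.truncn ((C + x - v) * N%:R).
pose q := Num.truncn (v * N%:R).
(* A window of width about [e * N]: it costs a height of that order, and the space-time error
   [e ^+ 2 * N ^+ 2] divided by it is again at most [e * N]. *)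
pose l1 := (Num.truncn (e * N%:R)).+1.
have oE : `|o%:R - C * N%:R| <= 1 by apply: truncn_close; rewrite mulr_ge0 // ltW.
have iE : `|i%:R - (C + x) * N%:R| <= 1 by apply: truncn_close; rewrite mulr_ge0 // ltW.
have x0E : `|x0%:R - (C + x - v) * N%:R| <= 1.
  by apply: truncn_close; rewrite mulr_ge0 // ltW.
have qE : `|q%:R - v * N%:R| <= 1 by apply: truncn_close; rewrite mulr_ge0 // ltW.
have oT : o%:R <= C * N%:R by rewrite truncn_le mulr_ge0 // ltW.
have iT : i%:R <= (C + x) * N%:R by rewrite truncn_le mulr_ge0 // ltW.
have x0T : x0%:R <= (C + x - v) * N%:R by rewrite truncn_le mulr_ge0 // ltW.
have qT : q%:R <= v * N%:R by rewrite truncn_le mulr_ge0 // ltW.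
have l1T : e * N%:R <= l1%:R <= e * N%:R + 1.
  rewrite ltW ?truncnS_gt //= -natr1 lerD2r truncn_le mulr_ge0 // ltW //.
have oL : (o <= L)%N.
  rewrite -(ler_nat R); apply: le_trans oT _; apply: le_trans hL.
  by rewrite ler_pM2r //; lra.
have iL : (i <= L)%N.
  rewrite -(ler_nat R); apply: le_trans iT _; apply: le_trans hL.
  by rewrite ler_pM2r //; lra.
have x0L : (x0 <= L)%N.
  rewrite -(ler_nat R); apply: le_trans x0T _; apply: le_trans hL.
  by rewrite ler_pM2r //; lra.
have wL : (x0 + q + l1 <= m * k)%N.
  rewrite -(ler_nat R); apply: le_trans hL; rewrite !natrD.
  have : (C + x - v) * N%:R + v * N%:R + (e * N%:R + 1) <= 2 * C * N%:R.
    have : (C + x + 1 - 2 * C) * N%:R <= 0 by apply: mulr_le0_ge0; [lra|exact: ltW].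
    have : e * N%:R <= 1 / 4 * N%:R by rewrite ler_wpM2r // ltW.
    by rewrite !mulrBl !mulrDl; lra.
  by case/andP: l1T => _; lra.
have hph := phi_itv b12 b2_lt1 ht.
have hp : all (@itv01 R) (riem th rh o L) by apply: all_riem.
have /andP[th0 th1] := ht; have /andP[rh0 rh1] := hr; have /andP[l0 l1'] := hl.
pose Err es rows := k%:R * addf (fun es r => rstat k (fun es cs h => lerr b1 b2 k es cs h
       + pen (density R k es)) m es r.2 r.1) rows es : R.
pose S j := \sum_(r <- take j (riem th rh o L)) r.
pose dev j (es : seq bool) := `|(mass (take j es))%:R - S j|.
have Sdiff : `|S o - S x0 - N%:R * h_init th rh (x - v)| <= 2.
  exact: riem_profile.
have C20 : 0 <= C2.
  by rewrite /C2 addr_ge0 // ?mulr_ge0 // ?sqr_ge0 // !addr_ge0.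
have l1R : 0 < l1%:R :> R by rewrite ltr0n.
have point es rows : size es = size (riem th rh o L) -> size rows = N ->
  `|hgt o es rows i - N%:R * h| <=
   (Err es rows / l1%:R + (dev o es + dev x0 es)
     + (N%:R * C2 / l1%:R + 2 * l1%:R + 8)) + pos (- sg * (hgt o es rows i - N%:R * h)).
  move=> se sr; apply: le_trans (norm_pos_sg _ sg2) _; rewrite lerD2r.
  have lip : `|hgt o es rows i - hgt o es rows (x0 + q)%N| <= 3.
    apply: le_trans (hgt_lip _ _ _ _ _) _; rewrite natrD.
    move: iE x0E qE; rewrite !ler_norml => /andP[ia ib] /andP[xa xb] /andP[qa qb].
    clear - R b1 b2 b1_gt0 b12 b2_lt1 ia ib xa xb qa qb.
    by apply/andP; split; lra.
  have se' : size es = (m * k)%N by rewrite se size_riem.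
  have := @hgt_line _ b1 b2 k k0 sg o es rows m l1 x0 v c0 pen sg2 isT v0 se' pen0 hpen.
  rewrite sr => /(_ wL); rewrite -/q -/(Err es rows) -/C2 => line.
  have h0 : `|hgt o es [::] x0 - N%:R * h_init th rh (x - v)| <= dev o es + dev x0 es + 2.
    rewrite /hgt /= /Jin /= add0r.
    rewrite -[X in `|X|](_ : ((mass (take o es))%:R - S o) - ((mass (take x0 es))%:R - S x0)
       + (S o - S x0 - N%:R * h_init th rh (x - v)) = _); last by ring.
    apply: le_trans (ler_normD _ _) _; rewrite lerD //.
    exact: ler_normB.
  have sgle (y : R) : sg * y <= `|y|.
    by rewrite -[`|y|]mul1r -sgN -normrM ler_norm.
  apply: pos_le; last first.
    have E0 : 0 <= Err es rows.
      rewrite /Err mulr_ge0 // (addfE _ _ _ (false, [::])).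
      apply: sumr_ge0 => t _; rewrite rstatE.
      by apply: sumr_ge0 => j _; rewrite addr_ge0 // /lerr normr_ge0.
    have D0 : 0 <= dev o es + dev x0 es by rewrite addr_ge0 // /dev normr_ge0.
    have n0 : 0 <= N%:R * C2 / l1%:R by rewrite divr_ge0 // mulr_ge0.
    have l0' : 0 <= l1%:R :> R by [].
    have Q := divr_ge0 E0 l0'; clear - R b1 b2 b1_gt0 b12 b2_lt1 Q D0 n0 l0'; lra.
  have -> : sg * (hgt o es rows i - N%:R * h) =
     sg * (hgt o es rows i - hgt o es rows (x0 + q)%N) +
     sg * (hgt o es rows (x0 + q)%N - hgt o es [::] x0 - N%:R * c0) +
     sg * (hgt o es [::] x0 - N%:R * h_init th rh (x - v)).
    by rewrite -hE; ring.
  have s1 := sgle (hgt o es rows i - hgt o es rows (x0 + q)%N).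
  have s2 := sgle (hgt o es [::] x0 - N%:R * h_init th rh (x - v)).
  clear - R b1 b2 b1_gt0 b12 b2_lt1 line lip h0 s1 s2; lra.
apply: le_trans (le_Esys b1_gt0 b12 b2_lt1 (G := fun es rows =>
   (Err es rows / l1%:R + (dev o es + dev x0 es)
     + (N%:R * C2 / l1%:R + 2 * l1%:R + 8)) + pos (- sg * (hgt o es rows i - N%:R * h)))
   hp hph point) _.
have eN0 : 0 < e * N%:R by apply: lt_le_trans eN; rewrite ltr0n.
pose F1 (es : seq bool) (rows : seq rowdata) := Err es rows / l1%:R.
pose F2 (es : seq bool) (rows : seq rowdata) := dev o es + dev x0 es.
pose cst : R := N%:R * C2 / l1%:R + 2 * l1%:R + 8.
pose F4 es rows := pos (- sg * (hgt o es rows i - N%:R * h)).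
rewrite -[X in X <= _]/(Esys (riem th rh o L) (ph th) N (fun es rows =>
  (F1 es rows + F2 es rows + cst) + F4 es rows)).
rewrite (EsysD _ _ _ _ _ (fun es rows => F1 es rows + F2 es rows + cst) F4).
rewrite (EsysD _ _ _ _ _ (fun es rows => F1 es rows + F2 es rows) (fun _ _ => cst)).
rewrite (EsysD _ _ _ _ _ F1 F2) Esys_cst //.
have b_F1 : Esys (riem th rh o L) (ph th) N F1 <= e * N%:R.
  have -> : Esys (riem th rh o L) (ph th) N F1 =
     l1%:R^-1 * (k%:R * Esys (riem th rh o L) (ph th) N (fun es rows =>
     addf (fun es r => rstat k (fun es cs h => lerr b1 b2 k es cs h
       + pen (density R k es)) m es r.2 r.1) rows es)).
    rewrite -!EsysZ; apply: eq_Ex => es; apply: eq_Ex => rows.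
    by rewrite /F1 /Err mulrC.
  rewrite mulrC ler_pdivrMr //; apply: le_trans hErr _.
  have /andP[l1a _] := l1T.
  by rewrite -exprMn expr2 ler_pM2l.
have b_F2 : Esys (riem th rh o L) (ph th) N F2 <= 2 * (e * N%:R) + 3 * C / e.
  rewrite (Esys_init b1_gt0 b12 b2_lt1 _ _ (fun es => dev o es + dev x0 es)) // ExD.
  have sz : size (riem th rh o L) = L by rewrite size_riem.
  have d1 := Ex_mass_take_dev hp eN0 (_ : (o <= size (riem th rh o L))%N).
  have d2 := Ex_mass_take_dev hp eN0 (_ : (x0 <= size (riem th rh o L))%N).
  rewrite sz in d1 d2; apply: le_trans (lerD (d1 oL) (d2 x0L)) _.
  have -> : e * N%:R + o%:R / (e * N%:R) + (e * N%:R + x0%:R / (e * N%:R)) =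
     2 * (e * N%:R) + (o%:R + x0%:R) / N%:R / e.
    by field; rewrite !gt_eqF.
  rewrite lerD2l ler_pM2r ?invr_gt0 // ler_pdivrMr //.
  rewrite !mulrDl in x0T; clear - R b1 b2 b1_gt0 b12 b2_lt1 x0T oT xC v0 NR0 C0; nra.
have b_F4 : Esys (riem th rh o L) (ph th) N F4 <= 3 * (e * N%:R) + (3 * C + 1) / e + 2.
  apply: le_trans (cmp _ _ _ _ _ oL) _.
  have hph' := phi_itv b12 b2_lt1 hl.
  have hpl : all (@itv01 R) (nseq L l) by rewrite all_nseq hl orbT.
  pose hh := N%:R * ph l + o%:R * l - i%:R * l.
  apply: le_trans (le_Esys b1_gt0 b12 b2_lt1 (G := fun es rows =>
     `|hgt o es rows i - hh| + 2) hpl hph' _) _.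
    move=> es rows _ _; have hhE : `|hh - N%:R * h| <= 2.
      rewrite /hh /h (_ : _ - _ = l * (o%:R - i%:R + x * N%:R)); last by ring.
      move: oE iE; rewrite mulrDl !ler_norml => /andP[oa ob] /andP[ia ib].
      clear - R b1 b2 b1_gt0 b12 b2_lt1 oa ob ia ib l0 l1'.
      by apply/andP; split; nra.
    apply: pos_le; last by rewrite addr_ge0.
    apply: (@le_trans _ _ `|hgt o es rows i - N%:R * h|).
      by rewrite -[X in _ <= X]mul1r -sgN -(normrN sg) -normrM ler_norm.
    rewrite -[X in `|X|](subrKA hh); apply: le_trans (ler_normD _ _) _.
    by rewrite lerD2l.
  rewrite (EsysD _ _ _ _ _ (fun es rows => `|hgt o es rows i - hh|) (fun _ _ => 2)) Esys_cst //.
  rewrite lerD2r; apply: le_trans (Esys_hgt_stationary b1_gt0 b12 b2_lt1 N hl eN0 oL iL) _.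
  have -> : (N + o + i)%:R / (e * N%:R) = (N%:R + o%:R + i%:R) / N%:R / e.
    by rewrite !natrD; field; rewrite !gt_eqF.
  rewrite lerD2l ler_pM2r ?invr_gt0 // ler_pdivrMr //.
  rewrite !mulrDl in iT; clear - R b1 b2 b1_gt0 b12 b2_lt1 iT oT xC NR0; nra.
have b_c : cst <= C2 / e + 2 * (e * N%:R) + 10.
  have /andP[l1a l1b] := l1T.
  have cle : N%:R * C2 / l1%:R <= C2 / e.
    rewrite ler_pdivrMr // mulrAC ler_pdivlMr //.
    have -> : N%:R * C2 * e = C2 * (e * N%:R) by ring.
    by rewrite ler_wpM2l.
  rewrite /cst; clear - R b1 b2 b1_gt0 b12 b2_lt1 cle l1a l1b eN; lra.
have E6 : (6 * C + 1) / e = 3 * C / e + (3 * C + 1) / e by rewrite -mulrDl; congr (_ / _); ring.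
clear - R b1 b2 b1_gt0 b12 b2_lt1 b_F1 b_F2 b_F4 b_c KN E6 eN0; lra.
Qed.

(* [fan th rh x l]: the characteristic of speed phi' l through (x, 1) starts at a
   point where the initial height is - l times the position. *)
Definition fan (th rh x l : R) : Prop :=
  [/\ rh <= l, l <= th & h_init th rh (x - dphi b1 b2 l) = - l * (x - dphi b1 b2 l)].

(** Left of the fan the density [th] serves and right of it [rh]; in between, [l] is chosen so that
    its characteristic from the origin passes through [x]. *)
Lemma exists_fan th rh x : 0 <= rh -> rh <= th -> exists l, fan th rh x l.
Proof.
move=> r0 rt; have t0 := le_trans r0 rt.
have [xt|tx] := lerP x (dphi b1 b2 th).
  by exists th; split=> //; rewrite /h_init subr_le0 xt.
have [rx|xr] := lerP (dphi b1 b2 rh) x.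
  exists rh; split=> //; rewrite /h_init; case: lerP => // xr.
  have -> : x - dphi b1 b2 rh = 0 by apply/eqP; rewrite eq_le xr subr_ge0 rx.
  by rewrite !mulr0.
have ka1 := kappa_gt1 b12 b2_lt1; have ka0 := kappa_gt0 b12 b2_lt1.
have x0 : 0 < x by apply: le_lt_trans tx; apply: dphi_ge0.
(* The solution of [dphi l = x], that is of [phi_den l ^+ 2 = ka / x]. *)
pose s := Num.sqrt (ka / x); pose l := (s - 1) / (ka - 1).
have s0 : 0 < s by rewrite sqrtr_gt0 divr_gt0.
have s2 : s ^+ 2 = ka / x by rewrite sqr_sqrtr // divr_ge0 // ltW.
have lE : phi_den b1 b2 l = s.
  by rewrite /phi_den /l mulrC divfK ?subrK // subr_eq0 gt_eqF.
have dl : dphi b1 b2 l = x.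
  by rewrite /dphi lE s2 invf_div mulrCA divff ?mulr1 // gt_eqF.
have mono u w : 0 <= u -> phi_den b1 b2 u <= phi_den b1 b2 w -> u <= w.
  by move=> _; rewrite /phi_den lerD2r ler_pM2l // subr_gt0.
have sq u : 0 <= u -> dphi b1 b2 u = ka / phi_den b1 b2 u ^+ 2 by [].
have ltsq (a b : R) : 0 < a -> 0 < b -> ka / a ^+ 2 < ka / b ^+ 2 -> b <= a.
  move=> a0 b0; rewrite ltr_pM2l // ltf_pV2 ?posrE ?exprn_gt0 // => h.
  by rewrite leNgt; apply/negP => ab; move: h; rewrite ltNge lerXn2r ?nnegrE ?ltW.
have dth := phi_den_gt0 b12 b2_lt1 t0; have drh := phi_den_gt0 b12 b2_lt1 r0.
have rl : rh <= l.
  apply: mono => //; rewrite lE; apply: ltsq => //.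
  by rewrite s2 invf_div mulrCA divff ?mulr1 // gt_eqF.
have lt : l <= th.
  apply: mono; first exact: le_trans rl.
  by rewrite lE; apply: ltsq => //; rewrite s2 invf_div mulrCA divff ?mulr1 // gt_eqF.
by exists l; split=> //; rewrite dl subrr /h_init lexx !mulr0.
Qed.

(** Initial height at the foot of the ray of chord speed plus the flux relative to that ray,
    [phi u - slope * u], which takes the same value at [u = th] and at [u = rh]. *)
Definition shock_height (th rh x : R) : R :=
  h_init th rh (x - slope b1 b2 th rh) + (ph th - slope b1 b2 th rh * th).

Definition limit_height (th rh x h : R) : Prop :=
  if rh <= th then exists2 l, fan th rh x l & h = ph l - l * x
  else h = shock_height th rh x.

(** The block size is chosen before [x] and [h], so one box serves all rays. As speeds are at most
    [ka], the condition [ka <= C + x] keeps the feet of the rays inside the box. *)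
Lemma height_limit th rh C e : itv01 th -> itv01 rh -> 0 < C -> 0 < e ->
  exists2 k, (0 < k)%N & forall x h, ka <= C + x -> x <= C - 1 -> limit_height th rh x h ->
  exists N0 : nat, forall N m, (N0 <= N)%N -> 2 * C * N%:R <= (m * k)%:R ->
   (m * k)%:R <= (2 * C + 1) * N%:R ->
   Esys (riem th rh (Num.truncn (C * N%:R)) (m * k)) (ph th) N (fun es rows =>
     `|hgt (Num.truncn (C * N%:R)) es rows (Num.truncn ((C + x) * N%:R)) - N%:R * h|)
   <= e * N%:R.
Proof.
move=> ht hr C0 e0; have /andP[t0 t1] := ht; have /andP[r0 r1] := hr.
pose e' := Num.min (e / 20) (1 / 4).
have e'0 : 0 < e' by rewrite lt_min !divr_gt0.
have e'4 : e' <= 1 / 4 by rewrite ge_min lexx orbT.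
have e'e : e' * 20 <= e by rewrite -ler_pdivlMr // ge_min lexx.
have C1 : 0 < 2 * C + 1 by lra.
have d0 : 0 < e' ^+ 2 / 2 by rewrite divr_gt0 // exprn_gt0.
have [k k0 [N0 hk]] := block_error_small b1_gt0 b12 b2_lt1 C1 d0.
exists k => // x h kCx xC lim.
suff [N1 H] : exists N1 : nat, forall N m, (N1 <= N)%N -> (N0 <= N)%N ->
   2 * C * N%:R <= (m * k)%:R ->
   (m * k)%:R <= (2 * C + 1) * N%:R ->
   Esys (riem th rh (Num.truncn (C * N%:R)) (m * k)) (ph th) N (fun es rows =>
     `|hgt (Num.truncn (C * N%:R)) es rows (Num.truncn ((C + x) * N%:R)) - N%:R * h|)
   <= 20 * e' * N%:R.
  exists (N1 + N0)%N => N m NN hL1 hL2.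
  apply: le_trans (H N m _ _ hL1 hL2) _.
  - by apply: leq_trans NN; rewrite leq_addr.
  - by apply: leq_trans NN; rewrite leq_addl.
  - by rewrite ler_wpM2r // mulrC.
have oL N m : 2 * C * N%:R <= (m * k)%:R -> (Num.truncn (C * N%:R) <= m * k)%N.
  move=> hL; rewrite -(ler_nat R); apply: le_trans hL.
  have CN : 0 <= C * N%:R by rewrite mulr_ge0 // ltW.
  by apply: le_trans (_ : _ <= C * N%:R) _; [rewrite truncn_le | lra].
have dN (N : nat) : e' ^+ 2 / 2 * N%:R ^+ 2 <= e' ^+ 2 * N%:R ^+ 2.
  by rewrite ler_wpM2r ?sqr_ge0 // ler_pdivrMr // ler_peMr ?sqr_ge0 // ler1n.
move: lim; rewrite /limit_height; case: lerP => [rt|tr].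
- case=> l [rl lt fanE] hE.
  have l0 := le_trans r0 rl; have l1 := le_trans lt t1.
  have hl : itv01 l by rewrite /itv01 l0.
  have v0 := dphi_ge0 b12 b2_lt1 l0.
  have vC : dphi b1 b2 l <= C + x by apply: le_trans kCx; apply: dphi_le.
  have hEq : h_init th rh (x - dphi b1 b2 l) + (ph l - l * dphi b1 b2 l) = ph l - l * x.
    by rewrite fanE; ring.
  have hpen u : 0 <= u <= 1 -> 1 * (ph u - (ph l - l * dphi b1 b2 l) - dphi b1 b2 l * u) <= 0.
    by move=> /andP[u0 _]; have := phi_tangent b12 b2_lt1 u0 l0; rewrite mulrBr; lra.
  have cmp o L N i a : (o <= L)%N ->
    Esys (riem th rh o L) (ph th) N (fun es rows => pos (- 1 * (hgt o es rows i - a))) <=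
    Esys (nseq L l) (ph l) N (fun es rows => pos (- 1 * (hgt o es rows i - a))).
    move=> oL'; have E p q f : Esys p q N (fun es rows => pos (- 1 * (f es rows - a))) =
        Esys p q N (fun es rows => pos (a - f es rows)).
      by apply: eq_Ex => es; apply: eq_Ex => rows; rewrite mulN1r opprB.
    by rewrite !(E _ _ (fun es rows => hgt o es rows i)); apply: rarefaction_compare.
  have [N1 H] := @hgt_lln_bound 1 th rh l _ _ x C e' (fun=> 0) k (expr1n _ _) ht hr hl v0
    e'0 e'4 k0 (ltW C0) vC xC (fun=> lexx 0) hpen hEq cmp.
  exists N1 => N m NN1 NN0 hL1 hL2; set o := Num.truncn _; rewrite hE; apply: H => //.
  have [hk1 _] := hk N m o th rh NN0 ht hr (oL _ _ hL1) hL2.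
  apply: le_trans (dN N); apply: le_trans hk1.
  rewrite le_eqVlt; apply/orP; left; apply/eqP; congr (_ * _).
  apply: eq_Ex => es; apply: eq_Ex => rows; apply: eq_addf => es' r.
  by rewrite rstatD [X in _ + X](_ : _ = 0) ?addr0 // rstatE big1.
- move=> hE; set s := slope b1 b2 th rh; set c := ph th - s * th.
  have s0 := slope_ge0 b12 b2_lt1 t0 r0.
  have vC : s <= C + x by apply: le_trans kCx; apply: slope_le.
  have rE : ph rh = ph th + s * (rh - th) by rewrite -slopeE // addrC subrK.
  (* The comparison is with the state on the side of the shock where the ray lies. *)
  pose l := if x - s <= 0 then th else rh.
  have hl : itv01 l by rewrite /l; case: ifP.
  have hEq : h_init th rh (x - s) + c = ph l - l * x.
    by rewrite /h_init /l /c; case: ifP => _; rewrite ?rE; ring.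
  have ka0 := kappa_ge0 b12 b2_lt1.
  have pen0 u : 0 <= shock_pen b1 b2 th rh u.
    by apply: mulr_ge0 => //; rewrite addr_ge0 // pos_ge0.
  have hpen u : 0 <= u <= 1 -> - 1 * (ph u - c - s * u) <= shock_pen b1 b2 th rh u.
    move=> /andP[u0 u1].
    suff : c + s * u - ph u <= shock_pen b1 b2 th rh u by lra.
    have sk := slope_le b12 b2_lt1 t0 r0; rewrite -/s in s0 sk.
    have p1 := le_pos (th - u); have p2 := le_pos (u - rh).
    have p3 := pos_ge0 (th - u); have p4 := pos_ge0 (u - rh).
    rewrite /shock_pen.
    have [ut|tu] := lerP u th.
      have := phi_lip b12 b2_lt1 u0 ut; rewrite /c => ?.
      have : 0 <= s * (th - u) by rewrite mulr_ge0 // subr_ge0.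
      by nra.
    have [ur|ru] := lerP u rh.
      have := phi_chord_in b12 b2_lt1 t0 (ltW tu) ur; rewrite -/s /c => ?.
      by nra.
    have := le_phi b12 b2_lt1 r0 (ltW ru); rewrite rE /c => ?.
    have : s * (u - rh) <= ka * (u - rh) by rewrite ler_wpM2r // subr_ge0 ltW.
    by nra.
  have cmp o L N i a : (o <= L)%N ->
    Esys (riem th rh o L) (ph th) N (fun es rows => pos (- (- 1) * (hgt o es rows i - a))) <=
    Esys (nseq L l) (ph l) N (fun es rows => pos (- (- 1) * (hgt o es rows i - a))).
    move=> oL'; have E p q f : Esys p q N (fun es rows => pos (- (- 1) * (f es rows - a))) =
        Esys p q N (fun es rows => pos (f es rows - a)).
      by apply: eq_Ex => es; apply: eq_Ex => rows; rewrite opprK mul1r.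
    rewrite !(E _ _ (fun es rows => hgt o es rows i)); apply: shock_compare => //.
      exact: ltW.
    by rewrite /l; case: ifP; [left|right].
  have [N1 H] := @hgt_lln_bound (- 1) th rh l s c x C e' (shock_pen b1 b2 th rh) k
    (etrans (sqrrN _) (expr1n _ _)) ht hr hl s0
    e'0 e'4 k0 (ltW C0) vC xC pen0 hpen hEq cmp.
  exists N1 => N m NN1 NN0 hL1 hL2; set o := Num.truncn _; rewrite hE /shock_height -/s -/c hEq; apply: H => //.
  have [_ hk1] := hk N m o th rh NN0 ht hr (oL _ _ hL1) hL2.
  by apply: le_trans (hk1 (ltW tr)) _; rewrite [2 * _]mulrC divfK ?pnatr_eq0.
Qed.

End HeightLimit.

(** * Entropy solution of the Riemann problem *)

Section SmoothStep.
Variable R : realType.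

Lemma is_derive_quadratic (f : R -> R) (z c K : R) :
  (forall h, `|h| <= 1 -> `|f (z + h) - f z - c * h| <= K * h ^+ 2) ->
  is_derive z 1 f c.
Proof.
move=> H.
have cv : (fun h => h^-1 *: (f (h *: 1 + z) - f z)) @ 0^' --> c.
  apply/cvgrPdist_le => e e0.
  have K1 : 0 < `|K| + 1 by rewrite ltr_wpDl.
  near=> h.
  have h0 : h != 0 by near: h; exact: nbhs_dnbhs_neq.
  have he : `|h| <= e / (`|K| + 1).
    near: h; apply: dnbhs0_le; exact: divr_gt0.
  have h1 : `|h| <= 1 by near: h; apply: dnbhs0_le.
  rewrite /= [h *: 1]mulr1 distrC.
  have -> : h^-1 *: (f (h + z) - f z) - c = h^-1 * (f (z + h) - f z - c * h).
    by rewrite /GRing.scale /= [h + z]addrC; field.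
  rewrite normrM normfV ler_pdivrMl ?normr_gt0 //.
  apply: le_trans (H h h1) _; rewrite -(real_normK (num_real h)).
  move: he; rewrite ler_pdivlMr // => he.
  have a0 : 0 <= `|h| by []. have k0 := ler_norm K.
  have := ler_wpM2l a0 he; have : K * `|h| ^+ 2 <= `|K| * `|h| ^+ 2.
    by rewrite ler_wpM2r // exprn_ge0.
  rewrite expr2; nra.
have dv : derivable f z 1 by apply/cvg_ex; exists c; exact: cv.
apply: DeriveDef => //; rewrite /derive; exact: cvg_lim cv.
Unshelve. all: by end_near.
Qed.

Definition ppart (z : R) : R := Num.max z 0.

Lemma ppart_cases z : (0 <= z /\ ppart z = z) \/ (z <= 0 /\ ppart z = 0).
Proof.
rewrite /ppart; have [z0|z0] := leP 0 z; first by left.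
by right; split=> //; exact: ltW.
Qed.

(* Integral of the hat function supported by [0, 2]. *)
Definition sstep (z : R) : R :=
  (ppart z ^+ 2 - 2 * ppart (z - 1) ^+ 2 + ppart (z - 2) ^+ 2) / 2.
Definition dstep (z : R) : R := ppart z - 2 * ppart (z - 1) + ppart (z - 2).

Lemma sstep_taylor (z h : R) : `|sstep (z + h) - sstep z - dstep z * h| <= 2 * h ^+ 2.
Proof.
have H (u : R) : `|ppart (u + h) ^+ 2 - ppart u ^+ 2 - 2 * ppart u * h| <= h ^+ 2.
  rewrite ler_norml.
  case: (ppart_cases u) => -[u0 ->]; case: (ppart_cases (u + h)) => -[uh0 ->];
   apply/andP; split; nra.
have := H z; have := H (z - 1); have := H (z - 2).
rewrite /sstep /dstep ![z + h - _]addrAC.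
rewrite !ler_norml => /andP[? ?] /andP[? ?] /andP[? ?]; apply/andP; split; lra.
Qed.

Lemma is_derive_sstep_aff (c d x : R) :
  is_derive x 1 (fun x => sstep (c * x + d)) (c * dstep (c * x + d)).
Proof.
apply: (@is_derive_quadratic _ _ _ (2 * c ^+ 2)) => h _.
have := sstep_taylor (c * x + d) (c * h).
rewrite (_ : c * x + d + c * h = c * (x + h) + d); last by ring.
rewrite (_ : dstep _ * (c * h) = c * dstep (c * x + d) * h); last by ring.
by rewrite exprMn [2 * (_ * _)]mulrA.
Qed.

Lemma is_derive_sstep (z : R) : is_derive z 1 sstep (dstep z).
Proof.
apply: (@is_derive_quadratic _ _ _ 2) => h _; exact: sstep_taylor.
Qed.

(** The primitive of [sstep] that vanishes on the left; it gives exact values for the integrals of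
    the weights. *)
Definition sprim (z : R) : R :=
  (ppart z ^+ 3 - 2 * ppart (z - 1) ^+ 3 + ppart (z - 2) ^+ 3) / 6.

Lemma is_derive_sprim_aff (c d x : R) :
  is_derive x 1 (fun x => sprim (c * x + d)) (c * sstep (c * x + d)).
Proof.
have H (u h M : R) : `|h| <= M -> `|ppart (u + h) ^+ 3 - ppart u ^+ 3 - 3 * ppart u ^+ 2 * h|
    <= (3 * `|u| + 4 * M) * h ^+ 2.
  move=> hM; have u1 := ler_norm u; have u2 := ler_norm (- u); rewrite normrN in u2.
  move: hM; rewrite !ler_norml => /andP[h1 h2].
  have hh : 0 <= h ^+ 2 by apply: sqr_ge0.
  case: (ppart_cases u) => -[u0 ->]; case: (ppart_cases (u + h)) => -[uh0 ->].
  - have -> : (u + h) ^+ 3 - u ^+ 3 - 3 * u ^+ 2 * h = (3 * u + h) * h ^+ 2 by ring.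
    by rewrite -mulNr; apply/andP; split; apply: ler_wpM2r => //; lra.
  - have a1 : u ^+ 2 <= h ^+ 2 by nra.
    have -> : 0 ^+ 3 - u ^+ 3 - 3 * u ^+ 2 * h = (- u - 3 * h) * u ^+ 2 by ring.
    have a2 : 0 <= - u - 3 * h <= 4 * M by apply/andP; split; lra.
    have a3 : 0 <= u ^+ 2 by apply: sqr_ge0.
    move/andP: a2 => [a4 a5]; apply/andP; split; first by nra.
    apply: le_trans (ler_wpM2l a4 a1) _; apply: ler_wpM2r => //.
    by have := normr_ge0 u; lra.
  - have a1 : (u + h) ^+ 2 <= h ^+ 2 by nra.
    have -> : (u + h) ^+ 3 - 0 ^+ 3 - 3 * 0 ^+ 2 * h = (u + h) * (u + h) ^+ 2.
      by ring.
    have a3 : 0 <= (u + h) ^+ 2 by apply: sqr_ge0.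
    apply/andP; split; first by have := normr_ge0 u; nra.
    apply: le_trans (ler_wpM2l uh0 a1) _; apply: ler_wpM2r => //.
    by have := normr_ge0 u; lra.
  - have -> : 0 ^+ 3 - 0 ^+ 3 - 3 * 0 ^+ 2 * h = 0 :> R by ring.
    have : 0 <= (3 * `|u| + 4 * M) * h ^+ 2.
      by rewrite mulr_ge0 //; have := normr_ge0 u; lra.
    by move=> ?; apply/andP; split; lra.
pose z := c * x + d; pose M := `|c|.
pose K := ((3 * `|z| + 4 * M) + 2 * (3 * `|z - 1| + 4 * M) + (3 * `|z - 2| + 4 * M)) * c ^+ 2.
apply: (@is_derive_quadratic _ _ _ K) => h h1.
have cM : `|c * h| <= M by rewrite normrM ler_piMr.
have := H z _ _ cM; have := H (z - 1) _ _ cM; have := H (z - 2) _ _ cM.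
rewrite /K; set K1 := 3 * `|z| + _; set K2 := 3 * `|z - 1| + _; set K3 := 3 * `|z - 2| + _.
have K10 : 0 <= K1 by apply: addr_ge0; apply: mulr_ge0; rewrite ?normr_ge0.
have K20 : 0 <= K2 by apply: addr_ge0; apply: mulr_ge0; rewrite ?normr_ge0.
have K30 : 0 <= K3 by apply: addr_ge0; apply: mulr_ge0; rewrite ?normr_ge0.
rewrite (_ : c * (x + h) + d = z + c * h); last by rewrite /z; ring.
rewrite exprMn -/z /sprim /sstep ![z + c * h - _]addrAC.
have c2 : 0 <= c ^+ 2 * h ^+ 2 by rewrite mulr_ge0 ?sqr_ge0.
have := mulr_ge0 K10 c2; have := mulr_ge0 K20 c2; have := mulr_ge0 K30 c2.
rewrite !ler_norml => ? ? ? /andP[? ?] /andP[? ?] /andP[? ?]; apply/andP; split; lra.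
Qed.

Lemma sprim_le0 z : z <= 0 -> sprim z = 0.
Proof.
move=> z0; rewrite /sprim /ppart !max_r; first by ring.
all: lra.
Qed.

Lemma sprim_ge2 z : 2 <= z -> sprim z = z - 1.
Proof.
move=> z0; rewrite /sprim /ppart !max_l; first by field.
all: lra.
Qed.

Lemma sstep_le0 z : z <= 0 -> sstep z = 0.
Proof.
move=> z0; rewrite /sstep /ppart !max_r; first by ring.
all: lra.
Qed.

Lemma sstep_ge2 z : 2 <= z -> sstep z = 1.
Proof.
move=> z0; rewrite /sstep /ppart !max_l; first by field.
all: lra.
Qed.

Lemma dstep_ge0 z : 0 <= dstep z.
Proof.
rewrite /dstep; case: (ppart_cases z) => -[? ->];
case: (ppart_cases (z - 1)) => -[? ->]; case: (ppart_cases (z - 2)) => -[? ->]; lra.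
Qed.

Lemma dstep_le1 z : dstep z <= 1.
Proof.
rewrite /dstep; case: (ppart_cases z) => -[? ->];
case: (ppart_cases (z - 1)) => -[? ->]; case: (ppart_cases (z - 2)) => -[? ->]; lra.
Qed.

Lemma dstep_out z : z <= 0 \/ 2 <= z -> dstep z = 0.
Proof.
rewrite /dstep; case: (ppart_cases z) => -[? ->];
case: (ppart_cases (z - 1)) => -[? ->]; case: (ppart_cases (z - 2)) => -[? ->]; lra.
Qed.

Lemma sstep_mono u v : u <= v -> sstep u <= sstep v.
Proof.
rewrite /sstep.
case: (ppart_cases u) => -[? ->]; case: (ppart_cases (u - 1)) => -[? ->];
 case: (ppart_cases (u - 2)) => -[? ->];
case: (ppart_cases v) => -[? ->];
case: (ppart_cases (v - 1)) => -[? ->]; case: (ppart_cases (v - 2)) => -[? ->] => ?; nra.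
Qed.

Lemma sstep_itv z : 0 <= sstep z <= 1.
Proof.
apply/andP; split.
  have [z0|z0] := leP z 0; first by rewrite sstep_le0.
  by rewrite -(sstep_le0 (lexx 0)) sstep_mono // ltW.
have [z2|z2] := leP 2 z; first by rewrite sstep_ge2.
by rewrite -(sstep_ge2 (lexx 2)) sstep_mono // ltW.
Qed.

Lemma sstep_lip u v : u <= v -> sstep v - sstep u <= v - u.
Proof.
rewrite /sstep.
case: (ppart_cases u) => -[? ->]; case: (ppart_cases (u - 1)) => -[? ->];
 case: (ppart_cases (u - 2)) => -[? ->];
case: (ppart_cases v) => -[? ->];
case: (ppart_cases (v - 1)) => -[? ->]; case: (ppart_cases (v - 2)) => -[? ->] => ?; nra.
Qed.

Lemma continuous_ppart : continuous ppart.
Proof.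
by move=> z; apply: (@continuous_max _ _ id (fun=> 0)); [exact: cvg_id|exact: cvg_cst].
Qed.

Lemma continuous_shift (f : R -> R) (c : R) :
  continuous f -> continuous (fun z : R => f (z - c)).
Proof.
move=> cf z; apply: (@continuous_comp _ _ _ (fun z => z - c) f z); last exact: cf.
by apply: (@continuousB _ R^o); [exact: cvg_id|exact: cvg_cst].
Qed.

Lemma continuous_dstep : continuous dstep.
Proof.
move=> z; apply: cvgD; first apply: cvgB.
- exact: continuous_ppart.
- by apply: cvgM; [exact: cvg_cst|exact: (@continuous_shift ppart 1 continuous_ppart z)].
- exact: (@continuous_shift ppart 2 continuous_ppart z).
Qed.

Lemma continuous_sstep : continuous sstep.
Proof.
move=> z; apply: differentiable_continuous; apply/derivable1_diffP.
by have [] := is_derive_sstep z.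
Qed.

End SmoothStep.

(** * Iterated integrals of bounded functions supported in a box *)

Section IteratedIntegrals.
Variable R : realType.
Local Notation mu := (@lebesgue_measure R).

(** Vanishing off [-A, A] x [0, 1] together with a bound makes both iterated integrals finite, so
    extended real integrals can be handled as real numbers. *)
Definition box_bounded (A C : R) (f : R * R -> R) : Prop :=
  [/\ measurable_fun setT f, (forall p, `|f p| <= C) &
      forall p, A < `|p.1| \/ p.2 < 0 \/ 1 < p.2 -> f p = 0].

Lemma integral_itv_cst (a b c : R) : a <= b ->
  (\int[mu]_(x in `[a, b]) c%:E = (c * (b - a))%:E)%E.
Proof.
move=> ab; rewrite integral_cst //= lebesgue_measure_itv /= lte_fin.
have [ab'|ba] := ltP a b; first by rewrite -EFinD -EFinM.
have -> : b = a by apply/eqP; rewrite eq_le ab ba.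
by rewrite subrr mulr0 mule0.
Qed.

Lemma bounded_integrable (a b C : R) (f : R -> R) :
  measurable_fun setT f -> (forall x, `|f x| <= C) ->
  mu.-integrable `[a, b] (EFin \o f).
Proof.
move=> mf hf; apply: measurable_bounded_integrable => //=.
- have [ab|ba] := leP a b; last by rewrite set_itv_ge ?measure0 ?ltry // -leNgt bnd_simp.
  by rewrite lebesgue_measure_itv /=; case: ifP => _; rewrite ?ltry // -EFinD ltry.
- exact: measurable_funTS.
- exists C; split; first exact: num_real.
  by move=> M CM x _ /=; apply: le_trans (hf x) (ltW CM).
Qed.

Lemma integral_compact (A : R) (f : R -> R) : (forall x, A < `|x| -> f x = 0) ->
  (\int[mu]_x (f x)%:E = \int[mu]_(x in `[(- A)%R, A]) (f x)%:E)%E.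
Proof.
move=> f0; rewrite [RHS]integral_mkcond; apply: eq_integral => x _.
rewrite patchE; case: ifPn => //; rewrite notin_setE /= in_itv /= => /negP.
rewrite -ler_norml -ltNge => /f0 ->; by [].
Qed.

Lemma box_slice A C f y : box_bounded A C f ->
  measurable_fun setT (fun x => f (x, y)) /\ mu.-integrable setT (fun x => (f (x, y))%:E).
Proof.
case=> mf bf sf; have mfy : measurable_fun setT (fun x => f (x, y)).
  by apply: measurableT_comp => //; exact: pair2_measurable.
split=> //; apply/integrableP; split; first exact/measurable_EFinP.
under eq_integral do rewrite /= .
rewrite (@integral_compact A (fun x => `|f (x, y)|)); last first.
  by move=> x Ax; rewrite sf ?normr0 //; left.
have := @bounded_integrable (- A) A C _ mfy (fun x => bf (x, y)).
by move=> /integrableP[_].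
Qed.

Definition inner (f : R * R -> R) (y : R) : R := fine (\int[mu]_x (f (x, y))%:E)%E.

Lemma innerE A C f y : box_bounded A C f -> (\int[mu]_x (f (x, y))%:E = (inner f y)%:E)%E.
Proof.
move=> bf; have [_ it] := box_slice y bf.
by rewrite /inner fineK //; apply: integrable_fin_num.
Qed.

Lemma inner_bound A C f y : 0 <= A -> box_bounded A C f -> `|inner f y| <= C * (2 * A).
Proof.
move=> A0 bf; have [mfy it] := box_slice y bf; case: (bf) => mf hf sf.
rewrite -lee_fin -abse_EFin -(innerE y bf).
apply: le_trans (le_abse_integral _ measurableT _) _; first by case/integrableP: it.
under eq_integral do rewrite abse_EFin.
rewrite (@integral_compact A (fun x => `|f (x, y)|)); last first.
  by move=> x Ax; rewrite sf ?normr0 //; left.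
have -> : ((C * (2 * A))%:E = \int[mu]_(x in `[(- A)%R, A]) C%:E)%E.
  by rewrite integral_itv_cst ?opprK -?mulr2n ?mulr_natl // ge0_cp.
apply: ge0_le_integral => //=.
- by apply/measurable_EFinP; apply: measurable_funTS; apply: measurableT_comp.
- by move=> x _; rewrite lee_fin.
Qed.

Lemma inner_measurable (f : R * R -> R) : measurable_fun setT f -> measurable_fun setT (inner f).
Proof.
move=> mf; have mE : measurable_fun setT (EFin \o f) by apply/measurable_EFinP.
rewrite /inner; apply: measurableT_comp => //.
rewrite (_ : (fun y => _) = ((fun y => \int[mu]_x ((EFin \o f)^\+ (x, y))) \-
    (fun y => \int[mu]_x ((EFin \o f)^\- (x, y))))%E); last first.
  apply/funext => y; rewrite [LHS]integralE.
  by congr (_ - _)%E; apply: eq_integral => x _; rewrite ?funeposE ?funenegE.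
apply: emeasurable_funB.
  apply: (@measurable_fun_fubini_tonelli_G _ _ _ _ _ mu ((EFin \o f)^\+)%E) => //.
  exact: measurable_funepos.
apply: (@measurable_fun_fubini_tonelli_G _ _ _ _ _ mu ((EFin \o f)^\-)%E) => //.
exact: measurable_funeneg.
Qed.

Lemma inner_integrable A C f : 0 <= A -> box_bounded A C f ->
  mu.-integrable `[0, 1] (EFin \o inner f).
Proof.
move=> A0 bf; apply: (@bounded_integrable _ _ (C * (2 * A))).
  by apply: inner_measurable; case: bf.
by move=> y; apply: inner_bound.
Qed.

Lemma innerD A C C' f g y : box_bounded A C f -> box_bounded A C' g ->
  inner (fun p => f p + g p) y = inner f y + inner g y.
Proof.
move=> bf bg; have [mf if_] := box_slice y bf; have [mg ig] := box_slice y bg.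
apply: EFin_inj; rewrite EFinD -(innerE y bf) -(innerE y bg) -integralD //=.
rewrite /inner fineK //; apply: integrable_fin_num => //.
exact: (integrableD measurableT if_ ig).
Qed.

Lemma box_boundedD A C C' f g : box_bounded A C f -> box_bounded A C' g ->
  box_bounded A (C + C') (fun p => f p + g p).
Proof.
move=> [mf hf sf] [mg hg sg]; split.
- exact: measurable_funD.
- by move=> p; apply: le_trans (ler_normD _ _) _; rewrite lerD.
- by move=> p hp; rewrite sf // sg // addr0.
Qed.

Definition outer (f : R * R -> R) : R := Rintegral mu `[0, 1] (inner f).

Lemma outerD A C C' f g : 0 <= A -> box_bounded A C f -> box_bounded A C' g ->
  outer (fun p => f p + g p) = outer f + outer g.
Proof.
move=> A0 bf bg; rewrite /outer -RintegralD //; last 2 first.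
- exact: (inner_integrable A0 bf).
- exact: (inner_integrable A0 bg).
by apply: eq_Rintegral => y _; apply: innerD bf bg.
Qed.

Lemma outerE A C f : 0 <= A -> box_bounded A C f ->
  (\int[mu]_(y in `]0%R, 1%R[) \int[mu]_x (f (x, y))%:E = (outer f)%:E)%E.
Proof.
move=> A0 bf; under eq_integral do rewrite (innerE _ bf).
rewrite integral_itv_obnd_cbnd; last first.
  apply/measurable_EFinP; apply: measurable_funTS; apply: inner_measurable.
  by case: bf.
rewrite integral_itv_bndo_bndc; last first.
  apply/measurable_EFinP; apply: measurable_funTS; apply: inner_measurable.
  by case: bf.
rewrite /outer /Rintegral fineK //; apply: integrable_fin_num => //.
exact: (inner_integrable A0 bf).
Qed.

End IteratedIntegrals.

(** * Test functions: smoothed indicators of slabs between moving lines *)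

Section Slabs.
Variable R : realType.
Local Notation mu := (@lebesgue_measure R).

Section Continuity.
Variables (T : topologicalType) (f g : T -> R).
Hypotheses (cf : continuous f) (cg : continuous g).

Lemma ctsD : continuous (fun p => f p + g p).
Proof. by move=> p; apply: cvgD; [exact: cf|exact: cg]. Qed.
Lemma ctsB : continuous (fun p => f p - g p).
Proof. by move=> p; apply: cvgB; [exact: cf|exact: cg]. Qed.
Lemma ctsM : continuous (fun p => f p * g p).
Proof. by move=> p; apply: cvgM; [exact: cf|exact: cg]. Qed.
Lemma cts_comp (h : R -> R) : continuous h -> continuous (fun p => h (f p)).
Proof. by move=> ch p; apply: (@continuous_comp _ _ _ f h p); [exact: cf|exact: ch]. Qed.
End Continuity.

Lemma cts_cst (T : topologicalType) (c : R) : continuous (fun _ : T => c).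
Proof. by move=> p; exact: cvg_cst. Qed.

Lemma cts_fst : continuous (fun p : R * R => p.1).
Proof. by move=> p; exact: cvg_fst. Qed.

Lemma cts_snd : continuous (fun p : R * R => p.2).
Proof. by move=> p; exact: cvg_snd. Qed.

(* Position relative to the line of speed [a] issued from [al], at scale [e]. *)
Definition aff (e al a : R) (p : R * R) : R := (p.1 - al - a * p.2) / e.

Lemma cts_aff e al a : continuous (aff e al a).
Proof.
apply: ctsM; last exact: cts_cst.
apply: ctsB; last by apply: ctsM; [exact: cts_cst|exact: cts_snd].
by apply: ctsB; [exact: cts_fst|exact: cts_cst].
Qed.

Lemma measurable_aff e al a : measurable_fun setT (aff e al a).
Proof.
apply: measurable_funM => //; apply: measurable_funB.
  by apply: measurable_funB => //; exact: measurable_fst.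
by apply: measurable_funM => //; exact: measurable_snd.
Qed.

(** The region between the line of speed [sl_a] issued from [sl_al] and the line of speed [sl_b]
    issued from [sl_be]. *)
Record slab := Slab { sl_al : R; sl_a : R; sl_be : R; sl_b : R }.

Definition slab_ok (s : slab) : Prop :=
  forall y, 0 <= y <= 1 -> sl_al s + sl_a s * y <= sl_be s + sl_b s * y.

Variables (e t : R).
Hypotheses (e_gt0 : 0 < e) (t_gt0 : 0 < t) (t_lt : t <= 1 / 8).

(** The smoothed indicator of the slab: it rises, then falls, within distance [2 * e] to the right
    of the respective line. *)
Definition wgt (s : slab) (p : R * R) : R :=
  sstep (aff e (sl_al s) (sl_a s) p) - sstep (aff e (sl_be s) (sl_b s) p).
Definition wgtx (s : slab) (p : R * R) : R :=
  (dstep (aff e (sl_al s) (sl_a s) p) - dstep (aff e (sl_be s) (sl_b s) p)) / e.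
Definition wgty (s : slab) (p : R * R) : R :=
  (sl_b s * dstep (aff e (sl_be s) (sl_b s) p)
   - sl_a s * dstep (aff e (sl_al s) (sl_a s) p)) / e.

(** A time cut-off rising on [t, 3t] and falling on [1 - 3t, 1 - t]; [t <= 1 / 8] keeps the two
    flanks apart. *)
Definition ramp (y : R) : R := sstep ((y - t) / t) + sstep ((1 - t - y) / t) - 1.
Definition dramp (y : R) : R := (dstep ((y - t) / t) - dstep ((1 - t - y) / t)) / t.

Definition bump (s : slab) (x y : R) : R := wgt s (x, y) * ramp y.

Lemma is_derive_wgtx s (x y : R) : is_derive x 1 (fun x => wgt s (x, y)) (wgtx s (x, y)).
Proof.
have E al a z : aff e al a (z, y) = e^-1 * z + (- al - a * y) / e.
  by rewrite /aff /=; ring.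
rewrite (_ : (fun x => wgt s (x, y)) = (fun x => sstep (e^-1 * x + (- sl_al s - sl_a s * y) / e))
    - (fun x => sstep (e^-1 * x + (- sl_be s - sl_b s * y) / e))); last first.
  by apply/funext => z; rewrite /wgt !E.
apply: is_derive_eq.
  by apply: is_deriveB; exact: is_derive_sstep_aff.
by rewrite /wgtx !E; ring.
Qed.

Lemma is_derive_wgty s (x y : R) : is_derive y 1 (fun y => wgt s (x, y)) (wgty s (x, y)).
Proof.
have E al a z : aff e al a (x, z) = (- a / e) * z + (x - al) / e.
  by rewrite /aff /=; ring.
rewrite (_ : (fun y => wgt s (x, y)) = (fun y => sstep ((- sl_a s / e) * y + (x - sl_al s) / e))
    - (fun y => sstep ((- sl_b s / e) * y + (x - sl_be s) / e))); last first.
  by apply/funext => z; rewrite /wgt !E.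
apply: is_derive_eq.
  by apply: is_deriveB; exact: is_derive_sstep_aff.
by rewrite /wgty !E; ring.
Qed.

Lemma is_derive_ramp (y : R) : is_derive y 1 ramp (dramp y).
Proof.
apply: (@is_derive_quadratic _ _ _ _ (4 / t ^+ 2)) => h _.
have := sstep_taylor ((y - t) / t) (h / t); have := sstep_taylor ((1 - t - y) / t) (- (h / t)).
rewrite -[(y - t) / t + h / t]mulrDl -[(1 - t - y) / t + - _]mulrBl sqrrN.
rewrite [y - t + h]addrAC -[1 - t - y - h]addrA -[- y - h]opprD expr_div_n.
rewrite /ramp /dramp !ler_norml => /andP[? ?] /andP[? ?]; apply/andP; split; lra.
Qed.

Lemma dX_bump s (x y : R) : derivable (bump s ^~ y) x 1 /\ dX (bump s) x y = wgtx s (x, y) * ramp y.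
Proof.
have D : is_derive x 1 (bump s ^~ y) (wgtx s (x, y) * ramp y).
  rewrite (_ : bump s ^~ y = (fun x => wgt s (x, y)) * (cst (ramp y))) //.
  apply: is_derive_eq; first by apply: is_deriveM; exact: is_derive_wgtx.
  by rewrite /GRing.scale /= mulr0 add0r mulrC.
by split; [case: D|rewrite /dX derive1E derive_val].
Qed.

Lemma dY_bump s (x y : R) : derivable (bump s x) y 1 /\
  dY (bump s) x y = wgty s (x, y) * ramp y + wgt s (x, y) * dramp y.
Proof.
have D : is_derive y 1 (bump s x) (wgty s (x, y) * ramp y + wgt s (x, y) * dramp y).
  rewrite (_ : bump s x = (fun y => wgt s (x, y)) * ramp) //.
  apply: is_derive_eq; first by apply: is_deriveM; [exact: is_derive_wgty|exact: is_derive_ramp].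
  by rewrite /GRing.scale /= addrC mulrC.
by split; [case: D|rewrite /dY derive1E derive_val].
Qed.

Lemma ramp_out y : y <= t \/ 1 - t <= y -> ramp y = 0 /\ dramp y = 0.
Proof.
have [t0 t8] := conj t_gt0 t_lt.
case=> hy.
  have h1 : (y - t) / t <= 0 by rewrite ler_pdivrMr // mul0r subr_le0.
  have h2 : 2 <= (1 - t - y) / t by rewrite ler_pdivlMr //; lra.
  rewrite /ramp /dramp (sstep_le0 h1) (sstep_ge2 h2) !dstep_out; [|by right|by left].
  by rewrite add0r !subrr mul0r.
have h1 : (1 - t - y) / t <= 0 by rewrite ler_pdivrMr // mul0r; lra.
have h2 : 2 <= (y - t) / t by rewrite ler_pdivlMr //; lra.
rewrite /ramp /dramp (sstep_le0 h1) (sstep_ge2 h2) !dstep_out; [|by left|by right].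
by rewrite addr0 !subrr mul0r.
Qed.

Lemma ramp_itv y : 0 <= ramp y <= 1.
Proof.
have [t0 t8] := conj t_gt0 t_lt.
have /andP[a1 a2] := sstep_itv ((y - t) / t).
have /andP[b1 b2] := sstep_itv ((1 - t - y) / t).
rewrite /ramp; apply/andP; split; last by lra.
have [h|h] := leP y (1 / 2).
  by rewrite (@sstep_ge2 _ ((1 - t - y) / t)) ?addrK // ler_pdivlMr //; lra.
by rewrite (@sstep_ge2 _ ((y - t) / t)); [lra|rewrite ler_pdivlMr //; lra].
Qed.

Lemma dramp_bound y : `|dramp y| <= t^-1.
Proof.
rewrite /dramp normrM normfV (gtr0_norm t_gt0) ler_piMl //; first by rewrite invr_ge0 ltW.
have := dstep_ge0 ((y - t) / t); have := dstep_ge0 ((1 - t - y) / t).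
have := dstep_le1 ((y - t) / t); have := dstep_le1 ((1 - t - y) / t).
by rewrite ler_norml => *; apply/andP; split; lra.
Qed.

Lemma wgt_ge0 s x y : slab_ok s -> 0 <= y <= 1 -> 0 <= wgt s (x, y) <= 1.
Proof.
move=> hs hy; have h := hs y hy.
have /andP[a1 a2] := sstep_itv (aff e (sl_al s) (sl_a s) (x, y)).
have /andP[b1 b2] := sstep_itv (aff e (sl_be s) (sl_b s) (x, y)).
rewrite /wgt subr_ge0; apply/andP; split; last by lra.
by apply: sstep_mono; rewrite /aff ler_pM2r ?invr_gt0 //=; lra.
Qed.

(** The margin [2 * e] is the width of a smoothed edge, so that the weight vanishes off [-A, A]. *)
Definition slab_in (A : R) (s : slab) : Prop :=
  forall y, 0 <= y <= 1 ->
   [/\ - A <= sl_al s + sl_a s * y, sl_al s + sl_a s * y <= A - 2 * e,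
       - A <= sl_be s + sl_b s * y & sl_be s + sl_b s * y <= A - 2 * e].

Lemma aff_out A al a x y : - A <= al + a * y -> al + a * y <= A - 2 * e -> A < `|x| ->
  (x < 0 /\ aff e al a (x, y) <= 0) \/ (0 <= x /\ 2 <= aff e al a (x, y)).
Proof.
have e0 := e_gt0; rewrite /aff /= => h1 h2; case: (leP 0 x) => x0.
  rewrite ger0_norm // => Ax; right; split=> //; rewrite ler_pdivlMr //; lra.
rewrite ltr0_norm // => Ax; left; split=> //; rewrite ler_pdivrMr // mul0r; lra.
Qed.

Lemma wgt_out A s x y : slab_in A s -> 0 <= y <= 1 -> A < `|x| ->
  [/\ wgt s (x, y) = 0, wgtx s (x, y) = 0 & wgty s (x, y) = 0].
Proof.
move=> hs hy Ax; have [h1 h2 h3 h4] := hs y hy.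
rewrite /wgt /wgtx /wgty.
case: (aff_out h1 h2 Ax) => -[x1 q1]; case: (aff_out h3 h4 Ax) => -[x2 q2].
- by rewrite !sstep_le0 // !dstep_out; [rewrite !mulr0 !subrr mul0r|left..].
- by move: (lt_le_trans x1 x2); rewrite ltxx.
- by move: (lt_le_trans x2 x1); rewrite ltxx.
- by rewrite !sstep_ge2 // !dstep_out; [rewrite !mulr0 !subrr mul0r|right..].
Qed.

Lemma wgtx_bound s p : `|wgtx s p| <= e^-1.
Proof.
rewrite /wgtx normrM normfV (gtr0_norm e_gt0) ler_piMl //; first by rewrite invr_ge0 ltW.
set u := aff _ _ _ _; set v := aff _ _ _ _.
have := dstep_ge0 u; have := dstep_ge0 v; have := dstep_le1 u; have := dstep_le1 v.
by rewrite ler_norml => *; apply/andP; split; lra.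
Qed.

Lemma wgty_bound s p : `|wgty s p| <= (`|sl_b s| + `|sl_a s|) / e.
Proof.
rewrite /wgty normrM normfV (gtr0_norm e_gt0) ler_pM2r ?invr_gt0 //.
apply: le_trans (ler_normB _ _) _; rewrite !normrM.
by rewrite lerD // ler_piMr // ger0_norm ?dstep_ge0 ?dstep_le1.
Qed.

Lemma test_bump A s : slab_ok s -> slab_in A s -> test_fun (bump s).
Proof.
have [t0 t8] := conj t_gt0 t_lt.
move=> ok hin; split.
- move=> x y; rewrite /bump.
  have [hy|hy] := boolP (0 <= y <= 1).
    by rewrite mulr_ge0 //; [case/andP: (wgt_ge0 x ok hy)|case/andP: (ramp_itv y)].
  rewrite (ramp_out _).1 ?mulr0 //; move: hy; rewrite negb_and -!ltNge.
  by case/orP=> hy; [left|right]; lra.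
- exists A, t, (1 - t); split=> //; split; first by lra.
  move=> x y hxy; rewrite /bump.
  have [hy|hy] := boolP (t < y < 1 - t); last first.
    rewrite (ramp_out _).1 ?mulr0 //; move: hy; rewrite negb_and -!leNgt.
    by case/orP=> hy; [left|right].
  case: hxy => [Ax|hy'].
    have y01 : 0 <= y <= 1 by case/andP: hy => ? ?; apply/andP; split; lra.
    by have [-> _ _] := wgt_out hin y01 Ax; rewrite mul0r.
  by case/andP: hy => ? ?; case: hy' => ?; lra.
- by move=> x y; split; [case: (dX_bump s x y)|case: (dY_bump s x y)].
- have cr : continuous (fun p : R * R => ramp p.2).
    apply: (cts_comp cts_snd) => y.
    apply: differentiable_continuous; apply/derivable1_diffP.
    by have [] := is_derive_ramp y.
  have cw : continuous (fun p => wgt s p).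
    by apply: ctsB; apply: cts_comp; try exact: cts_aff; exact: continuous_sstep.
  rewrite (_ : (fun p => _) = (fun p => wgt s p * ramp p.2)); last first.
    by apply/funext => -[x y].
  exact: ctsM.
- have cr : continuous (fun p : R * R => ramp p.2).
    apply: (cts_comp cts_snd) => y.
    apply: differentiable_continuous; apply/derivable1_diffP.
    by have [] := is_derive_ramp y.
  have cw : continuous (fun p => wgt s p).
    by apply: ctsB; apply: cts_comp; try exact: cts_aff; exact: continuous_sstep.
  have cd al a : continuous (fun p => dstep (aff e al a p)).
    by apply: cts_comp; [exact: cts_aff|exact: continuous_dstep].
  have cdr : continuous (fun p : R * R => dramp p.2).
    apply: ctsM; last exact: cts_cst.
    apply: ctsB; apply: cts_comp; try exact: continuous_dstep.
      by apply: ctsM; [apply: ctsB; [exact: cts_snd|exact: cts_cst]|exact: cts_cst].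
    by apply: ctsM; [apply: ctsB; [exact: cts_cst|exact: cts_snd]|exact: cts_cst].
  split.
    rewrite (_ : (fun p => _) = (fun p => wgtx s p * ramp p.2)); last first.
      by apply/funext => -[x y]; rewrite (dX_bump s x y).2.
    apply: ctsM => //; apply: ctsM; last exact: cts_cst.
    exact: ctsB.
  rewrite (_ : (fun p => _) = (fun p => wgty s p * ramp p.2 + wgt s p * dramp p.2)); last first.
    by apply/funext => -[x y]; rewrite (dY_bump s x y).2.
  apply: ctsD; apply: ctsM => //; apply: ctsM; last exact: cts_cst.
  by apply: ctsB; apply: ctsM => //; exact: cts_cst.
Qed.

End Slabs.

(** * Kruzkov's inequality on a slab *)

Section EntropySlabs.
Variables (R : realType) (f G0 : R -> R) (G : R -> R -> R) (Kf : R).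
Local Notation mu := (@lebesgue_measure R).
Hypothesis f_mono : forall u v, 0 <= u -> u <= v -> v <= 1 -> f u <= f v.
Hypothesis f_lip : forall u v, 0 <= u -> u <= v -> v <= 1 -> f v - f u <= Kf * (v - u).
Hypotheses (f0 : f 0 = 0) (f1 : f 1 = 1).
Hypothesis hG : entropy_solution f G0 G.

Lemma G_itv x y : 0 <= y <= 1 -> 0 <= G x y <= 1.
Proof. by case: hG => _ h _ _ _; apply: h. Qed.

Lemma G_meas : measurable_fun setT (fun p : R * R => G p.1 p.2).
Proof. by case: hG. Qed.

Lemma G_slice_meas y : measurable_fun setT (fun x => G x y).
Proof.
have h := measurableT_comp G_meas (@pair2_measurable _ _ R R y).
exact: h.
Qed.

Lemma Kf_ge0 : 0 <= Kf.
Proof. by have := f_lip (lexx 0) ler01 (lexx 1); rewrite f0 f1 !subr0 mulr1 => /(le_trans ler01). Qed.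

Lemma f_itv u : 0 <= u <= 1 -> 0 <= f u <= 1.
Proof.
by case/andP=> u0 u1; rewrite -{1}f0 -f1 f_mono //= f_mono.
Qed.

Definition clamp (z : R) : R := Num.max 0 (Num.min z 1).

Lemma clamp_itv z : 0 <= clamp z <= 1.
Proof. by rewrite /clamp le_max lexx /= ge_max ler01 ge_min lexx orbT. Qed.

Lemma clamp_id z : 0 <= z <= 1 -> clamp z = z.
Proof. by case/andP=> z0 z1; rewrite /clamp min_l // max_r. Qed.

Lemma clamp_lip u v : u <= v -> 0 <= clamp v - clamp u <= v - u.
Proof.
have H z : [\/ z <= 0 /\ clamp z = 0, (0 <= z /\ z <= 1) /\ clamp z = z | 1 <= z /\ clamp z = 1].
  rewrite /clamp; have [z0|z0] := leP z 0.
    by apply: Or31; rewrite min_l ?max_l // (le_trans z0).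
  have [z1|z1] := leP z 1.
    by apply: Or32; rewrite max_r ?ltW.
  by apply: Or33; rewrite max_r ?ltW.
move=> uv; case: (H u) => -[hu ->]; case: (H v) => -[hv ->]; apply/andP; split; lra.
Qed.

Lemma lipschitz_continuous (h : R -> R) K : (forall u v, u <= v -> `|h v - h u| <= K * (v - u)) ->
  continuous h.
Proof.
move=> hl z; apply/cvgrPdist_le => e e0.
have K1 : 0 < `|K| + 1 by rewrite ltr_wpDl.
near=> y.
have ye : `|z - y| <= e / (`|K| + 1).
  by near: y; apply: cvgr_dist_le; [exact: cvg_id|exact: divr_gt0].
have H : `|h z - h y| <= K * `|z - y|.
  have [zy|yz] := leP z y.
    by rewrite distrC (@ler0_norm _ (z - y)) ?subr_le0 // opprB hl.
  by rewrite (@gtr0_norm _ (z - y)) ?subr_gt0 // hl // ltW.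
apply: le_trans H _; move: ye; rewrite ler_pdivlMr // => ye.
have := ler_norm K; have := normr_ge0 (z - y); nra.
Unshelve. all: by end_near.
Qed.

(** Off the strip [0 <= y <= 1] the values of [G] are unconstrained, and [f] is only known to be
    Lipschitz on [0, 1]; clamping makes the integrand measurable on the whole plane. *)
Definition fc (z : R) : R := f (clamp z).

Lemma fc_id z : 0 <= z <= 1 -> fc z = f z.
Proof. by move=> hz; rewrite /fc clamp_id. Qed.

Lemma measurable_fc : measurable_fun setT fc.
Proof.
apply: continuous_measurable_fun; apply: (@lipschitz_continuous _ Kf) => u v uv.
have /andP[c1 c2] := clamp_lip uv; rewrite subr_ge0 in c1.
have /andP[u0 u1] := clamp_itv u; have /andP[v0 v1] := clamp_itv v.
have le := f_mono u0 c1 v1; rewrite /fc ger0_norm ?subr_ge0 //.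
by apply: le_trans (f_lip u0 c1 v1) _; apply: ler_wpM2l => //; exact: Kf_ge0.
Qed.

Variables (e t A : R).
Hypotheses (e_gt0 : 0 < e) (t_gt0 : 0 < t) (t_lt : t <= 1 / 8) (A_ge0 : 0 <= A).
Local Notation wgt := (wgt e).
Local Notation wgtx := (wgtx e).
Local Notation wgty := (wgty e).
Local Notation ramp := (ramp t).
Local Notation dramp := (dramp t).

(** For a nondecreasing [f] the Kruzkov entropy flux, with its sign factor, is the absolute value of
    [f G - f k]. *)
Definition entf (s : slab R) (k : R) (p : R * R) : R :=
  `|G p.1 p.2 - k| * (wgty s p * ramp p.2 + wgt s p * dramp p.2)
  + `|fc (G p.1 p.2) - fc k| * (wgtx s p * ramp p.2).

Lemma continuous_ramp : continuous ramp.
Proof.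
move=> y; apply: differentiable_continuous; apply/derivable1_diffP.
by have [] := is_derive_ramp t y.
Qed.

Lemma continuous_dramp : continuous dramp.
Proof.
apply: ctsM; last exact: cts_cst.
apply: ctsB; apply: cts_comp; try exact: continuous_dstep.
  apply: ctsM; last exact: cts_cst.
  by apply: ctsB; [move=> y; exact: cvg_id|exact: cts_cst].
apply: ctsM; last exact: cts_cst.
by apply: ctsB; [exact: cts_cst|move=> y; exact: cvg_id].
Qed.

Lemma measurable_sstep_aff al a : measurable_fun setT (fun p => sstep (aff e al a p)).
Proof.
apply: measurableT_comp; last exact: measurable_aff.
by apply: continuous_measurable_fun; exact: continuous_sstep.
Qed.

Lemma measurable_dstep_aff al a : measurable_fun setT (fun p => dstep (aff e al a p)).
Proof.
apply: measurableT_comp; last exact: measurable_aff.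
by apply: continuous_measurable_fun; exact: continuous_dstep.
Qed.

Lemma measurable_wgt s : measurable_fun setT (wgt s).
Proof. by apply: measurable_funB; exact: measurable_sstep_aff. Qed.

Lemma measurable_wgtx s : measurable_fun setT (wgtx s).
Proof.
by apply: measurable_funM => //; apply: measurable_funB; exact: measurable_dstep_aff.
Qed.

Lemma measurable_wgty s : measurable_fun setT (wgty s).
Proof.
apply: measurable_funM => //; apply: measurable_funB; apply: measurable_funM => //;
exact: measurable_dstep_aff.
Qed.

Lemma measurable_entf s k : measurable_fun setT (entf s k).
Proof.
have mr : measurable_fun setT (fun p : R * R => ramp p.2).
  by apply: measurableT_comp; [apply: continuous_measurable_fun; exact: continuous_ramp|
    exact: measurable_snd].
have md : measurable_fun setT (fun p : R * R => dramp p.2).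
  by apply: measurableT_comp; [apply: continuous_measurable_fun; exact: continuous_dramp|
    exact: measurable_snd].
apply: measurable_funD; apply: measurable_funM.
- apply: measurableT_comp => //; apply: measurable_funB => //; exact: G_meas.
- apply: measurable_funD; apply: measurable_funM => //.
    exact: measurable_wgty.
  exact: measurable_wgt.
- apply: measurableT_comp => //; apply: measurable_funB => //.
  by apply: measurableT_comp; [exact: measurable_fc|exact: G_meas].
- by apply: measurable_funM => //; exact: measurable_wgtx.
Qed.

Lemma abs_diff01 (u v : R) : 0 <= u <= 1 -> 0 <= v <= 1 -> `|u - v| <= 1.
Proof. by move=> /andP[? ?] /andP[? ?]; rewrite ler_norml; apply/andP; split; lra. Qed.

Lemma box_entf s k : slab_ok s -> slab_in e A s -> 0 <= k <= 1 ->
  box_bounded A ((`|sl_b s| + `|sl_a s|) / e + t^-1 + e^-1) (entf s k).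
Proof.
move=> ok hin hk.
have C0 : 0 <= (`|sl_b s| + `|sl_a s|) / e + t^-1 + e^-1.
  by rewrite !addr_ge0 ?mulr_ge0 ?invr_ge0 ?addr_ge0 // ltW.
have out y : ~~ (0 <= y <= 1) -> ramp y = 0 /\ dramp y = 0.
  have [t0 t8] := conj t_gt0 t_lt.
  move=> hy; apply: (ramp_out t_gt0 t_lt); move: hy; rewrite negb_and -!ltNge.
  by case/orP=> hy; [left|right]; lra.
split; first exact: measurable_entf.
- move=> -[x y]; rewrite /entf /=.
  have [hy|/out[-> ->]] := boolP (0 <= y <= 1); last first.
    by rewrite !(mulr0, addr0, normr0).
  have hGk := abs_diff01 (G_itv x hy) hk.
  have hfk : `|fc (G x y) - fc k| <= 1.
    by apply: abs_diff01; apply: f_itv; apply: clamp_itv.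
  have /andP[w0 w1] := wgt_ge0 e_gt0 x ok hy.
  have /andP[r0 r1] := ramp_itv t_gt0 t_lt y.
  have h1 : `|wgty s (x, y) * ramp y| <= (`|sl_b s| + `|sl_a s|) / e.
    rewrite normrM (ger0_norm r0); apply: le_trans (wgty_bound e_gt0 s (x, y)).
    by rewrite ler_piMr.
  have h2 : `|wgt s (x, y) * dramp y| <= t^-1.
    rewrite normrM (ger0_norm w0); apply: le_trans (dramp_bound t_gt0 y).
    by rewrite ler_piMl.
  have h3 : `|wgtx s (x, y) * ramp y| <= e^-1.
    rewrite normrM (ger0_norm r0); apply: le_trans (wgtx_bound e_gt0 s (x, y)).
    by rewrite ler_piMr.
  apply: le_trans (ler_normD _ _) _; rewrite lerD //.
    rewrite normrM normr_id; apply: le_trans (_ : _ <= `|wgty s (x, y) * ramp y + wgt s (x, y) * dramp y|) _.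
      by rewrite ler_piMl.
    by apply: le_trans (ler_normD _ _) _; rewrite lerD.
  by rewrite normrM normr_id; apply: le_trans h3; rewrite ler_piMl.
- move=> -[x y] /= hxy; rewrite /entf /=.
  have [hy|/out[-> ->]] := boolP (0 <= y <= 1); last first.
    by rewrite !(mulr0, addr0).
  case: hxy => [Ax|hy'].
    have [-> -> ->] := wgt_out e_gt0 hin hy Ax.
    by rewrite !(mul0r, addr0, mulr0).
  by case/andP: hy => ? ?; case: hy' => ?; lra.
Qed.

Lemma entf_ge0 s k : slab_ok s -> slab_in e A s -> 0 <= k <= 1 -> 0 <= outer (entf s k).
Proof.
move=> ok hin hk; rewrite -lee_fin -(outerE A_ge0 (box_entf ok hin hk)).
case: hG => _ _ _ _ ent.
apply: le_trans (ent k (bump e t s) hk (test_bump e_gt0 t_gt0 t_lt ok hin)) _.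
rewrite le_eqVlt; apply/orP; left; apply/eqP.
apply: eq_integral => y; rewrite inE /= in_itv /= => /andP[y0 y1].
have y01 : 0 <= y <= 1 by rewrite !ltW.
apply: eq_integral => x _; congr _%:E.
rewrite (dX_bump e t s x y).2 (dY_bump e t s x y).2 /entf /=.
have Gxy := G_itv x y01; rewrite !fc_id //; congr (_ + _ * _).
have /andP[g0 g1] := Gxy; have /andP[k0 k1] := hk.
have [gk|kg|->] := ltgtP (G x y) k.
- rewrite ltr0_sg ?subr_lt0 // mulN1r ler0_norm // subr_le0.
  by apply: f_mono => //; exact: ltW.
- rewrite gtr0_sg ?subr_gt0 // mul1r ger0_norm // subr_ge0.
  by apply: f_mono => //; exact: ltW.
- by rewrite !subrr normr0 mulr0.
Qed.

End EntropySlabs.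

(** * Exact integrals of the weights *)

Section FundamentalTheorem.
Variable R : realType.
Local Notation mu := (@lebesgue_measure R).

Lemma Rintegral_derive (F f : R -> R) (a b : R) : a < b ->
  (forall x : R, is_derive x 1 F (f x)) -> continuous f ->
  Rintegral mu `[a, b] f = F b - F a.
Proof.
move=> ab dF cf; rewrite /Rintegral.
have cF : continuous F.
  move=> x; apply: differentiable_continuous; apply/derivable1_diffP.
  by have [] := dF x.
rewrite (@continuous_FTC2 _ f F a b ab).
- by [].
- exact: continuous_subspaceT.
- split.
  + by move=> x _; have [] := dF x.
  + exact: cvg_at_right_filter (cF a).
  + exact: cvg_at_left_filter (cF b).
- by move=> x _; rewrite derive1E; have [_] := dF x.
Qed.

Lemma Rintegral_dstep (A e p : R) : 0 < e -> - A <= p -> p <= A - 2 * e ->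
  Rintegral mu `[- A, A] (fun x => dstep ((x - p) / e) / e) = 1.
Proof.
move=> e0 pA1 pA2.
have E x : (x - p) / e = e^-1 * x + (- p / e) by ring.
have AA : - A < A by lra.
have dF (x : R) : is_derive x 1 (fun x => sstep (e^-1 * x + (- p / e))) (dstep ((x - p) / e) / e).
  by rewrite E [dstep _ / e]mulrC; exact: is_derive_sstep_aff.
have cf : continuous (fun x : R => dstep ((x - p) / e) / e).
  apply: ctsM; last exact: cts_cst.
  apply: cts_comp; last exact: continuous_dstep.
  by apply: ctsM; [apply: ctsB; [move=> x; exact: cvg_id|exact: cts_cst]|exact: cts_cst].
rewrite (Rintegral_derive AA dF cf) -!E sstep_ge2 ?sstep_le0 ?subr0 //.
  by rewrite ler_pdivrMr //; lra.
by rewrite ler_pdivlMr //; lra.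
Qed.

Lemma Rintegral_sstep (A e p q : R) : 0 < e -> - A <= p -> p <= A - 2 * e ->
  - A <= q -> q <= A - 2 * e ->
  Rintegral mu `[- A, A] (fun x => sstep ((x - p) / e) - sstep ((x - q) / e)) = q - p.
Proof.
move=> e0 pA1 pA2 qA1 qA2.
have E u x : (x - u) / e = e^-1 * x + (- u / e) by ring.
have AA : - A < A by lra.
have D u (x : R) : is_derive x 1 (fun x => e * sprim (e^-1 * x + (- u / e))) (sstep ((x - u) / e)).
  rewrite (_ : (fun x => _) = e *: (fun x => sprim (e^-1 * x + (- u / e)))) //.
  apply: is_derive_eq; first by apply: is_deriveZ; exact: is_derive_sprim_aff.
  by rewrite /GRing.scale /= mulrA divff ?mul1r ?E // gt_eqF.
have dF (x : R) := is_deriveB (D p x) (D q x).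
have c u : continuous (fun x : R => sstep ((x - u) / e)).
  apply: cts_comp; last exact: continuous_sstep.
  by apply: ctsM; [apply: ctsB; [move=> x; exact: cvg_id|exact: cts_cst]|exact: cts_cst].
rewrite (Rintegral_derive AA dF (ctsB (c p) (c q))) !fctE -!E.
have h1 u : u <= A - 2 * e -> 2 <= (A - u) / e by move=> ?; rewrite ler_pdivlMr //; lra.
have h2 u : - A <= u -> (- A - u) / e <= 0 by move=> ?; rewrite ler_pdivrMr //; lra.
rewrite (sprim_ge2 (h1 _ pA2)) (sprim_ge2 (h1 _ qA2)) (sprim_le0 (h2 _ pA1)) (sprim_le0 (h2 _ qA1)).
by field; rewrite gt_eqF.
Qed.

End FundamentalTheorem.

(** * The integrated inequality between times zero and one *)

Section SlabInequality.
Variables (R : realType) (f G0 : R -> R) (G : R -> R -> R) (Kf : R).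
Local Notation mu := (@lebesgue_measure R).
Hypothesis f_mono : forall u v, 0 <= u -> u <= v -> v <= 1 -> f u <= f v.
Hypothesis f_lip : forall u v, 0 <= u -> u <= v -> v <= 1 -> f v - f u <= Kf * (v - u).
Hypotheses (f0 : f 0 = 0) (f1 : f 1 = 1).
Hypothesis hG : entropy_solution f G0 G.
Let Gi := G_itv hG.

Variables (e A : R).
Hypotheses (e_gt0 : 0 < e) (A_gt0 : 0 < A).
Variables (s1 s2 : slab R) (k1 k2 : R).
Hypotheses (ok1 : slab_ok s1) (ok2 : slab_ok s2).
Hypotheses (in1 : slab_in e A s1) (in2 : slab_in e A s2).
Hypotheses (hk1 : 0 <= k1 <= 1) (hk2 : 0 <= k2 <= 1).
Local Notation wgt := (wgt e).
Local Notation wgtx := (wgtx e).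
Local Notation wgty := (wgty e).

(** Two slabs with two constants cover both uses: equal slabs turn a pair of entropies into a
    one-sided one, and slabs sharing an edge describe a shock. *)
Definition dens (y x : R) : R := `|G x y - k1| * wgt s1 (x, y) + `|G x y - k2| * wgt s2 (x, y).
Definition mass_at (y : R) : R := Rintegral mu `[- A, A] (dens y).

Lemma dens_meas y : measurable_fun setT (dens y).
Proof.
have mw s : measurable_fun setT (fun x => wgt s (x, y)).
  apply: (measurableT_comp (measurable_wgt e s)); exact: pair2_measurable.
apply: measurable_funD; apply: measurable_funM => //; apply: measurableT_comp => //;
  apply: measurable_funB => //; exact: (G_slice_meas hG).
Qed.

Lemma dens_itv y x : 0 <= y <= 1 -> 0 <= dens y x <= 2.
Proof.
move=> hy; have /andP[a1 a2] := wgt_ge0 e_gt0 x ok1 hy.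
have /andP[b1 b2] := wgt_ge0 e_gt0 x ok2 hy.
have g1 := abs_diff01 (Gi x hy) hk1; have g2 := abs_diff01 (Gi x hy) hk2.
have n1 := normr_ge0 (G x y - k1); have n2 := normr_ge0 (G x y - k2).
rewrite /dens; apply/andP; split; first by rewrite addr_ge0 ?mulr_ge0.
by rewrite -[2]/(1 + 1) lerD // -[1]mulr1 ler_pM.
Qed.

Lemma bounded_int (C : R) (h : R -> R) : measurable_fun setT h ->
  (forall x, `|h x| <= C) -> mu.-integrable `[- A, A] (EFin \o h).
Proof. exact: bounded_integrable. Qed.

Lemma dens_int y : 0 <= y <= 1 -> mu.-integrable `[- A, A] (EFin \o dens y).
Proof.
move=> hy; apply: (@bounded_int 2); first exact: dens_meas.
by move=> x; have /andP[h0 h2] := dens_itv x hy; rewrite ger0_norm.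
Qed.

Lemma wgt_lipt s x y z : y <= z ->
  `|wgt s (x, z) - wgt s (x, y)| <= (`|sl_a s| + `|sl_b s|) / e * (z - y).
Proof.
move=> yz; have H al a : `|sstep (aff e al a (x, z)) - sstep (aff e al a (x, y))|
    <= `|a| / e * (z - y).
  have lip u v : `|sstep u - sstep v| <= `|u - v| :> R.
    wlog uv : u v / v <= u => [W|].
      by case: (leP v u) => [/W //|/ltW /W]; rewrite distrC [X in _ <= X -> _]distrC.
    by rewrite !ger0_norm ?subr_ge0 ?sstep_lip // sstep_mono.
  apply: le_trans (lip _ _) _.
  have -> : aff e al a (x, z) - aff e al a (x, y) = - (a / e * (z - y)) by rewrite /aff /=; ring.
  have zy : 0 <= z - y by rewrite subr_ge0.
  by rewrite normrN !normrM normfV (gtr0_norm e_gt0) (ger0_norm zy).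
rewrite /wgt; set u := sstep _; set v := sstep _; set u' := sstep _; set v' := sstep _.
rewrite -[X in `|X|](_ : (u - u') - (v - v') = _); last by ring.
by apply: le_trans (ler_normB _ _) _; rewrite mulrDl mulrDl; apply: lerD; exact: H.
Qed.

(** The continuity of [G] in time with values in L^1 on [-A, A] controls the change of [G]; the
    weights are Lipschitz in time. *)
Lemma mass_continuous y0 d : 0 <= y0 <= 1 -> 0 < d -> exists2 h, 0 < h &
  forall y, 0 <= y <= 1 -> `|y - y0| < h -> `|mass_at y - mass_at y0| <= d.
Proof.
move=> hy0 d0.
pose C := (`|sl_a s1| + `|sl_b s1|) / e + (`|sl_a s2| + `|sl_b s2|) / e.
have C0 : 0 <= C by rewrite addr_ge0 ?mulr_ge0 ?addr_ge0 ?invr_ge0 // ltW.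
case: hG => _ _ _ + _ => /(_ (- A) A y0 hy0).
move=> /fine_cvgP[_].
move=> /cvgrPdist_lt /(_ (d / 4)); rewrite divr_gt0 // => /(_ isT).
rewrite /= => nb.
have [h0 h00 hh] : exists2 h, 0 < h & forall y, 0 <= y <= 1 -> `|y - y0| < h ->
   Rintegral mu `[- A, A] (fun x => `|G x y - G x y0|) < d / 4.
  move: nb => [h /= h0 hh]; exists h => // y hy yh.
  have := hh y; rewrite /= distrC => /(_ yh); rewrite in_itv /= => /(_ hy).
  rewrite sub0r normrN ger0_norm //.
  by apply: fine_ge0; apply: integral_ge0 => x _; rewrite lee_fin.
exists (Num.min h0 (d / (4 * A * C + 1))).
  by rewrite lt_min h00 divr_gt0 // ltr_wpDl // !mulr_ge0 // ltW.
move=> y hy; rewrite lt_min => /andP[yh0 yh1].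
have Gd := hh y hy yh0.
have mGd : measurable_fun setT (fun x => `|G x y - G x y0|).
  by apply: measurableT_comp => //; apply: measurable_funB; exact: (G_slice_meas hG).
have iGd : mu.-integrable `[- A, A] (EFin \o (fun x => `|G x y - G x y0|)).
  by apply: (@bounded_int 1) => // x; rewrite normr_id; apply: abs_diff01; exact: Gi.
have Wd s x : `|wgt s (x, y) - wgt s (x, y0)| <= (`|sl_a s| + `|sl_b s|) / e * `|y - y0|.
  have [yy|yy] := leP y0 y; first by rewrite (@ger0_norm _ (y - y0)) ?subr_ge0 // wgt_lipt.
  by rewrite distrC (@distrC _ _ y) (@ger0_norm _ (y0 - y)) ?subr_ge0 ?wgt_lipt // ltW.
have pt x : `|dens y x - dens y0 x| <= 2 * `|G x y - G x y0| + C * `|y - y0|.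
  have one k s : slab_ok s -> 0 <= k <= 1 ->
     `| `|G x y - k| * wgt s (x, y) - `|G x y0 - k| * wgt s (x, y0)| <=
     `|G x y - G x y0| + (`|sl_a s| + `|sl_b s|) / e * `|y - y0|.
    move=> ok hk.
    have -> : `|G x y - k| * wgt s (x, y) - `|G x y0 - k| * wgt s (x, y0) =
       (`|G x y - k| - `|G x y0 - k|) * wgt s (x, y) + `|G x y0 - k| * (wgt s (x, y) - wgt s (x, y0)).
      by ring.
    apply: le_trans (ler_normD _ _) _; rewrite lerD //.
      rewrite normrM; have /andP[w0 w1] := wgt_ge0 e_gt0 x ok hy.
      rewrite (ger0_norm w0); apply: le_trans (_ : _ <= `| `|G x y - k| - `|G x y0 - k| |) _.
        by rewrite ler_piMr.
      apply: le_trans (ler_dist_dist _ _) _.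
      by rewrite (_ : _ - _ - (_ - _) = G x y - G x y0) //; ring.
    rewrite normrM normr_id; apply: le_trans (Wd s x).
    by rewrite ler_piMl //; apply: abs_diff01 => //; exact: Gi.
  rewrite /dens (_ : _ - _ = (`|G x y - k1| * wgt s1 (x, y) - `|G x y0 - k1| * wgt s1 (x, y0))
    + (`|G x y - k2| * wgt s2 (x, y) - `|G x y0 - k2| * wgt s2 (x, y0))); last by ring.
  apply: le_trans (ler_normD _ _) _.
  have := one k1 s1 ok1 hk1; have := one k2 s2 ok2 hk2.
  by rewrite /C mulrDl; lra.
have mD : measurable (`[- A, A] : set (measurableTypeR R)) by [].
have iDy := dens_int hy; have iDy0 := dens_int hy0.
have iB : mu.-integrable `[- A, A] (EFin \o (fun x => dens y x - dens y0 x)).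
  apply: (@bounded_int 2); first by apply: measurable_funB; exact: dens_meas.
  move=> x; have /andP[? ?] := dens_itv x hy; have /andP[? ?] := dens_itv x hy0.
  by rewrite ler_norml; apply/andP; split; lra.
have iC : mu.-integrable `[- A, A] (EFin \o (fun=> C * `|y - y0|)).
  by apply: (@bounded_int (C * `|y - y0|)) => // x; rewrite ger0_norm // mulr_ge0.
have i2 : mu.-integrable `[- A, A] (EFin \o (fun x => 2 * `|G x y - G x y0|)).
  apply: (@bounded_int 2); first exact: measurable_funM.
  move=> x; rewrite normrM normr_id ger0_norm // ler_piMr //.
  by apply: abs_diff01; exact: Gi.
rewrite /mass_at -RintegralB //.
apply: le_trans (le_normr_Rintegral _ iB) _; first by [].
apply: (@le_trans _ _ (Rintegral mu `[- A, A] (fun x => 2 * `|G x y - G x y0| + C * `|y - y0|))).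
  apply: le_Rintegral => //.
  - apply: (@bounded_int 2).
      by apply: measurableT_comp => //; apply: measurable_funB; exact: dens_meas.
    move=> x; rewrite normr_id; have /andP[? ?] := dens_itv x hy.
    have /andP[? ?] := dens_itv x hy0.
    by rewrite ler_norml; apply/andP; split; lra.
  - by have := integrableD mD i2 iC; apply: eq_integrable.
rewrite RintegralD // RintegralZl // Rintegral_cst //.
have muE : fine (mu `[- A, A]) = 2 * A.
  rewrite lebesgue_measure_itv /= lte_fin ifT; last by have := A_gt0; lra.
  by rewrite -EFinD /= opprK mulr_natl mulr2n.
rewrite muE; move: yh1; rewrite ltr_pdivlMr; last first.
  by rewrite ltr_wpDl // !mulr_ge0 // ltW.
have AC : 0 <= A * C by rewrite mulr_ge0 // ltW.
have := normr_ge0 (y - y0); move: Gd AC; set N := `|y - y0|.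
set I := Rintegral _ _ _ => Gd AC N0 hN.
have : 4 * A * C * N <= d by nra.
by nra.
Qed.

Variables (al1 a1 al2 a2 K1 K2 : R).
Hypothesis line1 : forall y, 0 <= y <= 1 -> - A <= al1 + a1 * y <= A - 2 * e.
Hypothesis line2 : forall y, 0 <= y <= 1 -> - A <= al2 + a2 * y <= A - 2 * e.
Hypothesis flux_bound : forall p g, 0 <= g <= 1 ->
  (`|g - k1| * wgty s1 p + `|f g - f k1| * wgtx s1 p)
  + (`|g - k2| * wgty s2 p + `|f g - f k2| * wgtx s2 p)
  <= K1 * (dstep (aff e al1 a1 p) / e) + K2 * (dstep (aff e al2 a2 p) / e).

(** Each kernel [dstep (aff e al a p) / e] has integral one in space, so the pointwise flux bound
    integrates to [K1 + K2] whatever [e]. *)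
Lemma inner_le t y : 0 < t -> t <= 1 / 8 -> 0 <= y <= 1 ->
  inner (fun p => entf f G e t s1 k1 p + entf f G e t s2 k2 p) y <=
  dramp t y * mass_at y + ramp t y * (K1 + K2).
Proof.
move=> t0 t8 hy.
have B1 := box_entf f_mono f_lip f0 f1 hG e_gt0 t0 t8 ok1 in1 hk1.
have B2 := box_entf f_mono f_lip f0 f1 hG e_gt0 t0 t8 ok2 in2 hk2.
have BB := box_boundedD B1 B2.
have -> : inner (fun p => entf f G e t s1 k1 p + entf f G e t s2 k2 p) y =
    Rintegral mu `[- A, A] (fun x => entf f G e t s1 k1 (x, y) + entf f G e t s2 k2 (x, y)).
  rewrite /inner /Rintegral (@integral_compact _ A (fun x => entf f G e t s1 k1 (x, y) + entf f G e t s2 k2 (x, y))) //.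
  by move=> x Ax; case: BB => _ _ h; apply: (h (x, y)); left.
have mD : measurable (`[- A, A] : set (measurableTypeR R)) by [].
pose q1 x := dstep (aff e al1 a1 (x, y)) / e; pose q2 x := dstep (aff e al2 a2 (x, y)) / e.
have qm al a : measurable_fun setT (fun x => dstep (aff e al a (x, y)) / e).
  apply: measurable_funM => //; apply: (measurableT_comp (measurable_dstep_aff e al a)).
  exact: pair2_measurable.
have qb al a x : `|dstep (aff e al a (x, y)) / e| <= e^-1.
  rewrite normrM normfV (gtr0_norm e_gt0) (ger0_norm (dstep_ge0 _)).
  by apply: ler_piMl; [rewrite invr_ge0 ltW|exact: dstep_le1].
have iq1 : mu.-integrable `[- A, A] (EFin \o q1) by apply: (@bounded_int e^-1); [exact: qm|exact: qb].
have iq2 : mu.-integrable `[- A, A] (EFin \o q2) by apply: (@bounded_int e^-1); [exact: qm|exact: qb].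
have Iq al a : - A <= al + a * y <= A - 2 * e ->
   Rintegral mu `[- A, A] (fun x => dstep (aff e al a (x, y)) / e) = 1.
  move=> /andP[h1 h2]; rewrite -[RHS](Rintegral_dstep e_gt0 h1 h2).
  by apply: eq_Rintegral => x _; rewrite /aff /= opprD addrA.
have iD := dens_int hy.
have iZ c (h : R -> R) : mu.-integrable `[- A, A] (EFin \o h) ->
   mu.-integrable `[- A, A] (EFin \o (fun x => c * h x)).
  by move=> ih; have := integrableZl mD c ih; apply: eq_integrable.
have iS (h g : R -> R) : mu.-integrable `[- A, A] (EFin \o h) -> mu.-integrable `[- A, A] (EFin \o g) ->
   mu.-integrable `[- A, A] (EFin \o (fun x => h x + g x)).
  by move=> ih ig; have := integrableD mD ih ig; apply: eq_integrable.
have -> : dramp t y * mass_at y + ramp t y * (K1 + K2) =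
  Rintegral mu `[- A, A] (fun x => dramp t y * dens y x + ramp t y * (K1 * q1 x + K2 * q2 x)).
  have i1 := iZ K1 _ iq1; have i2 := iZ K2 _ iq2; have i3 := iS _ _ i1 i2.
  rewrite (RintegralD mD (iZ (dramp t y) _ iD) (iZ (ramp t y) _ i3)).
  rewrite (RintegralZl _ mD iD) (RintegralZl _ mD i3) (RintegralD mD i1 i2).
  by rewrite (RintegralZl _ mD iq1) (RintegralZl _ mD iq2) /q1 /q2 !Iq ?mulr1 ?line1 ?line2.
apply: le_Rintegral => //.
- have [mB _] := box_slice y BB; case: BB => _ bB _.
  exact: (bounded_int mB (fun x => bB (x, y))).
- by apply: (iS); apply: (iZ) => //; apply: (iS); apply: (iZ).
move=> x _; rewrite /entf /= !fc_id //; try exact: Gi.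
have /andP[r0 r1] := ramp_itv t0 t8 y.
have := ler_wpM2l r0 (flux_bound (x, y) (Gi x hy)); rewrite /dens /q1 /q2.
set w1 := wgt s1 (x, y); set w2 := wgt s2 (x, y).
set m := dramp t y * _; rewrite -(lerD2l m) => /(le_trans _); apply.
by rewrite le_eqVlt; apply/orP; left; apply/eqP; rewrite /m; ring.
Qed.

(** The two parts of [dramp] live on times in [t, 3t] and [1 - 3t, 1 - t], where [mass_at] may be
    replaced by its end values. *)
Lemma dramp_mass_le t d y : 0 < t -> t <= 1 / 8 -> 0 <= y <= 1 ->
  (forall z, 0 <= z <= 1 -> z < 4 * t -> mass_at z <= mass_at 0 + d) ->
  (forall z, 0 <= z <= 1 -> 1 - 4 * t < z -> mass_at 1 - d <= mass_at z) ->
  dramp t y * mass_at y <=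
  (mass_at 0 + d) * (dstep ((y - t) / t) / t) - (mass_at 1 - d) * (dstep ((1 - t - y) / t) / t).
Proof.
move=> t0 t8 hy h0 h1; rewrite /dramp mulrBl mulrBl.
have key z m m' : (0 < z -> z < 2 -> m <= m') -> m * (dstep z / t) <= m' * (dstep z / t).
  move=> mm; have [z0|z0] := leP z 0; first by rewrite dstep_out ?mul0r ?mulr0 //; left.
  have [z2|z2] := leP 2 z; first by rewrite dstep_out ?mul0r ?mulr0 //; right.
  by apply: ler_wpM2r (mm z0 z2); apply: divr_ge0; [exact: dstep_ge0|exact: ltW].
apply: lerB.
  rewrite mulrC; apply: key => [_]; rewrite ltr_pdivrMr // => yt.
  by apply: h0 => //; lra.
rewrite [X in _ <= X]mulrC; apply: key => [_]; rewrite ltr_pdivrMr // => yt.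
by apply: h1 => //; lra.
Qed.

Definition time_flux (t u v K y : R) : R :=
  u * (dstep ((y - t) / t) / t) - v * (dstep ((1 - t - y) / t) / t) + K * ramp t y.

Lemma time_flux_continuous t u v K : continuous (time_flux t u v K).
Proof.
have idc : continuous (fun y : R => y) by move=> y; exact: cvg_id.
have cl : continuous (fun y => (y - t) / t).
  by apply: ctsM; [apply: ctsB => //|]; exact: cts_cst.
have cr : continuous (fun y => (1 - t - y) / t).
  by apply: ctsM; [apply: ctsB => //|]; exact: cts_cst.
apply: ctsD; last by apply: ctsM; [exact: cts_cst|exact: continuous_ramp].
apply: ctsB; (apply: ctsM; first exact: cts_cst); (apply: ctsM; last exact: cts_cst);
  apply: cts_comp => //; exact: continuous_dstep.
Qed.

(** Each kernel in time has integral one and [ramp] has integral [1 - 4 * t]; the correction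
    disappears with [t]. *)
Lemma Rintegral_time_flux t u v K : 0 < t -> t <= 1 / 8 ->
  Rintegral mu `[0, 1] (time_flux t u v K) = u - v + K - 4 * (t * K).
Proof.
move=> t0 t8.
have El y : (y - t) / t = t^-1 * y + (- 1) by field; rewrite gt_eqF.
have Er y : (1 - t - y) / t = (- t^-1) * y + (1 - t) / t by ring.
pose S1 := fun y : R => sstep (t^-1 * y + (- 1)).
pose S2 := fun y : R => sstep ((- t^-1) * y + (1 - t) / t).
pose P1 := fun y : R => sprim (t^-1 * y + (- 1)).
pose P2 := fun y : R => sprim ((- t^-1) * y + (1 - t) / t).
pose F := (u *: S1 + v *: S2) + K *: (t *: P1 - t *: P2 - id).
have dF (y : R) : is_derive y 1 F (time_flux t u v K y).
  have D1 := is_deriveZ u (is_derive_sstep_aff t^-1 (- 1) y).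
  have D2 := is_deriveZ v (is_derive_sstep_aff (- t^-1) ((1 - t) / t) y).
  have D3 := is_deriveZ t (is_derive_sprim_aff t^-1 (- 1) y).
  have D4 := is_deriveZ t (is_derive_sprim_aff (- t^-1) ((1 - t) / t) y).
  have D5 := is_deriveZ K (is_deriveB (is_deriveB D3 D4) (is_derive_id y 1)).
  apply: (is_derive_eq (is_deriveD (is_deriveD D1 D2) D5)).
  rewrite /time_flux /ramp -El -Er /GRing.scale /=; set a := sstep _; set b := sstep _.
  set a' := dstep _; set b' := dstep _.
  by field; rewrite gt_eqF.
rewrite (Rintegral_derive ltr01 dF (@time_flux_continuous t u v K)).
rewrite /F !fctE /S1 /S2 /P1 /P2 -!El -!Er /GRing.scale /=.
have l1 : 2 <= (1 - t) / t by rewrite ler_pdivlMr //; lra.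
have l0 : (0 - t) / t <= 0 by rewrite ler_pdivrMr //; lra.
have r1 : (1 - t - 1) / t <= 0 by rewrite ler_pdivrMr //; lra.
have r0 : 2 <= (1 - t - 0) / t by rewrite ler_pdivlMr //; lra.
rewrite (sstep_ge2 l1) (sstep_le0 l0) (sstep_le0 r1) (sstep_ge2 r0).
rewrite (sprim_ge2 l1) (sprim_le0 l0) (sprim_le0 r1) (sprim_ge2 r0).
by field; rewrite gt_eqF.
Qed.

(** The cut-off parameter [t] tends to zero while the width [e] of the edges stays fixed. *)
Lemma slab_inequality : mass_at 1 <= mass_at 0 + (K1 + K2).
Proof.
apply/ler_addgt0Pl => d d0.
have d3 : 0 < d / 4 by lra.
have z01 : 0 <= (0 : R) <= 1 by lra.
have o01 : 0 <= (1 : R) <= 1 by lra.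
have [h0 h00 H0] := mass_continuous z01 d3.
have [h1 h10 H1] := mass_continuous o01 d3.
pose K := `|K1 + K2|.
have K0 : 0 <= K by exact: normr_ge0.
(* The first two bounds put the flanks of [ramp] within the moduli of continuity at times zero and
   one; the last makes [4 * t * K] at most d / 2. The two tolerances d / 4 supply the rest. *)
pose t := Num.min (Num.min (h0 / 4) (h1 / 4)) (Num.min (1 / 8) (d / (8 * K + 8))).
have tle : [/\ t <= h0 / 4, t <= h1 / 4, t <= 1 / 8 & t <= d / (8 * K + 8)].
  by rewrite /t; split; rewrite !ge_min lexx ?orbT.
have t0 : 0 < t by rewrite /t !lt_min !divr_gt0 //; lra.
case: tle => t1 t2 t8 t3; clearbody t.
have {}t3 : 8 * (t * K) <= d.
  by move: t3; rewrite ler_pdivlMr; [nra|lra].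
have A0 := ltW A_gt0.
have B1 := box_entf f_mono f_lip f0 f1 hG e_gt0 t0 t8 ok1 in1 hk1.
have B2 := box_entf f_mono f_lip f0 f1 hG e_gt0 t0 t8 ok2 in2 hk2.
have BB := box_boundedD B1 B2.
have := addr_ge0 (entf_ge0 f_mono f_lip f0 f1 hG e_gt0 t0 t8 A0 ok1 in1 hk1)
  (entf_ge0 f_mono f_lip f0 f1 hG e_gt0 t0 t8 A0 ok2 in2 hk2).
rewrite -(outerD A0 B1 B2).
have [u uE] : exists u, u = mass_at 0 + d / 4 by eexists.
have [v vE] : exists v, v = mass_at 1 - d / 4 by eexists.
pose g := time_flux t u v (K1 + K2).
have cg : continuous g by exact: time_flux_continuous.
have ig : mu.-integrable `[0, 1] (EFin \o g).
  apply: continuous_compact_integrable; first exact: segment_compact.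
  exact: continuous_subspaceT.
have le_g : outer (fun p => entf f G e t s1 k1 p + entf f G e t s2 k2 p) <= Rintegral mu `[0, 1] g.
  apply: le_Rintegral => //; first exact: (inner_integrable A0 BB).
  move=> y; rewrite /= in_itv /= => hy; apply: le_trans (inner_le t0 t8 hy) _.
  rewrite /g /time_flux uE vE [ramp t y * _]mulrC lerD2r; apply: dramp_mass_le => // z hz zt.
    have := H0 z hz; rewrite subr0 ger0_norm; last by case/andP: hz.
    by move=> /(_ ltac:(lra)); rewrite ler_norml => /andP[_]; lra.
  have := H1 z hz; rewrite distrC ger0_norm; last by rewrite subr_ge0; case/andP: hz.
  by move=> /(_ ltac:(lra)); rewrite ler_norml => /andP[]; lra.
rewrite (Rintegral_time_flux _ _ _ t0 t8) in le_g => ge0.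
have := le_trans ge0 le_g.
have : - (K1 + K2) <= K by rewrite /K -normrN ler_norm.
by move=> kK; have := ler_wpM2l (ltW t0) kK; rewrite uE vE mulrN; lra.
Qed.

End SlabInequality.

Lemma max_shift (R : realType) (w d : R) : 0 <= d ->
  Num.max 0 (w - d) - (w - d) <= Num.max (- w) 0 + d.
Proof. by move=> d0; case: (leP 0 (w - d)) => ?; case: (leP (- w) 0) => ?; lra. Qed.

(** * Bounds for step initial data: one-sided entropies and shocks *)

Section RiemannBounds.
Variables (R : realType) (f : R -> R) (G : R -> R -> R) (Kf th rh : R).
Local Notation mu := (@lebesgue_measure R).
Hypothesis f_mono : forall u v, 0 <= u -> u <= v -> v <= 1 -> f u <= f v.
Hypothesis f_lip : forall u v, 0 <= u -> u <= v -> v <= 1 -> f v - f u <= Kf * (v - u).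
Hypotheses (f0 : f 0 = 0) (f1 : f 1 = 1).
Hypothesis hG : entropy_solution f (fun x => if x <= 0 then th else rh) G.
Hypotheses (hth : 0 <= th <= 1) (hrh : 0 <= rh <= 1).

Lemma Kf_ge1 : 1 <= Kf.
Proof. by have := f_lip (lexx 0) ler01 (lexx 1); rewrite f0 f1 !subr0 mulr1. Qed.

Lemma Rintegral_window (A p q c : R) (h : R -> R) : p <= q -> measurable_fun setT h ->
  (forall x, 0 <= h x <= c) -> (forall x, x < p \/ q < x -> h x = 0) ->
  Rintegral mu `[- A, A] h <= c * (q - p).
Proof.
move=> pq mh hc h0; have c0 : 0 <= c by case/andP: (hc 0) => /le_trans; apply.
rewrite -lee_fin /Rintegral fineK; last first.
  apply: integrable_fin_num => //; apply: (@bounded_integrable _ _ _ c) => // x.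
  by case/andP: (hc x) => ? ?; rewrite ger0_norm.
rewrite -integral_itv_cst // integral_mkcond [X in (_ <= X)%E]integral_mkcond.
apply: ge0_le_integral => //.
- by move=> x _; rewrite patchE; case: ifP => // _; rewrite lee_fin; case/andP: (hc x).
- apply: (proj1 (measurable_restrictT (EFin \o h) _)) => //.
  by apply/measurable_EFinP; apply: measurable_funTS.
- by apply: (proj1 (measurable_restrictT (fun=> c%:E) _)) => //; exact: measurable_cst.
- move=> x _; rewrite !patchE; case: (boolP (x \in `[p, q]%classic)) => [_|].
    by case: ifP => _; rewrite lee_fin //; case/andP: (hc x).
  rewrite notin_setE /= in_itv /= => /negP; rewrite negb_and -!ltNge => /orP hx.
  by case: ifP => // _; rewrite h0.
Qed.

Lemma Rintegral_sub (A p q : R) (h g : R -> R) (C : R) : - A <= p -> q <= A ->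
  measurable_fun setT h -> measurable_fun setT g ->
  (forall x, 0 <= h x <= C) -> (forall x, `|g x| <= C) -> (forall x, p <= x <= q -> g x <= h x) ->
  Rintegral mu `[p, q] g <= Rintegral mu `[- A, A] h.
Proof.
move=> Ap qA mh mg hC gC gh.
have ih u v : mu.-integrable `[u, v] (EFin \o h).
  by apply: (@bounded_integrable _ _ _ C) => // x; case/andP: (hC x) => ? ?; rewrite ger0_norm.
apply: (@le_trans _ _ (Rintegral mu `[p, q] h)).
  by apply: le_Rintegral => //; exact: bounded_integrable gC.
rewrite /Rintegral fine_le //; try exact: integrable_fin_num.
apply: ge0_subset_integral => //.
- by apply/measurable_EFinP; apply: measurable_funTS.
- by move=> x _; rewrite lee_fin; case/andP: (hC x).
- by move=> x; rewrite /= !in_itv /= => /andP[? ?]; apply/andP; split; lra.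
Qed.

Let Gi := G_itv hG.

Lemma wgt_meas (e y : R) s : measurable_fun setT (fun x => wgt e s (x, y)).
Proof. by apply: (measurableT_comp (measurable_wgt e s)); exact: pair2_measurable. Qed.

Lemma Rintegral_wgt (e A y : R) s : 0 < e -> slab_in e A s -> 0 <= y <= 1 ->
  Rintegral mu `[- A, A] (fun x => wgt e s (x, y)) = (sl_be s + sl_b s * y) - (sl_al s + sl_a s * y).
Proof.
move=> e0 hin hy; have [h1 h2 h3 h4] := hin y hy.
rewrite -(Rintegral_sstep e0 h1 h2 h3 h4); apply: eq_Rintegral => x _.
by rewrite /wgt /aff /=; congr (sstep (_ / _) - sstep (_ / _)); ring.
Qed.

Lemma wgt_left (e x y : R) s : 0 < e -> slab_ok s -> 0 <= y <= 1 -> x <= sl_al s + sl_a s * y ->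
  wgt e s (x, y) = 0.
Proof.
move=> e0 ok hy hx; have := ok y hy => h.
by rewrite /wgt !sstep_le0 ?subrr // /aff /= ler_pdivrMr // mul0r; lra.
Qed.

Lemma wgt_right (e x y : R) s : 0 < e -> slab_ok s -> 0 <= y <= 1 ->
  sl_be s + sl_b s * y + 2 * e <= x -> wgt e s (x, y) = 0.
Proof.
move=> e0 ok hy hx; have := ok y hy => h.
by rewrite /wgt !sstep_ge2 ?subrr // /aff /= ler_pdivlMr //; lra.
Qed.

Lemma wgt_mid (e x y : R) s : 0 < e -> sl_al s + sl_a s * y + 2 * e <= x ->
  x <= sl_be s + sl_b s * y -> wgt e s (x, y) = 1.
Proof.
move=> e0 h1 h2; rewrite /wgt sstep_ge2 ?sstep_le0 ?subr0 // /aff /=.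
  by rewrite ler_pdivrMr // mul0r; lra.
by rewrite ler_pdivlMr //; lra.
Qed.

Lemma line_flux (e E F KA KB : R) s p : 0 < e ->
  F - sl_a s * E <= KA -> sl_b s * E - F <= KB ->
  E * wgty e s p + F * wgtx e s p <= KA * (dstep (aff e (sl_al s) (sl_a s) p) / e)
    + KB * (dstep (aff e (sl_be s) (sl_b s) p) / e).
Proof.
move=> e0 hA hB; rewrite /wgty /wgtx; set q1 := dstep (aff e (sl_al s) _ _); set q2 := dstep _.
have Q1 : 0 <= q1 / e by apply: divr_ge0; [exact: dstep_ge0|exact: ltW].
have Q2 : 0 <= q2 / e by apply: divr_ge0; [exact: dstep_ge0|exact: ltW].
apply: le_trans (lerD (ler_wpM2r Q1 hA) (ler_wpM2r Q2 hB)).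
by rewrite le_eqVlt; apply/orP; left; apply/eqP; ring.
Qed.

Lemma norm_max (x : R) : `|x| = 2 * Num.max x 0 - x.
Proof.
have [x0|x0] := leP x 0; first by rewrite ler0_norm //; lra.
by rewrite gtr0_norm //; lra.
Qed.

Lemma measG y : measurable_fun setT (G ^~ y).
Proof. exact: (G_slice_meas hG). Qed.

Lemma G_init x : G x 0 = if x <= 0 then th else rh.
Proof. by case: hG => _ _ ->. Qed.

Let z01 : 0 <= (0 : R) <= 1. Proof. by lra. Qed.
Let o01 : 0 <= (1 : R) <= 1. Proof. by lra. Qed.

Lemma slice_integrable (h : R -> R) (u v C : R) : measurable_fun setT h -> (forall x, `|h x| <= C) ->
  mu.-integrable `[u, v] (EFin \o h).
Proof. exact: bounded_integrable. Qed.

Section OneSlab.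
Variables (e A m k c KA KB : R) (P : R -> R) (s : slab R).
Hypotheses (e_gt0 : 0 < e) (A_gt0 : 0 < A) (ok : slab_ok s) (hin : slab_in e A s).
Hypotheses (hm : 0 <= m <= 1) (hk : 0 <= k <= 1) (mP : measurable_fun setT P).
Hypothesis P01 : forall g, 0 <= g <= 1 -> 0 <= P g <= 1.
Hypothesis PE : forall g, 0 <= g <= 1 -> `|g - m| + `|g - k| = c + 2 * P g.
Hypothesis hKA : forall g, 0 <= g <= 1 ->
  `|f g - f m| + `|f g - f k| - sl_a s * (c + 2 * P g) <= KA.
Hypothesis hKB : forall g, 0 <= g <= 1 ->
  sl_b s * (c + 2 * P g) - (`|f g - f m| + `|f g - f k|) <= KB.

Definition excess (y x : R) : R := P (G x y) * wgt e s (x, y).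

Lemma excess_meas y : measurable_fun setT (excess y).
Proof.
apply: measurable_funM; last exact: wgt_meas.
by apply: (measurableT_comp mP); exact: measG.
Qed.

Lemma excess_itv y x : 0 <= y <= 1 -> 0 <= excess y x <= 1.
Proof.
move=> hy; have /andP[p0 p1] := P01 (Gi x hy).
have /andP[w0 w1] := wgt_ge0 e_gt0 x ok hy.
by rewrite /excess mulr_ge0 //= mulr_ile1.
Qed.

(** One slab is used with two constants: the sum of the two entropies is affine in the one-sided
    entropy [P], and the affine part integrates explicitly. *)
Lemma excess_inequality :
  2 * Rintegral mu `[- A, A] (excess 1) + c * ((sl_be s + sl_b s) - (sl_al s + sl_a s)) <=
  2 * Rintegral mu `[- A, A] (excess 0) + c * (sl_be s - sl_al s) + (KA + KB).
Proof.
have l1 y : 0 <= y <= 1 -> - A <= sl_al s + sl_a s * y <= A - 2 * e by move=> /hin[-> ->].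
have l2 y : 0 <= y <= 1 -> - A <= sl_be s + sl_b s * y <= A - 2 * e by move=> /hin[_ _ -> ->].
have fb p g : 0 <= g <= 1 ->
  (`|g - m| * wgty e s p + `|f g - f m| * wgtx e s p)
  + (`|g - k| * wgty e s p + `|f g - f k| * wgtx e s p)
  <= KA * (dstep (aff e (sl_al s) (sl_a s) p) / e) + KB * (dstep (aff e (sl_be s) (sl_b s) p) / e).
  move=> hg; rewrite addrACA -!mulrDl PE //.
  by apply: line_flux => //; [exact: hKA|exact: hKB].
have := slab_inequality f_mono f_lip f0 f1 hG e_gt0 A_gt0 ok ok hin hin hm hk l1 l2 fb.
have massE y : 0 <= y <= 1 -> mass_at G e A s s m k y =
    2 * Rintegral mu `[- A, A] (excess y) + c * ((sl_be s + sl_b s * y) - (sl_al s + sl_a s * y)).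
  move=> hy; have iw : mu.-integrable `[- A, A] (EFin \o (fun x => wgt e s (x, y))).
    apply: (@slice_integrable _ _ _ 1); first exact: wgt_meas.
    by move=> x; have /andP[? ?] := wgt_ge0 e_gt0 x ok hy; rewrite ger0_norm.
  have iH : mu.-integrable `[- A, A] (EFin \o excess y).
    apply: (@slice_integrable _ _ _ 1); first exact: excess_meas.
    by move=> x; have /andP[? ?] := excess_itv x hy; rewrite ger0_norm.
  have icw : mu.-integrable `[- A, A] (EFin \o (fun x => c * wgt e s (x, y))).
    by have := integrableZl _ c iw; apply.
  have icH : mu.-integrable `[- A, A] (EFin \o (fun x => 2 * excess y x)).
    by have := integrableZl _ 2 iH; apply.
  rewrite -(Rintegral_wgt e_gt0 hin hy) -RintegralZl // -RintegralZl // -RintegralD //.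
  apply: eq_Rintegral => x _; rewrite /dens -mulrDl PE; last exact: Gi.
  by rewrite /excess; ring.
by rewrite !massE // !mulr1 !mulr0 !addr0.
Qed.
End OneSlab.

(** The constants [m] and 0 produce the positive part of [G - m]. The left edge has speed [v] and
    passes [a] at time one up to its smoothed width; the right edge is vertical and far away, with
    only outflow. [B] bounds the flux of the positive part across the left edge. *)
Lemma upper_bound (m v B a b : R) : rh <= m -> m <= th -> 0 <= v ->
  (forall g, 0 <= g <= 1 -> Num.max (f g - f m) 0 - v * Num.max (g - m) 0 <= B) ->
  a <= b ->
  Rintegral mu `[a, b] (fun x => G x 1 - m) <= (th - m) * Num.max (v - a) 0 + B.
Proof.
move=> rm mt v0 hB ab.
have hm : 0 <= m <= 1 by case/andP: hth; case/andP: hrh => *; apply/andP; split; lra.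
have /andP[m0 m1] := hm; have /andP[_ th1] := hth.
apply/ler_addgt0Pl => d d0.
pose e := Num.min (d / 4) 1.
have e0 : 0 < e by rewrite lt_min divr_gt0 //=.
have ed : 4 * e <= d by have : e <= d / 4 by [rewrite ge_min lexx]; lra.
have e1 : e <= 1 by rewrite ge_min lexx orbT.
clearbody e.
have [R0 R0E] : exists R0, R0 = `|a| + `|b| + v + 2 by eexists.
have [A AE] : exists A, A = R0 + 2 + 4 * e by eexists.
have [na nb] := conj (ler_norm a) (ler_norm b).
have na' := ler_norm (- a); have nb' := ler_norm (- b); rewrite !normrN in na' nb'.
have [a0 b0] := conj (normr_ge0 a) (normr_ge0 b).
have A0 : 0 < A by lra.
pose s := Slab (a - v - 2 * e) v R0 0.
have hy y : 0 <= y <= 1 -> 0 <= v * y <= v.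
  by case/andP=> y0 y1; rewrite mulr_ge0 //= ler_piMr.
have ok : slab_ok s by move=> y /hy /andP[? ?]; rewrite /= mul0r; lra.
have hin : slab_in e A s by move=> y /hy /andP[? ?]; rewrite /= mul0r; split; lra.
pose P g := Num.max (g - m) 0.
have P0 g : 0 <= P g by rewrite le_max lexx orbT.
have P01 g : 0 <= g <= 1 -> 0 <= P g <= 1.
  by case/andP=> g0 g1; rewrite P0 /= ge_max ler01 andbT; lra.
have mP : measurable_fun setT P by apply: measurable_maxr => //; apply: measurable_funB.
have PE g : 0 <= g <= 1 -> `|g - m| + `|g - 0| = m + 2 * P g.
  by case/andP=> g0 g1; rewrite subr0 (ger0_norm g0) norm_max /P; ring.
have FE g : 0 <= g <= 1 -> `|f g - f m| + `|f g - f 0| = f m + 2 * Num.max (f g - f m) 0.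
  case/andP=> g0 g1; have fg0 : 0 <= f g by rewrite -f0; apply: f_mono.
  by rewrite f0 subr0 (ger0_norm fg0) norm_max; ring.
have hKA g : 0 <= g <= 1 ->
    `|f g - f m| + `|f g - f 0| - sl_a s * (m + 2 * P g) <= f m - v * m + 2 * B.
  by move=> hg; rewrite FE //= /P; have := hB g hg; lra.
have hKB g : 0 <= g <= 1 -> sl_b s * (m + 2 * P g) - (`|f g - f m| + `|f g - f 0|) <= - f m.
  move=> hg; rewrite FE //= mul0r; have : 0 <= Num.max (f g - f m) 0 by rewrite le_max lexx orbT.
  by lra.
have := excess_inequality e0 A0 ok hin hm z01 mP P01 PE hKA hKB.
have mG1 : measurable_fun setT (fun x => G x 1 - m) by apply: measurable_funB => //; exact: measG.
have low : Rintegral mu `[a, b] (fun x => G x 1 - m) <= Rintegral mu `[- A, A] (excess e P s 1).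
  have [Aa bA] : - A <= a /\ b <= A by split; lra.
  apply: (@Rintegral_sub A a b _ _ 1) => //; first exact: excess_meas.
  - by move=> x; apply: excess_itv.
  - by move=> x; apply: abs_diff01 => //; exact: Gi.
  move=> x /andP[ax xb]; rewrite /excess wgt_mid //= ?mulr1; last 2 first.
  + by lra.
  + by lra.
  by rewrite le_max lexx.
have up : Rintegral mu `[- A, A] (excess e P s 0) <= (th - m) * (Num.max (v - a) 0 + 2 * e).
  have tm : 0 <= th - m by lra.
  have qz : Num.max 0 (a - v - 2 * e) - (a - v - 2 * e) <= Num.max (v - a) 0 + 2 * e.
    by rewrite -[v - a]opprB; apply: max_shift; rewrite mulr_ge0 // ltW.
  apply: le_trans (ler_wpM2l tm qz).
  apply: Rintegral_window => //; [by rewrite le_max lexx orbT|exact: excess_meas| |].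
    move=> x; have /andP[-> _] := excess_itv e0 ok P01 x z01 => /=.
    have /andP[w0 w1] := wgt_ge0 e0 x ok z01.
    rewrite /excess G_init; apply: (@le_trans _ _ (P (if x <= 0 then th else rh))).
      exact: ler_piMr.
    by rewrite ge_max tm andbT; case: ifP => _; rewrite lerD2r // (le_trans rm).
  move=> x [xz|]; first by rewrite /excess wgt_left ?mulr0 //= addr0 ltW.
  rewrite gt_max => /andP[x0 _]; rewrite /excess G_init leNgt x0 /= /P max_r ?mul0r //.
  by rewrite subr_le0.
move: low up; rewrite /=; set I1 := Rintegral _ _ _; set I2 := Rintegral _ _ _; set I3 := Rintegral _ _ _.
move=> low up si.
have te : (th - m) * e <= e by apply: ler_piMl; [exact: ltW|lra].
have me : 0 <= m * e by rewrite mulr_ge0 // ltW.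
set mx := Num.max _ _ in up *.
have E1 : (th - m) * (mx + 2 * e) = (th - m) * mx + 2 * ((th - m) * e) by ring.
have E2 : m * (R0 + 0 - (a - v - 2 * e + v)) = m * (R0 - (a - v - 2 * e)) - v * m by ring.
rewrite E1 in up; rewrite E2 in si.
set t1 := (th - m) * mx in up *; set t2 := (th - m) * e in up te; set t3 := m * (R0 - _) in si.
set t4 := v * m in si; lra.
Qed.

(** The mirror argument with the constants [m] and 1. The right edge has speed [v] and ends at [b];
    the far left edge moves inwards at the maximal speed [Kf], so nothing enters through it. *)
Lemma lower_bound (m v B a b : R) : rh <= m -> m <= th -> 0 <= v ->
  (forall g, 0 <= g <= 1 -> v * Num.max (m - g) 0 - Num.max (f m - f g) 0 <= B) ->
  a <= b ->
  Rintegral mu `[a, b] (fun x => m - G x 1) <= (m - rh) * Num.max (b - v) 0 + B.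
Proof.
move=> rm mt v0 hB ab.
have hm : 0 <= m <= 1 by case/andP: hth; case/andP: hrh => *; apply/andP; split; lra.
have /andP[m0 m1] := hm; have /andP[rh0 _] := hrh; have Kf1 := Kf_ge1.
apply/ler_addgt0Pl => d d0.
pose e := Num.min (d / 4) 1.
have e0 : 0 < e by rewrite lt_min divr_gt0 //=.
have ed : 4 * e <= d by have : e <= d / 4 by [rewrite ge_min lexx]; lra.
have e1 : e <= 1 by rewrite ge_min lexx orbT.
clearbody e.
have [R0 R0E] : exists R0, R0 = `|a| + `|b| + v + Kf + 4 by eexists.
have [A AE] : exists A, A = R0 + 2 + 4 * e by eexists.
have [na nb] := conj (ler_norm a) (ler_norm b).
have na' := ler_norm (- a); have nb' := ler_norm (- b); rewrite !normrN in na' nb'.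
have [a0 b0] := conj (normr_ge0 a) (normr_ge0 b).
have A0 : 0 < A by lra.
pose s := Slab (- R0) Kf (b - v) v.
have hy (w y : R) : 0 <= w -> 0 <= y <= 1 -> 0 <= w * y <= w.
  by move=> w0 /andP[y0 y1]; rewrite mulr_ge0 //= ler_piMr.
have Kf0 : 0 <= Kf by lra.
have ok : slab_ok s.
  by move=> y y01; have /andP[? ?] := hy _ _ v0 y01; have /andP[? ?] := hy _ _ Kf0 y01; rewrite /=; lra.
have hin : slab_in e A s.
  move=> y y01; have /andP[? ?] := hy _ _ v0 y01; have /andP[? ?] := hy _ _ Kf0 y01.
  by rewrite /=; split; lra.
pose P g := Num.max (m - g) 0.
have P0 g : 0 <= P g by rewrite le_max lexx orbT.
have P01 g : 0 <= g <= 1 -> 0 <= P g <= 1.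
  by case/andP=> g0 g1; rewrite P0 /= ge_max ler01 andbT; lra.
have mP : measurable_fun setT P by apply: measurable_maxr => //; apply: measurable_funB.
have PE g : 0 <= g <= 1 -> `|g - m| + `|g - 1| = (1 - m) + 2 * P g.
  case/andP=> g0 g1; rewrite (distrC g m) (norm_max (m - g)) (distrC g 1) ger0_norm ?subr_ge0 // /P; ring.
have FE g : 0 <= g <= 1 -> `|f g - f m| + `|f g - f 1| = (1 - f m) + 2 * Num.max (f m - f g) 0.
  case/andP=> g0 g1; have fg1 : f g <= 1 by rewrite -f1; apply: f_mono.
  by rewrite f1 (distrC (f g) (f m)) (norm_max (f m - f g)) (distrC (f g) 1) ger0_norm ?subr_ge0 //; ring.
have hKA g : 0 <= g <= 1 -> `|f g - f m| + `|f g - f 1| - sl_a s * ((1 - m) + 2 * P g) <=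
    (1 - f m) - Kf * (1 - m).
  move=> hg; rewrite FE //= /P; have /andP[g0 g1] := hg.
  have : Num.max (f m - f g) 0 <= Kf * Num.max (m - g) 0.
    have [gm|gm] := leP (m - g) 0.
      by rewrite mulr0 ge_max lexx andbT subr_le0 f_mono //; lra.
    rewrite ge_max f_lip //=; last by lra.
    by apply: mulr_ge0; lra.
  by lra.
have hKB g : 0 <= g <= 1 -> sl_b s * ((1 - m) + 2 * P g) - (`|f g - f m| + `|f g - f 1|) <=
    v * (1 - m) - (1 - f m) + 2 * B.
  by move=> hg; rewrite FE //= /P; have := hB g hg; lra.
have := excess_inequality e0 A0 ok hin hm o01 mP P01 PE hKA hKB.
have mG1 : measurable_fun setT (fun x => m - G x 1) by apply: measurable_funB => //; exact: measG.
have low : Rintegral mu `[a, b] (fun x => m - G x 1) <= Rintegral mu `[- A, A] (excess e P s 1).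
  have [Aa bA] : - A <= a /\ b <= A by split; lra.
  apply: (@Rintegral_sub A a b _ _ 1) => //; first exact: excess_meas.
  - by move=> x; apply: excess_itv.
  - by move=> x; apply: abs_diff01 => //; exact: Gi.
  move=> x /andP[ax xb]; rewrite /excess wgt_mid //= ?mulr1; last 2 first.
  + by lra.
  + by rewrite subrK.
  by rewrite le_max lexx.
have up : Rintegral mu `[- A, A] (excess e P s 0) <= (m - rh) * (Num.max (b - v) 0 + 2 * e).
  have tm : 0 <= m - rh by lra.
  have qz : Num.max (b - v) 0 + 2 * e - 0 <= Num.max (b - v) 0 + 2 * e by rewrite subr0.
  have mx0 : 0 <= Num.max (b - v) 0 by rewrite le_max lexx orbT.
  apply: le_trans (ler_wpM2l tm qz).
  apply: Rintegral_window => //; [by rewrite addr_ge0 // mulr_ge0 // ltW|exact: excess_meas| |].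
    move=> x; have /andP[-> _] := excess_itv e0 ok P01 x z01 => /=.
    have /andP[w0 w1] := wgt_ge0 e0 x ok z01.
    rewrite /excess G_init; apply: (@le_trans _ _ (P (if x <= 0 then th else rh))).
      exact: ler_piMr.
    by rewrite ge_max tm andbT; case: ifP => _; rewrite lerD2l lerN2 // (le_trans rm).
  move=> x [x0|xb].
    by rewrite /excess G_init ltW //= /P max_r ?mul0r // subr_le0.
  rewrite /excess wgt_right ?mulr0 //= addr0; apply: le_trans (ltW xb).
  by rewrite lerD2r le_max lexx.
move: low up; rewrite /=; set I1 := Rintegral _ _ _; set I2 := Rintegral _ _ _; set I3 := Rintegral _ _ _.
move=> low up si.
have te : (m - rh) * e <= e by apply: ler_piMl; [exact: ltW|lra].
set mx := Num.max _ _ in up *.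
have E1 : (m - rh) * (mx + 2 * e) = (m - rh) * mx + 2 * ((m - rh) * e) by ring.
have E2 : (1 - m) * (b - v + v - (- R0 + Kf)) = (1 - m) * (b - v - - R0) + v * (1 - m) - Kf * (1 - m) by ring.
rewrite E1 in up; rewrite E2 in si.
set t1 := (m - rh) * mx in up *; set t2 := (m - rh) * e in up te.
set t3 := (1 - m) * (b - v - - R0) in si.
set t4 := v * (1 - m) in si; set t5 := Kf * (1 - m) in si; lra.
Qed.

(** Two slabs share an edge of speed [s]; the distance to [th] is measured on its left and the
    distance to [rh] on its right. By the hypothesis on [g] their sum has no gain across the edge,
    and initially it comes only from a layer of order [e] around the origin. The range of [al] lets
    that layer be put on either side of the shock. *)
Lemma shock_mass (s al e a b : R) : th <= rh -> 0 <= s -> s <= Kf ->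
  (forall g, 0 <= g <= 1 -> s * `|g - th| - `|f g - f th| + `|f g - f rh| - s * `|g - rh| <= 0) ->
  a <= b -> 0 < e -> e <= 1 -> - (2 * e) <= al -> al <= 0 ->
  (b <= al + s -> Rintegral mu `[a, b] (fun x => `|G x 1 - th|) <= 4 * e) /\
  (al + s + 2 * e <= a -> Rintegral mu `[a, b] (fun x => `|G x 1 - rh|) <= 4 * e).
Proof.
move=> thrh s0 sK hs ab e0 e1 al0 al1; have Kf1 := Kf_ge1.
have [R0 R0E] : exists R0, R0 = `|a| + `|b| + s + Kf + 8 by eexists.
have [A AE] : exists A, A = R0 + 2 + 4 * e by eexists.
have [na nb] := conj (ler_norm a) (ler_norm b).
have na' := ler_norm (- a); have nb' := ler_norm (- b); rewrite !normrN in na' nb'.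
have [a0 b0] := conj (normr_ge0 a) (normr_ge0 b).
have A0 : 0 < A by lra.
pose sL := Slab (- R0) Kf al s; pose sR := Slab al s R0 0.
have hy (w y : R) : 0 <= w -> 0 <= y <= 1 -> 0 <= w * y <= w.
  by move=> w0 /andP[y0 y1]; rewrite mulr_ge0 //= ler_piMr.
have Kf0 : 0 <= Kf by lra.
have okL : slab_ok sL.
  by move=> y y01; have /andP[? ?] := hy _ _ s0 y01; have /andP[? ?] := hy _ _ Kf0 y01; rewrite /=; lra.
have okR : slab_ok sR.
  by move=> y y01; have /andP[? ?] := hy _ _ s0 y01; rewrite /= mul0r; lra.
have hinL : slab_in e A sL.
  move=> y y01; have /andP[? ?] := hy _ _ s0 y01; have /andP[? ?] := hy _ _ Kf0 y01.
  by rewrite /=; split; lra.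
have hinR : slab_in e A sR.
  by move=> y y01; have /andP[? ?] := hy _ _ s0 y01; rewrite /= mul0r; split; lra.
have fb p g : 0 <= g <= 1 ->
  (`|g - th| * wgty e sL p + `|f g - f th| * wgtx e sL p)
  + (`|g - rh| * wgty e sR p + `|f g - f rh| * wgtx e sR p)
  <= 0 * (dstep (aff e al s p) / e) + 0 * (dstep (aff e al s p) / e).
  move=> hg; have /andP[g0 g1] := hg.
  have lL : `|f g - f th| - Kf * `|g - th| <= 0.
    have /andP[t0 t1] := hth; rewrite subr_le0.
    have [gt|tg] := leP g th.
      rewrite (distrC (f g)) (distrC g) !ger0_norm ?subr_ge0 ?f_mono //.
      exact: f_lip.
    have fge : 0 <= f g - f th by rewrite subr_ge0 f_mono // ltW.
    have gge : 0 <= g - th by rewrite subr_ge0 ltW.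
    rewrite (ger0_norm fge) (ger0_norm gge).
    by apply: f_lip => //; exact: ltW.
  have lR : 0 * `|g - rh| - `|f g - f rh| <= 0 by rewrite mul0r sub0r oppr_le0.
  have h1 := @line_flux e `|g - th| `|f g - f th| 0 (s * `|g - th| - `|f g - f th|) sL p e0 lL (lexx _).
  have h2 := @line_flux e `|g - rh| `|f g - f rh| (`|f g - f rh| - s * `|g - rh|) 0 sR p e0 (lexx _) lR.
  apply: le_trans (lerD h1 h2) _; rewrite /= !mul0r add0r !addr0 -mulrDl.
  apply: mulr_le0_ge0; first by have := hs g hg; lra.
  by apply: divr_ge0; [exact: dstep_ge0|exact: ltW].
have l1 y : 0 <= y <= 1 -> - A <= al + s * y <= A - 2 * e by move=> /hinR[-> ->].
have := slab_inequality f_mono f_lip f0 f1 hG e0 A0 okL okR hinL hinR hth hrh l1 l1 fb.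
rewrite !addr0 => mass_le.
have dm y := @dens_meas R f _ G hG e sL sR th rh y.
have di y x (hy' : 0 <= y <= 1) := @dens_itv R f _ G hG e e0 sL sR th rh okL okR hth hrh y x hy'.
have m0 : mass_at G e A sL sR th rh 0 <= 4 * e.
  have := @Rintegral_window A (- (2 * e)) (2 * e) 1 (dens G e sL sR th rh 0).
  rewrite opprK mul1r => W; apply: le_trans (W _ _ _ _) _ => //; try by lra.
    move=> x; have /andP[-> _] := di 0 x z01 => /=.
    have /andP[w0 w1] := wgt_ge0 e0 x okL z01; have /andP[w0' w1'] := wgt_ge0 e0 x okR z01.
    have d1 := abs_diff01 hrh hth.
    rewrite /dens G_init; case: ifP => _; rewrite subrr normr0 mul0r ?add0r ?addr0.
      by rewrite mulr_ile1 // distrC.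
    by rewrite mulr_ile1.
  move=> x [xl|xr]; rewrite /dens G_init.
    have -> : x <= 0 by lra.
    by rewrite subrr normr0 mul0r add0r wgt_left ?mulr0 //= ?addr0; lra.
  have -> : (x <= 0) = false by apply/negbTE; rewrite -ltNge; lra.
  by rewrite subrr normr0 mul0r addr0 wgt_right ?mulr0 //= ?addr0; lra.
have [Aa bA] : - A <= a /\ b <= A by split; lra.
have mA c : measurable_fun setT (fun x => `|G x 1 - c|).
  by apply: measurableT_comp => //; apply: measurable_funB => //; exact: measG.
have bd c : 0 <= c <= 1 -> forall x, `| `|G x 1 - c| | <= 2.
  by move=> hc x; rewrite normr_id; apply: le_trans (abs_diff01 (Gi x o01) hc) _; rewrite ler1n.
have fin (g : R -> R) : measurable_fun setT g -> (forall x, `|g x| <= 2) ->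
    (forall x, a <= x <= b -> g x <= dens G e sL sR th rh 1 x) -> Rintegral mu `[a, b] g <= 4 * e.
  move=> mg gb gd; apply: le_trans (le_trans mass_le m0).
  by apply: (@Rintegral_sub A a b _ _ 2) => // x; apply: di.
split=> hb; apply: fin => //; try exact: bd; move=> x /andP[ax xb]; rewrite /dens.
  have /andP[w0 w1] := wgt_ge0 e0 x okR o01.
  rewrite (wgt_mid e0) /= ?mulr1; [|by lra|by lra].
  by rewrite lerDl mulr_ge0.
have /andP[w0 w1] := wgt_ge0 e0 x okL o01.
rewrite (wgt_mid e0 (s := sR)) /= ?mulr1 ?mul0r ?addr0; [|by lra|by lra].
by rewrite lerDr mulr_ge0.
Qed.
End RiemannBounds.

(** * Integrals of the entropy solution at time one *)

Section EntropyHeight.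
Variables (R : realType) (b1 b2 th rh : R) (G : R -> R -> R).
Hypotheses (b12 : b1 < b2) (b2_lt1 : b2 < 1).
Hypotheses (hth : 0 <= th <= 1) (hrh : 0 <= rh <= 1).
Local Notation mu := (@lebesgue_measure R).
Local Notation ka := (kappa b1 b2).
Local Notation ph := (phi b1 b2).
Hypothesis hG : entropy_solution ph (fun x => if x <= 0 then th else rh) G.

Let ph_mono u v : 0 <= u -> u <= v -> v <= 1 -> ph u <= ph v.
Proof. by move=> u0 uv _; exact: le_phi. Qed.
Let ph_lip u v : 0 <= u -> u <= v -> v <= 1 -> ph v - ph u <= ka * (v - u).
Proof. by move=> u0 uv _; exact: phi_lip. Qed.
Let ph0 : ph 0 = 0. Proof. exact: phi0. Qed.
Let ph1 : ph 1 = 1. Proof. exact: phi1. Qed.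
Let Gi := G_itv hG.
Let o01 : 0 <= (1 : R) <= 1. Proof. by rewrite ler01 lexx. Qed.

Lemma final_integrable a b (h : R -> R) (C : R) : measurable_fun setT h -> (forall x, `|h x| <= C) ->
  mu.-integrable `[a, b] (EFin \o h).
Proof. exact: bounded_integrable. Qed.

Lemma G1_integrable a b : mu.-integrable `[a, b] (EFin \o (fun x => G x 1)).
Proof.
apply: (@final_integrable _ _ _ 1); first exact: (G_slice_meas hG).
by move=> x; have /andP[? ?] := Gi x o01; rewrite ger0_norm.
Qed.

Lemma cst_integrable a b (c : R) : mu.-integrable `[a, b] (EFin \o (fun=> c)).
Proof. by apply: (@final_integrable _ _ _ `|c|). Qed.

Lemma Rintegral_itv_cst a b (c : R) : a <= b -> Rintegral mu `[a, b] (fun=> c) = c * (b - a).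
Proof. by move=> ab; rewrite /Rintegral integral_itv_cst. Qed.

Lemma Rintegral_G1B a b m : a <= b ->
  Rintegral mu `[a, b] (fun x => G x 1 - m) = Rintegral mu `[a, b] (fun x => G x 1) - m * (b - a).
Proof.
move=> ab; rewrite (RintegralB _ (G1_integrable a b) (cst_integrable a b m)) //.
by rewrite Rintegral_itv_cst.
Qed.

Lemma Rintegral_BG1 a b m : a <= b ->
  Rintegral mu `[a, b] (fun x => m - G x 1) = m * (b - a) - Rintegral mu `[a, b] (fun x => G x 1).
Proof.
move=> ab; rewrite (RintegralB _ (cst_integrable a b m) (G1_integrable a b)) //.
by rewrite Rintegral_itv_cst.
Qed.

Lemma dphi_lt u v : 0 <= u -> u < v -> dphi b1 b2 v < dphi b1 b2 u.
Proof.
move=> u0 uv; have v0 := ltW (le_lt_trans u0 uv).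
have k0 := kappa_gt0 b12 b2_lt1; have k1 := kappa_gt1 b12 b2_lt1.
have du := phi_den_gt0 b12 b2_lt1 u0; have dv := phi_den_gt0 b12 b2_lt1 v0.
rewrite /dphi ltr_pM2l // ltf_pV2 ?posrE ?exprn_gt0 // ltr_pXn2r ?nnegrE ?ltW //.
by rewrite /phi_den ltrD2r ltr_pM2l // subr_gt0.
Qed.

Lemma fan_cases x l : fan b1 b2 th rh x l ->
  [\/ x < dphi b1 b2 l /\ l = th, x = dphi b1 b2 l | dphi b1 b2 l < x /\ l = rh].
Proof.
case=> _ _; rewrite /h_init.
have [xl|xl|xl] := ltgtP x (dphi b1 b2 l).
- rewrite subr_le0 (ltW xl) => /mulIf; rewrite subr_eq0 lt_eqF // => /(_ isT) /oppr_inj <-.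
  by constructor 1.
- rewrite subr_le0 leNgt xl /= => /mulIf; rewrite subr_eq0 gt_eqF // => /(_ isT) /oppr_inj <-.
  by constructor 3.
- by constructor 2.
Qed.

Lemma fan_anti a b la lb : a <= b -> fan b1 b2 th rh a la -> fan b1 b2 th rh b lb -> lb <= la.
Proof.
move=> ab fa fb; have [ra ta _] := fa; have [rb tb _] := fb.
case: (fan_cases fa) => [[_ ->//]| ea |[ea la_rh]]; case: (fan_cases fb) => [[eb _]| eb|[_ -> //]].
all: rewrite leNgt; apply/negP => lab; have := dphi_lt (le_trans (andP hrh).1 ra) lab; lra.
Qed.

(** The upper bound takes the level [lb] and the characteristic speed of [la], the lower bound the
    level [la] and the speed of [lb]. The tangents of [phi] at [la] and [lb] give the constants [B],
    and the two bounds coincide. *)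
Lemma entropy_height_rarefaction a b la lb : a <= b -> fan b1 b2 th rh a la ->
  fan b1 b2 th rh b lb ->
  Rintegral mu `[a, b] (fun x => G x 1) = (ph la - la * a) - (ph lb - lb * b).
Proof.
move=> ab fa fb; have [ra ta _] := fa; have [rb tb _] := fb; have ba := fan_anti ab fa fb.
have rh0 : 0 <= rh by case/andP: hrh.
have la0 := le_trans rh0 ra; have lb0 := le_trans rh0 rb.
have tan u v (u0 : 0 <= u) (v0 : 0 <= v) := phi_tangent b12 b2_lt1 u0 v0.
apply/eqP; rewrite eq_le; apply/andP; split.
- have hB g : 0 <= g <= 1 -> Num.max (ph g - ph lb) 0 - dphi b1 b2 la * Num.max (g - lb) 0 <=
     ph la - ph lb - dphi b1 b2 la * (la - lb).
    case/andP=> g0 g1; have [gl|lg] := leP (g - lb) 0.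
      rewrite mulr0 subr0 max_r; first by have := tan lb la lb0 la0; lra.
      by rewrite subr_le0; apply: ph_mono => //; case/andP: hth => *; lra.
    rewrite max_l; first by have := tan g la g0 la0; lra.
    by rewrite subr_ge0; apply: ph_mono => //; lra.
  have := upper_bound ph_mono ph_lip ph0 ph1 hG hth hrh rb tb (dphi_ge0 b12 b2_lt1 la0) hB ab.
  rewrite Rintegral_G1B // => ub.
  have key : (th - lb) * Num.max (dphi b1 b2 la - a) 0 <= (la - lb) * (dphi b1 b2 la - a).
    case: (fan_cases fa) => [[xa e]|->|[xa e]].
    - by rewrite max_l; [rewrite e|rewrite subr_ge0 ltW].
    - by rewrite subrr maxxx !mulr0.
    - have -> : lb = la by apply/eqP; rewrite eq_le ba e rb.
      by rewrite max_r; [rewrite mulr0 subrr mul0r|rewrite subr_le0 ltW].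
  move: ub key; set I := Rintegral _ _ _; set M := (th - lb) * _; set D := dphi _ _ _; lra.
- have hB g : 0 <= g <= 1 -> dphi b1 b2 lb * Num.max (la - g) 0 - Num.max (ph la - ph g) 0 <=
     ph lb - ph la + dphi b1 b2 lb * (la - lb).
    case/andP=> g0 g1; have [gl|lg] := leP (la - g) 0.
      rewrite mulr0 sub0r max_r; first by have := tan la lb la0 lb0; lra.
      by rewrite subr_le0; apply: ph_mono => //; lra.
    rewrite max_l; first by have := tan g lb g0 lb0; lra.
    by rewrite subr_ge0; apply: ph_mono => //; case/andP: hth => *; lra.
  have := lower_bound ph_mono ph_lip ph0 ph1 hG hth hrh ra ta (dphi_ge0 b12 b2_lt1 lb0) hB ab.
  rewrite Rintegral_BG1 // => ub.
  have key : (la - rh) * Num.max (b - dphi b1 b2 lb) 0 <= (la - lb) * (b - dphi b1 b2 lb).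
    case: (fan_cases fb) => [[xb e]|->|[xb e]].
    - have <- : lb = la by apply/eqP; rewrite eq_le ba e ta.
      by rewrite max_r; [rewrite mulr0 subrr mul0r|rewrite subr_le0 ltW].
    - by rewrite subrr maxxx !mulr0.
    - by rewrite max_l; [rewrite e|rewrite subr_ge0 ltW].
  move: ub key; set I := Rintegral _ _ _; set M := (la - rh) * _; set D := dphi _ _ _; lra.
Qed.

Lemma shock_entropy g : th < rh -> 0 <= g <= 1 ->
  slope b1 b2 th rh * `|g - th| - `|ph g - ph th| + `|ph g - ph rh|
   - slope b1 b2 th rh * `|g - rh| <= 0.
Proof.
move=> tr /andP[g0 g1]; have /andP[t0 t1] := hth; have /andP[r0 r1] := hrh.
have E := slopeE b12 b2_lt1 t0 r0; set s := slope b1 b2 th rh in E *.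
have [gt|tg] := leP g th.
  have gr := le_trans gt (ltW tr).
  have h1 := ph_mono g0 gt t1; have h2 := ph_mono g0 gr r1.
  rewrite (distrC g th) (distrC g rh) (distrC (ph g) (ph th)) (distrC (ph g) (ph rh)).
  by rewrite !ger0_norm ?subr_ge0 //; lra.
have h1 := ph_mono t0 (ltW tg) g1.
have [gr|rg] := leP g rh.
  have h2 := ph_mono g0 gr r1; have c := phi_chord_in b12 b2_lt1 t0 (ltW tg) gr.
  rewrite -/s in c; rewrite (distrC g rh) (distrC (ph g) (ph rh)).
  by rewrite !ger0_norm ?subr_ge0 ?(ltW tg) //; lra.
have h2 := ph_mono r0 (ltW rg) g1.
by rewrite !ger0_norm ?subr_ge0 ?(ltW tg) ?(ltW rg) //; lra.
Qed.

Lemma Rintegral_close a b m : a <= b ->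
  (forall e, 0 < e -> e <= 1 -> Rintegral mu `[a, b] (fun x => `|G x 1 - m|) <= 4 * e) ->
  Rintegral mu `[a, b] (fun x => G x 1) = m * (b - a).
Proof.
move=> ab small; apply/eqP; rewrite -subr_eq0 -Rintegral_G1B // -normr_le0.
apply/ler_addgt0Pl => d d0; rewrite addr0.
have iB : mu.-integrable `[a, b] (EFin \o (fun x => G x 1 - m)).
  apply: (@final_integrable _ _ _ (1 + `|m|)).
    by apply: measurable_funB => //; exact: (G_slice_meas hG).
  move=> x; apply: le_trans (ler_normB _ _) _; rewrite lerD2r.
  by have /andP[? ?] := Gi x o01; rewrite ger0_norm.
apply: le_trans (le_normr_Rintegral _ iB) _; first by [].
pose e := Num.min (d / 4) 1.
have e0 : 0 < e by rewrite lt_min divr_gt0 //=.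
have e1 : e <= 1 by rewrite ge_min lexx orbT.
have ed : e <= d / 4 by rewrite ge_min lexx.
by apply: le_trans (small e e0 e1) _; lra.
Qed.

(** The solution is identified as [th] up to the shock and [rh] beyond it. The edge offset is 0 for
    the left part and [- (2 * e)] for the right part, so that both reach the shock position
    exactly. *)
Lemma entropy_height_shock a b : th < rh -> a <= b ->
  Rintegral mu `[a, b] (fun x => G x 1) = shock_height b1 b2 th rh a - shock_height b1 b2 th rh b.
Proof.
move=> tr; have /andP[t0 t1] := hth; have /andP[r0 r1] := hrh.
have s0 := slope_ge0 b12 b2_lt1 t0 r0; have sK := slope_le b12 b2_lt1 t0 r0.
have se g (hg : 0 <= g <= 1) := shock_entropy tr hg.
rewrite /shock_height /h_init; set s := slope b1 b2 th rh in s0 sK se *.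
have left_ x y : x <= y -> y <= s -> Rintegral mu `[x, y] (fun x => G x 1) = th * (y - x).
  move=> xy ys; apply: Rintegral_close => // e e0 e1.
  have [+ _] := @shock_mass R ph G ka th rh ph_mono ph_lip ph0 ph1 hG hth hrh s 0 e x y (ltW tr) s0 sK se xy e0 e1 ltac:(lra) (lexx 0).
  by rewrite add0r; apply.
have right_ x y : x <= y -> s <= x -> Rintegral mu `[x, y] (fun x => G x 1) = rh * (y - x).
  move=> xy sx; apply: Rintegral_close => // e e0 e1.
  have [_] := @shock_mass R ph G ka th rh ph_mono ph_lip ph0 ph1 hG hth hrh s (- (2 * e)) e x y (ltW tr) s0 sK se xy e0 e1 (lexx _) ltac:(lra).
  by apply; lra.
move=> ab; rewrite !subr_le0.
have [bs|sb] := leP b s.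
  by have as_ := le_trans ab bs; rewrite as_ left_ //; ring.
have [as_|sa] := leP a s; last by rewrite (right_ _ _ ab (ltW sa)) /=; ring.
have := @Rintegral_itvB R (fun x => G x 1) (BLeft a) (BRight b) s (G1_integrable a b).
rewrite !bnd_simp => /(_ as_ (ltW sb)) /eqP; rewrite subr_eq => /eqP ->.
rewrite Rintegral_itv_obnd_cbnd; last first.
  apply: integrableS (G1_integrable a b) => //.
  by move=> x; rewrite /= !in_itv /= => /andP[? ->]; rewrite andbT; lra.
by rewrite (left_ _ _ as_ (lexx s)) (right_ _ _ (ltW sb) (lexx s)) /=; ring.
Qed.

Lemma entropy_height a b ha hb : a <= b -> limit_height b1 b2 th rh a ha ->
  limit_height b1 b2 th rh b hb -> Rintegral mu `[a, b] (fun x => G x 1) = ha - hb.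
Proof.
move=> ab; rewrite /limit_height; case: (leP rh th) => [_ [la fa ->] [lb fb ->]|tr -> ->].
  exact: entropy_height_rarefaction.
exact: entropy_height_shock.
Qed.

End EntropyHeight.

(** * Law of the truncated process *)

Section IndependentWeights.
Variables (d : measure_display) (T : measurableType d) (R : realType) (P : probability T R).
Variables (I : eqType) (X : I -> T -> nat).
Hypothesis mX : forall i v, measurable [set w | X i w = v].
Hypothesis indX : mutually_independent P X.

Definition cyl (s : seq (I * nat)) : set T := [set w | all (fun p => X p.1 w == p.2) s].
Definition fp (i : I) (v : nat) : R := fine (P [set w | X i w = v]).
Definition cyl_weight (s : seq (I * nat)) : R := \prod_(p <- s) fp p.1 p.2.

(* [A] has probability [q] and is independent of the variables with index in [S]. *)
Definition iw (A : set T) (q : R) (S : pred I) : Prop :=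
  measurable A /\ forall s, uniq (unzip1 s) -> all S (unzip1 s) ->
    P (A `&` cyl s) = (q * cyl_weight s)%:E.

Lemma fpE i v : P [set w | X i w = v] = (fp i v)%:E.
Proof. by rewrite /fp fineK // fin_num_measure. Qed.

Lemma cyl_cons i v s : cyl ((i, v) :: s) = [set w | X i w = v] `&` cyl s.
Proof. by apply/seteqP; split=> w; rewrite /cyl /=; [case/andP=> /eqP|case=> -> ->; rewrite eqxx]. Qed.

Lemma cyl_nil : cyl [::] = setT.
Proof. by apply/seteqP; split. Qed.

Lemma measurable_cyl s : measurable (cyl s).
Proof.
elim: s => [|[i v] s IH]; first by rewrite cyl_nil.
by rewrite cyl_cons; apply: measurableI.
Qed.

Lemma iw_setT : iw setT 1 predT.
Proof.
split=> // s us _; rewrite setTI mul1r.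
pose v i := nth 0%N (unzip2 s) (index i (unzip1 s)).
have vE p : p \in s -> v p.1 = p.2.
  move=> ps; have sz : (index p s < size s)%N by rewrite index_mem.
  have -> : p.1 = nth p.1 (unzip1 s) (index p s).
    by rewrite (nth_map p) // nth_index.
  rewrite /v index_uniq ?size_map // (nth_map p) // nth_index //.
have -> : cyl s = \bigcap_(i in [set i | i \in unzip1 s]) [set w | X i w = v i].
  apply/seteqP; split=> w /=.
    move=> /allP h i /mapP[p ps ->] /=; rewrite vE //; exact/eqP/h.
  by move=> h; apply/allP => p ps /=; rewrite -vE //; apply/eqP/(h p.1); rewrite /= map_f.
rewrite indX // big_map /cyl_weight -prodEFin.
by apply: eq_big_seq => p ps; rewrite vE // fpE.
Qed.

Lemma iw_sub A q (S S' : pred I) : iw A q S -> (forall i, S' i -> S i) -> iw A q S'.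
Proof. by move=> [mA h] sub; split=> // s us /(sub_all sub) /(h s us). Qed.

Lemma iw_prob A q S : iw A q S -> P A = q%:E.
Proof. by move=> [_ /(_ [::] isT isT)]; rewrite cyl_nil setIT /cyl_weight big_nil mulr1. Qed.

Lemma iw_eq A q S i v : iw A q S -> S i ->
  iw (A `&` [set w | X i w = v]) (q * fp i v) (fun j => (j != i) && S j).
Proof.
move=> [mA h] Si; split; first exact: measurableI.
move=> s us als; rewrite -setIA -cyl_cons h /=; last 2 first.
- by rewrite us andbT; apply/negP => /(allP als); rewrite eqxx.
- by rewrite Si /=; apply: sub_all als => j /andP[].
by rewrite /cyl_weight big_cons /= mulrA.
Qed.

Lemma iw_diff A B q q' S : B `<=` A -> iw A q S -> iw B q' S -> iw (A `\` B) (q - q') S.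
Proof.
move=> BA [mA hA] [mB hB]; split; first exact: measurableD.
move=> s us als; have mC := measurable_cyl s.
have -> : (A `\` B) `&` cyl s = (A `&` cyl s) `\` (B `&` cyl s).
  apply/seteqP; split=> w; first by move=> [[Aw nB] Cw]; split=> // -[].
  by move=> [[Aw Cw] nB]; split=> //; split=> // Bw; apply: nB.
rewrite measureD; [|exact: measurableI..|by rewrite ltey_eq fin_num_measure //; exact: measurableI].
have -> : A `&` cyl s `&` (B `&` cyl s) = B `&` cyl s.
  by apply/seteqP; split=> w; [move=> [_]|move=> [Bw Cw]; do 2 split=> //; apply: BA].
transitivity ((q * cyl_weight s)%:E - (q' * cyl_weight s)%:E)%E.
  by congr (_ - _)%E; [exact: hA|exact: hB].
by rewrite -EFinB mulrBl.
Qed.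

Lemma iw_notin A q S i vs : iw A q S -> S i -> uniq vs ->
  iw (A `&` [set w | X i w \notin vs]) (q * (1 - \sum_(v <- vs) fp i v)) (fun j => (j != i) && S j).
Proof.
move=> hA Si; elim: vs => [_|v vs IH /= /andP[nv uv]].
  rewrite big_nil subr0 mulr1 (_ : _ `&` _ = A); last by apply/seteqP; split=> w // [].
  by apply: iw_sub hA _ => j /andP[].
have -> : A `&` [set w | X i w \notin v :: vs] =
    (A `&` [set w | X i w \notin vs]) `\` (A `&` [set w | X i w = v]).
  apply/seteqP; split=> w /=; rewrite in_cons negb_or.
    by move=> [Aw /andP[/eqP ne ni]]; split=> // -[_ /ne].
  by move=> [[Aw ni] ne]; split=> //; rewrite ni andbT; apply/eqP => e; apply: ne.
rewrite big_cons opprD addrCA [X in q * X]addrC mulrDr mulrN.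
apply: iw_diff; [|exact: IH|exact: iw_eq].
by move=> w /= [Aw ->].
Qed.

Lemma iw_neq A q S i v : iw A q S -> S i ->
  iw (A `&` [set w | X i w <> v]) (q * (1 - fp i v)) (fun j => (j != i) && S j).
Proof.
move=> hA Si; have := iw_notin hA Si (isT : uniq [:: v]).
rewrite big_seq1; congr iw; apply/seteqP; split=> w /=; rewrite inE => -[Aw].
  by move/eqP.
by move=> ne; split=> //; apply/eqP.
Qed.

Lemma iw_set0 S : iw set0 0 S.
Proof. by split=> // s _ _; rewrite set0I measure0 mul0r. Qed.

Lemma iw_setU A B q q' S : A `&` B = set0 -> iw A q S -> iw B q' S -> iw (A `|` B) (q + q') S.
Proof.
move=> AB [mA hA] [mB hB]; split; first exact: measurableU.
move=> s us als; have mC := measurable_cyl s.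
rewrite setIUl measureU; [|exact: measurableI..|].
  transitivity ((q * cyl_weight s)%:E + (q' * cyl_weight s)%:E)%E.
    by congr (_ + _)%E; [exact: hA|exact: hB].
  by rewrite -EFinD mulrDl.
by rewrite setIACA AB set0I.
Qed.

Lemma iw_bigU (K : eqType) (r : seq K) (A : K -> set T) (q : K -> R) S : uniq r ->
  (forall k k' w, A k w -> A k' w -> k = k') -> (forall k, k \in r -> iw (A k) (q k) S) ->
  iw [set w | exists2 k, k \in r & A k w] (\sum_(k <- r) q k) S.
Proof.
move=> + dA; elim: r => [_ _|k r IH /= /andP[nk ur] h].
  rewrite big_nil (_ : [set w | _] = set0); first exact: iw_set0.
  by apply/seteqP; split=> w // -[].
rewrite big_cons (_ : [set w | _] = A k `|` [set w | exists2 k, k \in r & A k w]).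
  apply: iw_setU; [|by apply: h; rewrite mem_head|].
    apply/seteqP; split=> w // -[Ak [k' k'r Ak']]; move: nk.
    by rewrite (dA _ _ _ Ak Ak') k'r.
  by apply: IH => // k' k'r; apply: h; rewrite in_cons k'r orbT.
apply/seteqP; split=> w /=.
  by move=> [k']; rewrite in_cons => /predU1P[->|k'r] Aw; [left|right; exists k'].
by move=> [Aw|[k' k'r Aw]]; [exists k; rewrite ?mem_head|exists k'; rewrite // in_cons k'r orbT].
Qed.

End IndependentWeights.

Fixpoint grow (es : seq bool) (x : int) (h : option int) (c : int -> bool) (jj : int -> nat)
    : seq bool :=
  if es is e :: es' then
    let r := local_rule e (c x) (jj x) x h in r.1 :: grow es' (x + 1) r.2 c jj
  else [::].

Lemma iota_rcons r : iota 1 r.+1 = iota 1 r ++ [:: r.+1].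
Proof. by rewrite -{1}[r.+1]addn1 iotaD. Qed.

Section RowLaw.
Variables (R : realType) (d : measure_display) (T : measurableType d) (P : probability T R).
Variables (b1 b2 theta rho : R) (eta0 : int -> T -> bool) (chi : nat -> int -> T -> bool)
  (jmp : nat -> int -> T -> nat).
Hypotheses (b1_gt0 : 0 < b1) (b12 : b1 < b2) (b2_lt1 : b2 < 1).
Hypothesis hmeas : forall (i : idx) (v : nat), measurable [set w | drive_rv eta0 chi jmp i w = v].
Hypothesis hindep : mutually_independent P (drive_rv eta0 chi jmp).
Hypothesis hlaw0 : forall x : int, P [set w | eta0 x w] = (if x <= 0 then theta else rho)%:E.
Hypothesis hlawchi : forall (t : nat) (x : int), P [set w | chi t x w] = b1%:E.
Hypothesis hlawj : forall (t : nat) (x : int) (r : nat), (0 < r)%N ->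
  P [set w | jmp t x w = r] = ((1 - b2) * b2 ^+ r.-1)%:E.

Local Notation X := (drive_rv eta0 chi jmp).
Local Notation iw := (iw P X).
Local Notation fp := (fp P X).
Local Notation dcoins := (dcoins b1 b2).
Local Notation dcoin := (dcoin b1 b2).

Definition idens (x : int) : R := if x <= 0 then theta else rho.

Lemma fp_init x : fp (inl (inl x)) 1 = idens x.
Proof.
rewrite /fp (_ : [set w | _] = [set w | eta0 x w]) ?hlaw0 //.
by apply/seteqP; split=> w /=; case: (eta0 x w).
Qed.

Lemma fp_chi t x : fp (inl (inr (t, x))) 1 = b1.
Proof.
rewrite /fp (_ : [set w | _] = [set w | chi t x w]) ?hlawchi //.
by apply/seteqP; split=> w /=; case: (chi t x w).
Qed.

Lemma fp_jmp t x r : fp (inr (t, x)) r.+1 = (1 - b2) * b2 ^+ r.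
Proof. by rewrite /fp /= hlawj. Qed.

Lemma sum_fp_jmp t x r : 1 - \sum_(v <- iota 1 r) fp (inr (t, x)) v = b2 ^+ r.
Proof.
elim: r => [|r IH]; first by rewrite big_nil subr0 expr0.
rewrite iota_rcons big_cat big_seq1 /= opprD addrA IH fp_jmp exprS; ring.
Qed.

(* Indices of the variables not read before the visit of site [x] in step [t]. *)
Definition fresh (t : nat) (x : int) (i : idx) : bool :=
  match i with
  | inl (inl _) => false
  | inl (inr (s, y)) | inr (s, y) => (t < s)%N || (s == t) && (x <= y)
  end.
Definition later (t : nat) (i : idx) : bool :=
  match i with
  | inl (inl _) => false
  | inl (inr (s, y)) | inr (s, y) => (t <= s)%N
  end.

Lemma fresh_step t x i : fresh t (x + 1) i -> fresh t x i.
Proof.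
by case: i => [[y|[s y]]|[s y]] //= /orP[->//|/andP[-> ?]]; apply/orP; right => /=; lia.
Qed.

Lemma fresh_later t x i : later t.+1 i -> fresh t x i.
Proof. by case: i => [[y|[s y]]|[s y]] //= ->. Qed.

Definition row_weight (h : bool) (es out : seq bool) : R :=
  Ex (dcoins (size es)) (fun cs => (outs es cs h == out)%:R).

Lemma Ex_coin_cst (K : R) : Ex dcoin (fun=> K) = K.
Proof. by rewrite Ex_coin; ring. Qed.

Lemma row_weight_nil h out : row_weight h [::] out = ([::] == out)%:R.
Proof. by rewrite /row_weight Ex_coins0. Qed.

Lemma row_weight_cons0 h e es : row_weight h (e :: es) [::] = 0.
Proof.
rewrite /row_weight /= Ex_coinsS -[RHS](Ex_coin_cst 0); apply: eq_Ex => c.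
by rewrite /= Ex0.
Qed.

Lemma row_weight_cons h e es o out : row_weight h (e :: es) (o :: out) =
  Ex dcoin (fun c => ((vert c e h).1 == o)%:R * row_weight (vert c e h).2 es out).
Proof.
rewrite /row_weight /= Ex_coinsS; apply: eq_Ex => c; rewrite -ExZ; apply: eq_Ex => cs /=.
by rewrite eqseq_cons; case: (_ == o); rewrite ?mul1r ?mul0r.
Qed.

Lemma iw_empty A q S : A = set0 -> q = 0 -> iw A q S.
Proof. by move=> -> ->; exact: iw_set0. Qed.

Lemma iw_cast A B q q' S : iw A q S -> A = B -> q = q' -> iw B q' S.
Proof. by move=> ? <- <-. Qed.

Let gr t es x h w := grow es x h (fun y => chi t y w) (fun y => jmp t y w).

Lemma row_law t es : forall x,
  (forall A q, iw A q (fresh t x) -> forall out,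
    iw (A `&` [set w | gr t es x None w = out]) (q * row_weight false es out) (later t.+1)) /\
  (forall C q l r, x = l + 1 + r%:Z -> iw C q (fun i => fresh t x i || (i == inr (t, l))) ->
    forall out, iw (C `&` [set w | (jmp t l w \notin iota 1 r) /\
                                   gr t es x (Some (l + (jmp t l w)%:Z)) w = out])
      (q * b2 ^+ r * row_weight true es out) (later t.+1)).
Proof.
elim: es => [|e es IH] x.
  split=> [A q hA out|C q l r xE hC out]; rewrite row_weight_nil.
    case: eqP => [<-|ne]; last first.
      by apply: iw_empty; rewrite ?mulr0 //; apply/seteqP; split=> w // -[_ e]; exact: (ne e).
    apply: (iw_cast (iw_sub hA (@fresh_later t x))); rewrite ?mulr1 //.
    by apply/seteqP; split=> w // [].
  case: eqP => [<-|ne]; last first.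
    by apply: iw_empty; rewrite ?mulr0 //; apply/seteqP; split=> w // -[_ [_ e]]; exact: (ne e).
  have Sl : fresh t x (inr (t, l)) || (inr (t, l) == inr (t, l) :> idx) by rewrite eqxx orbT.
  have h := iw_notin hmeas hC Sl (iota_uniq 1 r).
  apply: (iw_cast (iw_sub h _)) => [i li||].
  - rewrite (fresh_later x li) /= andbT; apply/eqP => ei.
    by move: li; rewrite ei /= ltnn.
  - by apply/seteqP; split=> w [Cw /=]; [move=> ?; split|move=> []; split].
  - by rewrite sum_fp_jmp mulr1.
have [IH1 IH2] := IH (x + 1).
have fc : fresh t x (inl (inr (t, x))) by rewrite /= eqxx lexx orbT.
have fstep (i : idx) : fresh t (x + 1) i -> (i != inl (inr (t, x))) && fresh t x i.
  move=> fi; rewrite (fresh_step fi) andbT; apply/eqP => ei; move: fi.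
  by rewrite ei /= ltnn eqxx /=; lia.
have fstepj (i : idx) : fresh t (x + 1) i || (i == inr (t, x)) -> fresh t x i.
  by move=> /orP[/fresh_step //|/eqP ->] /=; rewrite eqxx lexx orbT.
have fstepc (i : idx) : fresh t (x + 1) i || (i == inr (t, x)) -> (i != inl (inr (t, x))) && fresh t x i.
  by move=> fi; rewrite fstepj // andbT; case/orP: fi => [/fstep/andP[]|/eqP ->].
have x1E : x + 1 = x + 1 + 0%:Z by rewrite addr0.
split=> [A q hA [|o out]|C q l r xE hC [|o out]].
- by apply: iw_empty; rewrite ?row_weight_cons0 ?mulr0 //; apply/seteqP; split=> w // -[].
- rewrite row_weight_cons; case: e.
    case: o.
      have h1 := IH1 _ _ (iw_sub (iw_eq hmeas 1 hA fc) fstep) out.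
      apply: (iw_cast h1); last by rewrite fp_chi Ex_coin /=; ring.
      apply/seteqP; split=> w /=; rewrite /gr /=.
        by move=> [[Aw +] <-]; case: (chi t x w).
      by move=> [Aw]; case: (chi t x w) => //= -[].
    have h1 := iw_sub (iw_neq hmeas 1 hA fc) fstepc.
    apply: (iw_cast (IH2 _ _ _ _ x1E h1 out)); last by rewrite fp_chi Ex_coin expr0 /=; ring.
    apply/seteqP; split=> w /=; rewrite /gr /=.
      by move=> [[Aw +] [_ <-]]; case: (chi t x w).
    by move=> [Aw]; case: (chi t x w) => //= -[].
  case: o.
    apply: iw_empty; first by apply/seteqP; split=> w // -[].
    by rewrite Ex_coin /=; ring.
  apply: (iw_cast (IH1 _ _ (iw_sub hA (@fresh_step t x)) out)).
    by apply/seteqP; split=> w [Aw]; rewrite /gr /=; [move=> <-|case].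
  by rewrite Ex_coin /=; ring.
- by apply: iw_empty; rewrite ?row_weight_cons0 ?mulr0 //; apply/seteqP; split=> w // -[_ []].
have Sl : fresh t x (inr (t, l)) || (inr (t, l) == inr (t, l) :> idx) by rewrite eqxx orbT.
have subl (i : idx) : fresh t x i -> (i != inr (t, l)) && (fresh t x i || (i == inr (t, l))).
  move=> fi; rewrite fi andbT; apply/eqP => ei; move: fi.
  by rewrite ei /= ltnn eqxx /= xE; lia.
rewrite row_weight_cons; case: e.
  case: o; last first.
    apply: iw_empty; first by apply/seteqP; split=> w // -[_ []].
    by rewrite Ex_coin /=; ring.
  have h := iw_sub (iw_notin hmeas hC Sl (iota_uniq 1 r)) subl.
  apply: (iw_cast (IH2 _ _ _ _ x1E (iw_sub h fstepj) out)).
    apply/seteqP; split=> w /=; rewrite /gr /=.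
      by move=> [[Cw nj] [_ <-]].
    by move=> [Cw [nj [<-]]].
  by rewrite sum_fp_jmp Ex_coin expr0 /=; ring.
have dE w : (l + (jmp t l w)%:Z == x) = (jmp t l w == r.+1) by rewrite xE; lia.
case: o.
  have h := iw_sub (iw_eq hmeas r.+1 hC Sl) subl.
  apply: (iw_cast (IH1 _ _ (iw_sub h (@fresh_step t x)) out)).
    apply/seteqP; split=> w /=; rewrite /gr /=.
      move=> [[Cw je] <-]; split=> //; rewrite dE je eqxx /=; split=> //.
      by rewrite mem_iota; lia.
    rewrite dE; move=> [Cw [nj]]; case: eqP => //= je [<-]; by rewrite je.
  by rewrite fp_jmp Ex_coin /=; ring.
have xE' : x + 1 = l + 1 + r.+1%:Z by rewrite xE; lia.
have subr (i : idx) : fresh t (x + 1) i || (i == inr (t, l)) -> fresh t x i || (i == inr (t, l)).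
  by move=> /orP[/fresh_step -> //|->]; rewrite orbT.
apply: (iw_cast (IH2 _ _ _ _ xE' (iw_sub hC subr) out)).
  rewrite iota_rcons; apply/seteqP; split=> w /=; rewrite /gr /= dE mem_cat mem_seq1 negb_or.
    by move=> [Cw [/andP[nj /negbTE ->] <-]].
  by move=> [Cw [nj]]; case: eqP => //= _ [<-]; rewrite nj.
by rewrite Ex_coin exprS /=; ring.
Qed.

Fixpoint inits (x : int) (n : nat) (w : T) : seq bool :=
  if n is n'.+1 then eta0 x w :: inits (x + 1) n' w else [::].
Fixpoint densities (x : int) (n : nat) : seq R :=
  if n is n'.+1 then idens x :: densities (x + 1) n' else [::].

Definition ifresh (x : int) (i : idx) : bool := if i is inl (inl y) then x <= y else true.

Lemma init_law n : forall x A q, iw A q (ifresh x) ->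
  forall out, iw (A `&` [set w | inits x n w = out])
    (q * Ex (dinit (densities x n)) (fun es => (es == out)%:R)) (later 0).
Proof.
elim: n => [|n IH] x A q hA out.
  rewrite /dinit Ex_nil; case: eqP => [<-|ne]; last first.
    by apply: iw_empty; rewrite ?mulr0 //; apply/seteqP; split=> w // -[_ e]; exact: (ne e).
  apply: (iw_cast (iw_sub hA _)) => [[[y|[s y]]|[s y]]//||]; rewrite ?mulr1 //.
  by apply/seteqP; split=> w // [].
have fx : ifresh x (inl (inl x)) by rewrite /= lexx.
rewrite /dinit /= Ex_cons; case: out => [|o out].
  apply: iw_empty; first by apply/seteqP; split=> w // -[].
  rewrite -[RHS](mulr0 q) -(Ex0 (bern (idens x))); congr (_ * _); apply: eq_Ex => e.
  by rewrite /= Ex0.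
have sub (i : idx) : ifresh (x + 1) i ->
   (i != inl (inl x)) && ifresh x i.
  case: i => [[y|i]|i] //= xy; rewrite (_ : x <= y) ?andbT; last by lia.
  by apply/eqP => -[yx]; move: xy; rewrite yx; lia.
have E (e : bool) : Ex (dinit (densities (x + 1) n)) (fun es => (e :: es == o :: out)%:R) =
   (e == o)%:R * Ex (dinit (densities (x + 1) n)) (fun es => (es == out)%:R) :> R.
  rewrite -ExZ; apply: eq_Ex => es; rewrite eqseq_cons.
  by case: (e == o); rewrite ?mul1r ?mul0r.
rewrite Ex_bern !E; case: o {E}.
  apply: (iw_cast (IH _ _ _ (iw_sub (iw_eq hmeas 1 hA fx) sub) out)).
    apply/seteqP; split=> w /=; first by move=> [[Aw +] <-]; case: (eta0 x w).
    by move=> [Aw [-> <-]].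
  by rewrite fp_init /=; ring.
apply: (iw_cast (IH _ _ _ (iw_sub (iw_neq hmeas 1 hA fx) sub) out)).
  apply/seteqP; split=> w /=; first by move=> [[Aw +] <-]; case: (eta0 x w).
  by move=> [Aw [-> <-]].
by rewrite fp_init /=; ring.
Qed.

Fixpoint tcfg (a : int) (L t : nat) (w : T) : seq bool :=
  if t is t'.+1 then grow (tcfg a L t' w) a None (fun y => chi t' y w) (fun y => jmp t' y w)
  else inits a L w.

Lemma size_grow es x h c jj : size (grow es x h c jj) = size es.
Proof. by elim: es x h => //= e es IH x h; rewrite IH. Qed.

Lemma size_inits x n w : size (inits x n w) = n.
Proof. by elim: n x => //= n IH x; rewrite IH. Qed.

Lemma size_tcfg a L t w : size (tcfg a L t w) = L.
Proof. by elim: t => [|t IH] /=; rewrite ?size_inits ?size_grow. Qed.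

Lemma size_densities x n : size (densities x n) = n.
Proof. by elim: n x => //= n IH x; rewrite IH. Qed.

(** The input has density 0 because particles left of [a] are removed. Independence from the
    variables of later steps is what carries the induction. *)
Lemma tcfg_law a L t out : iw [set w | tcfg a L t w = out]
  (Esys b1 b2 (densities a L) 0 t (fun es rows => (run rows es == out)%:R)) (later t).
Proof.
elim: t out => [|t IH] out.
  have h1 : iw setT 1 (ifresh a).
    by apply: iw_sub (iw_setT hmeas hindep) _.
  apply: (iw_cast (@init_law L a setT 1 h1 out)); first by rewrite setTI.
  by rewrite mul1r /Esys; apply: eq_Ex => es; rewrite /drows Ex_nil.
(* The law at time [t.+1] is a sum over the finitely many configurations possible at time [t]. *)
pose all_es := [seq val s | s : L.-tuple bool].
have uall : uniq all_es by rewrite map_inj_uniq ?enum_uniq //; exact: val_inj.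
have mall s : size s = L -> s \in all_es.
  by move=> /eqP sz; apply/mapP; exists (Tuple sz); rewrite ?mem_enum.
pose A es := [set w | tcfg a L t w = es] `&` [set w | gr t es a None w = out].
have hA es : es \in all_es -> iw (A es)
   (Esys b1 b2 (densities a L) 0 t (fun es0 rows => (run rows es0 == es)%:R) * row_weight false es out)
   (later t.+1).
  move=> _; apply: (row_law t es a).1; apply: iw_sub (IH es) _.
  by move=> [[y|[s y]]|[s y]] //= /orP[/ltnW//|/andP[/eqP ->]].
have dA es es' w : A es w -> A es' w -> es = es' by move=> [<- _] [<-].
apply: (iw_cast (iw_bigU hmeas uall dA hA)).
  apply/seteqP; split=> w /=; first by move=> [es _ [/= <- <-]].
  by move=> e; exists (tcfg a L t w); [apply: mall; exact: size_tcfg|split].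
under eq_bigr do rewrite mulrC -[X in _ * X]/(Ex _ _) -ExZ.
rewrite -Ex_sum /Esys; apply: eq_Ex_dseq => es; rewrite size_map size_densities => szes.
under eq_bigr do rewrite -ExZ.
rewrite -Ex_sum -addn1 /drows nseqD Ex_cat; apply: eq_Ex => rows.
rewrite /= Ex_cons Ex_prod Ex_bern mul0r add0r subr0 mul1r.
have szr : size (run rows es) = L by rewrite size_run.
rewrite (bigD1_seq (run rows es)) //=; last exact: mall.
rewrite eqxx mulr1 big1 ?addr0; last first.
  by move=> s /negbTE ne; rewrite eq_sym ne mulr0.
rewrite /row_weight szr; apply: eq_Ex => cs; rewrite Ex_nil /run foldl_cat /=.
by [].
Qed.

End RowLaw.

(** * Harris construction and boundary influence *)

Section Harris.
Variables (c : int -> bool) (jj : int -> nat).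

Lemma nth_grow (eta : conf) es (a x : int) (n : nat) : x = a + n%:Z ->
  (forall i, (i < size es)%N -> nth false es i = eta (x + i%:Z)) ->
  forall i, (i < size es)%N ->
  nth false (grow es x (trunc_state eta c jj a n) c jj) i = trunc_val eta c jj a (x + i%:Z).
Proof.
elim: es x n => [|e es IH] x n xE he i //.
have e0 : e = eta x by have := he 0%N isT; rewrite /= addr0.
case: i => [|i] /= isz.
  by rewrite addr0 /trunc_val xE e0 xE (_ : absz (a + n%:Z - a)%R = n) //; lia.
have := IH (x + 1) n.+1 _ _ i isz; rewrite /= -xE -e0 => -> //.
- by congr trunc_val; lia.
- by rewrite xE; lia.
- move=> k ksz; have := he k.+1 ksz; rewrite /= => ->; congr eta; lia.
Qed.

Lemma trunc_state_reset (eta : conf) (a z : int) (n : nat) : eta z -> ~~ c z -> a <= z ->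
  a + n%:Z = z + 1 -> trunc_state eta c jj a n = Some (z + (jj z)%:Z).
Proof.
move=> ez /negbTE cz az; case: n => [|n] /= anz; first by lia.
have -> : a + n%:Z = z by lia.
by rewrite ez cz /=; case: trunc_state.
Qed.

(* Past a site that surely emits a moving particle, the dynamics does not depend
   on the configuration to its left. *)
Lemma trunc_state_agree (eta eta' : conf) (z : int) (k : nat) : eta z -> ~~ c z ->
  (forall x, z <= x -> x < z + 1 + k%:Z -> eta x = eta' x) ->
  forall (a a' : int) (n n' : nat), a <= z -> a' <= z -> a + n%:Z = z + 1 + k%:Z -> a' + n'%:Z = z + 1 + k%:Z ->
  trunc_state eta c jj a n = trunc_state eta' c jj a' n'.
Proof.
move=> ez cz; elim: k => [|k IH] ag a a' n n' az a'z nE n'E.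
  have ez' : eta' z by rewrite -ag //; lia.
  rewrite (trunc_state_reset ez cz az); last by lia.
  by rewrite (trunc_state_reset ez' cz a'z) //; lia.
case: n nE => [|n] nE; first by lia.
case: n' n'E => [|n'] n'E; first by lia.
have ag' x : z <= x -> x < z + 1 + k%:Z -> eta x = eta' x by move=> ? ?; apply: ag; lia.
rewrite /= (IH ag' a a' n n') //; [|lia..].
have -> : a + n%:Z = a' + n'%:Z by lia.
by rewrite ag //; lia.
Qed.

Lemma trunc_val_agree (eta eta' : conf) (z x a a' : int) : eta z -> ~~ c z ->
  (forall y, z <= y -> y <= x -> eta y = eta' y) -> a <= z -> a' <= z -> z < x ->
  trunc_val eta c jj a x = trunc_val eta' c jj a' x.
Proof.
move=> ez cz ag az a'z zx; rewrite /trunc_val ag //; last exact: ltW.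
rewrite (@trunc_state_agree eta eta' z (absz (x - z - 1)%R) ez cz _ a a' _ (absz (x - a')%R)) //; [|lia..].
by move=> y zy yx; apply: ag => //; lia.
Qed.

Lemma s6v_step_stable (eta : conf) x v : (exists z, forall a, a <= z -> trunc_val eta c jj a x = v) ->
  s6v_step eta c jj x = v.
Proof.
move=> [z hz]; rewrite /s6v_step; case: v hz => hz.
  by apply/asboolP; exists z => a /hz.
apply/asboolP => -[a0 /(_ (Order.min a0 z))]; rewrite hz ?ge_min ?lexx ?orbT //.
by move=> /(_ isT).
Qed.

(** Agreement before the step is required only from [z] on: the state leaving [z] is the same
    whatever reaches it. *)
Lemma s6v_step_grow (eta : conf) es (a z : int) : eta z -> ~~ c z -> a <= z ->
  (forall i, (i < size es)%N -> z <= a + i%:Z -> eta (a + i%:Z) = nth false es i) ->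
  forall i, (i < size es)%N -> z < a + i%:Z ->
  s6v_step eta c jj (a + i%:Z) = nth false (grow es a None c jj) i.
Proof.
move=> ez cz az ag i isz zi.
pose eta' (x : int) := nth false es (absz (x - a)%R).
have eE k : (k < size es)%N -> nth false es k = eta' (a + k%:Z).
  by move=> _; rewrite /eta' (_ : absz _ = k) //; lia.
have -> := @nth_grow eta' es a a 0 _ eE i isz; last by rewrite addr0.
apply: s6v_step_stable; exists z => a' a'z.
apply: (@trunc_val_agree eta eta' z) => // y zy yx; have -> : y = a + (absz (y - a)%R)%:Z by lia.
rewrite -eE; last by lia.
by apply: ag; lia.
Qed.

Lemma s6v_step_stay (eta : conf) x : eta x -> c x -> s6v_step eta c jj x.
Proof.
move=> ex cx; apply: s6v_step_stable; exists 0 => a _.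
by rewrite /trunc_val ex cx; case: trunc_state.
Qed.

(** For [theta = 0] there are almost surely no resting particles to use on the left; the empty
    half-line takes over their role. *)
Lemma trunc_state_vacant (eta : conf) (a : int) : (forall x, x < a -> ~~ eta x) ->
  forall (a' : int) (n' : nat), a' + n'%:Z <= a -> trunc_state eta c jj a' n' = None.
Proof.
move=> e0 a'; elim=> [//|n' IH] le /=.
rewrite IH; last by lia.
by rewrite (negbTE (e0 _ _)) //; lia.
Qed.

Lemma trunc_state_vacant_shift (eta : conf) (a a' : int) (n : nat) : (forall x, x < a -> ~~ eta x) -> a' <= a ->
  trunc_state eta c jj a' (absz (a - a')%R + n) = trunc_state eta c jj a n.
Proof.
move=> e0 a'a; elim: n => [|n IH]; first by rewrite addn0 (trunc_state_vacant e0) //; lia.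
by rewrite addnS /= IH (_ : a' + _ = a + n%:Z) //; lia.
Qed.

Lemma s6v_step_vacant (eta : conf) (a x : int) : (forall x, x < a -> ~~ eta x) -> x < a ->
  ~~ s6v_step eta c jj x.
Proof.
move=> e0 xa; apply/negbT/s6v_step_stable; exists x => a' a'x.
rewrite /trunc_val (negbTE (e0 _ xa)) (trunc_state_vacant e0) //; lia.
Qed.

Lemma s6v_step_grow_vacant (eta : conf) es (a : int) : (forall x, x < a -> ~~ eta x) ->
  (forall i, (i < size es)%N -> eta (a + i%:Z) = nth false es i) ->
  forall i, (i < size es)%N -> s6v_step eta c jj (a + i%:Z) = nth false (grow es a None c jj) i.
Proof.
move=> e0 ag i isz.
have -> := @nth_grow eta es a a 0 _ (fun k h => esym (ag k h)) i isz; last by rewrite addr0.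
apply: s6v_step_stable; exists a => a' a'a; rewrite /trunc_val.
have -> : absz (a + i%:Z - a')%R = (absz (a - a')%R + i)%N by lia.
have -> : absz (a + i%:Z - a)%R = (0 + i)%N by lia.
by rewrite add0n trunc_state_vacant_shift.
Qed.

End Harris.

(** * Agreement of the process on the line with the truncated process *)

Section Coupling.
Variables (d : measure_display) (T : measurableType d) (eta0 : int -> T -> bool) (chi : nat -> int -> T -> bool)
  (jmp : nat -> int -> T -> nat).
Local Notation tcfg := (tcfg eta0 chi jmp).
Local Notation s6v := (s6v eta0 chi jmp).

Definition good_site (t : nat) (z : int) (w : T) : bool :=
  [&& eta0 z w, all (fun s => chi s z w) (iota 0 t) & ~~ chi t z w].

Lemma nth_inits x n i w : (i < n)%N -> nth false (inits eta0 x n w) i = eta0 (x + i%:Z) w.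
Proof.
elim: n x i => [//|n IH] x [|i] /= h; first by rewrite addr0.
by rewrite IH //; congr eta0; lia.
Qed.

Lemma s6v_stays t z w : eta0 z w -> all (fun s => chi s z w) (iota 0 t) -> s6v t w z.
Proof.
elim: t => [//|t IH] e0; rewrite -addn1 iotaD all_cat /= andbT => /andP[al ct].
by rewrite addn1; apply: s6v_step_stay => //; apply: IH.
Qed.

(** The sites [z t] increase with [t]: agreement to the right of [z t] after step [t] covers the
    site [z t.+1], from which the next step is again determined. *)
Lemma s6v_tcfg (a : int) L N (z : nat -> int) w : (forall t, (t < N)%N -> good_site t (z t) w) ->
  (forall t, (t < N)%N -> a <= z t) -> (forall t, (t.+1 < N)%N -> z t < z t.+1) ->
  forall t i, (t <= N)%N -> (i < L)%N -> (if t is t'.+1 then z t' < a + i%:Z else true) ->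
  s6v t w (a + i%:Z) = nth false (tcfg a L t w) i.
Proof.
move=> good az zinc; elim=> [|t IH] i tN iL zi; first by rewrite nth_inits.
have /and3P[g1 g2 g3] := good t tN.
apply: (@s6v_step_grow _ _ _ _ a (z t)); rewrite ?size_tcfg //; try exact: az.
  exact: s6v_stays.
move=> k kL zk; apply: IH => //; first exact: ltnW.
case: t tN zk {g1 g2 g3 zi} => // t tN zk; apply: lt_le_trans zk; exact: zinc.
Qed.

Lemma s6v_tcfg_vacant (a : int) L w : (forall x, x < a -> ~~ eta0 x w) ->
  forall t, (forall x, x < a -> ~~ s6v t w x) /\
    forall i, (i < L)%N -> s6v t w (a + i%:Z) = nth false (tcfg a L t w) i.
Proof.
move=> e0; elim=> [|t [IH1 IH2]]; first by split=> // i iL; rewrite nth_inits.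
split=> [x xa|i iL]; first exact: (s6v_step_vacant _ _ IH1).
by apply: s6v_step_grow_vacant; rewrite ?size_tcfg.
Qed.

End Coupling.

Definition no_input (r : rowdata) : rowdata := (false, r.2).

(** * Decay of the influence of the left boundary *)

Section BoundaryInfluence.
Variables (R : realType) (b1 b2 : R).
Hypotheses (b1_gt0 : 0 < b1) (b12 : b1 < b2) (b2_lt1 : b2 < 1).
Local Notation ph := (phi b1 b2).
Local Notation dcoin := (dcoin b1 b2).
Local Notation dcoins := (dcoins b1 b2).
Local Notation drow := (drow b1 b2).
Local Notation drows := (drows b1 b2).

(** A potential giving weight [z ^+ i] to a discrepancy at position [i], so that for [z > 1] a small
    expectation excludes discrepancies far to the right. *)
Fixpoint wdisc (z : R) (xs ys : seq bool) : R :=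
  if (xs, ys) is (x :: xs', y :: ys') then (x != y)%:R + z * wdisc z xs' ys' else 0.

Lemma wdisc_ge0 z xs ys : 0 <= z -> 0 <= wdisc z xs ys.
Proof.
move=> z0; elim: xs ys => [|x xs IH] [|y ys] //=; rewrite addr_ge0 ?ler0n //.
exact: mulr_ge0.
Qed.

Lemma wdisc_refl z xs : wdisc z xs xs = 0.
Proof. by elim: xs => //= x xs ->; rewrite eqxx mulr0 addr0. Qed.

Lemma wdisc_drop z m xs ys : 1 <= z -> size xs = size ys ->
  (drop m xs != drop m ys)%:R * z ^+ m <= wdisc z xs ys.
Proof.
move=> z1; have z0 := le_trans ler01 z1; elim: m xs ys => [|m IH] xs ys sz.
  rewrite !drop0 expr0 mulr1; elim: xs ys sz => [|x xs IH] [|y ys] //=.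
  move=> [sz].
  have := IH _ sz; rewrite eqseq_cons; case: (x == y) => //=.
    by rewrite add0r => h; apply: le_trans h _; rewrite ler_peMl // wdisc_ge0.
  by move=> _; rewrite lerDl mulr_ge0 // wdisc_ge0.
case: xs ys sz => [|x xs] [|y ys] //=; first by rewrite mul0r.
move=> [sz].
rewrite exprS mulrCA; apply: le_trans (ler_wpM2l z0 (IH _ _ sz)) _.
by rewrite lerDr ler0n.
Qed.

(* The weight is chosen so that [z * b2 < 1]: a discrepancy moves right by a
   stochastically geometric distance, of parameter at most [b2]. *)
Definition disc_base : R := (1 + b2) / (2 * b2).
Local Notation z := disc_base.

Lemma disc_base_gt1 : 1 < z.
Proof.
have [h1 h2 h3] := And3 b1_gt0 b12 b2_lt1.
by rewrite /disc_base ltr_pdivlMr; lra.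
Qed.

Lemma disc_baseE : 2 * z * b2 = 1 + b2.
Proof.
have [h1 h2 h3] := And3 b1_gt0 b12 b2_lt1.
by rewrite /disc_base; field; rewrite gt_eqF //; lra.
Qed.

(** The constant 2 bounds the expected weight deposited by a horizontal discrepancy: it solves
    [c = (1 - b2) + b2 * z * c] by the choice of [z]. A vertical discrepancy stays or becomes a
    horizontal one at the next site, hence the factor [2 * z]. *)
Lemma row_wdisc xs : forall ys g h, leb_seq xs ys -> g ==> h ->
  Ex (dcoins (size xs)) (fun cs => wdisc z (outs xs cs g) (outs ys cs h)) <=
  2 * (g != h)%:R + 2 * z * wdisc z xs ys.
Proof.
have z1 := disc_base_gt1; have z0 := lt_trans ltr01 z1.
have [h1 h2 h3] := And3 b1_gt0 b12 b2_lt1.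
elim: xs => [|x xs IH] [|y ys] //= g h.
  by move=> _ _; rewrite Ex_coins0 mulr0 addr0 mulr_ge0 // ler0n.
move=> /andP[xy le] gh; rewrite Ex_coinsS.
apply: (@le_trans _ _ (Ex dcoin (fun c =>
   ((vert c x g).1 != (vert c y h).1)%:R + 2 * z * ((vert c x g).2 != (vert c y h).2)%:R)
   + z * (2 * z * wdisc z xs ys))).
  rewrite -[X in _ <= _ + X](Ex_cst _ (is_dist_coin b1_gt0 b12 b2_lt1)) -ExD.
  apply: le_Ex => [|c]; first exact: is_dist_coin.
  rewrite /= ExD (Ex_cst _ (is_dist_coins b1_gt0 b12 b2_lt1 _)) ExZ -addrA lerD2l.
  have gh' : (vert c x g).2 ==> (vert c y h).2 by case/andP: (vert_mono c xy gh).
  apply: le_trans (ler_wpM2l (ltW z0) (IH _ _ _ le gh')) _.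
  by rewrite le_eqVlt; apply/orP; left; apply/eqP; ring.
rewrite Ex_coin; have E := disc_baseE.
have zb1 : 2 * z * b1 <= 2 * z * b2 by apply: ler_wpM2l; [rewrite mulr_ge0 // ltW|exact: ltW].
move: xy gh; case: x; case: y => //= _; case: g; case: h => //= _;
  rewrite ?mulr0 ?addr0 ?add0r ?mulr1; set W := wdisc _ _ _; nra.
Qed.

(** Growth exponential in [N] is harmless, as [N] is fixed while the distance to the boundary tends
    to infinity. *)
Lemma run_wdisc f L N : itv01 f -> forall xs ys, size xs = L -> leb_seq xs ys ->
  Ex (drows f L N) (fun rows => wdisc z (run (map no_input rows) xs) (run rows ys)) <=
  2 * N%:R * (2 * z) ^+ N + (2 * z) ^+ N * wdisc z xs ys.
Proof.
move=> hf; have z1 := disc_base_gt1; have z0 := lt_trans ltr01 z1.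
have zz0 : 0 <= 2 * z by rewrite mulr_ge0 // ltW.
elim: N => [|N IH] xs ys szx le.
  by rewrite /drows Ex_nil /= mulr0 mul0r add0r mul1r.
have p0 : 0 <= (2 * z) ^+ N by rewrite exprn_ge0.
have W0 := wdisc_ge0 xs ys (ltW z0).
rewrite /drows /= Ex_cons.
apply: (@le_trans _ _ (Ex (drow f L) (fun r => 2 * N%:R * (2 * z) ^+ N +
    (2 * z) ^+ N * wdisc z (outs xs r.2 false) (outs ys r.2 r.1)))).
  apply: le_Ex => [|[h cs]]; first exact: is_dist_drow.
  apply: IH => /=; first by rewrite size_outs.
  by have [] := row_mono cs le (isT : false ==> h).
rewrite ExD (Ex_cst _ (is_dist_drow b1_gt0 b12 b2_lt1 _ hf)) ExZ.
apply: (@le_trans _ _ (2 * N%:R * (2 * z) ^+ N + (2 * z) ^+ N * (2 + 2 * z * wdisc z xs ys))).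
  rewrite lerD2l; apply: ler_wpM2l => //; rewrite Ex_prod /=.
  rewrite -[X in _ <= X](Ex_cst _ (is_dist_bern hf)); apply: le_Ex => [|h].
    exact: is_dist_bern.
  rewrite -szx; apply: le_trans (row_wdisc le (isT : false ==> h)) _.
  by rewrite lerD2r; case: h => /=; rewrite ?mulr1 // mulr0.
have : (2 * z) ^+ N <= (2 * z) ^+ N.+1.
  by rewrite exprS ler_peMl //; lra.
rewrite exprS -natr1; have N0 : 0 <= N%:R :> R by [].
set p := (2 * z) ^+ N in p0 *; set W := wdisc z xs ys in W0 *; set q := 2 * z in zz0 *.
move=> pq; have : 0 <= (N%:R + 1) * (q * p - p).
  by apply: mulr_ge0; [rewrite addr_ge0|rewrite subr_ge0].
by rewrite mulrBr !mulrDl !mulrDr; lra.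
Qed.

Lemma Esys_no_input ps f N (F : seq bool -> seq rowdata -> R) :
  Esys b1 b2 ps 0 N F = Ex (dinit ps) (fun es => Ex (drows f (size ps) N)
    (fun rows => F es (map no_input rows))).
Proof.
apply: eq_Ex => es; symmetry; apply: Ex_map_nseq => g.
rewrite !Ex_prod !Ex_bern /= mul0r add0r subr0 mul1r; ring.
Qed.

Lemma Esys_boundary ps f N m (F : seq bool -> bool) : all (@itv01 R) ps -> itv01 f ->
  Esys b1 b2 ps 0 N (fun es rows => (F (drop m (run rows es)))%:R) <=
  Esys b1 b2 ps f N (fun es rows => (F (drop m (run rows es)))%:R)
    + 2 * N%:R * (2 * z) ^+ N * (z ^+ m)^-1.
Proof.
move=> hps hf; have z1 := disc_base_gt1; have z0 := lt_trans ltr01 z1.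
have zm : 0 < z ^+ m by rewrite exprn_gt0.
rewrite (Esys_no_input _ f) -[X in _ <= _ + X](Ex_cst _ (is_dist_dinit hps)) -ExD.
apply: le_Ex_dseq => [|es]; first exact: is_dist_dinit.
rewrite size_map => szes.
have := run_wdisc N hf szes (leb_seq_refl es); rewrite wdisc_refl mulr0 addr0.
rewrite -(ler_pM2r (_ : 0 < (z ^+ m)^-1)) ?invr_gt0 // -ExZr; set b := 2 * _ * _ * _ => le_b.
rewrite -lerBlDl; apply: le_trans le_b; rewrite -ExB.
apply: le_Ex => [|rows]; first exact: is_dist_drows.
rewrite ler_pdivlMr //.
have := @wdisc_drop z m (run (map no_input rows) es) (run rows es) (ltW z1).
rewrite !size_run => /(_ erefl); apply: le_trans.
rewrite ler_pM2r //; case: eqP => [->|_] /=; first by rewrite subrr.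
by case: (F _); case: (F _) => /=; lra.
Qed.

Lemma Ex_drow f L g : Ex (drow f L) g = Ex (bern f) (fun h => Ex (dcoins L) (fun cs => g (h, cs))).
Proof. exact: Ex_prod. Qed.

(* Burke: the flux through a stationary stretch is again a stationary input. *)
Lemma burke_restrict l m N (F : seq bool -> R) : 0 <= l -> forall es,
  Ex (dbern m l) (fun esl => Ex (drows (ph l) (m + size es) N)
     (fun rows => F (drop m (run rows (esl ++ es))))) =
  Ex (drows (ph l) (size es) N) (fun rows => F (run rows es)).
Proof.
move=> l0; elim: N => [|N IH] es.
  rewrite /drows /= Ex_nil; transitivity (Ex (@dbern R m l) (fun=> F es)).
    by apply: eq_Ex_dbern => esl sz; rewrite Ex_nil /= -sz drop_size_cat.
  elim: m => [|m IHm]; first by rewrite Ex_dbern0.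
  by rewrite Ex_dbernS Ex_bern IHm; ring.
pose Phi h cs := Ex (dbern m l) (fun esl => Ex (drows (ph l) (m + size es) N)
     (fun rows => F (drop m (run rows (esl ++ outs es cs h))))).
transitivity (Ex (dcoins (size es)) (fun csr => Ex (dbern m l) (fun esl => Ex (bern (ph l)) (fun h =>
   Ex (dcoins m) (fun csl => Ex (drows (ph l) (m + size es) N) (fun rows =>
     F (drop m (run rows (outs esl csl h ++ outs es csr (hout esl csl h)))))))))).
  rewrite -[RHS]Ex_exchange; apply: eq_Ex_dbern => esl szl.
  rewrite /drows /= Ex_cons Ex_drow -[RHS]Ex_exchange; apply: eq_Ex => h.
  rewrite Ex_coinsD -[RHS]Ex_exchange; apply: eq_Ex_coins => csl szc; apply: eq_Ex => csr.
  by apply: eq_Ex => rows /=; rewrite /step /= outs_cat // szc.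
rewrite /drows /= Ex_cons Ex_drow -[RHS]Ex_exchange; apply: eq_Ex => csr.
rewrite (row_burke b12 b2_lt1 m (fun eo ho => Ex (drows (ph l) (m + size es) N) (fun rows =>
     F (drop m (run rows (eo ++ outs es csr ho))))) l0).
rewrite Ex_exchange; apply: eq_Ex => h; have := IH (outs es csr h).
by rewrite size_outs.
Qed.

End BoundaryInfluence.

Section Densities.
Variables (R : realType) (theta rho : R).
Local Notation densities := (densities theta rho).

Lemma densities_cat x m n : densities x (m + n) = densities x m ++ densities (x + m%:Z) n.
Proof.
elim: m x => [|m IH] x /=; first by rewrite addr0.
by rewrite IH; congr (_ :: _ ++ densities _ _); lia.
Qed.

Lemma densities_left x m : x + m%:Z <= 1 -> densities x m = nseq m theta.
Proof.
elim: m x => [//|m IH] x xm /=; rewrite IH; last by lia.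
by rewrite /idens ifT //; lia.
Qed.

Lemma densities_right x m : 1 <= x -> densities x m = nseq m rho.
Proof.
elim: m x => [//|m IH] x xm /=; rewrite IH; last by lia.
by rewrite /idens ifF //; lia.
Qed.

End Densities.

Section Windows.
Variables (d : measure_display) (T : measurableType d).
Variables (eta0 : int -> T -> bool) (chi : nat -> int -> T -> bool) (jmp : nat -> int -> T -> nat).
Local Notation good_site := (good_site eta0 chi).
Local Notation tcfg := (tcfg eta0 chi jmp).
Local Notation s6v := (s6v eta0 chi jmp).

(** Each step [t] has its own stretch of [B] sites. The stretches follow each other from left to
    right, so good sites picked in them increase with [t]. *)
Definition bad (a : int) (B t : nat) : set T :=
  [set w | all (fun k => ~~ good_site t (a + (t * B)%:Z + k%:Z) w) (iota 0 B)].

Definition window (x0 : int) (L N : nat) (w : T) : seq bool :=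
  [seq s6v N w (x0 + i%:Z) | i <- iota 0 L].

Lemma window_tcfg a m L N w : (forall i, (m <= i < m + L)%N ->
    s6v N w (a + i%:Z) = nth false (tcfg a (m + L) N w) i) ->
  window (a + m%:Z) L N w = drop m (tcfg a (m + L) N w).
Proof.
move=> h; apply: (@eq_from_nth _ false); rewrite size_map size_iota.
  by rewrite size_drop size_tcfg addKn.
move=> i iL; rewrite (nth_map 0%N) ?size_iota // nth_iota // add0n nth_drop -h.
  by congr Defs.s6v; lia.
by rewrite leq_addr ltn_add2l.
Qed.

Lemma window_good a B L N w : (forall t, (t < N)%N -> ~ bad a B t w) ->
  window (a + (N * B)%:Z) L N w = drop (N * B) (tcfg a (N * B + L) N w).
Proof.
move=> nb; apply: window_tcfg => i /andP[iN iL].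
pose p t k := good_site t (a + (t * B)%:Z + k%:Z) w.
pose z t := a + (t * B)%:Z + (find (p t) (iota 0 B))%:Z.
have hp t : (t < N)%N -> has (p t) (iota 0 B).
  by move=> tN; apply/negbNE/negP => /hasPn h; apply: (nb t tN); apply/allP => k /h.
have fB t : (t < N)%N -> (find (p t) (iota 0 B) < B)%N.
  by move=> tN; have := hp t tN; rewrite has_find size_iota.
apply: (@s6v_tcfg _ _ _ _ _ a _ N z) => //.
- move=> t tN; have := nth_find 0%N (hp t tN).
  by rewrite nth_iota ?fB // add0n.
- by move=> t tN; rewrite /z; lia.
- by move=> t tN; have := fB t (ltnW tN); rewrite /z mulSn; lia.
- case: N {nb} hp fB iN iL => // N _ fB iN _; have := fB N (leqnn _).
  by move: iN; rewrite /z mulSn; lia.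
Qed.

End Windows.

(** * Probabilities of good sites and of truncated configurations *)

Section Transfer.
Variables (R : realType) (d : measure_display) (T : measurableType d) (P : probability T R).
Variables (b1 b2 theta rho : R) (eta0 : int -> T -> bool) (chi : nat -> int -> T -> bool)
  (jmp : nat -> int -> T -> nat).
Hypotheses (b1_gt0 : 0 < b1) (b12 : b1 < b2) (b2_lt1 : b2 < 1).
Hypotheses (htheta : 0 <= theta <= 1) (hrho : 0 <= rho <= 1).
Hypothesis hmeas : forall (i : idx) (v : nat), measurable [set w | drive_rv eta0 chi jmp i w = v].
Hypothesis hindep : mutually_independent P (drive_rv eta0 chi jmp).
Hypothesis hlaw0 : forall x : int, P [set w | eta0 x w] = (if x <= 0 then theta else rho)%:E.
Hypothesis hlawchi : forall (t : nat) (x : int), P [set w | chi t x w] = b1%:E.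
Hypothesis hlawj : forall (t : nat) (x : int) (r : nat), (0 < r)%N ->
  P [set w | jmp t x w = r] = ((1 - b2) * b2 ^+ r.-1)%:E.

Local Notation X := (drive_rv eta0 chi jmp).
Local Notation iw := (iw P X).
Local Notation good_site := (good_site eta0 chi).
Local Notation densities := (densities theta rho).
Local Notation idens := (idens theta rho).
Local Notation tcfg := (tcfg eta0 chi jmp).
Local Notation bad := (bad eta0 chi).
Local Notation Esys := (Esys b1 b2).
Local Notation ph := (phi b1 b2).

Definition site (i : idx) : int :=
  match i with inl (inl x) => x | inl (inr (_, x)) | inr (_, x) => x end.
Definition from (x : int) (i : idx) : bool := x <= site i.

Lemma from_neq x i j : from (x + 1) i -> site j = x -> (i != j) && from x i.
Proof.
rewrite /from => fi sj; have -> : x <= site i by lia.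
by rewrite andbT; apply/eqP => ij; move: fi; rewrite ij sj; lia.
Qed.

Lemma good_law t x A q : iw A q (from x) ->
  iw (A `&` [set w | good_site t x w]) (q * (idens x * b1 ^+ t * (1 - b1))) (from (x + 1)).
Proof.
move=> hA.
pose S n (i : idx) := from (x + 1) i || (if i is inl (inr (s, y)) then (y == x) && (n <= s)%N else false).
have key n : iw (A `&` [set w | eta0 x w && all (fun s => chi s x w) (iota 0 n)])
    (q * (idens x * b1 ^+ n)) (S n).
  elim: n => [|n IH].
    have fx : from x (inl (inl x)) by exact: lexx.
    apply: (iw_cast (iw_sub (iw_eq hmeas 1 hA fx) _)).
    - move=> [[y|[s y]]|[s y]]; rewrite /S /from /= ?orbF => h //.
      + by apply/andP; split; [apply/eqP => -[yx]; move: h; rewrite yx|]; lia.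
      + by case/orP: h => [|/andP[/eqP ->]] //; lia.
      + by lia.
    - by apply/seteqP; split=> w /=; rewrite andbT => -[Aw]; case: (eta0 x w).
    - by rewrite (fp_init chi jmp hlaw0) expr0 mulr1.
  have fx : S n (inl (inr (n, x))) by rewrite /S /= eqxx leqnn orbT.
  apply: (iw_cast (iw_sub (iw_eq hmeas 1 IH fx) _)).
  - move=> i Si; have -> : S n i.
      move: Si; rewrite /S => /orP[->//|]; case: i => [[//|[s y]]|//] /andP[-> ns].
      by rewrite (ltnW ns) orbT.
    rewrite andbT; apply/eqP => ei; move: Si; rewrite ei /S /from /= ltnn andbF orbF; lia.
  - have -> : iota 0 n.+1 = iota 0 n ++ [:: n] by rewrite -{1}[n.+1]addn1 iotaD.
    apply/seteqP; split=> w /=; rewrite all_cat /= andbT.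
      by move=> [[Aw /andP[-> ->]]]; case: (chi n x w).
    by move=> [Aw /and3P[-> ->]]; case: (chi n x w).
  - by rewrite (fp_chi eta0 jmp hlawchi) exprS; ring.
have fx : S t (inl (inr (t, x))) by rewrite /S /= eqxx leqnn orbT.
apply: (iw_cast (iw_sub (iw_neq hmeas 1 (key t) fx) _)).
- move=> i fi; have -> : S t i by rewrite /S fi.
  by rewrite andbT; have := @from_neq x i (inl (inr (t, x))) fi erefl => /andP[].
- apply/seteqP; split=> w /=; rewrite /good_site.
    by move=> [[Aw /andP[-> ->]]]; case: (chi t x w).
  by move=> [Aw /and3P[-> ->]]; case: (chi t x w).
- by rewrite (fp_chi eta0 jmp hlawchi); ring.
Qed.

Definition good_prob (t : nat) : R := theta * b1 ^+ t * (1 - b1).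

(** Whether a site is good depends only on variables located at that site, so the failures multiply;
    all sites involved have density [theta]. *)
Lemma bad_law t n : forall x A q, x + n%:Z <= 1 -> iw A q (from x) ->
  iw (A `&` [set w | all (fun k => ~~ good_site t (x + k%:Z) w) (iota 0 n)])
    (q * (1 - good_prob t) ^+ n) (from (x + n%:Z)).
Proof.
elim: n => [|n IH] x A q xn hA.
  apply: (iw_cast (iw_sub hA _)); rewrite ?addr0 ?expr0 ?mulr1 //.
  by apply/seteqP; split=> w // [].
have hA1 : iw A q (from (x + 1)).
  by apply: iw_sub hA _ => i; rewrite /from; lia.
have hD := iw_diff hmeas (@subIsetl _ A [set w | good_site t x w]) hA1 (good_law t hA).
have xn' : x + 1 + n%:Z <= 1 by lia.
apply: (iw_cast (iw_sub (IH _ _ _ xn' hD) _)).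
- by move=> i; rewrite /from; lia.
- have shift w : all (fun k => ~~ good_site t (x + k%:Z) w) (iota 0 n.+1) =
     ~~ good_site t x w && all (fun k => ~~ good_site t (x + 1 + k%:Z) w) (iota 0 n).
    rewrite /= addr0; congr (_ && _); rewrite -[1%N]addn0 iotaDl all_map.
    by apply: eq_all => k /=; congr (~~ good_site _ _ _); lia.
  apply/seteqP; split=> w; rewrite /= -/(iota 0 n.+1).
    move=> [[Aw ng] al]; split=> //; rewrite -[X in is_true X]/(all (fun k => ~~ good_site t (x + k%:Z) w) (iota 0 n.+1)) shift al andbT.
    by apply/negP => g; apply: ng.
  move=> [Aw]; rewrite -[X in is_true X]/(all (fun k => ~~ good_site t (x + k%:Z) w) (iota 0 n.+1)) shift => /andP[ng al].
  by split=> //; split=> // -[_ g]; move: ng; rewrite g.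
- rewrite /good_prob /idens ifT; last by lia.
  by rewrite exprS; ring.
Qed.

Lemma bad_prob a B t : a + (t.+1 * B)%:Z <= 1 ->
  measurable (bad a B t) /\ P (bad a B t) = ((1 - good_prob t) ^+ B)%:E.
Proof.
move=> le1; have h1 : iw setT 1 (from (a + (t * B)%:Z)).
  by apply: iw_sub (iw_setT hmeas hindep) _.
have h := @bad_law t B _ _ _ _ h1; have {h} h := h ltac:(lia).
split; first by case: h; rewrite setTI.
by have := iw_prob h; rewrite setTI mul1r.
Qed.

Lemma probability_exists_le (K : eqType) (r : seq K) (A : K -> set T) (q : K -> R) :
  (forall k, k \in r -> measurable (A k) /\ (P (A k) <= (q k)%:E)%E) ->
  measurable [set w | exists2 k, k \in r & A k w] /\
  (P [set w | exists2 k, k \in r & A k w] <= (\sum_(k <- r) q k)%:E)%E.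
Proof.
elim: r => [_|k r IH h].
  rewrite (_ : [set w | _] = set0); first by rewrite measure0 big_nil.
  by apply/seteqP; split=> w // -[].
have [mA pA] := h k (mem_head _ _).
have [|mU pU] := IH; first by move=> k' k'r; apply: h; rewrite in_cons k'r orbT.
rewrite (_ : [set w | _] = A k `|` [set w | exists2 k, k \in r & A k w]).
  split; first exact: measurableU.
  by apply: le_trans (measureU2 _ _ _) _ => //; rewrite big_cons EFinD leeD.
apply/seteqP; split=> w /=.
  by move=> [k']; rewrite in_cons => /predU1P[->|k'r] Aw; [left|right; exists k'].
by move=> [Aw|[k' k'r Aw]]; [exists k; rewrite ?mem_head|exists k'; rewrite // in_cons k'r orbT].
Qed.

Lemma tcfg_prob a L N (Q : seq bool -> bool) :
  measurable [set w | Q (tcfg a L N w)] /\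
  P [set w | Q (tcfg a L N w)] =
    (Esys (densities a L) 0 N (fun es rows => (Q (run rows es))%:R))%:E.
Proof.
pose r := [seq out <- [seq val s | s : L.-tuple bool] | Q out].
have ur : uniq r by rewrite filter_uniq // map_inj_uniq ?enum_uniq //; exact: val_inj.
have mr s : size s = L -> (s \in r) = Q s.
  move=> /eqP sz; rewrite mem_filter andb_idr // => _.
  by apply/mapP; exists (Tuple sz); rewrite ?mem_enum.
have h := iw_bigU (P := P) hmeas (A := fun out => [set w | tcfg a L N w = out])
  (q := fun out => Esys (densities a L) 0 N (fun es rows => (run rows es == out)%:R))
  (S := later N) ur.
have {}h := h (fun k k' w (e : tcfg a L N w = k) e' => etrans (esym e) e')
  (fun out _ => tcfg_law b1_gt0 b12 b2_lt1 hmeas hindep hlaw0 hlawchi hlawj a L N out).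
have E : [set w | exists2 k, k \in r & tcfg a L N w = k] = [set w | Q (tcfg a L N w)].
  apply/seteqP; split=> w /=; first by move=> [k + e]; rewrite -mr ?size_tcfg // e.
  by move=> Qw; exists (tcfg a L N w) => //; rewrite mr ?size_tcfg.
rewrite E in h; split; first by case: h.
rewrite (iw_prob h); congr _%:E; rewrite /Esys -Ex_sum.
apply: eq_Ex_dseq => es; rewrite size_map size_densities => szes; rewrite -Ex_sum.
apply: eq_Ex => rows; have szr : size (run rows es) = L by rewrite size_run.
have [Qr|nQr] := boolP (Q (run rows es)).
  rewrite (bigD1_seq (run rows es)) //= ?mr // eqxx big1 ?addr0 // => s /negbTE ne.
  by rewrite eq_sym ne.
rewrite big_seq big1 // => s sr; case: eqP => // e; move: nQr.
by rewrite e; move: sr; rewrite mem_filter => /andP[->].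
Qed.

Lemma all_densities x m : all (@itv01 R) (densities x m).
Proof. by elim: m x => //= m IH x; rewrite IH andbT /idens; case: ifP. Qed.

(** The extra stretch on the left is in equilibrium with the input, and what leaves it is again that
    input. Thus the long box required by the truncation has the same law, on the sites of interest,
    as a box of fixed size. *)
Lemma Esys_densities_restrict x m n N (F : seq bool -> R) : x + m%:Z <= 1 ->
  Esys (densities x (m + n)) (ph theta) N (fun es rows => F (drop m (run rows es))) =
  Esys (densities (x + m%:Z) n) (ph theta) N (fun es rows => F (run rows es)).
Proof.
move=> xm; rewrite /Esys densities_cat densities_left // size_cat size_nseq.
rewrite /dinit map_cat Ex_cat map_nseq -[LHS]Ex_exchange.
apply: eq_Ex_dseq => es; rewrite size_map size_densities => <-.
by rewrite -[RHS](@burke_restrict _ _ _ b12 b2_lt1 theta m) //; case/andP: htheta.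
Qed.

End Transfer.

(** * Measurability of the dynamics *)

Section DiscreteMeasurability.
Variables (d : measure_display) (T : measurableType d).

(** Measurability for countably many values, phrased by fibres so that lists, pairs and options
    carry no sigma-algebra of their own. *)
Definition dmeas (V : Type) (f : T -> V) : Prop := forall v, measurable [set w | f w = v].

Lemma measurable_exists (U : countType) (A : U -> set T) : (forall u, measurable (A u)) ->
  measurable [set w | exists u, A u w].
Proof.
move=> mA; rewrite (_ : [set w | _] = \bigcup_n (if unpickle n is Some u then A u else set0)).
  by apply: bigcupT_measurable => n; case: unpickle.
apply/seteqP; split=> w /=; first by move=> [u Au]; exists (pickle u) => //; rewrite pickleK.
by move=> [n _]; case: (unpickle n : option U) => // u Au; exists u.
Qed.

Lemma measurable_forall (U : countType) (A : U -> set T) : (forall u, measurable (A u)) ->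
  measurable [set w | forall u, A u w].
Proof.
move=> mA; rewrite (_ : [set w | _] = ~` [set w | exists u, (~` A u) w]).
  by apply: measurableC; apply: measurable_exists => u; apply: measurableC.
apply/seteqP; split=> w /= h; first by move=> [u]; apply; exact: h.
by move=> u; apply: contrapT => nA; apply: h; exists u.
Qed.

Lemma dmeas_pred (U : countType) (f : T -> U) (Q : U -> Prop) : dmeas f ->
  measurable [set w | Q (f w)].
Proof.
move=> mf; rewrite (_ : [set w | _] = [set w | exists u, (if `[< Q u >] then [set w | f w = u] else set0) w]).
  by apply: measurable_exists => u; case: ifP.
apply/seteqP; split=> w /=.
  by move=> Qw; exists (f w); case: asboolP.
by move=> [u]; case: asboolP => // Qu /= ->.
Qed.

Lemma dmeas_comp (U : countType) (V : Type) (f : T -> U) (h : U -> V) : dmeas f -> dmeas (h \o f).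
Proof. by move=> mf v; apply: (dmeas_pred (fun u => h u = v) mf). Qed.

Lemma dmeas_pair (U V : Type) (f : T -> U) (g : T -> V) : dmeas f -> dmeas g ->
  dmeas (fun w => (f w, g w)).
Proof.
move=> mf mg [u v]; rewrite (_ : [set w | _] = [set w | f w = u] `&` [set w | g w = v]).
  exact: measurableI.
by apply/seteqP; split=> w /=; [case=> -> ->|case=> -> ->].
Qed.

Lemma dmeas_cst (V : Type) (v : V) : dmeas (fun=> v).
Proof.
move=> v'; have [->|ne] := pselect (v = v').
  by rewrite (_ : [set w | _] = setT) //; apply/seteqP; split.
by rewrite (_ : [set w | _] = set0) //; apply/seteqP; split.
Qed.

Lemma dmeas_map (K : Type) (f : K -> T -> bool) (s : seq K) : (forall k, dmeas (f k)) ->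
  dmeas (fun w => [seq f k w | k <- s]).
Proof.
move=> mf; elim: s => [|k s IH] /=; first exact: dmeas_cst.
exact: (dmeas_comp (fun p => p.1 :: p.2) (dmeas_pair (mf k) IH)).
Qed.

Section Dynamics.
Variables (eta c : int -> T -> bool) (jj : int -> T -> nat).
Hypotheses (meta : forall x, dmeas (eta x)) (mc : forall x, dmeas (c x)) (mj : forall x, dmeas (jj x)).

Lemma dmeas_trunc_state a n :
  dmeas (fun w => trunc_state (eta ^~ w) (c ^~ w) (jj ^~ w) a n).
Proof.
elim: n => [|n IH]; first exact: dmeas_cst.
pose x := a + n%:Z.
exact: (dmeas_comp (fun p => (local_rule p.1.1 p.1.2.1 p.1.2.2 x p.2).2)
  (dmeas_pair (dmeas_pair (meta x) (dmeas_pair (mc x) (mj x))) IH)).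
Qed.

Lemma dmeas_trunc_val a x :
  dmeas (fun w => trunc_val (eta ^~ w) (c ^~ w) (jj ^~ w) a x).
Proof.
exact: (dmeas_comp (fun p => (local_rule p.1.1 p.1.2.1 p.1.2.2 x p.2).1)
  (dmeas_pair (dmeas_pair (meta x) (dmeas_pair (mc x) (mj x))) (dmeas_trunc_state a _))).
Qed.

Lemma dmeas_s6v_step x : dmeas (fun w => s6v_step (eta ^~ w) (c ^~ w) (jj ^~ w) x).
Proof.
have mt : measurable [set w | s6v_step (eta ^~ w) (c ^~ w) (jj ^~ w) x].
  rewrite (_ : [set w | _] = [set w | exists a0 : int, [set w | forall a : int,
     (if a <= a0 then [set w | trunc_val (eta ^~ w) (c ^~ w) (jj ^~ w) a x = true] else setT) w] w]).
    apply: measurable_exists => a0; apply: measurable_forall => a; case: ifP => // _.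
    exact: dmeas_trunc_val.
  apply/seteqP; split=> w; rewrite /s6v_step /=.
    by move/asboolP => [a0 h]; exists a0 => a; case: ifP => // /h.
  by move=> [a0 h]; apply/asboolP; exists a0 => a aa0; have := h a; rewrite aa0.
case; first exact: mt.
rewrite (_ : [set w | _] = ~` [set w | s6v_step (eta ^~ w) (c ^~ w) (jj ^~ w) x]).
  exact: measurableC.
by apply/seteqP; split=> w /=; [move=> ->|move/negP/negbTE].
Qed.
End Dynamics.
End DiscreteMeasurability.

Section WindowMeasurability.
Variables (d : measure_display) (T : measurableType d).
Variables (eta0 : int -> T -> bool) (chi : nat -> int -> T -> bool) (jmp : nat -> int -> T -> nat).
Hypothesis hmeas : forall (i : idx) (v : nat), measurable [set w | drive_rv eta0 chi jmp i w = v].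

Lemma dmeas_of_nat (b : T -> bool) : dmeas (fun w => nat_of_bool (b w)) -> dmeas b.
Proof.
move=> mb v; have := mb (nat_of_bool v); congr measurable.
by apply/seteqP; split=> w /=; [case: (b w); case: v|move=> ->].
Qed.

Lemma dmeas_s6v t x : dmeas (fun w => s6v eta0 chi jmp t w x).
Proof.
elim: t x => [|t IH] x; first by apply: dmeas_of_nat => v; exact: (hmeas (inl (inl x)) v).
apply: (dmeas_s6v_step (eta := fun x w => s6v eta0 chi jmp t w x) (c := chi t) (jj := jmp t)).
- exact: IH.
- by move=> y; apply: dmeas_of_nat => v; exact: (hmeas (inl (inr (t, y))) v).
- by move=> y v; exact: (hmeas (inr (t, y)) v).
Qed.

Lemma dmeas_window x0 L N : dmeas (window eta0 chi jmp x0 L N).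
Proof. by apply: (dmeas_map (f := fun i w => s6v eta0 chi jmp N w (x0 + i%:Z))) => i; exact: dmeas_s6v. Qed.

End WindowMeasurability.

Lemma geometric_small (R : realType) (C s e : R) : 0 <= C -> 0 <= s -> s < 1 -> 0 < e ->
  exists B : nat, C * s ^+ B <= e.
Proof.
move=> C0 s0 s1 e0; have C1 : 0 < C + 1 by rewrite ltr_wpDl.
have sc : `|s| < 1 by rewrite ger0_norm.
have := cvg_expr sc => /cvgrPdist_lt /(_ (e / (C + 1)) (divr_gt0 e0 C1)) [B _ hB].
exists B; have := hB B (leqnn B); rewrite /= sub0r normrN ger0_norm ?exprn_ge0 //.
rewrite ltr_pdivlMr // => /ltW; apply: le_trans; rewrite mulrC ler_wpM2l ?exprn_ge0 //.
by rewrite lerDl.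
Qed.

(** * Transfer of estimates in a finite box to the line *)

Section TransferLimit.
Variables (R : realType) (d : measure_display) (T : measurableType d) (P : probability T R).
Variables (b1 b2 theta rho : R) (eta0 : int -> T -> bool) (chi : nat -> int -> T -> bool)
  (jmp : nat -> int -> T -> nat).
Hypotheses (b1_gt0 : 0 < b1) (b12 : b1 < b2) (b2_lt1 : b2 < 1).
Hypotheses (htheta : 0 <= theta <= 1) (hrho : 0 <= rho <= 1).
Hypothesis hmeas : forall (i : idx) (v : nat), measurable [set w | drive_rv eta0 chi jmp i w = v].
Hypothesis hindep : mutually_independent P (drive_rv eta0 chi jmp).
Hypothesis hlaw0 : forall x : int, P [set w | eta0 x w] = (if x <= 0 then theta else rho)%:E.
Hypothesis hlawchi : forall (t : nat) (x : int), P [set w | chi t x w] = b1%:E.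
Hypothesis hlawj : forall (t : nat) (x : int) (r : nat), (0 < r)%N ->
  P [set w | jmp t x w = r] = ((1 - b2) * b2 ^+ r.-1)%:E.
Local Notation densities := (densities theta rho).
Local Notation tcfg := (tcfg eta0 chi jmp).
Local Notation window := (window eta0 chi jmp).
Local Notation Esys := (Esys b1 b2).
Local Notation ph := (phi b1 b2).
Local Notation z := (disc_base b2).

(** If [theta = 0], sites on the left are almost surely never good, but the sites [x <= 0] are then
    almost surely empty, which also decouples. *)
Definition exceptional (a : int) (B N : nat) : set T :=
  if theta == 0 then [set w | exists k : nat, eta0 (- k%:Z) w]
  else [set w | exists2 t, t \in iota 0 N & bad eta0 chi a B t w].

Lemma exceptional_prob a B N : a + (N * B)%:Z <= 1 ->
  measurable (exceptional a B N) /\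
  (P (exceptional a B N) <= (N%:R * (1 - (if theta == 0 then 1 else good_prob b1 theta N)) ^+ B)%:E)%E.
Proof.
move=> a1; rewrite /exceptional; case: eqP => [th0|/eqP thN0].
  have mA k : measurable [set w | eta0 (- k%:Z) w].
    have := hmeas (inl (inl (- k%:Z))) 1; congr measurable.
    by apply/seteqP; split=> w /=; case: (eta0 _ w).
  split; first exact: measurable_exists.
  pose F (k : nat) : set T := [set w | eta0 (- k%:Z) w].
  have sub : [set w | exists k : nat, eta0 (- k%:Z) w] `<=` \bigcup_k F k.
    by move=> w [k hk]; exists k.
  rewrite subrr; apply: (@le_trans _ _ 0%E); last first.
    by rewrite lee_fin mulr_ge0 // exprn_ge0.
  apply: le_trans (measure_sigma_subadditive P mA (measurable_exists mA) sub) _.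
  rewrite eseries0 // => k _ _; apply: etrans (hlaw0 (- k%:Z)) _.
  by rewrite th0 ifT //; lia.
have [th0 th1] := andP htheta; have [h1 h2 h3] := And3 b1_gt0 b12 b2_lt1.
have b1p t : 0 < b1 ^+ t by rewrite exprn_gt0.
have b1l t : b1 ^+ t <= 1 by apply: exprn_ile1; lra.
have gp t : 0 <= good_prob b1 theta t <= 1.
  rewrite /good_prob; apply/andP; split.
    by apply: mulr_ge0; [apply: mulr_ge0 => //; exact: ltW|lra].
  apply: mulr_ile1; [|lra| |lra]; first by apply: mulr_ge0 => //; exact: ltW.
  by apply: mulr_ile1 => //; exact: ltW.
have := @probability_exists_le _ _ _ P _ (iota 0 N) (bad eta0 chi a B)
  (fun t => (1 - good_prob b1 theta N) ^+ B).
have hb t : t \in iota 0 N -> measurable (bad eta0 chi a B t) /\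
   (P (bad eta0 chi a B t) <= ((1 - good_prob b1 theta N) ^+ B)%:E)%E.
  rewrite mem_iota add0n => /andP[_ tN].
  have tB : a + (t.+1 * B)%:Z <= 1.
    by apply: le_trans a1; rewrite lerD2l lez_nat leq_mul2r tN orbT.
  have [mb ->] := bad_prob b1_gt0 b12 b2_lt1 htheta hrho hmeas hindep hlaw0 hlawchi tB.
  split=> //; rewrite lee_fin lerXn2r ?nnegrE //.
  - by case/andP: (gp t) => ? ?; lra.
  - by case/andP: (gp N) => ? ?; lra.
  (* The probability of a good site decreases with the step, so its value at [N] serves for every
     step. *)
  rewrite lerD2l lerN2 /good_prob; apply: ler_wpM2r; first by lra.
  apply: ler_wpM2l => //; apply: ler_wiXn2l; [exact: ltW|lra|exact: ltnW].
move=> /(_ hb) [me pe]; split=> //; apply: le_trans pe _.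
by rewrite big_const_seq count_predT size_iota iter_addr_0 mulr_natl.
Qed.

Lemma window_exceptional a B L N w : a + (N * B)%:Z <= 1 -> ~ exceptional a B N w ->
  window (a + (N * B)%:Z) L N w = drop (N * B) (tcfg a (N * B + L) N w).
Proof.
move=> a1; rewrite /exceptional; case: eqP => [th0|_] nex; last first.
  by apply: window_good => t tN bt; apply: nex; exists t; rewrite ?mem_iota.
apply: window_tcfg => i /andP[_ iL].
have vac x : x < a -> ~~ eta0 x w.
  move=> xa; apply/negP => ex; apply: nex; exists (absz x).
  by have -> : - (absz x)%:Z = x by lia.
by have [_] := s6v_tcfg_vacant chi jmp (N * B + L) vac N; apply.
Qed.

(** The window starts at [1 - o] so that exactly its first [o] sites have density [theta]. Only [B]
    tends to infinity: the probability of an exceptional event and the influence of the absent input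
    both vanish, while the two sides of the claim do not involve [B]. *)
Theorem transfer o L N (F : seq bool -> bool) : (o <= L)%N ->
  (P [set w | F (window (1 - o%:Z) L N w)] <=
   (Esys (riem theta rho o L) (ph theta) N (fun es rows => (F (run rows es))%:R))%:E)%E.
Proof.
move=> oL; have [th0 th1] := andP htheta; have [h1 h2 h3] := And3 b1_gt0 b12 b2_lt1.
have z1 := disc_base_gt1 b1_gt0 b12 b2_lt1; have z0 := lt_trans ltr01 z1.
have mF : measurable [set w | F (window (1 - o%:Z) L N w)].
  exact: (dmeas_pred (fun s => F s) (dmeas_window hmeas _ _ _)).
have hph : itv01 (ph theta) by exact: phi_itv.
have densE : densities (1 - o%:Z) L = riem theta rho o L.
  rewrite -{1}(subnKC oL) densities_cat densities_left; last by lia.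
  by rewrite densities_right //; lia.
pose r := 1 - (if theta == 0 then 1 else good_prob b1 theta N).
have r01 : 0 <= r /\ r < 1.
  rewrite /r; case: eqP => [_|/eqP thN0]; first by rewrite subrr.
  have tp : 0 < theta by rewrite lt_neqAle eq_sym thN0.
  have bp : 0 < b1 ^+ N by rewrite exprn_gt0.
  have bl : b1 ^+ N <= 1 by apply: exprn_ile1; lra.
  have g1 : 0 < good_prob b1 theta N by rewrite /good_prob !mulr_gt0 //; lra.
  have g2 : good_prob b1 theta N <= 1.
    rewrite /good_prob; apply: mulr_ile1; [|lra| |lra].
      by apply: mulr_ge0 => //; exact: ltW.
    by apply: mulr_ile1 => //; exact: ltW.
  by split; lra.
case: r01 => r0 r1.
(* One ratio for both geometric errors, [r ^+ B] from missing good sites and the inverse of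
   [z ^+ (N * B)] from the boundary. *)
pose s := Num.max r z^-1.
have s0 : 0 <= s by rewrite le_max r0.
have s1 : s < 1 by rewrite gt_max r1 invf_lt1.
pose K := N%:R + 2 * N%:R * (2 * z) ^+ N.
have K0 : 0 <= 2 * N%:R * (2 * z) ^+ N.
  by apply: mulr_ge0; [apply: mulr_ge0|apply: exprn_ge0; apply: mulr_ge0 => //; exact: ltW].
apply/lee_addgt0Pr => e e0.
have [B hB] := geometric_small (addr_ge0 (ler0n R N) K0) s0 s1 e0.
have [a aE] : exists a, a = 1 - o%:Z - (N * B)%:Z by eexists.
have a1 : a + (N * B)%:Z <= 1 by rewrite aE subrK gerDl oppr_le0.
have [mX pX] := exceptional_prob a1.
have [mT pT] := tcfg_prob b1_gt0 b12 b2_lt1 hmeas hindep hlaw0 hlawchi hlawj a (N * B + L) N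
  (fun out => F (drop (N * B) out)).
have pT' : (P [set w | F (drop (N * B) (tcfg a (N * B + L) N w))] <= (Esys (densities a (N * B + L)) 0 N
    (fun es rows => (F (drop (N * B) (run rows es)))%:R))%:E)%E by rewrite pT.
have aN : 1 - o%:Z = a + (N * B)%:Z by rewrite aE subrK.
have sub : [set w | F (window (1 - o%:Z) L N w)] `<=`
   [set w | F (drop (N * B) (tcfg a (N * B + L) N w))] `|` exceptional a B N.
  move=> w /=; rewrite aN => Fw.
  have [ex|nex] := pselect (exceptional a B N w); [by right|left].
  by move: Fw; rewrite window_exceptional.
apply: le_trans (le_measure P _ _ sub) _; rewrite ?inE //; first exact: measurableU.
apply: le_trans (measureU2 _ _ _) _ => //.
have bnd := Esys_boundary b1_gt0 b12 b2_lt1 N (N * B) F (all_densities htheta hrho a (N * B + L)) hph.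
rewrite (Esys_densities_restrict rho b12 b2_lt1 htheta _ _ (fun s => (F s)%:R) a1) -aN densE in bnd.
apply: le_trans (leeD pT' pX) _; rewrite -!EFinD lee_fin.
apply: le_trans (lerD bnd (lexx _)) _; rewrite -addrA lerD2l; apply: le_trans hB.
rewrite [X in _ <= X]mulrDl addrC; apply: lerD.
  apply: ler_wpM2l => //; apply: lerXn2r; rewrite ?nnegrE //.
  by rewrite /s le_max lexx.
(* The case [N = 0] is apart, since [N * B] is at least [B] only for positive [N]; the error term is
   then zero. *)
case: (N) K0 => [|N'] K0; first by rewrite mulr0 !mul0r.
apply: ler_wpM2l => //; rewrite -exprVn.
have zi : 0 <= z^-1 <= 1 by rewrite invr_ge0 ltW //= invf_le1 // ltW.
apply: (@le_trans _ _ (z^-1 ^+ B)).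
  by case/andP: zi => zi0 zi1; apply: ler_wiXn2l => //; rewrite mulSn leq_addr.
by apply: lerXn2r; rewrite ?nnegrE //; [case/andP: zi|rewrite /s le_max lexx orbT].
Qed.

End TransferLimit.

(** * Convergence *)

Section Counting.
Variable R : realType.
Implicit Types s : seq bool.

Lemma mass_takeS s n : mass (take n.+1 s) = (mass (take n s) + nth false s n)%N.
Proof.
elim: s n => [|b s IH] [|n] //=; first by rewrite take0 addn0.
by rewrite IH addnA.
Qed.

Lemma mass_take_sum s i n : (mass (take (i + n) s))%:R =
  (mass (take i s))%:R + \sum_(0 <= k < n) (nth false s (i + k))%:R :> R.
Proof.
elim: n => [|n IH]; first by rewrite addn0 big_nil addr0.
by rewrite addnS mass_takeS natrD IH big_nat_recr //= addrA.
Qed.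

Lemma mass_take_lip s i j :
  `|(mass (take i s))%:R - (mass (take j s))%:R| <= `|i%:R - j%:R| :> R.
Proof.
wlog ij : i j / (j <= i)%N => [H|].
  by case: (leqP j i) => [/H //|/ltnW /H]; rewrite distrC [X in _ <= X -> _]distrC.
rewrite -(subnKC ij) mass_take_sum addrAC subrr add0r natrD addrAC subrr add0r.
rewrite !ger0_norm ?ler0n ?sumr_ge0 //.
rewrite -[X in _ <= X](_ : \sum_(0 <= k < i - j) 1 = _); last first.
  by rewrite big_const_nat subn0 iter_addr_0.
by apply: ler_sum => k _; rewrite lern1 leq_b1.
Qed.

(* [y] lies within one mesh of a grid point, so both the empirical mass and the
   limit height at [y] are controlled by their values on the grid. *)
Lemma grid_control (H : R -> R) (M : nat -> R) (N o J i : nat) (X : int) (C D t c : R) :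
  let gx (j : nat) := - (D + 1) + j%:R * t in
  let gi (j : nat) := Num.truncn ((C + gx j) * N%:R) in
  (0 < N)%N -> o = Num.truncn (C * N%:R) -> 0 < t -> 0 <= D -> D + 1 <= C ->
  2 * (D + 1) <= J%:R * t ->
  (forall a b, a <= b -> 0 <= H a - H b <= b - a) ->
  (forall k l : nat, `|M k - M l| <= `|k%:R - l%:R| :> R) ->
  (forall j, (j <= J)%N ->
    `|M (gi j) - M (gi 0%N) - N%:R * (H (gx 0%N) - H (gx j))| <= c * N%:R) ->
  - (N%:R * D) < X%:~R :> R -> X%:~R < N%:R * D :> R -> `|i%:R - (X%:~R + o%:R)| <= 1 :> R ->
  `|M i - M (gi 0%N) - N%:R * (H (gx 0%N) - H (X%:~R / N%:R))| <= (c + 2 * t) * N%:R + 3.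
Proof.
move=> gx gi N0 oE t0 D0 DC Jt Hl Ml grid X1 X2 iX.
have n0 : 0 < N%:R :> R by rewrite ltr0n.
have [y yE] : exists y : R, y = X%:~R / N%:R by eexists.
have XE : X%:~R = y * N%:R :> R by rewrite yE divfK // gt_eqF.
have y1 : - D < y by rewrite -(ltr_pM2r n0) -XE mulNr mulrC.
have y2 : y < D by rewrite -(ltr_pM2r n0) -XE mulrC.
pose j := Num.truncn ((y + D + 1) / t).
have yp : 0 <= (y + D + 1) / t by apply: divr_ge0; lra.
have /andP[j1 j2] := truncn_itv yp; rewrite -/j -natr1 in j1 j2.
rewrite ler_pdivlMr // in j1; rewrite ltr_pdivrMr // in j2.
have jJ : (j <= J)%N.
  by rewrite -(ler_nat R) -(ler_pM2r t0); apply: le_trans j1 _; lra.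
have xy : gx j <= y by rewrite /gx; lra.
have yx : y <= gx j + t by rewrite /gx; lra.
have g1 := grid j jJ; rewrite -yE.
have /andP[h1 h2] := Hl _ _ xy.
have gi0 : 0 <= (C + gx j) * N%:R.
  by apply: mulr_ge0 => //; rewrite /gx; have : 0 <= j%:R * t by [apply: mulr_ge0; [|exact: ltW]]; lra.
have o0 : 0 <= C * N%:R by apply: mulr_ge0 => //; lra.
have /andP[a1 a2] := truncn_itv gi0; rewrite -natr1 -/(gi j) in a1 a2.
have /andP[oa ob] := truncn_itv o0; rewrite -natr1 -oE in oa ob.
rewrite XE in iX; move: iX; rewrite ler_norml => /andP[i1 i2].
have xyN : gx j * N%:R <= y * N%:R by rewrite ler_pM2r.
have yxN : y * N%:R <= gx j * N%:R + t * N%:R by rewrite -mulrDl ler_pM2r.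
rewrite mulrDl in a1 a2.
have Mi : `|M i - M (gi j)| <= t * N%:R + 3.
  apply: le_trans (Ml _ _) _; rewrite ler_norml; apply/andP; split.
    have : 0 <= t * N%:R by apply: mulr_ge0 => //; exact: ltW.
    by lra.
  by lra.
have Hj : `|N%:R * (H (gx j) - H y)| <= t * N%:R.
  rewrite normrM normr_nat mulrC ler_pM2r // ger0_norm //; lra.
have -> : M i - M (gi 0%N) - N%:R * (H (gx 0%N) - H y) =
   (M i - M (gi j)) + (M (gi j) - M (gi 0%N) - N%:R * (H (gx 0%N) - H (gx j)))
   - N%:R * (H (gx j) - H y) by ring.
apply: le_trans (ler_normB _ _) _; apply: le_trans (lerD (ler_normD _ _) (lexx _)) _.
apply: le_trans (lerD (lerD Mi g1) Hj) _; rewrite mulrDl; lra.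
Qed.

End Counting.

Lemma absz_succ (x y : int) : x < y -> (`|y - x|.+1)%:Z = y - x + 1.
Proof. by lia. Qed.

(** * From heights at grid points to all intervals *)

Section FinalBounds.
Variables (R : realType) (b1 b2 theta rho : R).
Hypotheses (b1_gt0 : 0 < b1) (b12 : b1 < b2) (b2_lt1 : b2 < 1).
Hypotheses (htheta : 0 <= theta <= 1) (hrho : 0 <= rho <= 1).
Local Notation ph := (phi b1 b2).
Local Notation limit_height := (limit_height b1 b2 theta rho).

Lemma exists_limit_height x : exists h, limit_height x h.
Proof.
rewrite /limit_height; case: (leP rho theta) => rt; last by eexists.
have [r0 _] := andP hrho; have [l fl] := exists_fan b12 b2_lt1 x r0 rt.
by exists (ph l - l * x); exists l.
Qed.

(** Differences of [H] are integrals of [G] at time one, and [G] takes values in [0, 1]; the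
    explicit formulas for [H] do not enter. *)
Lemma limit_height_lip (G : R -> R -> R) (H : R -> R) :
  entropy_solution ph (fun x : R => if x <= 0 then theta else rho) G ->
  (forall x, limit_height x (H x)) -> forall a b, a <= b -> 0 <= H a - H b <= b - a.
Proof.
move=> hG hH a b ab.
rewrite -(entropy_height b12 b2_lt1 htheta hrho hG ab (hH a) (hH b)).
have o01 : 0 <= (1 : R) <= 1 by rewrite ler01 lexx.
have g x := andP (G_itv hG x o01).
apply/andP; split; first by apply: Rintegral_ge0 => x _; case: (g x).
rewrite -[b - a]mul1r -(Rintegral_itv_cst _ ab); apply: le_Rintegral => //.
- exact: (G1_integrable hG).
- exact: cst_integrable.
- by move=> x _; case: (g x).
Qed.

(** Heights are taken relative to the first grid point. The inflow and the initial mass then cancel,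
    and the event depends on the final configuration alone, as [transfer] requires. *)
Definition deviates (c : R) (N J : nat) (gi : nat -> nat) (h : nat -> R) (s : seq bool) : bool :=
  has (fun j => c * N%:R < `|(mass (take (gi j) s))%:R - (mass (take (gi 0%N) s))%:R
                             - N%:R * (h 0%N - h j)|) (iota 0 J.+1).

(** Union bound over the grid and Markov's inequality; the factor 2 accounts for the two heights in
    each difference. *)
Lemma deviates_small c e N J gi h ps f o : all (@itv01 R) ps -> itv01 f -> 0 < c -> (0 < N)%N ->
  (forall j, (j <= J)%N -> Esys b1 b2 ps f N
     (fun es rows => `|hgt R o es rows (gi j) - N%:R * h j|) <= e * N%:R) ->
  Esys b1 b2 ps f N (fun es rows => (deviates c N J gi h (run rows es))%:R) <=
  J.+1%:R * (2 * e / c).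
Proof.
move=> hps hf c0 N0 small; have n0 : 0 < N%:R :> R by rewrite ltr0n.
pose A j es rows := `|(hgt R o es rows (gi 0%N) - N%:R * h 0%N) - (hgt R o es rows (gi j) - N%:R * h j)|.
apply: (@le_trans _ _ (Esys b1 b2 ps f N (fun es rows => \sum_(j < J.+1) (c * N%:R < A j es rows)%R%:R))).
  apply: (le_Esys b1_gt0 b12 b2_lt1) => // es rows _ _.
  rewrite /deviates; case: hasP => [[j]|_]; last by rewrite sumr_ge0.
  rewrite mem_iota add0n => /andP[_ jJ] dev; rewrite (bigD1 (Ordinal jJ)) //=.
  have -> : c * N%:R < A j es rows.
    by apply: lt_le_trans dev _; rewrite /A /hgt le_eqVlt; apply/orP; left; apply/eqP; congr `|_|; ring.
  by rewrite lerDl sumr_ge0.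
rewrite (Esys_sum b1 b2 ps f N J.+1 (fun j es rows => (c * N%:R < A j es rows)%R%:R)).
have -> : J.+1%:R * (2 * e / c) = \sum_(j < J.+1) (2 * e / c) by rewrite sumr_const card_ord mulr_natl.
apply: ler_sum => j _.
have cN : 0 < c * N%:R by rewrite mulr_gt0.
apply: le_trans (Esys_markov b1_gt0 b12 b2_lt1 N hps hf cN _) _; first by move=> *; exact: normr_ge0.
rewrite ler_pdivrMr // mulrA divfK ?gt_eqF //.
apply: (@le_trans _ _ (e * N%:R + e * N%:R)); last by rewrite -mulrA mulr_natl mulr2n.
apply: le_trans (lerD (small 0%N isT) (small j (ltn_ord j))).
rewrite -EsysD; apply: (le_Esys b1_gt0 b12 b2_lt1) => // es rows _ _.
exact: ler_normB.
Qed.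

Lemma not_deviates_close (G : R -> R -> R) (H : R -> R) (d : measure_display) (T : measurableType d)
    eta0 chi jmp (N J o L : nat) (C D t eps : R) (w : T) :
  entropy_solution ph (fun x : R => if x <= 0 then theta else rho) G ->
  (forall x, limit_height x (H x)) ->
  let gx (j : nat) := - (D + 1) + j%:R * t in
  let gi (j : nat) := Num.truncn ((C + gx j) * N%:R) in
  (0 < N)%N -> o = Num.truncn (C * N%:R) -> 0 < t -> 0 <= D -> D + 3 <= C ->
  2 * (D + 1) <= J%:R * t -> 2 * C * N%:R <= L%:R -> t <= eps / 16 -> 24 <= eps * N%:R ->
  ~~ deviates (eps / 8) N J gi (fun j => H (gx j)) (window eta0 chi jmp (1 - o%:Z) L N w) ->
  forall X1 X2 : int, - (N%:R * D) < X1%:~R :> R -> X1 < X2 -> X2%:~R < N%:R * D :> R ->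
  `| N%:R^-1 * (\sum_(0 <= i < `|X2 - X1|.+1) (nat_of_bool (s6v eta0 chi jmp N w (X1 + i%:Z)))%:R)
     - Rintegral (@lebesgue_measure R) `[X1%:~R / N%:R, X2%:~R / N%:R] (fun x => G x 1)| <= eps.
Proof.
move=> hG hH gx gi N0 oE t0 D0 DC Jt LC te Ne nd X1 X2 hX1 X12 hX2.
have n0 : 0 < N%:R :> R by rewrite ltr0n.
have n1 : 1 <= N%:R :> R by rewrite ler1n.
have Hl := limit_height_lip hG hH.
set s := window eta0 chi jmp (1 - o%:Z) L N w in nd.
pose M i : R := (mass (take i s))%:R.
have Ml (i j : nat) : `|M i - M j| <= `|i%:R - j%:R| :> R by exact: mass_take_lip.
have grid j : (j <= J)%N ->
    `|M (gi j) - M (gi 0%N) - N%:R * (H (gx 0%N) - H (gx j))| <= (eps / 8) * N%:R.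
  move=> jJ; rewrite leNgt; apply/negP => dv; move/negP: nd; apply; apply/hasP; exists j => //.
  by rewrite mem_iota add0n.
have C0 : 0 <= C * N%:R by apply: mulr_ge0; lra.
have /andP[oa ob] := truncn_itv C0; rewrite -natr1 -oE in oa ob.
have X12r : X1%:~R < X2%:~R :> R by rewrite ltr_int.
have DN : D * N%:R + 3 * N%:R <= C * N%:R by rewrite -mulrDl ler_pM2r.
rewrite [_ * D]mulrC in hX1 hX2.
(* The window starts at the site [1 - o], so the site [X1] has position [X1 + o - 1] in it. *)
have i1ge : 0 <= X1 + o%:Z - 1.
  by rewrite -(ler_int R) intrB intrD -pmulrn; lra.
pose i1 := absz (X1 + o%:Z - 1)%R.
have i1E : i1%:Z = X1 + o%:Z - 1 by rewrite /i1 gez0_abs.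
have i1R : i1%:R = X1%:~R + o%:R - 1 :> R by rewrite pmulrn i1E intrB intrD -pmulrn.
pose n := `|X2 - X1|.+1.
have nE : n%:Z = X2 - X1 + 1 by exact: absz_succ.
have i2R : (i1 + n)%:R = X2%:~R + o%:R :> R.
  by rewrite natrD i1R [n%:R]pmulrn nE intrD intrB; ring.
have i2L : (i1 + n <= L)%N.
  rewrite -(ler_nat R) i2R; apply: le_trans LC.
  have : 0 <= D * N%:R by apply: mulr_ge0.
  by rewrite -mulrA mulr_natl mulr2n; lra.
have -> : \sum_(0 <= i < n) (nat_of_bool (s6v eta0 chi jmp N w (X1 + i%:Z)))%:R = M (i1 + n)%N - M i1.
  rewrite /M mass_take_sum addrAC subrr add0r; apply: eq_big_nat => k /andP[_ kn].
  have kL : (i1 + k < L)%N by apply: leq_trans i2L; rewrite ltn_add2l.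
  rewrite /s /window (nth_map 0%N) ?size_iota // nth_iota // add0n.
  by congr (nat_of_bool (s6v _ _ _ _ _ _))%:R; rewrite PoszD i1E; ring.
have y12 : X1%:~R / N%:R <= X2%:~R / N%:R :> R by rewrite ler_pM2r ?invr_gt0 // ltW.
rewrite (entropy_height b12 b2_lt1 htheta hrho hG y12 (hH _) (hH _)).
have DC' : D + 1 <= C by lra.
rewrite [D * _]mulrC in hX1 hX2.
have X2l : - (N%:R * D) < X2%:~R by exact: lt_trans hX1 X12r.
have X1r : X1%:~R < N%:R * D by exact: lt_trans X12r hX2.
have e1 : `|i1%:R - (X1%:~R + o%:R)| <= 1 :> R.
  by rewrite i1R addrAC subrr sub0r normrN normr1.
have e2 : `|(i1 + n)%:R - (X2%:~R + o%:R)| <= 1 :> R by rewrite i2R subrr normr0 ler01.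
have c1 := grid_control N0 oE t0 D0 DC' Jt Hl Ml grid hX1 X1r e1.
have c2 := grid_control N0 oE t0 D0 DC' Jt Hl Ml grid X2l hX2 e2.
rewrite -/gx -/gi in c1 c2.
rewrite -(ler_pM2l n0) -{1}(gtr0_norm n0) -normrM mulrBr mulrA divff ?gt_eqF // mul1r.
set y1 := X1%:~R / N%:R in c1 *; set y2 := X2%:~R / N%:R in c2 *.
have -> : M (i1 + n)%N - M i1 - N%:R * (H y1 - H y2) =
   (M (i1 + n)%N - M (gi 0%N) - N%:R * (H (gx 0%N) - H y2))
   - (M i1 - M (gi 0%N) - N%:R * (H (gx 0%N) - H y1)) by ring.
apply: le_trans (ler_normB _ _) _; apply: le_trans (lerD c2 c1) _.
(* The two grid estimates give [(eps / 4 + 4 * t) * N + 6] in total; [t <= eps / 16] and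
   [24 <= eps * N] bound this by three quarters of [eps * N]. *)
have tN : t * N%:R <= eps / 16 * N%:R by rewrite ler_pM2r.
rewrite mulrDl -mulrA; rewrite mulrC in Ne *; lra.
Qed.

End FinalBounds.

Theorem theorem4p2 (R : realType) (d : measure_display) (T : measurableType d)
    (P : probability T R) (b1 b2 : R)
    (hb1 : 0 < b1) (hb12 : b1 < b2) (hb2 : b2 < 1)
    (theta rho eps : R)
    (htheta : 0 <= theta <= 1) (hrho : 0 <= rho <= 1) (heps : 0 < eps)
    (eta0 : int -> T -> bool) (chi : nat -> int -> T -> bool)
    (jmp : nat -> int -> T -> nat)
    (hmeas : forall (i : idx) (v : nat),
        measurable [set w | drive_rv eta0 chi jmp i w = v])
    (hindep : mutually_independent P (drive_rv eta0 chi jmp))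
    (hlaw0 : forall x : int,
        P [set w | eta0 x w] = (if x <= 0 then theta else rho)%:E)
    (hlawchi : forall (t : nat) (x : int), P [set w | chi t x w] = b1%:E)
    (hlawj : forall (t : nat) (x : int) (r : nat), (0 < r)%N ->
        P [set w | jmp t x w = r] = ((1 - b2) * b2 ^+ r.-1)%:E)
    (G : R -> R -> R)
    (hG : entropy_solution (phi b1 b2)
            (fun x : R => if x <= 0 then theta else rho) G) :
  (fun N : nat =>
     fine (P [set w | exists X1 X2 : int,
        [/\ - (N%:R / eps) < X1%:~R, X1 < X2, X2%:~R < N%:R / eps &
            `| N%:R^-1 *
                 (\sum_(0 <= i < `|X2 - X1|.+1)
                    (nat_of_bool (s6v eta0 chi jmp N w (X1 + i%:Z)))%:R)
               - Rintegral (@lebesgue_measure R)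
                   `[X1%:~R / N%:R, X2%:~R / N%:R] (fun x => G x 1) | > eps]]))
    @ \oo --> (0 : R).
Proof.
have ka0 := kappa_gt0 hb12 hb2.
have [D DE] : exists D : R, D = eps^-1 by eexists.
have D0 : 0 <= D by rewrite DE invr_ge0 ltW.
(* The box extends [C * N] to each side. Grid points lie between [- (D + 1)] and [D + 2], and rays
   of speed up to [kappa] that end there must start inside the box. *)
have [C CE] : exists C : R, C = D + kappa b1 b2 + 3 by eexists.
have [t tE] : exists t : R, t = Num.min 1 (eps / 16) by eexists.
have t0 : 0 < t by rewrite tE lt_min ltr01 divr_gt0.
have t1 : t <= 1 by rewrite tE ge_min lexx.
have te : t <= eps / 16 by rewrite tE ge_min lexx orbT.
have [H hH] := choice (exists_limit_height theta hb12 hb2 hrho).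
have [J JE] : exists J : nat, J = (Num.truncn (2 * (D + 1) / t)).+1 by eexists.
have q0 : 0 <= 2 * (D + 1) / t by apply: divr_ge0; [lra|exact: ltW].
have Jt : 2 * (D + 1) <= J%:R * t.
  by rewrite -ler_pdivrMr // JE ltW // truncnS_gt.
have Jt' : J%:R * t <= 2 * (D + 1) + t.
  have /andP[a _] := truncn_itv q0; move: a; rewrite ler_pdivlMr // => a.
  by rewrite JE -natr1 mulrDl mul1r lerD2r.
pose gx (j : nat) := - (D + 1) + j%:R * t.
have c0 : 0 < eps / 8 by rewrite divr_gt0.
apply/cvgrPdist_le => dl dl0.
(* Chosen so that the bound of [deviates_small] at tolerance [eps / 8] equals [dl]. *)
have [e eE] : exists e : R, e = dl * (eps / 8) / (2 * J.+1%:R) by eexists.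
have e0 : 0 < e by rewrite eE divr_gt0 ?mulr_gt0.
have C0 : 0 < C by lra.
have [k k0 HL] := height_limit hb1 hb12 hb2 htheta hrho C0 e0.
have gxr j : (j <= J)%N -> kappa b1 b2 <= C + gx j /\ gx j <= C - 1.
  move=> jJ; have jt : j%:R * t <= J%:R * t by rewrite ler_pM2r // ler_nat.
  have j0 : 0 <= j%:R * t by apply: mulr_ge0 => //; exact: ltW.
  by rewrite /gx; split; lra.
have /choice[N0 hN0] : forall j : nat, exists N0 : nat, (j <= J)%N ->
   forall N m, (N0 <= N)%N -> 2 * C * N%:R <= (m * k)%:R -> (m * k)%:R <= (2 * C + 1) * N%:R ->
   Esys b1 b2 (riem theta rho (Num.truncn (C * N%:R)) (m * k)) (phi b1 b2 theta) N (fun es rows =>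
     `|hgt R (Num.truncn (C * N%:R)) es rows (Num.truncn ((C + gx j) * N%:R)) - N%:R * H (gx j)|)
   <= e * N%:R.
  move=> j; have [jJ|_] := boolP (j <= J)%N; last by exists 0%N.
  have [x1 x2] := gxr j jJ; have [M hM] := HL _ _ x1 x2 (hH (gx j)).
  by exists M => _.
(* Beyond the thresholds of the grid points, [k <= N] allows the box to be rounded up to a multiple
   of [k] within [(2 * C + 1) * N], and the last term yields [24 <= eps * N]. *)
exists (maxn (\max_(j < J.+1) N0 j) (maxn k.+1 (Num.truncn (24 / eps)).+1)) => // N /=.
rewrite !geq_max => /and3P[/bigmax_leqP maxN kN eN].
have N_gt0 : (0 < N)%N by apply: leq_trans kN.
have n0 : 0 < N%:R :> R by rewrite ltr0n.
have Ne : 24 <= eps * N%:R.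
  rewrite mulrC -ler_pdivrMr //; apply: le_trans (ltW (truncnS_gt _)) _.
  by rewrite ler_nat.
have kr : 0 < k%:R :> R by rewrite ltr0n.
have [m mE] : exists m : nat, m = (Num.truncn (2 * C * N%:R / k%:R)).+1 by eexists.
have CN : 0 <= C * N%:R by apply: mulr_ge0; exact: ltW.
have r0 : 0 <= 2 * C * N%:R / k%:R by apply: divr_ge0 => //; rewrite -mulrA mulr_ge0.
have Lge : 2 * C * N%:R <= (m * k)%:R.
  by rewrite natrM -ler_pdivrMr // mE ltW // truncnS_gt.
have Lle : (m * k)%:R <= (2 * C + 1) * N%:R.
  have /andP[a _] := truncn_itv r0; move: a; rewrite ler_pdivlMr // => a.
  rewrite natrM mE -[(Num.truncn _).+1%:R]natr1 [X in X <= _]mulrDl mul1r [X in _ <= X]mulrDl mul1r.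
  by apply: lerD => //; rewrite ler_nat ltnW.
have [ o oE] : exists o, o = Num.truncn (C * N%:R) by eexists.
have oL : (o <= m * k)%N.
  rewrite -(ler_nat R); apply: le_trans Lge; rewrite oE.
  apply: le_trans (_ : _ <= C * N%:R) _; first by rewrite truncn_le.
  by rewrite -mulrA mulr_natl mulr2n lerDl.
pose gi (j : nat) := Num.truncn ((C + gx j) * N%:R).
pose F := deviates (eps / 8) N J gi (fun j => H (gx j)).
have small j : (j <= J)%N -> Esys b1 b2 (riem theta rho o (m * k)) (phi b1 b2 theta) N
     (fun es rows => `|hgt R o es rows (gi j) - N%:R * H (gx j)|) <= e * N%:R.
  by move=> jJ; rewrite oE; apply: hN0 => //; exact: (maxN (Ordinal (jJ : (j < J.+1)%N)) isT).
have hps : all (@itv01 R) (riem theta rho o (m * k)) by apply: all_riem.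
have hph : itv01 (phi b1 b2 theta) by exact: phi_itv.
have dev := deviates_small hb1 hb12 hb2 hps hph c0 N_gt0 small.
have tr := transfer hb1 hb12 hb2 htheta hrho hmeas hindep hlaw0 hlawchi hlawj N F oL.
set E := [set w | _].
have mE' : measurable E.
  (* The event is a countable union over the endpoints, and for given endpoints it is a condition on
     a finite window. *)
  apply: (@measurable_exists _ _ int) => X1; apply: (@measurable_exists _ _ int) => X2.
  set n := `|X2 - X1|.+1; set I := Rintegral _ _ _.
  pose Q (s : seq bool) : Prop := [/\ - (N%:R / eps) < X1%:~R, X1 < X2, X2%:~R < N%:R / eps &
    `|N%:R^-1 * (\sum_(0 <= i < n) (nth false s i)%:R) - I| > eps].
  have := dmeas_pred Q (dmeas_window hmeas X1 n N); congr measurable.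
  have sumE w : \sum_(0 <= i < n) (nth false (window eta0 chi jmp X1 n N w) i)%:R =
     \sum_(0 <= i < n) (nat_of_bool (s6v eta0 chi jmp N w (X1 + i%:Z)))%:R :> R.
    apply: eq_big_nat => i /andP[_ iN].
    by rewrite /window (nth_map 0%N) ?size_iota // nth_iota.
  by apply/seteqP; split=> w; rewrite /Q /= sumE.
have sub : E `<=` [set w | F (window eta0 chi jmp (1 - o%:Z) (m * k) N w)].
  move=> w [X1 [X2 [h1 h2 h3 h4]]]; apply: contrapT => /negP nF.
  rewrite -DE in h1 h3.
  have DC : D + 3 <= C by lra.
  have := not_deviates_close hb12 hb2 htheta hrho hG hH N_gt0 oE t0 D0 DC Jt Lge te Ne nF h1 h2 h3.
  by rewrite leNgt h4.
have mF : measurable [set w | F (window eta0 chi jmp (1 - o%:Z) (m * k) N w)].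
  exact: (dmeas_pred (fun s => F s) (dmeas_window hmeas _ _ _)).
have PE : (P E <= dl%:E)%E.
  apply: le_trans (le_measure P _ _ sub) _; rewrite ?inE //.
  apply: le_trans tr _; rewrite lee_fin; apply: le_trans dev _.
  rewrite eE le_eqVlt; apply/orP; left; apply/eqP; field.
  by rewrite !gt_eqF //=; lra.
rewrite sub0r normrN ger0_norm ?fine_ge0 //.
by rewrite -lee_fin fineK // fin_num_measure.
Qed.
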